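(* Fix a real number $p\ge 1$. Let $K\subset\mathbb{R}^d$ be a (real) $d$-cone with its vertex at the origin, let $v\in\mathbb{R}^d$, and let $s\in\mathbb{C}^d$. Then the solid-angle generating function $\alpha_{v+K}$ of the $d$-cone $v+K$ satisfies $$\alpha_{v+K}(-s)=(-1)^d\,\alpha_{-v+K}(s),$$ understood as an identity of meromorphic functions of $s\in\mathbb{C}^d$.
   Context: A convex cone in $\mathbb{R}^d$ is an intersection of finitely many half-spaces $\{x\in\mathbb{R}^d: a\cdot x\le b\}$ (with arbitrary real data) whose bounding hyperplanes $\{x : a\cdot x=b\}$ meet in at least one point. It is pointed if these hyperplanes meet in exactly one point (the vertex, or apex). Throughout, ''cone'' means pointed cone, and a $d$-cone is a cone of dimension $d$. No rationality is assumed. Notation: $v+K=\{v+x:x\in K\}$, $\|t\|_p=(|t_1|^p+\dots+|t_d|^p)^{1/p}$, and $\langle x,y\rangle=\sum_k x_ky_k$ (bilinear, extended to complex vectors without conjugation). $l^p$-solid angle of $x\in\mathbb{R}^d$ with respect to a cone $C\subset\mathbb{R}^d$: $$\omega_C(x)=\omega_{p,C}(x):=\lim_{\epsilon\to0^+}\frac{1}{\epsilon^{d/p}}\int_C e^{-\frac{c}{\epsilon}\|t-x\|_p^p}\,dt,\qquad c=\bigl(2\,\Gamma(\tfrac1p+1)\bigr)^p.$$ Equivalently, it is the proportion of a sufficiently small $l^p$-ball centered at $x$ that lies in $C$. Solid-angle generating function of a cone $C$: $$\alpha_C(s):=\sum_{m\in C\cap\mathbb{Z}^d}\omega_C(m)\,e^{2\pi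 i\langle s,m\rangle}.$$ For $C=v+K$ with $K$ a cone with vertex at the origin, the series is considered for $s\in\mathbb{C}^d$ with $-\mathrm{Im}(s)\in K^*$, where $K^*=\{x\in\mathbb{R}^d:\langle x,y\rangle<0\ \text{for all nonzero } y\in K\}$ is the polar cone. Elsewhere, $\alpha_C$ is understood through meromorphic continuation in $s$.
   Formalization: For irrational cones the generating function need not continue meromorphically to C^d; the formal theorem assumes that α_{v+K} has a meromorphic continuation, and concludes that α_{-v+K} has one and that the identity holds for every such continuation. *)

(* Defs.v *)
From HB Require Import structures.
From mathcomp Require Import all_boot all_order all_algebra.
From mathcomp Require Import all_classical all_reals all_analysis.
From mathcomp.analysis.showcase Require Import summability.
From mathcomp Require Import complex.

Set Implicit Arguments.
Unset Strict Implicit.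
Unset Printing Implicit Defensive.

Import Order.TTheory GRing.Theory Num.Theory.
Import numFieldNormedType.Exports.

Local Open Scope classical_set_scope.
Local Open Scope ring_scope.

(** * Cones *)

Section Cones.
Context {R : realType} {d : nat}.
Implicit Types (a x y v : 'rV[R]_d) (C K : set 'rV[R]_d).

Definition dotp {S : comPzRingType} {n} (x y : 'rV[S]_n) : S :=
  \sum_k x 0 k * y 0 k.

Definition half_space a (b : R) : set 'rV[R]_d := [set x | dotp a x <= b].

Definition bounding_hyperplane a (b : R) : set 'rV[R]_d :=
  [set x | dotp a x = b].

(* The condition [a i != 0] makes the sets above genuine half-spaces and
   hyperplanes. *)
Definition pointed_cone C v := exists (n : nat) (a : 'I_n -> 'rV[R]_d)
    (b : 'I_n -> R),
  [/\ forall i, a i != 0,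
      C = \bigcap_i half_space (a i) (b i) &
      \bigcap_i bounding_hyperplane (a i) (b i) = [set v]].

(* The dimension of a set is that of its affine hull: the largest [k] such that
   the set contains [k + 1] affinely independent points [x0], [x0 + row i M]. *)
Definition affinely_independent_in C (k : nat) :=
  exists x0 (M : 'M[R]_(k, d)),
    [/\ C x0, forall i, C (x0 + row i M) & row_free M].

Definition has_dim C (k : nat) :=
  affinely_independent_in C k /\
  forall k', affinely_independent_in C k' -> (k' <= k)%N.

Definition translate v C : set 'rV[R]_d := [set v + x | x in C].

Definition polar_cone K : set 'rV[R]_d :=
  [set x | forall y, K y -> y != 0 -> dotp x y < 0].

End Cones.

(** * Solid angles *)

Section SolidAngle.
Context {R : realType}.

(* Integral of a nonnegative function over R^d, as an iterated Lebesgue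
   integral; by Tonelli it is the d-dimensional Lebesgue integral for the
   measurable functions to which it is applied below. *)
Fixpoint integral_rV (d : nat) : ('rV[R]_d -> \bar R) -> \bar R :=
  match d return ('rV[R]_d -> \bar R) -> \bar R with
  | 0 => fun f => f 0
  | d'.+1 => fun f =>
      (\int[lebesgue_measure]_x
         integral_rV (fun t : 'rV[R]_d' => f (row_mx (x%:M : 'rV_1) t)))%E
  end.

Definition Gamma (x : R) : R :=
  \int[lebesgue_measure]_(t in `]0, +oo[) (t `^ (x - 1) * expR (- t)).

Definition lpnorm (p : R) {d} (t : 'rV[R]_d) : R :=
  (\sum_k `|t 0 k| `^ p) `^ p^-1.

Definition solid_angle (p : R) {d} (C : set 'rV[R]_d) (x : 'rV[R]_d) : R :=
  let c := (2 * Gamma (p^-1 + 1)) `^ p in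
  lim ((fun e : R => (e `^ (d%:R / p))^-1 *
          fine (integral_rV (fun t =>
            (\1_C t * expR (- (c / e) * lpnorm p (t - x) `^ p))%:E)))
       @ 0^'+).

End SolidAngle.

(** * Functions of d complex variables *)

(* The regular algebra R[i]^o carries the normed-space structure of the
   complex numbers over themselves. *)
Notation Cplx R := (R[i]%C^o) (only parsing).

Section Meromorphic.
Context {R : realType} {d : nat}.
Implicit Types (F G g h : 'rV[Cplx R]_d -> Cplx R).

Definition holomorphic_on (A : set 'rV[Cplx R]_d) F :=
  forall s, A s -> differentiable F s.

(* Locally a quotient g / h of holomorphic functions on a ball, with h not
   identically zero there. Where h vanishes, the value of F is
   unconstrained. *)
Definition meromorphic F := forall a, exists (r : R[i]) g h,
  [/\ 0 < r, holomorphic_on (ball a r) g, holomorphic_on (ball a r) h,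
      exists2 s, ball a r s & h s != 0 &
      forall s, ball a r s -> h s != 0 -> F s = g s / h s].

(* Equality of meromorphic functions, which ignores the unconstrained values:
   agreement on a dense open set. *)
Definition meromorphic_eq F G := exists U : set 'rV[Cplx R]_d,
  [/\ open U, dense U & forall s, U s -> F s = G s].

End Meromorphic.

(** * Generating functions *)

Section GeneratingFunction.
Context {R : realType} (p : R) {d : nat}.
Implicit Types (K C : set 'rV[R]_d) (v : 'rV[R]_d) (s : 'rV[Cplx R]_d).

Definition cexp (z : R[i]) : R[i] :=
  (expR (complex.Re z))%:C%C *
  (cos (complex.Im z) +i* sin (complex.Im z))%C.

(* Sum over the lattice points of C in the sense of unconditional convergence
   (the limit of the finite partial sums along the directed set of finite sets
   of indices). *)
Definition solid_angle_series C s : Cplx R :=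
  @sum _ R[i]%C (Cplx R) (fun m : 'rV[int]_d =>
    let x : 'rV[R]_d := map_mx intr m in
    let xC : 'rV[Cplx R]_d := map_mx intr m in
    if x \in C then
      (solid_angle p C x)%:C%C
        * cexp (2 * (pi : R)%:C%C * 'i%C * dotp s xC)
    else 0).

Definition series_domain K : set 'rV[Cplx R]_d :=
  [set s | polar_cone K (- map_mx (@complex.Im R) s)].

(* F is the meromorphic function [alpha_{v+K}] on C^d: a meromorphic
   continuation of the generating series of [v + K], K having apex 0. *)
Definition is_alpha v K (F : 'rV[Cplx R]_d -> Cplx R) :=
  meromorphic F /\
  forall s, series_domain K s -> F s = solid_angle_series (translate v K) s.

End GeneratingFunction.

(* Main.v *)
(* Solid angles are additive over indicator functions taken up to null sets, so
   the coefficient of a lattice point depends only on the set of facets through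
   it. Modulo indicators of cones containing lines, the indicator of K is (-1)^d
   times that of -K. If every facet normal is proportional to an integer vector,
   the cones containing lines are invariant under nonzero lattice vectors u; the
   operators g |-> g - g(. - u) kill their coefficients, hence the two generating
   series, multiplied by the product of the 1 - e^{2 pi i <s,u>}, become the same
   finite exponential sum up to the sign, and reciprocity holds for the resulting
   quotients.

   If some facet normal is irrational (and the solid angle of the whole space is
   not 0), the series has no meromorphic continuation. That facet contains a ray
   R_+ u of K whose direction satisfies fewer rational equations than the facet.
   On a line s0 + z eta, with eta an integer vector and Im s0 a boundary point of
   the dual cone vanishing on u, the series is a power series in e^{2 pi i z}; if
   it had a meromorphic continuation then, up to a linear recurrence, its
   coefficients would tend to 0. Two sequences of lattice points that escape along
   the ray and approach the irrational facet from both sides translate the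
   coefficients of the series into two families which have the same limit by the
   recurrence, because their difference vanishes on low levels of eta. By
   uniqueness of Fourier coefficients the limits agree at every lattice point, but
   at one of them the first is 0 and the second is the full solid angle. *)

(* The hypothesis grants a continuation only for [v + K]; one for [- v + K] has to be produced. So
   the rational case works with an explicit quotient, and the irrational case has to end in a
   contradiction. Two obstacles shape the latter. Decay of Fourier coefficients alone decides
   nothing: the continuation may have poles at the edge of the domain, so only a linear combination
   of neighbouring levels tends to 0, and such recurrences have nonzero solutions. The difference of
   two limits of the same series vanishes on all low levels, and the recurrence, whose polynomial is
   nonzero at 0, then forces it to vanish everywhere. Moreover a given line may lie in the zero set
   of a local denominator. A small real translation avoids this; it keeps the imaginary part of the
   base point and only multiplies coefficients by characters of modulus 1, so a dense set of
   translations suffices. All contour integrals run over horizontal segments of length 1. Circles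
   are their images under e^{2 pi i z}, so Cauchy's theorem on rectangles serves both for discs and
   for the shift of contours. *)
Require Import Defs.
From mathcomp Require Import all_boot all_order all_algebra.
From mathcomp Require Import all_classical all_reals all_analysis.
From mathcomp Require Import measurable_realfun complex ring lra.

Set Implicit Arguments.
Unset Strict Implicit.
Unset Printing Implicit Defensive.

Import Order.TTheory GRing.Theory Num.Theory.
Import numFieldNormedType.Exports.
Import Normc.

Local Open Scope classical_set_scope.
Local Open Scope ring_scope.

Arguments normc : simpl never.

(** * Complex analysis in one variable *)

Section Complex.
Context {R : realType}.
Local Notation C := (Cplx R).
Implicit Types (z w : C) (f g : C -> C).

Lemma normcE z : `|z| = (normc z)%:C%C.
Proof. by rewrite normc_def; case: z. Qed.

Lemma normc_ge0 z : 0 <= normc z.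
Proof. by case: z => a b; rewrite /= sqrtr_ge0. Qed.

Lemma normc_eq0 z : (normc z == 0) = (z == 0).
Proof.
apply/eqP/eqP => [/eq0_normc //|->]; exact: normc0.
Qed.

Lemma normc_gt0 z : (0 < normc z) = (z != 0).
Proof. by rewrite lt_def normc_ge0 andbT normc_eq0. Qed.

Lemma normc_real (x : R) : normc (x%:C%C) = `|x|.
Proof. by rewrite /normc /= expr0n /= addr0 sqrtr_sqr. Qed.

Lemma normc_Re z : `|complex.Re z| <= normc z.
Proof.
case: z => a b; rewrite /normc /= -sqrtr_sqr ler_sqrt ?addr_ge0 ?sqr_ge0//.
by rewrite lerDl sqr_ge0.
Qed.

Lemma normc_Im z : `|complex.Im z| <= normc z.
Proof.
case: z => a b; rewrite /normc /= -sqrtr_sqr ler_sqrt ?addr_ge0 ?sqr_ge0//.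
by rewrite lerDr sqr_ge0.
Qed.

Lemma normc_le_ReIm z : normc z <= `|complex.Re z| + `|complex.Im z|.
Proof.
case: z => a b; rewrite /normc /=.
rewrite -[leRHS]ger0_norm ?addr_ge0// -sqrtr_sqr ler_sqrt ?sqr_ge0//.
by rewrite sqrrD !real_normK ?num_real// lerD2r lerDl mulrn_wge0 ?mulr_ge0.
Qed.

Lemma normcX z n : normc (z ^+ n) = normc z ^+ n.
Proof.
by elim: n => [|n IH]; [rewrite !expr0 normc1|rewrite !exprS normcM IH].
Qed.

Lemma normcB z w : normc (z - w) = normc (w - z).
Proof. by rewrite -normcN opprB. Qed.

Lemma ler_normcB z w : normc z - normc w <= normc (z - w).
Proof. by rewrite lerBlDr -{1}(subrK w z) le_normcD. Qed.

Lemma ler_normc_sum (I : Type) (r : seq I) (P : pred I) (F : I -> C) :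
  normc (\sum_(i <- r | P i) F i) <= \sum_(i <- r | P i) normc (F i).
Proof.
elim/big_rec2: _ => [|i y1 y2 _ H]; first by rewrite normc0.
by apply: (le_trans (le_normcD _ _)); rewrite lerD2l.
Qed.

Lemma normc_eq z w : (forall e : R, 0 < e -> normc (z - w) <= e) -> z = w.
Proof.
move=> H; apply/eqP; rewrite -subr_eq0 -normc_eq0 eq_le normc_ge0 andbT.
by apply/ler_addgt0Pl => e e0; rewrite addr0 H.
Qed.

(** The norm of [C] over itself is complex-valued. This lemma and the next two turn neighbourhoods,
    limits and derivatives into estimates on the real-valued [normc]. *)
Lemma near_normcP z (P : set C) :
  (\forall w \near z, P w) <->
  exists2 dl : R, 0 < dl & forall w, normc (w - z) < dl -> P w.
Proof.
split.
- move=> /nbhs_ballP[e /= e0 eP].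
  have eE : e = (complex.Re e)%:C%C by rewrite RRe_real// gtr0_real.
  exists (complex.Re e); first by rewrite -ltcR -eE.
  move=> w wz; apply: eP; rewrite /ball /=.
  by rewrite distrC normcE eE ltcR.
- move=> [dl dl0 H]; apply/nbhs_ballP; exists (dl%:C%C) => /=.
    by rewrite ltcR.
  move=> w; rewrite /ball /= distrC normcE ltcR; exact: H.
Qed.

Lemma cvg_normcP f z l : f x @[x --> z] --> l <->
  forall e : R, 0 < e -> exists2 dl : R, 0 < dl &
    forall w, normc (w - z) < dl -> normc (f w - l) < e.
Proof.
split.
- move=> fl e e0; apply/near_normcP.
  by apply: (fl [set w | normc (w - l) < e]); apply/near_normcP; exists e.
- move=> H P /near_normcP[e e0 eP]; have [dl dl0 dlP] := H _ e0.
  by apply/near_normcP; exists dl => // w /dlP /eP.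
Qed.

Lemma differentiable_normcP f z : differentiable f z <->
  exists l : C, forall e : R, 0 < e -> exists2 dl : R, 0 < dl &
    forall w, normc w < dl -> normc (f (z + w) - f z - l * w) <= e * normc w.
Proof.
split.
- move=> df; have := diff_locally df.
  move=> /eqaddoP H; exists ('d f z 1) => e e0.
  have /near_normcP[dl dl0 dlP] := H (e%:C%C) (ltac:(by rewrite ltcR)).
  exists dl => // w wdl.
  have := dlP w; rewrite subr0 => /(_ wdl) /=.
  rewrite !normcE -rmorphM /= lecR /=; congr (normc _ <= _).
  rewrite ![in LHS]fctE /= /shift /= opprD addrA [w + z]addrC; congr (_ - _).
  by rewrite -[w in LHS]mulr1 -[w * 1]/(w *: (1 : C)) linearZ /= mulrC.
- move=> [l H]; apply/derivable1_diffP.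
  apply/cvg_ex; exists l => P /near_normcP [e e0 eP].
  have [dl dl0 dlP] := H (e / 2) (ltac:(by rewrite divr_gt0)).
  apply/near_normcP; exists dl => //= h; rewrite subr0 => hdl h0; apply: eP.
  have hn0 : 0 < normc h by rewrite normc_gt0.
  rewrite /shift /= [h *: 1]mulr1 [h + z]addrC.
  have -> : h^-1 *: (f (z + h) - f z) - l = h^-1 * (f (z + h) - f z - l * h).
    by rewrite -[_ *: _]/(_ * _) [in RHS]mulrBr mulrCA mulVf// mulr1.
  rewrite normcM normcV mulrC ltr_pdivrMr// (le_lt_trans (dlP _ hdl))//.
  by rewrite ltr_pM2r// gtr_pMr// invf_lt1// ltr1n.
Qed.

End Complex.

(** * Integrals of complex-valued functions over a real segment *)

Section ComplexIntegral.
Context {R : realType}.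
Local Notation C := (Cplx R).
Local Notation mu := (@lebesgue_measure R).
Implicit Types (f g : R -> C) (a b c x : R).

Definition cont_at f x := forall e : R, 0 < e -> exists2 dl : R, 0 < dl &
  forall y, `|y - x| < dl -> normc (f y - f x) < e.

Definition cont_on f a b := forall x, a <= x <= b -> cont_at f x.

Definition cint f a b : C :=
  (\int[mu]_(x in `[a, b]) complex.Re (f x) +i*
   \int[mu]_(x in `[a, b]) complex.Im (f x))%C.

Local Arguments cint : simpl never.

Lemma cont_atD f g x : cont_at f x -> cont_at g x ->
  cont_at (fun y => f y + g y) x.
Proof.
move=> hf hg e e0; have e20 : 0 < e / 2 by rewrite divr_gt0.
have [d1 d10 h1] := hf _ e20; have [d2 d20 h2] := hg _ e20.
exists (Num.min d1 d2); first by rewrite lt_min d10.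
move=> y; rewrite lt_min => /andP[/h1 y1 /h2 y2].
rewrite opprD addrACA (le_lt_trans (le_normcD _ _))// [e]splitr ltrD//.
Qed.

Lemma cont_at_cst (k : C) x : cont_at (fun=> k) x.
Proof. by move=> e e0; exists 1 => // y _; rewrite subrr normc0. Qed.

Lemma cont_at_comp (h : C -> C) f x : cont_at f x ->
  {for f x, continuous h} -> cont_at (h \o f) x.
Proof.
move=> hf /cvg_normcP hh e e0; have [d1 d10 h1] := hh _ e0.
have [d2 d20 h2] := hf _ d10; exists d2 => // y /h2 /h1; exact.
Qed.

Lemma cont_atZ (k : C) f x : cont_at f x -> cont_at (fun y => k * f y) x.
Proof.
move=> hf; apply: (@cont_at_comp (fun z : C => k * z) f x hf).
exact: (@mulrl_continuous R[i] k).
Qed.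

Lemma cont_atN f x : cont_at f x -> cont_at (fun y => - f y) x.
Proof.
by move=> hf e /hf[dl dl0 h]; exists dl => // y /h; rewrite -opprD normcN.
Qed.

Lemma cont_atB f g x : cont_at f x -> cont_at g x ->
  cont_at (fun y => f y - g y) x.
Proof. by move=> hf hg; apply: cont_atD => //; exact: cont_atN. Qed.

Lemma cont_onB f g a b : cont_on f a b -> cont_on g a b ->
  cont_on (fun y => f y - g y) a b.
Proof. by move=> hf hg x xab; apply: cont_atB; auto. Qed.

Lemma cont_on_Re f a b : cont_on f a b ->
  {in `[a, b], continuous (fun x => complex.Re (f x))}.
Proof.
move=> hf x; rewrite in_itv /= => /hf hx; apply/cvgrPdist_lt => e /hx[dl dl0 h].
exists dl => //= y /=; rewrite distrC => /h; apply: le_lt_trans.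
by have := normc_Re (f y - f x); rewrite distrC; case: (f y) (f x) => [? ?] [? ?].
Qed.

Lemma cont_on_Im f a b : cont_on f a b ->
  {in `[a, b], continuous (fun x => complex.Im (f x))}.
Proof.
move=> hf x; rewrite in_itv /= => /hf hx; apply/cvgrPdist_lt => e /hx[dl dl0 h].
exists dl => //= y /=; rewrite distrC => /h; apply: le_lt_trans.
by have := normc_Im (f y - f x); rewrite distrC; case: (f y) (f x) => [? ?] [? ?].
Qed.

Lemma cont_on_integrable_Re f a b : cont_on f a b ->
  mu.-integrable `[a, b] (EFin \o (fun x => complex.Re (f x))).
Proof.
move=> hf; apply: continuous_compact_integrable; first exact: segment_compact.
exact/continuous_subspace_itv/cont_on_Re.
Qed.

Lemma cont_on_integrable_Im f a b : cont_on f a b ->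
  mu.-integrable `[a, b] (EFin \o (fun x => complex.Im (f x))).
Proof.
move=> hf; apply: continuous_compact_integrable; first exact: segment_compact.
exact/continuous_subspace_itv/cont_on_Im.
Qed.

Local Hint Resolve cont_on_integrable_Re cont_on_integrable_Im : core.

Lemma eq_cint f g a b : (forall x, a <= x <= b -> f x = g x) ->
  cint f a b = cint g a b.
Proof.
by move=> fg; congr (_ +i* _)%C; apply: eq_Rintegral => x;
  rewrite inE /= in_itv /= => /fg ->.
Qed.

Lemma cintD f g a b : cont_on f a b -> cont_on g a b ->
  cint (fun x => f x + g x) a b = cint f a b + cint g a b.
Proof.
move=> hf hg; rewrite {2 3}/cint -[RHS]/((_ + _) +i* (_ + _))%C.
congr (_ +i* _)%C; rewrite -RintegralD//; auto; apply: eq_Rintegral => x _;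
by case: (f x) (g x) => [? ?] [? ?].
Qed.

Lemma cintN f a b : cont_on f a b ->
  cint (fun x => - f x) a b = - cint f a b.
Proof.
move=> hf; rewrite {2}/cint -[RHS]/((- _) +i* (- _))%C.
congr (_ +i* _)%C; rewrite -mulN1r -RintegralZl//; auto; apply: eq_Rintegral => x _;
by case: (f x) => [? ?]; rewrite mulN1r.
Qed.

Lemma cintB f g a b : cont_on f a b -> cont_on g a b ->
  cint (fun x => f x - g x) a b = cint f a b - cint g a b.
Proof.
move=> hf hg; rewrite cintD// ?cintN//.
by move=> x xab; apply: cont_atN; exact: hg.
Qed.

Lemma cintZ (k : C) f a b : cont_on f a b ->
  cint (fun x => k * f x) a b = k * cint f a b.
Proof.
move=> hf; case: k => k1 k2; rewrite {2}/cint.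
rewrite -[RHS]/((_ - _) +i* (_ + _))%C -!RintegralZl//; auto.
have hR k : mu.-integrable `[a, b] (EFin \o (fun x => k * complex.Re (f x))).
  by apply: eq_integrable (integrableZl _ k (cont_on_integrable_Re hf)) => //.
have hI k : mu.-integrable `[a, b] (EFin \o (fun x => k * complex.Im (f x))).
  by apply: eq_integrable (integrableZl _ k (cont_on_integrable_Im hf)) => //.
congr (_ +i* _)%C.
  rewrite -RintegralB//; apply: eq_Rintegral => x _.
  by case: (f x) => [? ?].
rewrite -RintegralD//; apply: eq_Rintegral => x _.
by case: (f x) => [? ?].
Qed.

Lemma cint_cst (k : C) a b : a <= b -> cint (fun=> k) a b = k * (b - a)%:C%C.
Proof.
move=> ab; have h (r : R) : \int[mu]_(x in `[a, b]) r = r * (b - a).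
  rewrite Rintegral_cst//=; congr (_ * _).
  rewrite lebesgue_measure_itv /= lte_fin; case: ltP => [_|ba] //=.
  by rewrite (@le_anti _ _ a b) ?ab ?ba ?subrr.
by rewrite /cint !h; case: k => k1 k2; simpc.
Qed.

(** The factor 2 comes from bounding the real and imaginary parts separately. Only smallness of
    integrals matters later, never the sharp constant. *)
Lemma normc_cint f a b (M : R) : a <= b -> cont_on f a b ->
  (forall x, a <= x <= b -> normc (f x) <= M) ->
  normc (cint f a b) <= 2 * M * (b - a).
Proof.
move=> ab hf fM.
have h (g : R -> R) : mu.-integrable `[a, b] (EFin \o g) ->
    (forall x, a <= x <= b -> `|g x| <= M) ->
    `|\int[mu]_(x in `[a, b]) g x| <= M * (b - a).
  move=> ig gM; apply: (le_trans (le_normr_Rintegral _ ig)) => //.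
  have -> : M * (b - a) = \int[mu]_(x in `[a, b]) M.
    rewrite Rintegral_cst//=; congr (_ * _).
    rewrite lebesgue_measure_itv /= lte_fin; case: ltP => [_|ba] //=.
    by rewrite (@le_anti _ _ a b) ?ab ?ba ?subrr.
  apply: le_Rintegral => //.
  - exact: (integrable_norm ig).
  - apply: continuous_compact_integrable; first exact: segment_compact.
    by apply: continuous_subspaceT => x; exact: cvg_cst.
apply: (le_trans (normc_le_ReIm _)); rewrite /cint /=.
rewrite -mulrA mulr2n mulrDl mul1r lerD// h//; auto => x /fM; apply: le_trans.
  exact: normc_Re.
exact: normc_Im.
Qed.

Lemma cint_cat f a b c : a <= b -> b <= c -> cont_on f a c ->
  cint f a b + cint f b c = cint f a c.
Proof.
move=> ab bc hf; rewrite /cint -[LHS]/((_ + _) +i* (_ + _))%C.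
have hab : cont_on f a b.
  by move=> x /andP[ax xb]; apply: hf; rewrite ax (le_trans xb bc).
have hbc : cont_on f b c.
  by move=> x /andP[bx xc]; apply: hf; rewrite xc (le_trans ab bx).
have h (g : R -> R) : mu.-integrable `[a, b] (EFin \o g) ->
    mu.-integrable `[b, c] (EFin \o g) ->
    mu.-integrable `[a, c] (EFin \o g) ->
  \int[mu]_(x in `[a, b]) g x + \int[mu]_(x in `[b, c]) g x =
  \int[mu]_(x in `[a, c]) g x.
  move=> h1 h2 h3.
  rewrite -[X in X + _]Rintegral_itv_bndo_bndc; last first.
    by apply: integrableS h1 => //; apply: subset_itvl; rewrite bnd_simp.
  rewrite -Rintegral_setU//.
  - by rewrite -itv_bndbnd_setU// bnd_simp.
  - by rewrite -itv_bndbnd_setU// bnd_simp.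
  - apply/disj_setPS => x [] /=; rewrite !in_itv /= => /andP[_ xb] /andP[bx _].
    by move: (lt_le_trans xb bx); rewrite ltxx.
congr (_ +i* _)%C; apply: h; auto.
Qed.

Lemma cint_point f a : cint f a a = 0.
Proof. by rewrite /cint set_itv1 !Rintegral_set1. Qed.

End ComplexIntegral.
Arguments cint : simpl never.

(** * Goursat's theorem on rectangles *)

Section Goursat.
Context {R : realType}.
Local Notation C := (Cplx R).
Implicit Types (f g : C -> C) (a b c d x y : R).

Definition in_rect a b c d (z : C) :=
  (a <= complex.Re z <= b) && (c <= complex.Im z <= d).

(** The contour integral along the boundary, counterclockwise, with opposite sides grouped; dz = i
    dy on the vertical ones. *)
Definition rect_int f a b c d : C :=
  cint (fun x => f (x +i* c)%C - f (x +i* d)%C) a b +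
  'i%C * cint (fun y => f (b +i* y)%C - f (a +i* y)%C) c d.

Local Arguments rect_int : simpl never.

Lemma cont_at_hor f x y : {for (x +i* y)%C : C, continuous f} ->
  cont_at (fun x => f (x +i* y)%C) x.
Proof.
move=> hf; apply: (@cont_at_comp _ f (fun x => (x +i* y)%C)) => // e e0.
exists e => // z ze; rewrite -[_ - _]/((z - x) +i* (y - y))%C subrr.
by rewrite -[(_ +i* 0)%C]/((z - x)%:C%C) normc_real.
Qed.

Lemma cont_at_vert f x y : {for (x +i* y)%C : C, continuous f} ->
  cont_at (fun y => f (x +i* y)%C) y.
Proof.
move=> hf; apply: (@cont_at_comp _ f (fun y => (x +i* y)%C)) => // e e0.
exists e => // z ze; rewrite -[_ - _]/((x - x) +i* (z - y))%C subrr.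
by rewrite /normc /= expr0n /= add0r sqrtr_sqr.
Qed.

Definition rect_cont f a b c d := forall z, in_rect a b c d z ->
  {for z, continuous f}.

Lemma rect_cont_hor f a b c d y : rect_cont f a b c d -> c <= y <= d ->
  cont_on (fun x => f (x +i* y)%C) a b.
Proof.
by move=> hf yab x xab; apply: cont_at_hor; apply: hf; rewrite /in_rect /= xab.
Qed.

Lemma rect_cont_vert f a b c d x : rect_cont f a b c d -> a <= x <= b ->
  cont_on (fun y => f (x +i* y)%C) c d.
Proof.
by move=> hf xab y yab; apply: cont_at_vert; apply: hf; rewrite /in_rect /= xab.
Qed.

Lemma rect_contS f a b c d a' b' c' d' : rect_cont f a b c d ->
  a <= a' -> b' <= b -> c <= c' -> d' <= d -> rect_cont f a' b' c' d'.
Proof.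
move=> hf aa bb cc dd z /andP[/andP[h1 h2] /andP[h3 h4]]; apply: hf.
by rewrite /in_rect (le_trans aa h1) (le_trans h2 bb) (le_trans cc h3) (le_trans h4 dd).
Qed.

Lemma rect_edges f a b c d : a <= b -> c <= d -> rect_cont f a b c d ->
  cont_on (fun x => f (x +i* c)%C - f (x +i* d)%C) a b /\
  cont_on (fun y => f (b +i* y)%C - f (a +i* y)%C) c d.
Proof.
move=> ab cd hf; split; apply: cont_onB.
- by apply: (rect_cont_hor hf); rewrite lexx.
- by apply: (rect_cont_hor hf); rewrite lexx andbT.
- by apply: (rect_cont_vert hf); rewrite lexx andbT.
- by apply: (rect_cont_vert hf); rewrite lexx.
Qed.

Lemma rect_intB f g a b c d : a <= b -> c <= d ->
  rect_cont f a b c d -> rect_cont g a b c d ->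
  rect_int (fun z => f z - g z) a b c d = rect_int f a b c d - rect_int g a b c d.
Proof.
move=> ab cd hf hg; rewrite /rect_int opprD addrACA -mulrBr.
have [f1 f2] := rect_edges ab cd hf; have [g1 g2] := rect_edges ab cd hg.
rewrite -(cintB f1 g1) -(cintB f2 g2).
by congr (_ + _ * _); apply: eq_cint => x _; ring.
Qed.

(** Differences of an affine function across opposite sides are constant, so the integral is
    computed by hand. This is what may be subtracted from [f] in Goursat's argument. *)
Lemma rect_int_affine (u k : C) a b c d : a <= b -> c <= d ->
  rect_int (fun z => u + k * z) a b c d = 0.
Proof.
move=> ab cd; rewrite /rect_int.
rewrite (_ : cint _ a b = cint (fun=> k * ('i%C * (c - d)%:C%C)) a b); last first.
  apply: eq_cint => x _; rewrite opprD addrACA subrr add0r -mulrBr.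
  by congr (_ * _); apply/eqP; rewrite eq_complex /=; apply/andP; split; apply/eqP; ring.
rewrite (_ : cint _ c d = cint (fun=> k * (b - a)%:C%C) c d); last first.
  apply: eq_cint => x _; rewrite opprD addrACA subrr add0r -mulrBr.
  by congr (_ * _); apply/eqP; rewrite eq_complex /=; apply/andP; split; apply/eqP; ring.
rewrite !cint_cst// -[c - d]opprB rmorphN /=; ring.
Qed.

Lemma rect_int_vsplit f a m b c d : a <= m -> m <= b -> c <= d ->
  rect_cont f a b c d ->
  rect_int f a m c d + rect_int f m b c d = rect_int f a b c d.
Proof.
move=> am mb cd hf; rewrite /rect_int.
have ab := le_trans am mb.
have [e1 _] := rect_edges ab cd hf.
rewrite addrACA (cint_cat am mb e1) -mulrDr.
have [_ e2] := rect_edges am cd (rect_contS hf (lexx _) mb (lexx _) (lexx _)).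
have [_ e3] := rect_edges mb cd (rect_contS hf am (lexx _) (lexx _) (lexx _)).
rewrite -(cintD e2 e3).
by congr (_ + _ * _); apply: eq_cint => x _; ring.
Qed.

Lemma rect_int_hsplit f a b c m d : a <= b -> c <= m -> m <= d ->
  rect_cont f a b c d ->
  rect_int f a b c m + rect_int f a b m d = rect_int f a b c d.
Proof.
move=> ab cm md hf; rewrite /rect_int.
have cd := le_trans cm md.
have [_ e1] := rect_edges ab cd hf.
rewrite addrACA -mulrDr (cint_cat cm md e1).
have [e2 _] := rect_edges ab cm (rect_contS hf (lexx _) (lexx _) (lexx _) md).
have [e3 _] := rect_edges ab md (rect_contS hf (lexx _) (lexx _) cm (lexx _)).
rewrite -(cintD e2 e3).
by congr (_ + _ * _); apply: eq_cint => x _; ring.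
Qed.

Lemma normc_i : normc ('i%C : C) = 1.
Proof. by rewrite /normc /= expr0n /= add0r expr1n sqrtr1. Qed.

Lemma normc_rect_int f a b c d (M : R) : a <= b -> c <= d ->
  rect_cont f a b c d ->
  (forall z, in_rect a b c d z -> normc (f z) <= M) ->
  normc (rect_int f a b c d) <= 4 * M * ((b - a) + (d - c)).
Proof.
move=> ab cd hf fM.
have cc : c <= c <= d by rewrite lexx.
have dd : c <= d <= d by rewrite lexx andbT.
have aa : a <= a <= b by rewrite lexx.
have bb : a <= b <= b by rewrite lexx andbT.
have [e1 e2] := rect_edges ab cd hf.
apply: (le_trans (le_normcD _ _)); rewrite normcM normc_i mul1r mulrDr.
have -> : 4 * M = 2 * (M + M) by ring.
rewrite lerD// normc_cint//.
- move=> x xab; apply: (le_trans (le_normcD _ _)); rewrite normcN.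
  by rewrite lerD// fM// /in_rect /= xab.
- move=> x xab; apply: (le_trans (le_normcD _ _)); rewrite normcN.
  by rewrite lerD// fM// /in_rect /= xab ?aa ?bb.
Qed.

(** Bisection: some quarter keeps at least a quarter of the integral, and the nested rectangles
    shrink to a point [p]. There [f] differs from its affine approximation by o(size), so the
    integral is o(size^2), against a lower bound of order size^2. *)
Lemma goursat f a b c d : a <= b -> c <= d ->
  (forall z, in_rect a b c d z -> differentiable f z) ->
  rect_int f a b c d = 0.
Proof.
move=> ab cd df.
have hc : rect_cont f a b c d by move=> z /df /differentiable_continuous.
pose w := b - a; pose h := d - c.
have w0 : 0 <= w by rewrite subr_ge0.
have h0 : 0 <= h by rewrite subr_ge0.
pose half n (x : R) := x / 2 ^+ n.
have halfD n x : half n.+1 x + half n.+1 x = half n x.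
  by rewrite /half exprS; field; rewrite expf_neq0.
have half_ge0 n x : 0 <= x -> 0 <= half n x.
  by move=> x0; rewrite divr_ge0// exprn_ge0.
(* The state [(n, (x, y))] stands for the rectangle with lower left corner [(x, y)] and sides
   [w / 2 ^ n], [h / 2 ^ n]. *)
pose valid (s : nat * (R * R)) := let: (n, (x, y)) := s in
  [&& a <= x, x + half n w <= b, c <= y & y + half n h <= d].
pose rint (s : nat * (R * R)) := let: (n, (x, y)) := s in
  rect_int f x (x + half n w) y (y + half n h).
apply/eqP; apply: contrapT => /negP neq0.
pose E := normc (rect_int f a b c d).
have E0 : 0 < E by rewrite normc_gt0.
pose bad s := valid s && (E / 4 ^+ s.1 <= normc (rint s)).
pose next (s t : {s | bad s}) := let: (n, (x, y)) := val s in
  let: (n', (x', y')) := val t in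
  [/\ n' = n.+1, x' = x \/ x' = x + half n.+1 w &
      y' = y \/ y' = y + half n.+1 h].
have step s : {t | next s t}.
  apply: cid; case: s => [[n [x y]] badn].
  have /andP[/and4P[ax xb cy yd] big] := badn.
  pose x1 := x + half n.+1 w; pose y1 := y + half n.+1 h.
  have x1E : x1 + half n.+1 w = x + half n w by rewrite -addrA halfD.
  have y1E : y1 + half n.+1 h = y + half n h by rewrite -addrA halfD.
  have xx1 : x <= x1 by rewrite lerDl half_ge0.
  have yy1 : y <= y1 by rewrite lerDl half_ge0.
  have x1x : x1 <= x + half n w by rewrite -x1E lerDl half_ge0.
  have y1y : y1 <= y + half n h by rewrite -y1E lerDl half_ge0.
  have hcn : rect_cont f x (x + half n w) y (y + half n h).
    exact: (rect_contS hc).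
  have v1 : valid (n.+1, (x, y)).
    by rewrite /= ax cy (le_trans x1x)// (le_trans y1y).
  have v2 : valid (n.+1, (x1, y)).
    by rewrite /= x1E xb cy (le_trans ax)//= (le_trans y1y).
  have v3 : valid (n.+1, (x, y1)).
    by rewrite /= ax y1E yd (le_trans cy)//= (le_trans x1x).
  have v4 : valid (n.+1, (x1, y1)).
    by rewrite /= x1E xb y1E yd (le_trans cy)//= (le_trans ax).
  have splitE : rint (n, (x, y)) = rint (n.+1, (x, y)) + rint (n.+1, (x1, y)) +
      (rint (n.+1, (x, y1)) + rint (n.+1, (x1, y1))).
    rewrite /rint -/x1 -/y1 x1E y1E.
    have r1 := rect_contS hcn (lexx _) (lexx _) (lexx _) y1y.
    have r2 := rect_contS hcn (lexx _) (lexx _) yy1 (lexx _).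
    rewrite (rect_int_vsplit xx1 x1x yy1 r1) (rect_int_vsplit xx1 x1x y1y r2).
    by rewrite (rect_int_hsplit (le_trans xx1 x1x) yy1 y1y hcn).
  have ex : exists p : R * R, [/\ bad (n.+1, p), p.1 = x \/ p.1 = x1 &
      p.2 = y \/ p.2 = y1].
    apply: contrapT => /forallNP nex.
    have small p : valid (n.+1, p) -> p.1 = x \/ p.1 = x1 ->
        p.2 = y \/ p.2 = y1 -> normc (rint (n.+1, p)) < E / 4 ^+ n.+1.
      move=> vp p1 p2; rewrite ltNge; apply/negP => bp; apply: (nex p).
      by split=> //; rewrite /bad vp.
    move: big; rewrite leNgt => /negP; apply; rewrite splitE.
    have -> : E / 4 ^+ (n, (x, y)).1 = (E / 4 ^+ n.+1 + E / 4 ^+ n.+1) +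
        (E / 4 ^+ n.+1 + E / 4 ^+ n.+1).
      by rewrite /= exprS; field; rewrite expf_neq0.
    apply: (le_lt_trans (le_normcD _ _)); apply: ltrD;
      apply: (le_lt_trans (le_normcD _ _)); apply: ltrD.
    - exact: (small (x, y) v1 (or_introl erefl) (or_introl erefl)).
    - exact: (small (x1, y) v2 (or_intror erefl) (or_introl erefl)).
    - exact: (small (x, y1) v3 (or_introl erefl) (or_intror erefl)).
    - exact: (small (x1, y1) v4 (or_intror erefl) (or_intror erefl)).
  case: ex => -[x' y'] [bp p1 p2].
  by exists (exist _ (n.+1, (x', y')) bp); split.
have bad0 : bad (0%N, (a, c)).
  rewrite /bad /= /half expr0 !divr1 !lexx /w /h !subrKC !lexx /=.
  by [].
have [s [s0 sS]] := dependent_choice step (exist (fun s => is_true (bad s)) _ bad0).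
pose X n := (val (s n)).2.1; pose Y n := (val (s n)).2.2.
have sE n : val (s n) = (n, (X n, Y n)).
  rewrite /X /Y; suff : (val (s n)).1 = n by case: (val (s n)) => ? [? ?] /= ->.
  elim: n => [|n IH]; first by rewrite s0.
  have := sS n; rewrite /next; case: (val (s n)) IH => ? [? ?] /= ->.
  by case: (val (s n.+1)) => ? [? ?] [-> _ _].
have XS n : X n <= X n.+1 /\ X n.+1 + half n.+1 w <= X n + half n w.
  have := sS n; rewrite /next !sE -(halfD n) => -[_ [->|->] _]; split => //.
  - by rewrite lerD2l lerDl half_ge0.
  - by rewrite lerDl half_ge0.
  - by rewrite addrA.
have YS n : Y n <= Y n.+1 /\ Y n.+1 + half n.+1 h <= Y n + half n h.
  have := sS n; rewrite /next !sE -(halfD n) => -[_ _ [->|->]]; split => //.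
  - by rewrite lerD2l lerDl half_ge0.
  - by rewrite lerDl half_ge0.
  - by rewrite addrA.
have limP (Z : nat -> R) k : 0 <= k ->
    (forall n, Z n <= Z n.+1 /\ Z n.+1 + half n.+1 k <= Z n + half n k) ->
    exists p, forall n, Z n <= p <= Z n + half n k.
  move=> k0 ZS.
  have mono m n : (m <= n)%N -> Z m <= Z n.
    move=> /subnK <-; elim: (n - m)%N => // i /le_trans; apply.
    by rewrite addSn (ZS _).1.
  have mono2 m n : (m <= n)%N -> Z n + half n k <= Z m + half m k.
    move=> /subnK <-; elim: (n - m)%N => // i; apply: le_trans.
    by rewrite addSn (ZS _).2.
  have ub m n : Z m <= Z n + half n k.
    case: (leqP m n) => mn.
      by rewrite (le_trans (mono _ _ mn))// lerDl half_ge0.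
    by rewrite (le_trans _ (mono2 _ _ (ltnW mn)))// lerDl half_ge0.
  exists (sup (range Z)) => n; apply/andP; split.
    apply: ub_le_sup; last by exists n.
    by exists (Z 0%N + half 0 k) => _ [m _ <-].
  apply: ge_sup; first by exists (Z 0%N), 0%N.
  by move=> _ [m _ <-].
have [px pxP] := limP X w w0 XS; have [py pyP] := limP Y h h0 YS.
have sv n : valid (n, (X n, Y n)) && (E / 4 ^+ n <= normc (rint (n, (X n, Y n)))).
  by have := valP (s n); rewrite sE.
pose p : C := (px +i* py)%C.
have pin : in_rect a b c d p.
  have /andP[/and4P[v1 v2 v3 v4] _] := sv 0%N.
  have /andP[x1 x2] := pxP 0%N; have /andP[y1 y2] := pyP 0%N.
  by rewrite /in_rect /= (le_trans v1 x1) (le_trans x2 v2) (le_trans v3 y1) (le_trans y2 v4).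
have /differentiable_normcP[l hl] := df _ pin.
(* A rectangle reduced to a point is set aside because [w + h] becomes a denominator. *)
have [wh0|wh0] := eqVneq (w + h) 0.
  have [ww hh] : w = 0 /\ h = 0.
    by split; apply/eqP; rewrite eq_le ?w0 ?h0 andbT -wh0 ?lerDl ?lerDr.
  move: neq0; rewrite /rect_int.
  have -> : b = a by apply/eqP; rewrite -subr_eq0 -/w ww.
  have -> : d = c by apply/eqP; rewrite -subr_eq0 -/h hh.
  by rewrite !cint_point mulr0 addr0 eqxx.
have whp : 0 < w + h by rewrite lt_def wh0 addr_ge0.
(* With this choice the bound [4 * e * (w + h) ^+ 2 / 4 ^+ n] of the integral at stage [n] is half
   of the lower bound [E / 4 ^+ n]. *)
pose e := E / (8 * (w + h) ^+ 2).
have e0 : 0 < e by rewrite divr_gt0// mulr_gt0// exprn_gt0.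
have [dl dl0 hdl] := hl _ e0.
have [n hn] : exists n, half n (w + h) < dl.
  exists (Num.bound ((w + h) / dl)).
  rewrite /half ltr_pdivrMr ?exprn_gt0// -ltr_pdivrMl// mulrC.
  have := archi_boundP (divr_ge0 (ltW whp) (ltW dl0)) => /lt_trans; apply.
  by rewrite -natrX ltr_nat ltn_expl.
have /andP[/and4P[v1 v2 v3 v4] big] := sv n.
have zp z : in_rect (X n) (X n + half n w) (Y n) (Y n + half n h) z ->
    normc (z - p) <= half n (w + h).
  move=> /andP[/andP[h1 h2] /andP[h3 h4]]; apply: (le_trans (normc_le_ReIm _)).
  rewrite /half mulrDl lerD//.
    have -> : complex.Re (z - p) = complex.Re z - px by case: (z).
    have /andP[? ?] := pxP n; rewrite ler_norml; apply/andP; split.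
      by rewrite -/(half n w); lra.
    by rewrite -/(half n w); lra.
  have -> : complex.Im (z - p) = complex.Im z - py by case: (z).
  have /andP[? ?] := pyP n; rewrite ler_norml; apply/andP; split.
    by rewrite -/(half n h); lra.
  by rewrite -/(half n h); lra.
have hcn : rect_cont f (X n) (X n + half n w) (Y n) (Y n + half n h).
  exact: (rect_contS hc).
pose g := fun z : C => f p - l * p + l * z.
have hg z : {for z, continuous g}.
  apply: (@continuousD R[i] C); first exact: cst_continuous.
  exact: (@mulrl_continuous R[i] l).
have xle : X n <= X n + half n w by rewrite lerDl half_ge0.
have yle : Y n <= Y n + half n h by rewrite lerDl half_ge0.
have := big; rewrite /rint leNgt => /negP; apply.
rewrite -[rect_int f _ _ _ _]subr0 -[X in _ - X](rect_int_affine (f p - l * p) l xle yle).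
have hgc : rect_cont g (X n) (X n + half n w) (Y n) (Y n + half n h).
  by move=> z _; exact: hg.
rewrite -(rect_intB xle yle hcn hgc).
apply: (@le_lt_trans _ _ (4 * (e * half n (w + h)) * (half n w + half n h))).
  have -> : half n w + half n h =
    (X n + half n w - X n) + (Y n + half n h - Y n) by ring.
  apply: (normc_rect_int xle yle).
    move=> z hz; apply: (@continuousB R[i] C); first exact: hcn.
    exact: hg.
  move=> z /zp hz.
  have -> : f z - (f p - l * p + l * z) = f (p + (z - p)) - f p - l * (z - p).
    by rewrite subrKC; ring.
  apply: (le_trans (hdl _ (le_lt_trans hz hn))).
  by rewrite ler_pM2l.
rewrite /half /e.
have -> : 4 * (E / (8 * (w + h) ^+ 2) * ((w + h) / 2 ^+ n)) * (w / 2 ^+ n + h / 2 ^+ n)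
  = E / 2 / (2 ^+ n * 2 ^+ n) by field; rewrite wh0 expf_neq0.
rewrite -exprMn_comm; last exact: mulrC.
rewrite -natrM ltr_pM2r ?invr_gt0 ?exprn_gt0//.
by rewrite ltr_pdivrMr// ltr_pMr// ltr1n.
Qed.

End Goursat.
Arguments rect_int : simpl never.

(** * The complex exponential and e^{2 pi i z} *)

Section ComplexExp.
Context {R : realType}.
Local Notation C := (Cplx R).
Implicit Types (z w : C).

Lemma is_derive_small (f : R -> R) (x l : R) : is_derive x 1 f l ->
  forall e : R, 0 < e -> exists2 dl : R, 0 < dl &
    forall h : R, `|h| < dl -> `|f (x + h) - f x - l * h| <= e * `|h|.
Proof.
move=> [df dv] e e0.
have : h^-1 *: ((f \o shift x) (h *: 1) - f x) @[h --> 0^'] --> l.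
  by rewrite -dv; exact: df.
move=> /cvgrPdist_le /(_ _ e0)[dl /= dl0 H]; exists dl => // h hdl.
have [->|h0] := eqVneq h 0; first by rewrite addr0 mulr0 !subrr normr0 mulr0.
have := H h; rewrite /ball /= sub0r normrN => /(_ hdl h0).
rewrite /shift /= -[h *: 1]/(h * 1) mulr1 [h + x]addrC.
rewrite -(ler_pM2r (_ : 0 < `|h|)) ?normr_gt0// -normrM distrC mulrBl.
rewrite -[_ *: _]/(_ * _) [_ * (_ - _)]mulrC -mulrA mulVf// mulr1.
by apply.
Qed.

Lemma cexpD z w : cexp (z + w) = cexp z * cexp w.
Proof.
case: z w => [x y] [x' y']; rewrite /cexp /= expRD cosD sinD rmorphM /=.
rewrite mulrACA; congr (_ * _).
by apply/eqP; rewrite eq_complex /=; apply/andP; split; apply/eqP; ring.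
Qed.

Lemma cexp0 : cexp (0 : C) = 1.
Proof. by rewrite /cexp /= expR0 cos0 sin0 mul1r. Qed.

Lemma normc_cexp z : normc (cexp z) = expR (complex.Re z).
Proof.
case: z => x y; rewrite /cexp /= normcM normc_real gtr0_norm ?expR_gt0//.
by rewrite /normc cos2Dsin2 sqrtr1 mulr1.
Qed.

Lemma cexp_neq0 z : cexp z != 0.
Proof. by rewrite -normc_eq0 normc_cexp gt_eqF ?expR_gt0. Qed.

Lemma cexpN z : cexp (- z) = (cexp z)^-1.
Proof.
apply: (mulIf (cexp_neq0 z)); rewrite -cexpD addNr cexp0 mulVf//.
exact: cexp_neq0.
Qed.

(** The derivative at 0, assembled from the real derivatives of exp, cos and sin; the addition
    formula transports it to every point. *)
Lemma cexp_small : forall e : R, 0 < e -> exists2 dl : R, 0 < dl &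
  forall w, normc w < dl -> normc (cexp w - 1 - w) <= e * normc w.
Proof.
move=> e e0.
(* The four error terms [B1] to [B4] below contribute 1, 3, 2 and 3 times [e' * normc w], hence the
   9. *)
have [e' [e'0 e'1 e'e]] : exists e' : R, [/\ 0 < e', e' <= 1 & e' <= e / 9].
  exists (Num.min 1 (e / 9)).
  by rewrite lt_min ltr01 divr_gt0//; split => //; rewrite ge_min lexx ?orbT.
have [d1 d10 h1] := is_derive_small (is_derive_expR 0) e'0.
have [d2 d20 h2] := is_derive_small (is_derive_cos 0) e'0.
have [d3 d30 h3] := is_derive_small (is_derive_sin 0) e'0.
exists (Num.min e' (Num.min d1 (Num.min d2 d3))).
  by rewrite !lt_min e'0 d10 d20.
move=> [x y]; set w := (x +i* y)%C; rewrite !lt_min => /and4P[we wd1 wd2 wd3].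
have xw : `|x| <= normc w by exact: (normc_Re w).
have yw : `|y| <= normc w by exact: (normc_Im w).
have := h1 x (le_lt_trans xw wd1); rewrite add0r expR0 mul1r => H1.
have := h2 y (le_lt_trans yw wd2).
rewrite add0r cos0 sin0 oppr0 mul0r subr0 => H2.
have := h3 y (le_lt_trans yw wd3).
rewrite add0r cos0 sin0 subr0 mul1r => H3.
have ex2 : `|expR x| <= 3.
  have -> : expR x = (expR x - 1 - x) + (1 + x) by ring.
  apply: (le_trans (ler_normD _ _)).
  have -> : 3 = 1 + 2 :> R by ring.
  apply: lerD.
    apply: (le_trans H1); rewrite mulr_ile1 ?(ltW e'0)//.
    exact: (le_trans xw (le_trans (ltW we) e'1)).
  apply: (le_trans (ler_normD _ _)); rewrite normr1.
  by rewrite [2]mulr2n lerD2l; exact: (le_trans xw (le_trans (ltW we) e'1)).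
have ex1 : `|expR x - 1| <= 2 * e'.
  have -> : expR x - 1 = (expR x - 1 - x) + x by ring.
  apply: (le_trans (ler_normD _ _)); rewrite mulr2n mulrDl mul1r; apply: lerD.
    apply: (le_trans H1); rewrite ger_pMr//.
    exact: (le_trans xw (le_trans (ltW we) e'1)).
  exact: (le_trans xw (ltW we)).
have nw := normc_ge0 w.
apply: (le_trans (normc_le_ReIm _)).
have -> : complex.Re (cexp w - 1 - w) = (expR x - 1 - x) + expR x * (cos y - 1).
  by rewrite /cexp /=; ring.
have -> : complex.Im (cexp w - 1 - w) = (expR x - 1) * y + expR x * (sin y - y).
  by rewrite /cexp /=; ring.
have B1 : `|expR x - 1 - x| <= e' * normc w.
  by rewrite (le_trans H1)// ler_pM2l.
have B2 : `|expR x * (cos y - 1)| <= 3 * (e' * normc w).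
  rewrite normrM; apply: ler_pM => //.
  by rewrite (le_trans H2)// ler_pM2l.
have B3 : `|(expR x - 1) * y| <= 2 * e' * normc w by rewrite normrM ler_pM.
have B4 : `|expR x * (sin y - y)| <= 3 * (e' * normc w).
  rewrite normrM; apply: ler_pM => //.
  by rewrite (le_trans H3)// ler_pM2l.
apply: (@le_trans _ _ (9 * (e' * normc w))).
  have := ler_normD (expR x - 1 - x) (expR x * (cos y - 1)).
  have := ler_normD ((expR x - 1) * y) (expR x * (sin y - y)).
  lra.
rewrite mulrA ler_wpM2r//; lra.
Qed.

Lemma differentiable_cexp z : differentiable (cexp : C -> C) z.
Proof.
apply/differentiable_normcP; exists (cexp z) => e e0.
have c0 : 0 < normc (cexp z) by rewrite normc_cexp expR_gt0.
have [dl dl0 h] := cexp_small (divr_gt0 e0 c0).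
exists dl => // w /h hw.
have -> : cexp (z + w) - cexp z - cexp z * w = cexp z * (cexp w - 1 - w).
  by rewrite cexpD; ring.
rewrite normcM -ler_pdivlMl// mulrA [_^-1 * e]mulrC; exact: hw.
Qed.

Lemma differentiable_comp1 (f g : C -> C) z : differentiable f z ->
  differentiable g (f z) -> differentiable (fun x => g (f x)) z.
Proof. by move=> hf hg; exact: (differentiable_comp hf hg). Qed.

Lemma differentiable_mul (f g : C -> C) z : differentiable f z ->
  differentiable g z -> differentiable (fun x => f x * g x) z.
Proof. by move=> hf hg; exact: (differentiableM hf hg). Qed.

Lemma differentiable_exp (f : C -> C) n z : differentiable f z ->
  differentiable (fun x => f x ^+ n) z.
Proof.
move=> h; elim: n => [|n IH]; first exact: (differentiable_cst (1 : C)).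
have -> : (fun x : C => f x ^+ n.+1) = (fun x => f x * f x ^+ n).
  by apply/funext => x; rewrite exprS.
exact: differentiable_mul.
Qed.

Lemma differentiable_inv (f : C -> C) z : differentiable f z -> f z != 0 ->
  differentiable (fun x => (f x)^-1) z.
Proof. by move=> hf h0; exact: (differentiableV hf h0). Qed.

Lemma differentiable_sub (f g : C -> C) z : differentiable f z ->
  differentiable g z -> differentiable (fun x => f x - g x) z.
Proof. by move=> hf hg; exact: (differentiableB hf hg). Qed.

Lemma differentiable_add (f g : C -> C) z : differentiable f z ->
  differentiable g z -> differentiable (fun x => f x + g x) z.
Proof. by move=> hf hg; exact: (differentiableD hf hg). Qed.

Lemma differentiable_near (f g : C -> C) z :
  (exists2 r : R, 0 < r & forall w, normc (w - z) < r -> f w = g w) ->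
  differentiable f z -> differentiable g z.
Proof.
move=> [r r0 fg] /differentiable_normcP[l h]; apply/differentiable_normcP.
exists l => e /h[dl dl0 hd]; exists (Num.min r dl); first by rewrite lt_min r0.
move=> w; rewrite lt_min => /andP[wr wd]; rewrite -!fg ?subrr ?normc0//.
  exact: hd.
by rewrite addrAC subrr add0r.
Qed.

Definition e2pi z : C := cexp (2 * (pi : R)%:C%C * 'i%C * z).

Lemma e2piD z w : e2pi (z + w) = e2pi z * e2pi w.
Proof. by rewrite /e2pi mulrDr cexpD. Qed.

Lemma e2pi0 : e2pi 0 = 1.
Proof. by rewrite /e2pi mulr0 cexp0. Qed.

Lemma e2piN z : e2pi (- z) = (e2pi z)^-1.
Proof. by rewrite /e2pi mulrN cexpN. Qed.

Lemma e2pi_neq0 z : e2pi z != 0.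
Proof. exact: cexp_neq0. Qed.

Lemma normc_e2pi z : normc (e2pi z) = expR (- (2 * pi * complex.Im z)).
Proof.
case: z => x y; rewrite normc_cexp; congr expR; rewrite -[2]/(1 *+ 2) /=; ring.
Qed.

Lemma e2pi1 : e2pi 1 = 1.
Proof.
rewrite /e2pi mulr1 /cexp.
have -> : 2 * (pi : R)%:C%C * 'i%C = (0 +i* (2 * pi))%C.
  by apply/eqP; rewrite eq_complex -[2 in X in X == _]/(1 *+ 2) /=;
    apply/andP; split; apply/eqP; ring.
rewrite /= expR0 mul1r.
have -> : 2 * pi = pi *+ 2 :> R by rewrite mulr_natl.
by rewrite cos2pi sin2pi.
Qed.

Lemma e2pi_nat n : e2pi n%:R = 1.
Proof.
elim: n => [|n IH]; first exact: e2pi0.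
by rewrite -natr1 e2piD IH e2pi1 mul1r.
Qed.

Lemma e2pi_int (n : int) : e2pi n%:~R = 1.
Proof.
case: n => n; first exact: e2pi_nat.
by rewrite NegzE mulrNz e2piN [_%:~R]/(n.+1%:R) e2pi_nat invr1.
Qed.

Lemma differentiable_e2pi z : differentiable (e2pi : C -> C) z.
Proof.
apply: (@differentiable_comp1 (fun z => 2 * (pi : R)%:C%C * 'i%C * z)).
  by apply: differentiable_mul; [exact: differentiable_cst|].
exact: differentiable_cexp.
Qed.

End ComplexExp.

(* Inductive wrappers: unlike [differentiable] and [continuous], they are rigid
   for unification, which keeps trivial side goals cheap. *)
Variant cdiff {R : realType} (f : Cplx R -> Cplx R) (z : Cplx R) : Prop :=
  Cdiff of differentiable f z.

Variant ccont {R : realType} (f : Cplx R -> Cplx R) (z : Cplx R) : Prop :=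
  Ccont of {for z, continuous f}.

Section Cdiff.
Context {R : realType}.
Local Notation C := (Cplx R).
Implicit Types (f g : C -> C) (z w : C).

Lemma cdiffP f z : cdiff f z <->
  exists l : C, forall e : R, 0 < e -> exists2 dl : R, 0 < dl &
    forall w, normc w < dl -> normc (f (z + w) - f z - l * w) <= e * normc w.
Proof.
by split=> [[]/differentiable_normcP//|/differentiable_normcP]; constructor.
Qed.

Lemma ccontP f z : ccont f z <->
  forall e : R, 0 < e -> exists2 dl : R, 0 < dl &
    forall w, normc (w - z) < dl -> normc (f w - f z) < e.
Proof. by split=> [[]/cvg_normcP//|/cvg_normcP]; constructor. Qed.

Lemma cdiff_cont f z : cdiff f z -> ccont f z.
Proof. by case=> /differentiable_continuous; constructor. Qed.

Lemma cdiff_cst (k : C) z : cdiff (fun=> k) z.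
Proof. by constructor; exact: differentiable_cst. Qed.

Lemma cdiff_id z : cdiff (fun w => w) z.
Proof. by constructor. Qed.

Lemma cdiff_comp f g z : cdiff f z -> cdiff g (f z) -> cdiff (fun u => g (f u)) z.
Proof. by case=> hf [hg]; constructor; exact: differentiable_comp1. Qed.

Lemma cdiffM f g z : cdiff f z -> cdiff g z -> cdiff (fun u => f u * g u) z.
Proof. by case=> hf [hg]; constructor; exact: differentiable_mul. Qed.

Lemma cdiffX f n z : cdiff f z -> cdiff (fun u => f u ^+ n) z.
Proof. by case=> hf; constructor; exact: differentiable_exp. Qed.

Lemma cdiffV f z : cdiff f z -> f z != 0 -> cdiff (fun u => (f u)^-1) z.
Proof. by case=> hf h0; constructor; exact: differentiable_inv. Qed.

Lemma cdiffB f g z : cdiff f z -> cdiff g z -> cdiff (fun u => f u - g u) z.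
Proof. by case=> hf [hg]; constructor; exact: differentiable_sub. Qed.

Lemma cdiffD f g z : cdiff f z -> cdiff g z -> cdiff (fun u => f u + g u) z.
Proof. by case=> hf [hg]; constructor; exact: differentiable_add. Qed.

Lemma cdiff_prod (I : Type) (r : seq I) (F : I -> C -> C) z :
  (forall i, cdiff (F i) z) -> cdiff (fun u => \prod_(i <- r) F i u) z.
Proof.
move=> h; elim: r => [|i r IH].
  rewrite (_ : (fun _ => _) = fun=> 1); first exact: cdiff_cst.
  by apply/funext => u; rewrite big_nil.
rewrite (_ : (fun _ => _) = fun u => F i u * \prod_(i <- r) F i u).
  exact: cdiffM.
by apply/funext => u; rewrite big_cons.
Qed.

Lemma cdiff_near f g z :
  (exists2 r : R, 0 < r & forall w, normc (w - z) < r -> f w = g w) ->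
  cdiff f z -> cdiff g z.
Proof. by move=> fg [hf]; constructor; exact: differentiable_near hf. Qed.

Lemma cdiff_e2pi z : cdiff (e2pi : C -> C) z.
Proof. by constructor; exact: differentiable_e2pi. Qed.

Lemma ccont_cst (k : C) z : ccont (fun=> k) z.
Proof. exact/cdiff_cont/cdiff_cst. Qed.

Lemma ccontB f g z : ccont f z -> ccont g z -> ccont (fun u => f u - g u) z.
Proof. case=> hf [hg]; constructor; apply: (@continuousB R[i] C); [exact: hf|exact: hg]. Qed.

Lemma ccontM f g z : ccont f z -> ccont g z -> ccont (fun u => f u * g u) z.
Proof. case=> hf [hg]; constructor; apply: (@continuousM R[i] C); [exact: hf|exact: hg]. Qed.

Lemma ccont_comp f g z : ccont f z -> ccont g (f z) -> ccont (fun u => g (f u)) z.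
Proof.
move=> /ccontP hf /ccontP hg; apply/ccontP => e /hg[d1 /hf[d2 d20 h2] h1].
by exists d2 => // w /h2 /h1.
Qed.

Lemma ccont_hor f (x y : R) : ccont f (x +i* y)%C ->
  cont_at (fun x => f (x +i* y)%C) x.
Proof. by case; exact: cont_at_hor. Qed.

Lemma goursat_cdiff f a b c d : a <= b -> c <= d ->
  (forall z, in_rect a b c d z -> cdiff f z) -> rect_int f a b c d = 0.
Proof. by move=> ab cd h; apply: goursat => // z /h[]. Qed.

End Cdiff.

(** * Cauchy's formula and Taylor expansion, with circles parametrised by e^{2 pi i x} *)

Section Cauchy.
Context {R : realType}.
Local Notation C := (Cplx R).
Implicit Types (f g F G psi : C -> C) (z w a : C) (x y : R).

(** By periodicity the vertical sides of the rectangle cancel in Goursat's theorem. *)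
Lemma cint_periodic psi y1 y2 : y1 <= y2 ->
  (forall z, in_rect 0 1 y1 y2 z -> cdiff psi z) ->
  (forall y, y1 <= y <= y2 -> psi (1 +i* y)%C = psi (0 +i* y)%C) ->
  cint (fun x => psi (x +i* y1)%C) 0 1 = cint (fun x => psi (x +i* y2)%C) 0 1.
Proof.
move=> y12 dpsi per.
have hc : rect_cont psi 0 1 y1 y2 by move=> z /dpsi /cdiff_cont[].
have := goursat_cdiff ler01 y12 dpsi; rewrite /rect_int.
rewrite (@eq_cint _ _ (fun=> 0) y1 y2); last by move=> y /per ->; rewrite subrr.
rewrite (cint_cst _ y12) mul0r mulr0 addr0.
have c1 : cont_on (fun x => psi (x +i* y1)%C) 0 1.
  by apply: (rect_cont_hor hc); rewrite lexx.
have c2 : cont_on (fun x => psi (x +i* y2)%C) 0 1.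
  by apply: (rect_cont_hor hc); rewrite lexx andbT.
by rewrite (cintB c1 c2) => /eqP; rewrite subr_eq0 => /eqP.
Qed.

Lemma normc_dist_ReIm (x y x' y' : R) :
  normc ((x +i* y)%C - (x' +i* y')%C : C) <= `|x - x'| + `|y - y'|.
Proof. exact: normc_le_ReIm. Qed.

Lemma unif_cont_segment psi y0 :
  (forall x, 0 <= x <= 1 -> ccont psi ((x +i* y0)%C : C)) ->
  forall e : R, 0 < e -> exists2 dl : R, 0 < dl &
    forall y x, `|y - y0| < dl -> 0 <= x <= 1 ->
      normc (psi (x +i* y)%C - psi (x +i* y0)%C) <= e.
Proof.
move=> hc e e0.
pose P (y x : R) := normc (psi (x +i* y)%C - psi (x +i* y0)%C) <= e.
have := (compact_near_coveringP _).1 (@segment_compact R 0 1) R (nbhs y0) P _.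
have loc : forall x : R, [set` `[0, 1]] x -> \forall x' \near x & y \near y0, P y x'.
  move=> x; rewrite /= in_itv /= => xI.
  have e20 : 0 < e / 2 by rewrite divr_gt0.
  have /ccontP/(_ _ e20)[dl dl0 h] := hc x xI.
  have dl2 : 0 < dl / 2 by rewrite divr_gt0.
  exists (ball x (dl / 2), ball y0 (dl / 2)).
    by split; apply: nbhsx_ballx.
  move=> [x' y'] /= [bx by_]; rewrite /P.
  have -> : psi (x' +i* y')%C - psi (x' +i* y0)%C =
    (psi (x' +i* y')%C - psi (x +i* y0)%C) - (psi (x' +i* y0)%C - psi (x +i* y0)%C).
    by ring.
  rewrite /ball /= in bx by_.
  apply: (le_trans (le_normcD _ _)); rewrite normcN [e]splitr; apply: lerD.
    apply/ltW/h/(le_lt_trans (normc_dist_ReIm _ _ _ _)).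
    by rewrite [dl]splitr distrC [`|y' - _|]distrC ltrD.
  apply/ltW/h/(le_lt_trans (normc_dist_ReIm _ _ _ _)).
  by rewrite subrr normr0 addr0 distrC (lt_trans bx)// ltr_pdivrMr// ltr_pMr// ltr1n.
move=> /(_ _ loc) [dl /= dl0 H]; exists dl => // y x yd xI.
apply: (H y); first by rewrite /ball /= distrC.
by rewrite /= in_itv /=.
Qed.

(** The radius of the circle onto which [e2pi] maps the line of height [y]. It decreases in [y]:
    larger heights mean smaller circles. *)
Definition rad y : R := expR (- (2 * pi * y)).

Lemma rad_gt0 y : 0 < rad y. Proof. exact: expR_gt0. Qed.

Lemma normc_e2pi_rad x y : normc (e2pi (x +i* y)%C) = rad y.
Proof. exact: normc_e2pi. Qed.

Lemma twopi_gt0 : 0 < 2 * pi :> R.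
Proof. by rewrite mulr_gt0// pi_gt0. Qed.

Lemma rad_surj (r : R) : 0 < r -> exists y, rad y = r.
Proof.
move=> r0; exists (- (ln r / (2 * pi))); rewrite /rad mulrN opprK.
by rewrite mulrCA mulfV ?mulr1 ?gt_eqF ?twopi_gt0// lnK.
Qed.

Lemma ler_rad : {mono rad : x y /~ x <= y}.
Proof. by move=> x y; rewrite ler_expR lerN2 ler_pM2l// twopi_gt0. Qed.

Lemma ltr_rad : {mono rad : x y /~ x < y}.
Proof. by move=> x y; rewrite ltr_expR ltrN2 ltr_pM2l// twopi_gt0. Qed.

(** The mean value over the circle of radius [rad y], that is, the integral of F(w) dw / (2 pi i
    w). *)
Definition mean F y : C := cint (fun x => F (e2pi (x +i* y)%C)) 0 1.

Lemma cont_mean F y : (forall z, normc z = rad y -> ccont F z) ->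
  cont_on (fun x => F (e2pi (x +i* y)%C)) 0 1.
Proof.
move=> hF x _; apply: (@ccont_hor _ (F \o e2pi) x y).
apply: ccont_comp; first exact/cdiff_cont/cdiff_e2pi.
by apply: hF; rewrite normc_e2pi_rad.
Qed.

Lemma mean_const F y1 y2 : y1 <= y2 ->
  (forall z, rad y2 <= normc z <= rad y1 -> cdiff F z) ->
  mean F y1 = mean F y2.
Proof.
move=> y12 dF; apply: (@cint_periodic (F \o e2pi)) => //.
  move=> [x y] /andP[_ /= /andP[hy1 hy2]].
  apply: cdiff_comp; first exact: cdiff_e2pi.
  by apply: dF; rewrite normc_e2pi_rad !ler_rad hy1 hy2.
move=> y _ /=; congr F.
have -> : (1 +i* y)%C = 1 + (0 +i* y)%C :> C.
  by apply/eqP; rewrite eq_complex /= !addr0 add0r !eqxx.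
by rewrite e2piD e2pi1 mul1r.
Qed.

Lemma normc_mean F y (M : R) :
  (forall z, normc z = rad y -> ccont F z) ->
  (forall z, normc z = rad y -> normc (F z) <= M) -> normc (mean F y) <= 2 * M.
Proof.
move=> /cont_mean hF FM.
have := normc_cint (M := M) ler01 hF; rewrite subr0 mulr1; apply.
by move=> x _; apply: FM; rewrite normc_e2pi_rad.
Qed.

Lemma meanB F G y : (forall z, normc z = rad y -> ccont F z) ->
  (forall z, normc z = rad y -> ccont G z) ->
  mean (fun z => F z - G z) y = mean F y - mean G y.
Proof. by move=> /cont_mean hF /cont_mean hG; rewrite /mean -(cintB hF hG). Qed.

Lemma meanZ (k : C) F y : (forall z, normc z = rad y -> ccont F z) ->
  mean (fun z => k * F z) y = k * mean F y.
Proof. by move=> /cont_mean hF; rewrite /mean -(cintZ k hF). Qed.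

Lemma eq_mean F G y : (forall z, normc z = rad y -> F z = G z) ->
  mean F y = mean G y.
Proof. by move=> h; apply: eq_cint => x _; apply: h; rewrite normc_e2pi_rad. Qed.

Lemma mean_cvg F y0 e : 0 < e ->
  (forall z, normc z = rad y0 -> ccont F z) ->
  exists2 dl : R, 0 < dl & forall y, `|y - y0| < dl ->
    (forall z, normc z = rad y -> ccont F z) ->
    normc (mean F y - mean F y0) <= e.
Proof.
move=> e0 hF; have e20 : 0 < e / 2 by rewrite divr_gt0.
have hc x : 0 <= x <= 1 -> ccont (F \o e2pi) ((x +i* y0)%C : C).
  move=> _; apply: ccont_comp.
    exact/cdiff_cont/cdiff_e2pi.
  by apply: hF; rewrite normc_e2pi_rad.
have [dl dl0 h] := unif_cont_segment hc e20.
exists dl => // y yd hy.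
have c1 := cont_mean hy; have c2 := cont_mean hF.
rewrite /mean -(cintB c1 c2).
have := normc_cint (M := e / 2) ler01 (cont_onB c1 c2).
rewrite subr0 mulr1 mulrCA mulfV// mulr1; apply=> x xI; exact: h.
Qed.

(** The circle may be shrunk towards 0 without changing the mean, and there [F] is close to
    [F 0]. *)
Lemma mean_small F y e : 0 < e ->
  (forall z, 0 < normc z <= rad y -> cdiff F z) ->
  ccont F 0 -> F 0 = 0 -> normc (mean F y) <= e.
Proof.
move=> e0 dF c0 F0; have e20 : 0 < e / 2 by rewrite divr_gt0.
have /ccontP/(_ _ e20)[dl dl0 h] := c0.
have m0 : 0 < Num.min (rad y) (dl / 2) by rewrite lt_min rad_gt0 divr_gt0.
have [y' y'E] := rad_surj m0.
have y'y : rad y' <= rad y by rewrite y'E ge_min lexx.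
have y'd : rad y' < dl.
  rewrite y'E (@le_lt_trans _ _ (dl / 2)) ?ge_min ?lexx ?orbT//.
  by rewrite ltr_pdivrMr// ltr_pMr// ltr1n.
rewrite (@mean_const F y y'); first last.
- move=> z /andP[h1 h2]; apply: dF; rewrite h2 andbT.
  exact: lt_le_trans (rad_gt0 _) h1.
- by rewrite -ler_rad.
have := @normc_mean F y' (e / 2); rewrite mulrCA mulfV// mulr1; apply.
  move=> z zE; apply/cdiff_cont/dF.
  by rewrite zE rad_gt0.
move=> z zE; have := h z; rewrite subr0 F0 subr0 zE => /(_ y'd)/ltW; exact.
Qed.

(** At [a] only continuity is assumed. The mean is constant as long as the circle does not pass
    through [a], and continuity of the mean in the height carries it across that circle; inside,
    [mean_small] applies. *)
Lemma mean_vanish G a y (rho : R) : normc a < rad y -> rad y < rho ->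
  (forall z, normc z < rho -> z != a -> cdiff G z) ->
  (forall z, normc z < rho -> ccont G z) -> G 0 = 0 ->
  mean G y = 0.
Proof.
move=> ay yrho dG cG G0; apply: normc_eq => e e0; rewrite subr0.
have rho0 : 0 < rho := lt_trans (rad_gt0 y) yrho.
have c0 : ccont G 0 by apply: cG; rewrite normc0.
have [a0|an0] := eqVneq a 0.
  apply: (mean_small e0) => // z /andP[z0 zy]; apply: dG.
    exact: le_lt_trans zy yrho.
  by rewrite a0 -normc_gt0.
have na0 : 0 < normc a by rewrite normc_gt0.
have [ya yaE] := rad_surj na0.
have yya : y < ya by rewrite -ltr_rad yaE.
have e30 : 0 < e / 3 by rewrite divr_gt0.
have cy y' : y <= y' -> forall z, normc z = rad y' -> ccont G z.
  move=> yy' z zE; apply: cG; rewrite zE (le_lt_trans _ yrho)// ler_rad//.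
have [dl dl0 h] := mean_cvg e30 (cy _ (ltW yya)).
(* The circle of height [y1] lies just outside the one through [a], that of height [y2] just inside;
   [Num.max] keeps the former within the initial circle. *)
pose y1 := Num.max y (ya - dl / 2); pose y2 := ya + dl / 2.
have yy1 : y <= y1 by rewrite le_max lexx.
have dl2 : 0 < dl / 2 by rewrite divr_gt0.
have dldl : dl / 2 < dl by rewrite ltr_pdivrMr// ltr_pMr// ltr1n.
have y1a : y1 < ya by rewrite gt_max yya ltrBlDr ltrDl.
have ay2 : ya < y2 by rewrite ltrDl.
have E1 : mean G y = mean G y1.
  apply: mean_const => // z /andP[h1 h2]; apply: dG.
    exact: le_lt_trans yrho.
  apply: contraTneq h1 => ->; rewrite -ltNge -yaE ltr_rad//.
have E2 : normc (mean G y2) <= e / 3.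
  apply: mean_small => // z /andP[z0 zy2]; apply: dG.
    by rewrite (le_lt_trans zy2)// (lt_trans _ yrho)// ltr_rad (lt_trans yya).
  apply: contraTneq zy2 => ->; rewrite -ltNge -yaE ltr_rad//.
have D1 : normc (mean G y1 - mean G ya) <= e / 3.
  apply: h; last exact: cy.
  rewrite ltr_norml ltrBlDr (lt_trans y1a) ?ltrDr//= ?andbT.
  rewrite (lt_le_trans (_ : _ < - (dl / 2)))// ?ltrN2//.
  by rewrite lerBrDr addrC le_max lexx orbT.
have D2 : normc (mean G y2 - mean G ya) <= e / 3.
  apply: h; last by apply: cy; exact: ltW (lt_trans yya ay2).
  by rewrite /y2 [ya + _]addrC addrK gtr0_norm.
rewrite E1.
have -> : mean G y1 = (mean G y1 - mean G ya) - (mean G y2 - mean G ya) + mean G y2.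
  by ring.
have -> : e = e / 3 + e / 3 + e / 3 by field.
apply: (le_trans (le_normcD _ _)); apply: lerD => //.
by apply: (le_trans (le_normcD _ _)); rewrite normcN; apply: lerD.
Qed.

Lemma cdiff_kernel a z : z != a ->
  cdiff (fun z : C => z / (z - a)) z.
Proof.
move=> za; apply: (cdiffM (cdiff_id _)); apply: cdiffV.
  by apply: (cdiffB (cdiff_id _)); exact: cdiff_cst.
by rewrite subr_eq0.
Qed.

Lemma neq_normc z w : normc z < normc w -> w != z.
Proof. by apply: contraTneq => ->; rewrite ltxx. Qed.

(** The circle is enlarged until the kernel, which tends to 1 at infinity, is within [e / 2] of 1;
    the other factor 2 is that of [normc_mean]. *)
Lemma mean_cauchy_kernel a y : normc a < rad y ->
  mean (fun z => z / (z - a)) y = 1.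
Proof.
move=> ay; apply: normc_eq => e e0.
have e20 : 0 < e / 2 by rewrite divr_gt0.
pose r := Num.max (rad y) (normc a + normc a / (e / 2)).
have r0 : 0 < r by rewrite lt_max rad_gt0.
have [y' y'E] := rad_surj r0.
have yy : rad y <= rad y' by rewrite y'E le_max lexx.
have ay' : normc a < rad y' := lt_le_trans ay yy.
rewrite -(@mean_const _ y' y); first last.
- move=> z /andP[h1 h2]; apply: cdiff_kernel.
  exact/neq_normc/(lt_le_trans ay).
- by rewrite -ler_rad.
have dk z : normc z = rad y' -> ccont (fun z : C => z / (z - a)) z.
  move=> zE; apply/cdiff_cont/cdiff_kernel.
  by apply: neq_normc; rewrite zE.
have m1 : mean (fun=> 1) y' = 1.
  by rewrite /mean cint_cst// subr0 mulr1.
rewrite -[X in _ - X]m1 -meanB//; last by move=> z _; exact: ccont_cst.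
have -> : e = 2 * (e / 2) by field.
apply: normc_mean => z zE.
  apply: ccontB; first exact: dk.
  exact: ccont_cst.
have za : z - a != 0 by rewrite subr_eq0; apply: neq_normc; rewrite zE.
have -> : z / (z - a) - 1 = a / (z - a) by field.
rewrite normcM normcV ler_pdivrMr ?normc_gt0//.
rewrite -ler_pdivrMl// mulrC.
apply: le_trans (ler_normcB _ _); rewrite lerBrDl zE y'E le_max lexx orbT//.
Qed.

(** The difference quotient of [f] at [a] extends continuously to [a], so its mean vanishes by
    [mean_vanish]; the mean of the kernel gives the value. *)
Lemma cauchy_formula f a y (rho : R) : normc a < rad y -> rad y < rho ->
  (forall z, normc z < rho -> cdiff f z) ->
  mean (fun z => f z * (z / (z - a))) y = f a.
Proof.
move=> ay yrho df.
have arho := lt_trans ay yrho.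
have /cdiffP[l hl] := df _ arho.
(* The extra factor [z] compensates dw / w in [mean] and ensures [G 0 = 0]. *)
pose G z : C := if z == a then a * l else z * ((f z - f a) / (z - a)).
have dG z : normc z < rho -> z != a -> cdiff G z.
  move=> zrho za.
  apply: (@cdiff_near _ (fun z => z * ((f z - f a) / (z - a)))).
    exists (normc (z - a)); first by rewrite normc_gt0 subr_eq0.
    move=> w wz; rewrite /G ifN//; apply: contraTneq wz => ->.
    by rewrite normcB ltxx.
  apply: (cdiffM (cdiff_id _)); apply: cdiffM.
    by apply: cdiffB; [exact: df|exact: cdiff_cst].
  apply: cdiffV; last by rewrite subr_eq0.
  by apply: (cdiffB (cdiff_id _)); exact: cdiff_cst.
have cG z : normc z < rho -> ccont G z.
  move=> zrho; have [->|za] := eqVneq z a; last first.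
    exact/cdiff_cont/dG.
  pose q z : C := if z == a then l else (f z - f a) / (z - a).
  have -> : G = (fun z => z * q z).
    by apply/funext => w; rewrite /G /q; case: eqP => [->|].
  apply: ccontM; first exact/cdiff_cont/cdiff_id.
  apply/ccontP => e e0; have e20 : 0 < e / 2 by rewrite divr_gt0.
  have [dl dl0 h] := hl _ e20; exists dl => // w wd; rewrite /q eqxx.
  have [wa|wa] := eqVneq w a; first by rewrite subrr normc0.
  have wa0 : w - a != 0 by rewrite subr_eq0.
  have -> : (f w - f a) / (w - a) - l = (f w - f a - l * (w - a)) / (w - a).
    by field.
  rewrite normcM normcV ltr_pdivrMr ?normc_gt0//.
  have := h _ wd; rewrite subrKC => /le_lt_trans; apply.
  by rewrite ltr_pM2r ?normc_gt0// ltr_pdivrMr// ltr_pMr// ltr1n.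
have G0 : G 0 = 0 by rewrite /G; case: eqP => [<-|]; rewrite mul0r.
have /eqP := mean_vanish ay yrho dG cG G0.
have ck z : normc z = rad y -> ccont (fun z : C => z / (z - a)) z.
  move=> zE; apply/cdiff_cont/cdiff_kernel.
  by apply: neq_normc; rewrite zE.
rewrite (@eq_mean G (fun z => f z * (z / (z - a)) - f a * (z / (z - a)))); last first.
  move=> z zE; have za : z != a by apply: neq_normc; rewrite zE.
  rewrite /G ifN//; have : z - a != 0 by rewrite subr_eq0.
  by move=> ?; field.
rewrite meanB.
- rewrite meanZ// mean_cauchy_kernel// mulr1 subr_eq0 => /eqP //.
- move=> z zE; apply: ccontM; last exact: ck.
  by apply/cdiff_cont/df; rewrite zE.
- move=> z zE; apply: ccontM; last exact: ck.
  exact: ccont_cst.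
Qed.

Lemma ler_dist_normc z w : `|normc z - normc w| <= normc (z - w).
Proof.
have := ler_normcB z w; have := ler_normcB w z; rewrite normcB => h1 h2.
by rewrite ler_norml; apply/andP; split; lra.
Qed.

Lemma cont_on_bounded (h : R -> C) (a b : R) : a <= b -> cont_on h a b ->
  exists2 M : R, 0 <= M & forall x, a <= x <= b -> normc (h x) <= M.
Proof.
move=> ab hf; pose g x := normc (h x).
have cg : {within `[a, b], continuous g}.
  apply: continuous_subspace_itv => x; rewrite in_itv /= => /hf hx.
  apply/cvgrPdist_lt => e /hx[dl dl0 hd].
  exists dl => //= t /=; rewrite distrC => /hd; apply: le_lt_trans.
  by rewrite distrC; exact: ler_dist_normc.
have [c _ cM] := EVT_max ab cg.
exists (g c); first exact: normc_ge0.
by move=> x xI; apply: cM; rewrite in_itv.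
Qed.

Lemma cdiff_powV (k : nat) z : z != 0 -> cdiff (fun z : C => (z ^+ k)^-1) z.
Proof.
by move=> z0; apply: cdiffV; [exact/cdiffX/cdiff_id|rewrite expf_neq0].
Qed.

(** Geometric expansion of the Cauchy kernel. The remainder after [N] terms is again a mean, that of
    [f] times [(a / z) ^ N] times the kernel. *)
Lemma taylor f (rho r : R) : 0 < r -> r < rho ->
  (forall z, normc z < rho -> cdiff f z) ->
  exists (c : nat -> C) (M : R), 0 <= M /\
    forall N a, normc a <= r / 2 ->
      normc (f a - \sum_(k < N) c k * a ^+ k) <= M * (normc a / r) ^+ N.
Proof.
move=> r0 rrho df; have [y yE] := rad_surj r0.
pose c k : C := mean (fun z => f z * (z ^+ k)^-1) y.
have cf z : normc z = rad y -> ccont f z.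
  by move=> zE; apply/cdiff_cont/df; rewrite zE yE.
have [M M0 hM] := cont_on_bounded ler01 (cont_mean cf).
have nz z : normc z = rad y -> z != 0.
  by move=> zE; rewrite -normc_gt0 zE rad_gt0.
(* One factor 2 is that of [normc_cint], the other bounds the kernel, as [normc a] is at most half
   the radius. *)
exists c, (4 * M); split; first by rewrite mulr_ge0.
move=> N a ar.
have r2 : r / 2 < r by rewrite ltr_pdivrMr// ltr_pMr// ltr1n.
have ay : normc a < rad y by rewrite yE (le_lt_trans ar).
have za z : normc z = rad y -> z != a.
  by move=> zE; apply: neq_normc; rewrite zE.
pose Rem N z : C := f z * (a ^+ N * (z ^+ N)^-1) * (z / (z - a)).
have cRem n z : normc z = rad y -> ccont (Rem n) z.
  move=> zE; apply: ccontM; last exact/cdiff_cont/cdiff_kernel/za.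
  apply: ccontM; first exact: cf.
  by apply: ccontM; [exact: ccont_cst|exact/cdiff_cont/cdiff_powV/nz].
have -> : f a - \sum_(k < N) c k * a ^+ k = mean (Rem N) y.
  elim: N => [|n IH].
    rewrite big_ord0 subr0 -(@cauchy_formula f a y rho)// ?yE//.
    by apply: eq_mean => z _; rewrite /Rem !expr0 invr1 !mulr1.
  have cA z : normc z = rad y -> ccont (fun z => f z * (z ^+ n)^-1) z.
    move=> zE; apply: ccontM; first exact: cf.
    exact/cdiff_cont/cdiff_powV/nz.
  have cB z : normc z = rad y -> ccont (fun z => a ^+ n * (f z * (z ^+ n)^-1)) z.
    by move=> zE; apply: ccontM; [exact: ccont_cst|exact: cA].
  rewrite big_ord_recr /= opprD addrA IH mulrC -(meanZ _ cA) -(meanB (cRem n) cB).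
  apply: eq_mean => z zE; rewrite /Rem !exprS.
  have := za _ zE; have := nz _ zE; rewrite -subr_eq0 => z0; rewrite -subr_eq0 => z1.
  by field; rewrite z1 -[z]subr0 z0 subr0 expf_neq0// -[z]subr0.
have := normc_cint (M := 2 * M * (normc a / r) ^+ N) ler01 (cont_mean (cRem N)).
rewrite -/(mean _ _) subr0 mulr1 !mulrA -natrM; apply=> x xI.
move: (normc_e2pi_rad x y) (hM x xI); move: (e2pi _) => z zE hz.
rewrite /Rem !normcM !normcV !normcX zE yE.
have -> : 2 * M * (normc a / r) ^+ N = M * (normc a ^+ N / r ^+ N) * 2.
  by rewrite expr_div_n; ring.
have za0 : 0 < normc (z - a) by rewrite normc_gt0 subr_eq0 za.
apply: ler_pM.
- by rewrite mulr_ge0 ?normc_ge0// divr_ge0 ?exprn_ge0 ?normc_ge0// ltW.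
- by rewrite divr_ge0 ?(ltW r0)// ltW.
- by rewrite ler_wpM2r// divr_ge0 ?exprn_ge0 ?normc_ge0// ltW.
rewrite ler_pdivrMr//; apply: (@le_trans _ _ (2 * (r - normc a))).
  by have : normc a <= r / 2 := ar; lra.
by rewrite ler_pM2l// -yE -zE ler_normcB.
Qed.

End Cauchy.

(** * Zeros of holomorphic functions and the identity theorem *)

Section Identity.
Context {R : realType}.
Local Notation C := (Cplx R).
Implicit Types (f g : C -> C) (z w p : C).

Definition zero_near f p := exists2 r : R, 0 < r &
  forall z, normc (z - p) < r -> f z = 0.

(** If all Taylor coefficients vanish, the remainder estimate gives [f = 0] near 0. Otherwise the
    first nonzero coefficient determines the order [k] and is the value of [g] at 0. *)
Lemma zero_or_factor0 f (rho : R) : 0 < rho ->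
  (forall z, normc z < rho -> cdiff f z) ->
  zero_near f 0 \/ exists k g, [/\ forall z, normc z < rho -> cdiff g z,
    g 0 != 0 & forall z, normc z < rho -> f z = z ^+ k * g z].
Proof.
move=> rho0 df.
pose r := rho / 2; have r0 : 0 < r by rewrite divr_gt0.
have rrho : r < rho by rewrite ltr_pdivrMr// ltr_pMr// ltr1n.
have [c [M [M0 hc]]] := taylor r0 rrho df.
have r20 : 0 < r / 2 by rewrite divr_gt0.
have [ec|/forallNP nc] := pselect (exists k, c k != 0); last first.
  left; exists (r / 2) => // z; rewrite subr0 => zr.
  apply: normc_eq => e e0; rewrite subr0.
  have small : normc z / r <= 2^-1.
    by rewrite ler_pdivrMr// mulrC (ltW zr).
  have [N hN] : exists N, M * (normc z / r) ^+ N <= e.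
    exists (Num.bound (M / e)).
    apply: (@le_trans _ _ (M * 2^-1 ^+ Num.bound (M / e))).
      rewrite ler_wpM2l// lerXn2r// nnegrE ?invr_ge0//.
      by rewrite divr_ge0 ?normc_ge0// ltW.
    rewrite exprVn ler_pdivrMr ?exprn_gt0// -ler_pdivrMl// mulrC.
    have := archi_boundP (divr_ge0 M0 (ltW e0)) => /ltW /le_trans; apply.
    by rewrite -natrX ler_nat ltnW// ltn_expl.
  have := hc N z (ltW zr); rewrite big1 ?subr0; first by move/le_trans; apply.
  by move=> i _; have /negP/negPn/eqP -> := nc i; rewrite mul0r.
right.
have [k ck kmin] := @ex_minnP (fun k => c k != 0) ec.
have c0 i : (i < k)%N -> c i = 0.
  by move=> ik; apply: contraTeq ik => /kmin; rewrite leqNgt.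
have sumk (a : C) : \sum_(i < k) c i * a ^+ i = 0.
  by rewrite big1// => i _; rewrite c0// mul0r.
pose g z : C := if z == 0 then c k else f z / z ^+ k.
exists k, g; split.
- move=> z zrho; have [->|z0] := eqVneq z 0; last first.
    apply: (@cdiff_near _ (fun z => f z / z ^+ k)).
      exists (normc z); first by rewrite normc_gt0.
      move=> w wz; rewrite /g ifN//; apply: contraTneq wz => ->.
      by rewrite sub0r normcN ltxx.
    apply: cdiffM; first exact: df.
    exact: cdiff_powV.
  (* The next Taylor coefficient is the derivative of [g] at 0; the remainder of order [k.+2]
     divided by the [k]-th power is quadratic. *)
  apply/cdiffP; exists (c k.+1) => e e0.
  pose d := Num.min (r / 2) (e * r ^+ k.+2 / (M + 1)).
  have M1 : 0 < M + 1 by rewrite ltr_wpDl.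
  exists d; first by rewrite lt_min r20 divr_gt0// mulr_gt0// exprn_gt0.
  move=> w; rewrite lt_min => /andP[wr we]; rewrite add0r /g eqxx.
  have [w0|w0] := eqVneq w 0; first by rewrite w0 mulr0 !subrr normc0 mulr0.
  have := hc k.+2 w (ltW wr); rewrite !big_ord_recr /= sumk add0r.
  have -> : f w - (c k * w ^+ k + c k.+1 * w ^+ k.+1) =
      (f w / w ^+ k - c k - c k.+1 * w) * w ^+ k.
    by rewrite exprS; field; rewrite expf_neq0.
  have wn : 0 < normc w by rewrite normc_gt0.
  rewrite normcM normcX -ler_pdivlMr ?exprn_gt0// => /le_trans; apply.
  rewrite expr_div_n ler_pdivrMr ?exprn_gt0// (mulrA M) ler_pdivrMr ?exprn_gt0//.
  have h : (M + 1) * normc w <= e * r ^+ k.+2.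
    by rewrite mulrC -ler_pdivlMr// ltW.
  have -> : M * normc w ^+ k.+2 = (M * normc w) * (normc w * normc w ^+ k).
    by rewrite !exprS; ring.
  have -> : e * normc w * normc w ^+ k * r ^+ k.+2 =
    (e * r ^+ k.+2) * (normc w * normc w ^+ k) by ring.
  rewrite ler_pM2r ?mulr_gt0 ?exprn_gt0//; apply: le_trans h.
  by rewrite ler_wpM2r ?(ltW wn)// lerDl.
- by rewrite /g eqxx.
- move=> z _; have [->|z0] := eqVneq z 0; last first.
    by rewrite /g (negPf z0) mulrC divfK// expf_neq0.
  rewrite /g eqxx; apply/eqP; rewrite -subr_eq0 -normc_eq0 eq_le normc_ge0 andbT.
  have := hc k.+1 0; rewrite normc0 big_ord_recr /= sumk add0r.
  by rewrite mul0r [0 ^+ k.+1]exprS mul0r mulr0 (mulrC (c k)); apply; exact: ltW.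
Qed.

Lemma cdiff_shift f p z : cdiff f (p + z) -> cdiff (fun u => f (p + u)) z.
Proof.
move=> h.
exact: (@cdiff_comp _ (fun u => p + u) f z (cdiffD (cdiff_cst p z) (cdiff_id z)) h).
Qed.

Lemma zero_or_factor f p (rho : R) : 0 < rho ->
  (forall z, normc (z - p) < rho -> cdiff f z) ->
  zero_near f p \/ exists k g, [/\ forall z, normc (z - p) < rho -> cdiff g z,
    g p != 0 & forall z, normc (z - p) < rho -> f z = (z - p) ^+ k * g z].
Proof.
move=> rho0 df; have df' z : normc z < rho -> cdiff (fun u => f (p + u)) z.
  by move=> zr; apply: cdiff_shift; apply: df; rewrite addrAC subrr add0r.
have [[r r0 h]|[k [g [dg g0 fg]]]] := zero_or_factor0 rho0 df'.
  by left; exists r => // z zr; have := h (z - p); rewrite subr0 subrKC; apply.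
right; exists k, (fun z => g (- p + z)); split.
- by move=> z zr; apply: cdiff_shift; apply: dg; rewrite addrC.
- by rewrite addNr.
- move=> z zr; have := fg (z - p) zr.
  by rewrite subrKC => ->; rewrite [- p + z]addrC.
Qed.

Lemma ccont_neq0 g p : ccont g p -> g p != 0 -> exists2 r : R, 0 < r &
  forall z, normc (z - p) < r -> g z != 0.
Proof.
move=> /ccontP hg g0; have ng0 : 0 < normc (g p) by rewrite normc_gt0.
have [r r0 h] := hg _ ng0; exists r => // z /h hz.
by apply: contraTneq hz => ->; rewrite sub0r normcN ltxx.
Qed.

Lemma zero_accum f p (rho : R) : 0 < rho ->
  (forall z, normc (z - p) < rho -> cdiff f z) ->
  (forall r : R, 0 < r -> exists z, [/\ z != p, normc (z - p) < r & f z = 0]) ->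
  zero_near f p.
Proof.
move=> rho0 df acc; have [//|[k [g [dg g0 fg]]]] := zero_or_factor rho0 df.
have cg : ccont g p by apply/cdiff_cont/dg; rewrite subrr normc0.
have [r r0 h] := ccont_neq0 cg g0.
have [|z [zp]] := acc (Num.min r rho); first by rewrite lt_min r0.
rewrite lt_min => /andP[zr zrho]; rewrite fg// => /eqP.
by rewrite mulf_eq0 expf_eq0 subr_eq0 (negPf zp) andbF (negPf (h _ zr)).
Qed.

(** Connectedness of the unit interval as an induction principle, by a supremum. It drives every
    continuation along a segment and also replaces finite subcovers, with [A T] a property of the
    whole interval up to [T]. *)
Lemma segment_ind (A : R -> Prop) : A 0 ->
  (forall t : R, 0 <= t <= 1 ->
    (forall d : R, 0 < d -> exists s : R, [/\ 0 <= s <= 1, `|s - t| < d & A s]) ->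
    exists2 d : R, 0 < d & forall s : R, `|s - t| < d -> A s) -> A 1.
Proof.
move=> A0 Aloc.
pose S := [set t : R | 0 <= t <= 1 /\ forall s : R, 0 <= s <= t -> A s].
have S0 : S 0.
  split; first by rewrite lexx ler01.
  by move=> s /andP[s0 s1]; rewrite (_ : s = 0)//; apply/le_anti; rewrite s0 s1.
have Sub : ubound S 1 by move=> t [/andP[]].
have hS : has_sup S by split; [exists 0|exists 1].
pose T := sup S.
have T01 : 0 <= T <= 1.
  apply/andP; split; first by apply: ub_le_sup => //; exists 1.
  by apply: ge_sup => //; exists 0.
have near (d : R) : 0 < d -> exists2 s, S s & T - d < s by move=> d0; apply: sup_adherent.
have [d d0 hd] : exists2 d : R, 0 < d & forall s : R, `|s - T| < d -> A s.
  apply: Aloc => // d d0; have [s Ss sT] := near _ d0; exists s; split.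
  - by case: Ss.
  - rewrite distrC ger0_norm ?subr_ge0; first by rewrite ltrBlDr addrC -ltrBlDr.
    by apply: ub_le_sup => //; exists 1.
  - by case: Ss => /andP[s0 _]; apply; rewrite s0 lexx.
have [s [s01 Ss] sT] := near _ d0.
pose t := Num.min 1 (T + d / 2).
have d20 : 0 < d / 2 by rewrite divr_gt0.
have dd : d / 2 < d by rewrite ltr_pdivrMr// ltr_pMr// ltr1n.
have St : S t.
  split.
    rewrite ge_min lexx/= andbT le_min ler01/= addr_ge0 ?(ltW d20)//.
    by case/andP: T01.
  move=> u /andP[u0]; rewrite le_min => /andP[u1 uT].
  have [us|su] := leP u s; first by apply: Ss; rewrite u0.
  by apply: hd; rewrite ltr_norml; apply/andP; split; lra.
have tT : t <= T by apply: ub_le_sup => //; exists 1.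
have T1 : T = 1.
  move: tT; rewrite ge_min => /orP[h|]; last first.
    by rewrite gerDl leNgt d20.
  by apply/le_anti; rewrite h; case/andP: T01 => _ ->.
by apply: hd; rewrite T1 subrr normr0.
Qed.

Lemma identity_segment f :
  (forall t : R, 0 <= t <= 1 -> exists2 rho : R, 0 < rho &
    forall z, normc (z - t%:C%C) < rho -> cdiff f z) ->
  zero_near f 0 -> zero_near f 1.
Proof.
move=> df z0; apply: (@segment_ind (fun t => zero_near f (t%:C%C))) => // t t01 acc.
suff [r r0 h] : zero_near f t%:C%C.
  have r20 : 0 < r / 2 by rewrite divr_gt0.
  exists (r / 2) => // s st; exists (r / 2) => // z zs; apply: h.
  have -> : z - t%:C%C = (z - s%:C%C) + (s - t)%:C%C by rewrite rmorphB /=; ring.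
  by rewrite (le_lt_trans (le_normcD _ _))// [r]splitr ltrD// normc_real.
have [rho rho0 hrho] := df t t01.
apply: (zero_accum rho0 hrho) => r r0.
have [s [_ sr [q q0 hq]]] := acc _ r0.
pose m := Num.min q (r - `|s - t|).
have m0 : 0 < m by rewrite lt_min q0 subr_gt0.
(* A zero other than [t] is required, so a second candidate stands by in case the first one is
   [t]. *)
pose u := if s + m / 2 == t then s + m / 4 else s + m / 2.
have um : 0 < u - s < m by rewrite /u; case: eqP => _; apply/andP; split; lra.
have ut : u != t by rewrite /u; case: (eqVneq (s + m / 2) t) => // <-; apply/eqP; lra.
move: um => /andP[um1 um2].
exists (u%:C%C); split.
- by apply/eqP => /complexI/eqP; rewrite (negPf ut).
- rewrite -rmorphB normc_real.
  have -> : u - t = (u - s) + (s - t) by ring.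
  rewrite (le_lt_trans (ler_normD _ _))// (gtr0_norm um1) -ltrBrDr.
  by rewrite (lt_le_trans um2)// ge_min lexx orbT.
- apply: hq; rewrite -rmorphB normc_real gtr0_norm//.
  by rewrite (lt_le_trans um2)// ge_min lexx.
Qed.

End Identity.

(** * Functions of several complex variables *)

Section SeveralVariables.
Context {R : realType} {d : nat}.
Local Notation C := (Cplx R).
Local Notation Cd := 'rV[Cplx R]_d.
Implicit Types (F G : Cd -> C) (a b s t v : Cd) (z w : C).

Definition polydisc a (r : R) : set Cd :=
  [set s | forall i, normc (s 0 i - a 0 i) < r].

Variant holo F s : Prop := Holo of differentiable F s.

Lemma holo_line F a v z : holo F (a + z *: v) ->
  cdiff (fun z => F (a + z *: v)) z.
Proof.
case=> hF; constructor.
by apply: (@differentiable_comp _ _ _ _ (fun z : C => a + z *: v) F).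
Qed.

Lemma ball_polydisc a (r : R[i]) : 0 < r -> ball a r = polydisc a (complex.Re r).
Proof.
move=> r0; have rE : r = (complex.Re r)%:C%C by rewrite RRe_real// gtr0_real.
apply/seteqP; split=> s /=.
  move=> [_ h] i; have := h 0 i; rewrite /ball /= distrC normcE {1}rE ltcR; exact.
by move=> h; split=> // i j; rewrite ord1 /ball /= distrC normcE rE ltcR; exact: h.
Qed.

Lemma nbhs_polydiscP s (P : set Cd) :
  nbhs s P <-> exists2 r : R, 0 < r & polydisc s r `<=` P.
Proof.
split=> [/nbhs_ballP[r /= r0 rP]|[r r0 rP]].
  have rE : r = (complex.Re r)%:C%C by rewrite RRe_real// gtr0_real.
  exists (complex.Re r); first by rewrite -ltcR -rE.
  by rewrite -ball_polydisc.
apply/nbhs_ballP; exists (r%:C%C) => /=; first by rewrite ltcR.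
by rewrite ball_polydisc ?ltcR.
Qed.

Lemma polydisc_center a (r : R) : 0 < r -> polydisc a r a.
Proof. by move=> r0 i; rewrite subrr normc0. Qed.

Lemma ltr_sum_bound (I : finType) (u : I -> R) (r : R) : 0 < r ->
  (forall i, u i < r) -> exists2 q : R, 0 < q < r & forall i, u i < q.
Proof.
move=> r0 ur; pose m := \big[Num.max/0]_i u i.
have m0 : 0 <= m by exact: bigmax_ge_id.
have mr : m < r by apply/bigmax_ltP; split.
exists ((m + r) / 2); first by apply/andP; split; lra.
move=> i; have : u i <= m by exact: le_bigmax.
by move=> ?; lra.
Qed.

Lemma polydisc_open a (r : R) s : polydisc a r s ->
  exists2 e : R, 0 < e & polydisc s e `<=` polydisc a r.
Proof.
move=> asr; have [r0|r0] := leP r 0.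
  exists 1 => // t _ i; have := asr i; move=> /lt_le_trans/(_ r0).
  by rewrite ltNge normc_ge0.
have [q /andP[q0 qr] hq] := ltr_sum_bound r0 asr.
exists (r - q); first by rewrite subr_gt0.
move=> t ts i; have -> : t 0 i - a 0 i = (t 0 i - s 0 i) + (s 0 i - a 0 i) by ring.
rewrite (le_lt_trans (le_normcD _ _))//.
have -> : r = (r - q) + q by ring.
by rewrite ltrD.
Qed.

Lemma polydisc_convex a (r : R) s t (x : R) : 0 <= x <= 1 ->
  polydisc a r s -> polydisc a r t -> polydisc a r (s + x%:C%C *: (t - s)).
Proof.
move=> /andP[x0 x1] hs ht i; rewrite !mxE.
have -> : s 0 i + x%:C%C * (t 0 i - s 0 i) - a 0 i =
    (1 - x)%:C%C * (s 0 i - a 0 i) + x%:C%C * (t 0 i - a 0 i).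
  by rewrite rmorphB rmorph1 /=; ring.
rewrite (le_lt_trans (le_normcD _ _))// !normcM !normc_real !ger0_norm ?subr_ge0//.
have [x00|x0'] := eqVneq x 0; first by rewrite x00 subr0 mul1r mul0r addr0.
have -> : r = (1 - x) * r + x * r by ring.
rewrite ler_ltD//; first by rewrite ler_wpM2l ?subr_ge0// ltW.
by rewrite ltr_pM2l// lt_def x0' x0.
Qed.

Lemma line_near s v (e : R) : 0 < e -> exists2 q : R, 0 < q &
  forall z, normc z < q -> polydisc s e (s + z *: v).
Proof.
move=> e0; pose m := \big[Num.max/0]_i normc (v 0 i).
have m0 : 0 <= m by exact: bigmax_ge_id.
exists (e / (m + 1)); first by rewrite divr_gt0// ltr_wpDl.
move=> z zq i; rewrite !mxE addrAC subrr add0r normcM.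
have vi : normc (v 0 i) <= m by exact: (@le_bigmax _ _ _ 0 (fun i => normc (v 0 i))).
apply: (@le_lt_trans _ _ (normc z * (m + 1))).
  by rewrite ler_wpM2l ?normc_ge0// (le_trans vi)// lerDl.
by rewrite -ltr_pdivlMr// ltr_wpDl.
Qed.

(** Polydiscs are convex: each point is joined to [b] by a segment, and [F] is restricted to the
    complex line through it. *)
Lemma identity_polydisc F a (r : R) b : polydisc a r b ->
  (forall s, polydisc a r s -> holo F s) ->
  (exists2 e : R, 0 < e & forall s, polydisc b e s -> F s = 0) ->
  forall s, polydisc a r s -> F s = 0.
Proof.
move=> ab hF [e e0 Fb] c ac.
pose g z := F (b + z *: (c - b)).
have dg (t : R) : 0 <= t <= 1 -> exists2 rho : R, 0 < rho &
    forall z, normc (z - t%:C%C) < rho -> cdiff g z.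
  move=> t01; have at_ := polydisc_convex t01 ab ac.
  have [q q0 hq] := polydisc_open at_.
  have [rho rho0 hrho] := line_near (b + t%:C%C *: (c - b)) (c - b) q0.
  exists rho => // z /hrho /hq; rewrite -addrA -scalerDl subrKC => /hF.
  exact: holo_line.
have g0 : zero_near g 0.
  have [q q0 hq] := line_near b (c - b) e0; exists q => // z.
  by rewrite subr0 => /hq/Fb.
have [q q0 hq] := identity_segment dg g0.
by have := hq 1; rewrite subrr normc0 /g scale1r subrKC; apply.
Qed.

Lemma zero_near_disc (g : C -> C) (rho : R) :
  (forall z, normc z < rho -> cdiff g z) -> zero_near g 0 ->
  forall z, normc z < rho -> g z = 0.
Proof.
move=> dg g0 z zr.
have z1 : 0 < normc z + 1 by rewrite ltr_wpDl ?normc_ge0.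
have dg' (t : R) : 0 <= t <= 1 -> exists2 q : R, 0 < q &
    forall w, normc (w - t%:C%C) < q -> cdiff (fun w => g (z * w)) w.
  move=> /andP[t0 t1].
  exists ((rho - normc z) / (normc z + 1)).
    by rewrite divr_gt0// subr_gt0.
  move=> w; rewrite ltr_pdivlMr// => wt.
  apply: (@cdiff_comp _ (fun w => z * w)).
    exact: cdiffM (cdiff_cst _ _) (cdiff_id _).
  apply: dg; have -> : z * w = z * (w - t%:C%C) + z * t%:C%C by ring.
  rewrite (le_lt_trans (le_normcD _ _))// !normcM normc_real ger0_norm//.
  apply: (@lt_le_trans _ _ ((rho - normc z) + normc z)); last by rewrite subrK.
  rewrite ltr_leD//; last by rewrite ler_piMr ?normc_ge0.
  apply: le_lt_trans wt; rewrite mulrDr mulr1 mulrC lerDl normc_ge0//.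
have [q q0 hq] := g0.
have [] := @identity_segment _ (fun w => g (z * w)) dg'.
  exists (q / (normc z + 1)); first by rewrite divr_gt0.
  move=> w; rewrite subr0 ltr_pdivlMr// => wt.
  apply: hq; rewrite subr0 normcM; apply: le_lt_trans wt.
  by rewrite mulrDr mulr1 mulrC lerDl normc_ge0.
move=> p p0 /(_ 1); rewrite subrr normc0 mulr1; apply=> //.
Qed.

Definition Cvec (x : 'rV[R]_d) : Cd := map_mx (real_complex R) x.

(** Coordinates are freed one at a time: [k] counts those allowed to be nonreal. In the newly freed
    coordinate the real values accumulate at the centre, and the one-variable identity theorem
    applies. *)
Lemma totally_real F a (r : R) :
  (forall s, polydisc a r s -> holo F s) ->
  (forall x, polydisc a r (a + Cvec x) -> F (a + Cvec x) = 0) ->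
  forall s, polydisc a r s -> F s = 0.
Proof.
move=> hF F0.
suff H k : (k <= d)%N -> forall s, polydisc a r s ->
    (forall i : 'I_d, (k <= i)%N -> complex.Im (s 0 i - a 0 i) = 0) -> F s = 0.
  move=> s as_; apply: (H d) => // i; rewrite leqNgt ltn_ord //.
elim: k => [_ s as_ rs|k IH kd s as_ rs].
  pose x : 'rV[R]_d := \row_i complex.Re (s 0 i - a 0 i).
  have sE : s = a + Cvec x.
    apply/rowP => i; rewrite !mxE RRe_real ?subrKC//.
    by have := rs i isT; case: (_ - _) => u w /= ->; rewrite complex_real.
  by rewrite sE; apply: F0; rewrite -sE.
pose j := Ordinal kd.
pose upd z : Cd := \row_i (if i == j then a 0 j + z else s 0 i).
have updE z : upd z = upd 0 + z *: delta_mx 0 j.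
  apply/rowP => i; rewrite !mxE eqxx /=; case: eqP => _; rewrite ?mulr1 ?mulr0 ?addr0//.
have updP z : normc z < r -> polydisc a r (upd z).
  by move=> zr i; rewrite mxE; case: eqP => [->|_]; [rewrite addrAC subrr add0r|].
have -> : s = upd (s 0 j - a 0 j).
  by apply/rowP => i; rewrite mxE; case: eqP => [->|//]; rewrite subrKC.
apply: (@zero_near_disc (fun z => F (upd z)) r); last exact: as_.
  move=> z zr; have -> : (fun z => F (upd z)) = (fun z => F (upd 0 + z *: delta_mx 0 j)).
    by apply/funext => u; rewrite updE.
  by apply: holo_line; rewrite -updE; apply/hF/updP.
have r0 : 0 < r by apply: le_lt_trans (as_ j); exact: normc_ge0.
apply: (zero_accum r0).
  move=> z; rewrite subr0 => zr.
  have -> : (fun z => F (upd z)) = (fun z => F (upd 0 + z *: delta_mx 0 j)).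
    by apply/funext => u; rewrite updE.
  by apply: holo_line; rewrite -updE; apply/hF/updP.
move=> q q0; pose m := Num.min q r.
have m0 : 0 < m by rewrite lt_min q0.
have mm : m / 2 < m by rewrite ltr_pdivrMr// ltr_pMr// ltr1n.
have nm : normc (m / 2)%:C%C < m.
  by rewrite normc_real gtr0_norm// divr_gt0.
exists ((m / 2)%:C%C); split.
- by rewrite -normc_gt0 normc_real normr_gt0 gt_eqF// divr_gt0.
- by rewrite subr0 (lt_le_trans nm)// ge_min lexx.
- apply: (IH (ltnW kd)).
    by apply: updP; rewrite (lt_le_trans nm)// ge_min lexx orbT.
  move=> i ki; rewrite mxE; case: eqP => [->|/eqP ij].
    by rewrite addrAC subrr add0r.
  apply: rs; rewrite ltn_neqAle ki andbT.
  by apply: contra ij => /eqP kE; apply/eqP/val_inj.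
Qed.

End SeveralVariables.

(** * Identity theorem for meromorphic functions of several variables *)

Section Meromorphic.
Context {R : realType} {d : nat}.
Local Notation C := (Cplx R).
Local Notation Cd := 'rV[Cplx R]_d.
Implicit Types (F G P Q g h : Cd -> C) (a b s t v : Cd) (z w : C).

Lemma meromorphicP F : meromorphic F -> forall a, exists (r : R) g h,
  [/\ 0 < r, forall s, polydisc a r s -> holo g s,
      forall s, polydisc a r s -> holo h s,
      exists2 s, polydisc a r s & h s != 0 &
      forall s, polydisc a r s -> h s != 0 -> F s = g s / h s].
Proof.
move=> mF a; have [r [g [h [r0 hg hh hn0 hF]]]] := mF a.
have rE : r = (complex.Re r)%:C%C by rewrite RRe_real// gtr0_real.
exists (complex.Re r), g, h; rewrite -!ball_polydisc//; split=> //.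
- by rewrite -ltcR -rE.
- by move=> s /hg; constructor.
- by move=> s /hh; constructor.
Qed.

Lemma holo_neq0 F s : holo F s -> F s != 0 ->
  exists2 e : R, 0 < e & forall t, polydisc s e t -> F t != 0.
Proof.
move=> [/differentiable_continuous cF] F0.
have n0 : 0 < normc (F s) by rewrite normc_gt0.
have /nbhs_polydiscP[e e0 he] : nbhs s (F @^-1` [set z | normc (z - F s) < normc (F s)]).
  by apply: cF; apply/near_normcP; exists (normc (F s)).
exists e => // t /he /=; apply: contraTneq => ->.
by rewrite sub0r normcN ltxx.
Qed.

Lemma holo_dense F a (r : R) t (e : R) :
  (forall s, polydisc a r s -> holo F s) ->
  (exists2 s, polydisc a r s & F s != 0) -> polydisc a r t -> 0 < e ->
  exists t', [/\ polydisc t e t', polydisc a r t' & F t' != 0].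
Proof.
move=> hF [s as_ Fs] at_ e0; apply: contrapT => /forallNP nex.
have [q q0 hq] := polydisc_open at_.
have /eqP := Fs; apply; apply: (identity_polydisc at_ hF _ as_).
exists (Num.min e q); first by rewrite lt_min e0.
move=> u tu; have te : polydisc t e u.
  by move=> i; rewrite (lt_le_trans (tu i))// ge_min lexx.
have tq : polydisc t q u.
  by move=> i; rewrite (lt_le_trans (tu i))// ge_min lexx orbT.
apply/eqP; apply: contrapT => /negP Fu; apply: (nex u); split=> //; exact: hq.
Qed.

Lemma holoM F G s : holo F s -> holo G s -> holo (fun s => F s * G s) s.
Proof. by case=> hF [hG]; constructor; exact: (differentiableM hF hG). Qed.

Lemma holoB F G s : holo F s -> holo G s -> holo (fun s => F s - G s) s.
Proof. by case=> hF [hG]; constructor; exact: (differentiableB hF hG). Qed.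

Lemma polydisc_le a (r q : R) : r <= q -> polydisc a r `<=` polydisc a q.
Proof. by move=> rq s h i; exact: lt_le_trans (h i) rq. Qed.

Lemma polydisc_big a b : exists2 r : R, 0 < r & polydisc a r b.
Proof.
pose m := \big[Num.max/0]_i normc (b 0 i - a 0 i).
have m0 : 0 <= m by exact: bigmax_ge_id.
exists (m + 1); first by rewrite ltr_wpDl.
move=> i; rewrite (@le_lt_trans _ _ m)// ?ltrDl//.
exact: (@le_bigmax _ _ _ 0 (fun i => normc (b 0 i - a 0 i))).
Qed.

Lemma entire_dense P t (e : R) : (forall s, holo P s) -> (exists s, P s != 0) ->
  0 < e -> exists2 t', polydisc t e t' & P t' != 0.
Proof.
move=> hP [s Ps] e0; have [r r0 tr] := polydisc_big t s.
have Pn : exists2 s, polydisc t r s & P s != 0 by exists s.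
have [t' [h1 _ h2]] :=
  holo_dense (fun s _ => hP s) Pn (polydisc_center t r0) e0.
by exists t'.
Qed.

(** The relation is propagated from [b] along segments. Values of [F] at zeros of local denominators
    are arbitrary, so the property that propagates is density of the points around which the
    relation holds with [P] nonzero. *)
Lemma meromorphic_identity F P Q : meromorphic F ->
  (forall s, holo P s) -> (forall s, holo Q s) -> (exists s, P s != 0) ->
  (exists b, exists2 e : R, 0 < e &
     forall s, polydisc b e s -> F s * P s = Q s) ->
  exists U : set Cd, [/\ open U, dense U &
    forall s, U s -> P s != 0 /\ F s = Q s / P s].
Proof.
move=> /meromorphicP mF hP hQ P0 [b [e e0 hb]].
pose good s := exists2 q : R, 0 < q &
  forall t, polydisc s q t -> P t != 0 /\ F t * P t = Q t.
pose S a := exists2 q : R, 0 < q & forall t (e : R), polydisc a q t -> 0 < e ->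
  exists2 t', polydisc t e t' & good t'.
have goodI t : P t != 0 -> (exists2 q : R, 0 < q &
    forall u, polydisc t q u -> F u * P u = Q u) -> good t.
  move=> Pt [q q0 hq]; have [q' q'0 hq'] := holo_neq0 (hP t) Pt.
  exists (Num.min q q'); first by rewrite lt_min q0.
  move=> u tu; split.
    by apply: hq'; apply: polydisc_le tu; rewrite ge_min lexx orbT.
  by apply: hq; apply: polydisc_le tu; rewrite ge_min lexx.
have Sb : S b.
  exists e => // t q bt q0; have [q' q'0 hq'] := polydisc_open bt.
  have m0 : 0 < Num.min q q' by rewrite lt_min q0.
  have [t' tt' Pt'] := entire_dense t hP P0 m0.
  exists t'; first by apply: polydisc_le tt'; rewrite ge_min lexx.
  apply: goodI => //.
  have bt' : polydisc b e t'.
    by apply/hq'/(polydisc_le _ tt'); rewrite ge_min lexx orbT.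
  have [q'' q''0 hq''] := polydisc_open bt'.
  by exists q'' => // u /hq''/hb.
have Sall c : S c.
  pose gam (x : R) := b + x%:C%C *: (c - b).
  have -> : c = gam 1 by rewrite /gam scale1r subrKC.
  apply: (@segment_ind _ (fun x => S (gam x))).
    by rewrite /gam scale0r addr0.
  move=> x x01 acc; have [r [g [h [r0 hg hh hn0 hF]]]] := mF (gam x).
  have gam_near q : 0 < q -> exists2 dl : R, 0 < dl & forall y : R,
      `|y - x| < dl -> polydisc (gam x) q (gam y).
    move=> q0; have [dl dl0 hdl] := line_near (gam x) (c - b) q0.
    exists dl => // y yx; have -> : gam y = gam x + (y - x)%:C%C *: (c - b).
      by rewrite /gam -addrA -scalerDl rmorphB subrKC.
    by apply: hdl; rewrite normc_real.
  have [dl dl0 hdl] := gam_near _ r0.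
  exists dl => // y0 yx0.
  have [y [_ yx Sy]] := acc _ dl0.
  have xy := hdl _ yx.
  have [q q0 hq] := polydisc_open xy.
  have [p p0 Sp] := Sy.
  have [t' t't good_t'] := Sp _ _ (polydisc_center (gam y) p0) q0.
  have xt' := hq _ t't.
  have [q1 q10 hq1] := good_t'.
  have [u [tu xu hu]] := holo_dense hh hn0 xt' q10.
  have [q2 q20 hq2] := polydisc_open tu.
  have [q3 q30 hq3] := holo_neq0 (hh _ xu) hu.
  have [q4 q40 hq4] := polydisc_open xu.
  (* Clearing both denominators gives a holomorphic function that vanishes near the point [u], where
     [h] is nonzero and the relation is known. *)
  have key : forall s, polydisc (gam x) r s -> g s * P s - h s * Q s = 0.
    apply: (identity_polydisc xu).
      move=> s xs; apply: holoB; apply: holoM => //; [exact: hg|exact: hh].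
    exists (Num.min q2 (Num.min q3 q4)); first by rewrite !lt_min q20 q30.
    move=> s us.
    have s2 : polydisc t' q1 s.
      by apply/hq2/(polydisc_le _ us); rewrite ge_min lexx.
    have s3 : h s != 0.
      by apply/hq3/(polydisc_le _ us); rewrite !ge_min lexx orbT.
    have s4 : polydisc (gam x) r s.
      by apply/hq4/(polydisc_le _ us); rewrite !ge_min lexx !orbT.
    have [Ps <-] := hq1 _ s2; rewrite (hF _ s4 s3).
    by field.
  have [q5 q50 hq5] := polydisc_open (hdl _ yx0).
  exists q5 => // t e' yt e'0; have xt := hq5 _ yt.
  have hPdense : exists2 s, polydisc (gam x) r s & h s * P s != 0.
    have [s xs hs] := hn0.
    have [q6 q60 hq6] := holo_neq0 (hh _ xs) hs.
    have [q7 q70 hq7] := polydisc_open xs.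
    have m0 : 0 < Num.min q6 q7 by rewrite lt_min q60.
    have [s' ss' Ps'] := entire_dense s hP P0 m0.
    exists s'; first by apply/hq7/(polydisc_le _ ss'); rewrite ge_min lexx orbT.
    rewrite mulf_neq0//.
    by apply/hq6/(polydisc_le _ ss'); rewrite ge_min lexx.
  have hhP s : polydisc (gam x) r s -> holo (fun s => h s * P s) s.
    by move=> xs; apply: holoM => //; exact: hh.
  have [s' [ts' xs' hPs']] := holo_dense hhP hPdense xt e'0.
  exists s' => //.
  move: hPs'; rewrite mulf_eq0 negb_or => /andP[hs' Ps'].
  apply: goodI => //.
  have [q8 q80 hq8] := holo_neq0 (hh _ xs') hs'.
  have [q9 q90 hq9] := polydisc_open xs'.
  exists (Num.min q8 q9); first by rewrite lt_min q80.
  move=> w sw.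
  have hw : h w != 0 by apply/hq8/(polydisc_le _ sw); rewrite ge_min lexx.
  have xw : polydisc (gam x) r w.
    by apply/hq9/(polydisc_le _ sw); rewrite ge_min lexx orbT.
  rewrite (hF _ xw hw); have /eqP := key _ xw; rewrite subr_eq0 => /eqP gP.
  by rewrite mulrAC gP mulrC mulKf.
exists good; split.
- rewrite openE => s [q q0 hq]; apply/nbhs_polydiscP; exists q => // t st.
  by have [q' q'0 hq'] := polydisc_open st; exists q' => // u /hq'/hq.
- move=> O [s Os] oO.
  move: oO; rewrite openE => /(_ _ Os)/nbhs_polydiscP[q q0 hq].
  have [p p0 Sp] := Sall s.
  have [t' st' gt'] := Sp _ _ (polydisc_center s p0) q0.
  by exists t'; split=> //; exact: hq.
- move=> s [q q0 hq]; have [Ps FP] := hq _ (polydisc_center s q0).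
  by split=> //; rewrite -FP mulfK.
Qed.

End Meromorphic.

(** * Restriction of a meromorphic function to a complex line *)

Section LineRestriction.
Context {R : realType} {d : nat}.
Local Notation C := (Cplx R).
Local Notation Cd := 'rV[Cplx R]_d.
Implicit Types (F : Cd -> C) (s v : Cd) (x : 'rV[R]_d) (phi f g h : C -> C).

(** Requiring that [h] is not identically 0 near the real point [t] makes a pole there of finite
    order. *)
Definition local_quotient phi (t : R) := exists (rho : R) g h,
  [/\ 0 < rho, forall z, normc (z - t%:C%C) < rho -> cdiff g z,
      forall z, normc (z - t%:C%C) < rho -> cdiff h z,
      ~ zero_near h t%:C%C &
      forall z, normc (z - t%:C%C) < rho -> h z != 0 -> phi z = g z / h z].

Definition rball x (e : R) : set 'rV[R]_d := [set y | forall i, `|y 0 i - x 0 i| < e].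

Lemma rball_polydisc s x y (e : R) : rball x e y <->
  polydisc (s + Cvec x) e (s + Cvec y).
Proof.
have E i : normc ((s + Cvec y) 0 i - (s + Cvec x) 0 i) = `|y 0 i - x 0 i|.
  rewrite !mxE -normc_real; congr normc; rewrite rmorphB /=; ring.
by split=> h i; have := h i; rewrite E.
Qed.

Lemma line_near_real s v (e : R) (t : R) : 0 < e -> exists2 q : R, 0 < q &
  forall z, normc (z - t%:C%C) < q ->
    polydisc (s + t%:C%C *: v) e (s + z *: v).
Proof.
move=> e0; have [q q0 hq] := line_near (s + t%:C%C *: v) v e0.
exists q => // z /hq; by rewrite -addrA -scalerDl subrKC.
Qed.

Lemma polydiscD s x (e r : R) (t u : Cd) : polydisc s e t ->
  rball 0 r x -> polydisc s (e + r) (t + Cvec x).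
Proof.
move=> h k i; rewrite !mxE.
have -> : t 0 i + (x 0 i)%:C%C - s 0 i = (t 0 i - s 0 i) + (x 0 i)%:C%C by ring.
apply: (le_lt_trans (le_normcD _ _)); apply: ltrD; first exact: h.
by rewrite normc_real; have := k i; rewrite mxE subr0.
Qed.

Lemma meromorphic_line F s v (e : R) : meromorphic F -> 0 < e -> exists2 x,
  rball 0 e x & forall t : R, 0 <= t <= 1 ->
    local_quotient (fun z => F (s + Cvec x + z *: v)) t.
Proof.
move=> /meromorphicP mF e0.
pose P x t := local_quotient (fun z => F (s + Cvec x + z *: v)) t.
(* Openness in the translation allows successive corrections: the next one is taken so small that
   the points already treated stay good. *)
pose robust x0 T := forall e : R, 0 < e -> exists x, rball x0 e x /\
  exists2 dl : R, 0 < dl & forall y, rball x dl y ->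
    forall t : R, T t -> P y t.
pose G (T : R) := exists2 E : R, 0 < E & forall x0, rball 0 E x0 ->
  robust x0 [set t | 0 <= t <= T].
have loc (t : R) : exists2 q : R, 0 < q & forall x0, rball 0 q x0 ->
    robust x0 [set u | `|u - t| < q].
  have [r [g [h [r0 hg hh hn0 hF]]]] := mF (s + t%:C%C *: v).
  have r20 : 0 < r / 2 by rewrite divr_gt0.
  have [q q0 hq] := line_near_real s v t r20.
  have inr y z : rball 0 (r / 2) y -> normc (z - t%:C%C) < q ->
      polydisc (s + t%:C%C *: v) r (s + Cvec y + z *: v).
    move=> hy /hq hz; rewrite addrAC [r]splitr; exact: polydiscD.
  exists (Num.min q (r / 2)); first by rewrite lt_min q0.
  move=> x0 x00 e1 e10.
  have x0r : rball 0 (r / 2) x0.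
    by move=> i; rewrite (lt_le_trans (x00 i))// ge_min lexx orbT.
  have tt : normc (t%:C%C - t%:C%C : C) < q by rewrite subrr normc0.
  have x0in := inr _ _ x0r tt.
  have [p p0 hp] := polydisc_open x0in.
  pose m := Num.min (Num.min p e1) (r / 2 - \big[Num.max/0]_i `|x0 0 i|).
  have mx : \big[Num.max/0]_i `|x0 0 i| < r / 2.
    by apply/bigmax_ltP; split=> // i _; have := x0r i; rewrite mxE subr0.
  have m0 : 0 < m by rewrite !lt_min p0 e10 subr_gt0.
  have [x [hx hhx]] : exists x, rball x0 m x /\
      h (s + Cvec x + t%:C%C *: v) != 0.
    apply: contrapT => /forallNP nex.
    have z0 : forall u, polydisc (s + Cvec x0 + t%:C%C *: v) m u -> h u = 0.
      apply: totally_real => u.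
        move=> hu; apply/hh/hp/(polydisc_le _ hu).
        by rewrite !ge_min lexx.
      move=> hu; apply/eqP; apply: contrapT => /negP h0.
      apply: (nex (x0 + u)).
      have E : s + Cvec (x0 + u) + t%:C%C *: v = s + Cvec x0 + t%:C%C *: v + Cvec u.
        by apply/rowP => i; rewrite !mxE rmorphD /=; ring.
      split; last by rewrite E.
      have aK (V : zmodType) (a b : V) : a + b - a = b by rewrite addrAC subrr add0r.
      by move=> i; have := hu i; rewrite !mxE !aK normc_real.
    have [u hu] := hn0; apply/negP; rewrite negbK; apply/eqP.
    by apply: (identity_polydisc x0in hh _ hu); exists m.
  have xr : rball 0 (r / 2) x.
    move=> i; rewrite mxE subr0.
    have -> : x 0 i = (x 0 i - x0 0 i) + x0 0 i by ring.
    have b0 : `|x0 0 i| <= \big[Num.max/0]_i `|x0 0 i|.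
      exact: (@le_bigmax _ _ _ 0 (fun i => `|x0 0 i|)).
    have := hx i; rewrite !lt_min => /andP[_ b1].
    by rewrite (le_lt_trans (ler_normD _ _))//; lra.
  exists x; split.
    by move=> i; rewrite (lt_le_trans (hx i))// !ge_min lexx orbT.
  have xin := inr _ _ xr tt.
  have [p1 p10 hp1] := holo_neq0 (hh _ xin) hhx.
  pose mb := \big[Num.max/0]_i `|x 0 i|.
  have mbr : mb < r / 2.
    by apply/bigmax_ltP; split=> // i _; have := xr i; rewrite mxE subr0.
  exists (Num.min p1 (r / 2 - mb)); first by rewrite lt_min p10 subr_gt0.
  move=> y hy u /=; rewrite lt_min => /andP[ut _].
  have yr : rball 0 (r / 2) y.
    move=> i; rewrite mxE subr0.
    have -> : y 0 i = (y 0 i - x 0 i) + x 0 i by ring.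
    have b0 : `|x 0 i| <= mb by exact: (@le_bigmax _ _ _ 0 (fun i => `|x 0 i|)).
    have := hy i; rewrite !lt_min => /andP[_ b1].
    by rewrite (le_lt_trans (ler_normD _ _))//; lra.
  have hy0 : h (s + Cvec y + t%:C%C *: v) != 0.
    apply: hp1; rewrite addrAC [s + _ + _]addrAC; apply/rball_polydisc => i.
    by rewrite (lt_le_trans (hy i))// ge_min lexx.
  have rho0 : 0 < q - `|u - t| by rewrite subr_gt0.
  have inq z : normc (z - u%:C%C) < q - `|u - t| -> normc (z - t%:C%C) < q.
    move=> hz; have -> : z - t%:C%C = (z - u%:C%C) + (u - t)%:C%C.
      by rewrite rmorphB /=; ring.
    by rewrite (le_lt_trans (le_normcD _ _))// normc_real -ltrBrDr.
  exists (q - `|u - t|), (fun z => g (s + Cvec y + z *: v)),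
    (fun z => h (s + Cvec y + z *: v)); split=> //.
  - by move=> z /inq hz; apply/holo_line/hg/inr.
  - by move=> z /inq hz; apply/holo_line/hh/inr.
  (* If the denominator vanished near [u] on the line, the identity theorem along the segment from
     [u] to [t] would make it vanish at [t]. *)
  - move=> [w w0 hw]; move/eqP: hy0; apply.
    have tu1 : 0 < `|t - u| + 1 by rewrite ltr_wpDl.
    pose f z := h (s + Cvec y + (u%:C%C + z * (t - u)%:C%C) *: v).
    have seg (x' : R) : 0 <= x' <= 1 ->
        normc (u%:C%C + x'%:C%C * (t - u)%:C%C - t%:C%C : C) < q.
      move=> /andP[x0' x1'].
      have -> : u%:C%C + x'%:C%C * (t - u)%:C%C - t%:C%C = ((1 - x') * (u - t))%:C%C :> C.
        by rewrite !(rmorphM, rmorphB, rmorph1) /=; ring.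
      rewrite normc_real normrM ger0_norm ?subr_ge0// (le_lt_trans _ ut)//.
      by rewrite ler_piMl// gerBl.
    have df (x' : R) : 0 <= x' <= 1 -> exists2 rho : R, 0 < rho &
        forall z, normc (z - x'%:C%C) < rho -> cdiff f z.
      move=> /seg hs; set c : C := _ - _ in hs.
      exists ((q - normc c) / (`|t - u| + 1)).
        by rewrite divr_gt0 ?subr_gt0// ltr_wpDl.
      move=> z; rewrite ltr_pdivlMr// => hz.
      apply: (@cdiff_comp _ (fun z => u%:C%C + z * (t - u)%:C%C)
        (fun z => h (s + Cvec y + z *: v))).
        apply: cdiffD; first exact: cdiff_cst.
        by apply: cdiffM; [exact: cdiff_id|exact: cdiff_cst].
      apply/holo_line/hh/inr => //.
      have -> : u%:C%C + z * (t - u)%:C%C - t%:C%C = (z - x'%:C%C) * (t - u)%:C%C + c.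
        by rewrite /c; ring.
      rewrite (le_lt_trans (le_normcD _ _))// -ltrBrDr normcM normc_real.
      apply: le_lt_trans hz; rewrite ler_wpM2l ?normc_ge0// lerDl//.
    have f0 : zero_near f 0.
      exists (w / (`|t - u| + 1)); first by rewrite divr_gt0// ltr_wpDl.
      move=> z; rewrite subr0 ltr_pdivlMr// => hz.
      apply: hw; rewrite addrAC subrr add0r normcM normc_real.
      by apply: le_lt_trans hz; rewrite ler_wpM2l ?normc_ge0// lerDl.
    have [p2 p20 hp2] := identity_segment df f0.
    have := hp2 1; rewrite subrr normc0 /f mul1r rmorphB subrKC; exact.
  - by move=> z /inq hz; apply: hF; exact: inr.
have : G 1.
  apply: segment_ind.
    have [q q0 hq] := loc 0; exists q => // x0 /hq hx0 e1 /hx0[x [hx [dl dl0 hdl]]].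
    exists x; split=> //; exists dl => // y /hdl hy t /andP[t0 t1].
    by apply: hy; rewrite /= subr0 (_ : t = 0) ?normr0//; apply/le_anti/andP.
  move=> t t01 acc; have [q q0 hq] := loc t.
  exists q => // u0 ut; have [w [_ wt [E E0 hE]]] := acc _ q0.
  exists (Num.min (E / 2) (q / 2)); first by rewrite lt_min !divr_gt0.
  move=> x0 hx0 e1 e10.
  have EE : E / 2 < E by rewrite ltr_pdivrMr// ltr_pMr// ltr1n.
  have x0E : rball 0 E x0.
    by move=> i; rewrite (lt_trans _ EE)// (lt_le_trans (hx0 i))// ge_min lexx.
  have m0 : 0 < Num.min (e1 / 2) (q / 2) by rewrite lt_min !divr_gt0.
  have [x1 [hx1 [dl dl0 hdl]]] := hE _ x0E _ m0.
  have x1q : rball 0 q x1.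
    move=> i; rewrite mxE subr0.
    have -> : x1 0 i = (x1 0 i - x0 0 i) + x0 0 i by ring.
    have := hx1 i; have := hx0 i; rewrite !lt_min mxE subr0.
    move=> /andP[_ b1] /andP[_ b2].
    by rewrite (le_lt_trans (ler_normD _ _))//; lra.
  have m20 : 0 < Num.min (e1 / 2) (dl / 2) by rewrite lt_min !divr_gt0.
  have [x2 [hx2 [dl2 dl20 hdl2]]] := hq _ x1q _ m20.
  exists x2; split.
    move=> i; have -> : x2 0 i - x0 0 i = (x2 0 i - x1 0 i) + (x1 0 i - x0 0 i).
      by ring.
    have := hx1 i; have := hx2 i; rewrite !lt_min.
    move=> /andP[b1 _] /andP[b2 _].
    by rewrite (le_lt_trans (ler_normD _ _))//; lra.
  exists (Num.min dl2 (dl / 2)); first by rewrite lt_min dl20 divr_gt0.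
  move=> y hy u /andP[u1 u2].
  have [uw|wu] := leP u w.
    apply: hdl; last by rewrite /= u1.
    move=> i; have -> : y 0 i - x1 0 i = (y 0 i - x2 0 i) + (x2 0 i - x1 0 i).
      by ring.
    have := hy i; have := hx2 i; rewrite !lt_min.
    move=> /andP[_ b1] /andP[_ b2].
    by rewrite (le_lt_trans (ler_normD _ _))//; lra.
  apply: hdl2.
    by move=> i; rewrite (lt_le_trans (hy i))// ge_min lexx.
  rewrite /=; move: ut wt; rewrite !ltr_norml => /andP[? ?] /andP[? ?].
  by apply/andP; split; lra.
move=> [E E0 hE].
have m0 : 0 < Num.min E e by rewrite lt_min E0.
have [|x [hx [dl dl0 hdl]]] := hE 0 _ e e0.
  by move=> i; rewrite subrr normr0.
exists x => // t t01; apply: hdl => // i.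
by rewrite subrr normr0.
Qed.

End LineRestriction.

(** * Fourier coefficients of meromorphic functions *)

Section ContourShift.
Context {R : realType}.
Local Notation C := (Cplx R).
Implicit Types (phi chi f g h : C -> C) (z w u : C) (t x y : R).

(** A removable singularity; the value of [phi] at [u] itself is free, as always for meromorphic
    functions. *)
Definition extends phi u := exists2 rho : R, 0 < rho & exists2 chi,
  forall z, normc (z - u) < rho -> cdiff chi z &
  forall z, z != u -> normc (z - u) < rho -> phi z = chi z.

Lemma local_quotient_pole phi t : local_quotient phi t -> exists k (rho : R) chi,
  [/\ 0 < rho, forall z, normc (z - t%:C%C) < rho -> cdiff chi z &
   forall z, z != t%:C%C -> normc (z - t%:C%C) < rho ->
     phi z = chi z / (z - t%:C%C) ^+ k].
Proof.
move=> [rho [g [h [rho0 dg dh hn0 hphi]]]].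
have [//|[k [h1 [dh1 h10 hE]]]] := zero_or_factor rho0 dh.
have tt : normc (t%:C%C - t%:C%C : C) < rho by rewrite subrr normc0.
have [r r0 hr] := ccont_neq0 (cdiff_cont (dh1 _ tt)) h10.
exists k, (Num.min rho r), (fun z => g z * (h1 z)^-1); split.
- by rewrite lt_min rho0.
- move=> z; rewrite lt_min => /andP[z1 z2]; apply: cdiffM; first exact: dg.
  by apply: cdiffV; [exact: dh1|exact: hr].
move=> z zt; rewrite lt_min => /andP[z1 z2].
have zt0 : (z - t%:C%C) ^+ k != 0 by rewrite expf_neq0// subr_eq0.
have hz : h z != 0 by rewrite hE// mulf_neq0// hr.
rewrite hphi// hE// invfM mulrA; ring.
Qed.

Lemma e2pi_factor t : exists2 rho : R, 0 < rho & exists2 E,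
  forall z, normc (z - t%:C%C) < rho -> cdiff E z &
  forall z, normc (z - t%:C%C) < rho ->
    e2pi z - e2pi t%:C%C = (z - t%:C%C) * E z.
Proof.
pose f z := e2pi z - e2pi t%:C%C.
have df z : normc (z - t%:C%C) < 1 -> cdiff f z.
  by move=> _; apply: cdiffB; [exact: cdiff_e2pi|exact: cdiff_cst].
have [[r r0 hr]|[[|k] [E [dE E0 hE]]]] := zero_or_factor ltr01 df.
- exists r => //; exists (fun=> 0) => [z _|z /hr]; first exact: cdiff_cst.
  by rewrite /f => ->; rewrite mulr0.
- have := hE t%:C%C; rewrite /f !subrr normc0 expr0 mul1r => /(_ ltr01)/esym/eqP.
  by rewrite (negPf E0).
- exists 1 => //; exists (fun z => (z - t%:C%C) ^+ k * E z) => z zt.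
    apply: cdiffM; last exact: dE.
    by apply/cdiffX/cdiffB; [exact: cdiff_id|exact: cdiff_cst].
  by rewrite -/(f z) hE// exprS mulrA.
Qed.

(** The pole is cleared by a power of [e2pi z - e2pi t] instead of [z - t]: this keeps period 1, and
    a polynomial in [e2pi z] acts on Fourier coefficients as a recurrence. *)
Lemma extends_pole phi t : local_quotient phi t -> exists k, exists2 rho : R,
  0 < rho & forall x, `|x - t| < rho ->
    extends (fun z => (e2pi z - e2pi t%:C%C) ^+ k * phi z) x%:C%C.
Proof.
move=> /local_quotient_pole[k [rho [chi [rho0 dchi hphi]]]].
have [r r0 [E dE hE]] := e2pi_factor t.
pose m := Num.min rho r.
have m0 : 0 < m by rewrite lt_min rho0.
exists k, m => // x xt.
have [->|xnt] := eqVneq x t.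
  exists m => //; exists (fun z => E z ^+ k * chi z) => [z|z zt];
    rewrite lt_min => /andP[z1 z2].
    by apply: cdiffM; [apply/cdiffX/dE|exact: dchi].
  rewrite hphi// hE// exprMn; field.
  by rewrite expf_neq0// subr_eq0.
have xt0 : 0 < `|x - t| by rewrite normr_gt0 subr_eq0.
exists (Num.min `|x - t| (m - `|x - t|)); first by rewrite lt_min xt0 subr_gt0.
have inm z : normc (z - x%:C%C) < Num.min `|x - t| (m - `|x - t|) ->
    [/\ normc (z - t%:C%C) < rho & z - t%:C%C != 0].
  rewrite lt_min => /andP[z1 z2]; split.
    have -> : z - t%:C%C = (z - x%:C%C) + (x - t)%:C%C by rewrite rmorphB /=; ring.
    rewrite (le_lt_trans (le_normcD _ _))// normc_real -ltrBrDr.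
    by rewrite (lt_le_trans z2)// lerB// ge_min lexx.
  rewrite subr_eq0; apply: contraTneq z1 => ->.
  by rewrite -rmorphB normc_real distrC ltxx.
exists (fun z => (e2pi z - e2pi t%:C%C) ^+ k * (chi z * ((z - t%:C%C) ^+ k)^-1)).
  move=> z /inm[z1 z2]; apply: cdiffM.
    by apply/cdiffX/cdiffB; [exact: cdiff_e2pi|exact: cdiff_cst].
  apply: cdiffM; first exact: dchi.
  apply: cdiffV; last exact: expf_neq0.
  by apply/cdiffX/cdiffB; [exact: cdiff_id|exact: cdiff_cst].
move=> z _ /inm[z1 z2]; rewrite hphi//.
by rewrite -subr_eq0.
Qed.

Lemma extendsM phi f u : (forall z, cdiff f z) -> extends phi u ->
  extends (fun z => f z * phi z) u.
Proof.
move=> df [rho rho0 [chi dchi hphi]]; exists rho => //.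
exists (fun z => f z * chi z) => [z zu|z zu zr]; last by rewrite hphi.
by apply: cdiffM; [exact: df|exact: dchi].
Qed.

Definition pole_factor (s : seq (R * nat)) z : C :=
  \prod_(p <- s) (e2pi z - e2pi (p.1)%:C%C) ^+ p.2.

Lemma cdiff_pole_factor s z : cdiff (pole_factor s) z.
Proof.
apply: (@cdiff_prod _ _ s (fun p z => (e2pi z - e2pi (p.1)%:C%C) ^+ p.2)) => p.
by apply/cdiffX/cdiffB; [exact: cdiff_e2pi|exact: cdiff_cst].
Qed.

Lemma extends_eq phi f u : phi =1 f -> extends phi u -> extends f u.
Proof. by move=> /funext ->. Qed.

Lemma clear_poles phi : (forall t, 0 <= t <= 1 -> local_quotient phi t) ->
  exists s, forall t, 0 <= t <= 1 ->
    extends (fun z => pole_factor s z * phi z) t%:C%C.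
Proof.
move=> hphi.
pose A T := exists s, forall t, 0 <= t <= T ->
    extends (fun z => pole_factor s z * phi z) t%:C%C.
have loc t : 0 <= t <= 1 -> exists p, exists2 rho : R, 0 < rho &
    forall x, `|x - t| < rho ->
      extends (fun z => pole_factor [:: p] z * phi z) x%:C%C.
  move=> /hphi/extends_pole[k [rho rho0 h]]; exists (t, k), rho => // x /h.
  by apply: extends_eq => z; rewrite /pole_factor big_seq1.
apply: (@segment_ind _ A).
  have [|p [rho rho0 h]] := loc 0; first by rewrite lexx ler01.
  exists [:: p] => t /andP[t0 t1]; apply: h.
  by rewrite subr0 (_ : t = 0) ?normr0//; apply/le_anti/andP.
move=> t t01 acc; have [p [rho rho0 h]] := loc _ t01.
have [x [_ xt [s hs]]] := acc _ rho0.
exists rho => // y yt; exists (p :: s) => v /andP[v0 vy].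
have pE z : pole_factor (p :: s) z = pole_factor [:: p] z * pole_factor s z.
  by rewrite /pole_factor big_cons big_seq1.
have [vx|xv] := leP v x.
  apply: (@extends_eq (fun z => pole_factor [:: p] z * (pole_factor s z * phi z))).
    by move=> z; rewrite pE mulrA.
  apply: extendsM => [z|]; first exact: cdiff_pole_factor.
  by apply: hs; rewrite v0.
apply: (@extends_eq (fun z => pole_factor s z * (pole_factor [:: p] z * phi z))).
  by move=> z; rewrite pE mulrCA mulrA.
apply: extendsM => [z|]; first exact: cdiff_pole_factor.
apply: h; move: xt yt; rewrite !ltr_norml => /andP[? ?] /andP[? ?].
by apply/andP; split; lra.
Qed.

Definition limit_value phi z (v : C) := forall e : R, 0 < e ->
  exists2 dl : R, 0 < dl &
    forall w, w != z -> normc (w - z) < dl -> normc (phi w - v) < e.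

(** Replaces each value by the punctured limit, which fills in the removable singularities; the
    default 0 occurs only where no limit exists. *)
Definition hat phi z : C := xget 0 [set v | limit_value phi z v].

Lemma limit_value_uniq phi z v v' :
  limit_value phi z v -> limit_value phi z v' -> v = v'.
Proof.
move=> h h'; apply: normc_eq => e e0; have e20 : 0 < e / 2 by rewrite divr_gt0.
have [d1 d10 h1] := h _ e20; have [d2 d20 h2] := h' _ e20.
pose m := Num.min d1 d2.
have m0 : 0 < m by rewrite lt_min d10.
pose w := z + (m / 2)%:C%C.
have wz : w != z by rewrite -subr_eq0 /w addrAC subrr add0r -normc_gt0 normc_real normr_gt0 gt_eqF// divr_gt0.
have wm : normc (w - z) < m.
  by rewrite /w addrAC subrr add0r normc_real gtr0_norm ?divr_gt0// ltr_pdivrMr// ltr_pMr// ltr1n.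
have -> : v - v' = (phi w - v') - (phi w - v) by ring.
rewrite (le_trans (le_normcD _ _))// normcN [e]splitr lerD// ltW//.
  by apply: h2 => //; rewrite (lt_le_trans wm)// ge_min lexx orbT.
by apply: h1 => //; rewrite (lt_le_trans wm)// ge_min lexx.
Qed.

Lemma hatE phi u (rho : R) chi :
  (forall z, normc (z - u) < rho -> cdiff chi z) ->
  (forall z, z != u -> normc (z - u) < rho -> phi z = chi z) ->
  forall z, normc (z - u) < rho -> hat phi z = chi z.
Proof.
move=> dchi hphi z zr.
have lv : limit_value phi z (chi z).
  have /ccontP cz := cdiff_cont (dchi _ zr).
  move=> e /cz[dl dl0 hdl].
  have zr0 : 0 < rho - normc (z - u) by rewrite subr_gt0.
  have inr w : normc (w - z) < rho - normc (z - u) -> normc (w - u) < rho.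
    move=> h; have -> : w - u = (w - z) + (z - u) by ring.
    by rewrite (le_lt_trans (le_normcD _ _))// -ltrBrDr.
  have [zu|zu] := eqVneq z u.
    exists (Num.min dl (rho - normc (z - u))); first by rewrite lt_min dl0.
    move=> w wz; rewrite lt_min => /andP[w1 w2]; rewrite hphi.
    - exact: hdl.
    - by rewrite -zu.
    - exact: inr.
  exists (Num.min (normc (z - u)) (Num.min dl (rho - normc (z - u)))).
    by rewrite !lt_min dl0 zr0 normc_gt0 subr_eq0 zu.
  move=> w wz; rewrite !lt_min => /and3P[w0 w1 w2]; rewrite hphi.
  - exact: hdl.
  - by apply: contraTneq w0 => ->; rewrite normcB ltxx.
  - exact: inr.
apply: (@limit_value_uniq phi z) => //.
by apply: (@xgetPex _ 0 [set v | limit_value phi z v]); exists (chi z).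
Qed.

(** Periodicity is known only above the real axis, where the series converges. Points on the
    imaginary axis tending to 0 provide the zeros that the identity theorem needs to carry it
    below. *)
Lemma hat_periodic phi : (forall z, 0 < complex.Im z -> phi (z + 1) = phi z) ->
  extends phi 0 -> extends phi 1 ->
  exists2 rho : R, 0 < rho & forall z, normc z < rho ->
    hat phi (z + 1) = hat phi z.
Proof.
move=> per [r0 r00 [chi0 d0 e0]] [r1 r10 [chi1 d1 e1]].
pose g z := chi1 (z + 1) - chi0 z; pose r := Num.min r0 r1.
have rr0 : 0 < r by rewrite lt_min r00.
have le0 z : normc z < r -> normc (z - 0) < r0.
  by rewrite subr0 => h; rewrite (lt_le_trans h)// ge_min lexx.
have le1 z : normc z < r -> normc (z + 1 - 1) < r1.
  by rewrite addrK => h; rewrite (lt_le_trans h)// ge_min lexx orbT.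
have dg z : normc z < r -> cdiff g z.
  move=> zr; apply: cdiffB; last exact: d0 (le0 _ zr).
  apply: (@cdiff_comp _ (fun z => z + 1)); last exact: d1 (le1 _ zr).
  by apply: cdiffD; [exact: cdiff_id|exact: cdiff_cst].
have g0 z : 0 < complex.Im z -> normc z < r -> g z = 0.
  move=> Imz zr; have z0 : z != 0 by apply: contraTneq Imz => ->; rewrite ltxx.
  rewrite /g -e0// ?le0// -e1 ?le1// ?per ?subrr//.
  by rewrite -subr_eq0 addrK.
have [rho rho0 hg] : zero_near g 0.
  have dg0 z : normc (z - 0) < r -> cdiff g z by rewrite subr0; exact: dg.
  apply: (zero_accum rr0 dg0) => e e_gt0.
  pose t : R := Num.min e r / 2.
  have m0 : 0 < Num.min e r by rewrite lt_min e_gt0.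
  have t0 : 0 < t by rewrite divr_gt0.
  have : t < Num.min e r by rewrite /t ltr_pdivrMr// ltr_pMr// ltr1n.
  rewrite lt_min => /andP[te tr].
  have nt : normc (0 +i* t)%C = t by rewrite /normc expr0n add0r sqrtr_sqr gtr0_norm.
  exists (0 +i* t)%C; rewrite subr0 -normc_gt0 nt; split=> //.
  by apply: g0; rewrite ?nt.
exists (Num.min rho r); first by rewrite lt_min rho0.
move=> z; rewrite lt_min => /andP[zrho zr].
rewrite (hatE d0 e0 (le0 _ zr)) (hatE d1 e1 (le1 _ zr)).
by apply/eqP; rewrite -subr_eq0; apply/eqP/hg; rewrite subr0.
Qed.

Lemma hat_strip phi : (forall t, 0 <= t <= 1 -> extends phi t%:C%C) ->
  exists2 dl : R, 0 < dl & forall x y, 0 <= x <= 1 -> `|y| <= dl ->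
    cdiff (hat phi) (x +i* y)%C /\
    (y != 0 -> hat phi (x +i* y)%C = phi (x +i* y)%C).
Proof.
move=> hphi.
have loc t : 0 <= t <= 1 -> exists2 rho : R, 0 < rho & forall x y,
    `|x - t| < rho -> `|y| <= rho -> cdiff (hat phi) (x +i* y)%C /\
    (y != 0 -> hat phi (x +i* y)%C = phi (x +i* y)%C).
  move=> /hphi[rho rho0 [chi dchi hchi]].
  have rho20 : 0 < rho / 2 by rewrite divr_gt0.
  exists (rho / 2) => // x y xt yr.
  have zr : normc ((x +i* y)%C - t%:C%C : C) < rho.
    rewrite (le_lt_trans (normc_dist_ReIm _ _ _ _))// subr0 [rho]splitr.
    by rewrite ltr_leD.
  have hE := hatE dchi hchi; split.
    apply: (@cdiff_near _ chi); last exact: dchi.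
    exists (rho - normc ((x +i* y)%C - t%:C%C : C)); first by rewrite subr_gt0.
    move=> w hw; rewrite hE//.
    have -> : w - t%:C%C = (w - (x +i* y)%C) + ((x +i* y)%C - t%:C%C) by ring.
    by rewrite (le_lt_trans (le_normcD _ _))// -ltrBrDr.
  move=> y0; rewrite hE// hchi//; apply/eqP => /(congr1 (@complex.Im R)) /= yE.
  by rewrite yE eqxx in y0.
pose A T := exists2 dl : R, 0 < dl & forall x y, 0 <= x <= T -> `|y| <= dl ->
    cdiff (hat phi) (x +i* y)%C /\
    (y != 0 -> hat phi (x +i* y)%C = phi (x +i* y)%C).
apply: (@segment_ind _ A).
  have [|rho rho0 h] := loc 0; first by rewrite lexx ler01.
  exists rho => // x y /andP[x0 x1]; apply: h.
  by rewrite subr0 (_ : x = 0) ?normr0//; apply/le_anti/andP.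
move=> t t01 acc; have [rho rho0 h] := loc _ t01.
have [s [_ st [dl dl0 hs]]] := acc _ rho0.
exists rho => // v vt; exists (Num.min dl rho); first by rewrite lt_min dl0.
move=> x y /andP[x0 xv]; rewrite le_min => /andP[y1 y2].
have [xs|sx] := leP x s; first by apply: hs; rewrite ?x0.
apply: h => //; move: st vt; rewrite !ltr_norml => /andP[? ?] /andP[? ?].
by apply/andP; split; lra.
Qed.

(** Once the poles on the unit segment are cleared, the contour moves from height [dl] to [- dl] by
    periodicity. There the character e^{-2 pi i n z} has modulus [rad dl ^+ n], with
    [rad dl < 1]. *)
Lemma fourier_decay phi :
  (forall z, 0 < complex.Im z -> phi (z + 1) = phi z) ->
  (forall t, 0 <= t <= 1 -> local_quotient phi t) ->
  exists q : {poly C}, q.[0] != 0 /\ exists2 dl : R, 0 < dl &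
    forall e : R, 0 < e -> exists N : nat, forall n, (N <= n)%N ->
      normc (cint (fun x => q.[e2pi (x +i* dl)%C] * phi (x +i* dl)%C *
                     e2pi (- n%:R * (x +i* dl)%C)) 0 1) <= e.
Proof.
move=> per /clear_poles[s hs].
pose psi z := pole_factor s z * phi z.
have psi_per z : 0 < complex.Im z -> psi (z + 1) = psi z.
  move=> Imz; rewrite /psi per//; congr (_ * _); apply: eq_bigr => p _.
  by rewrite e2piD e2pi1 mulr1.
have [dl1 dl10 hdl1] := hat_strip hs.
have ex0 : extends psi 0 by apply: (hs 0); rewrite lexx ler01.
have ex1 : extends psi 1 by apply: (hs 1); rewrite lexx ler01.
have [r2 r20 hr2] := hat_periodic psi_per ex0 ex1.
pose dl := Num.min dl1 (r2 / 2).
have dl0 : 0 < dl by rewrite lt_min dl10 divr_gt0.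
have hdl x y : 0 <= x <= 1 -> `|y| <= dl -> cdiff (hat psi) (x +i* y)%C /\
    (y != 0 -> hat psi (x +i* y)%C = psi (x +i* y)%C).
  by move=> x01 ydl; apply: hdl1 => //; rewrite (le_trans ydl)// ge_min lexx.
(* Its roots are values of [e2pi], hence nonzero; this gives [q.[0] != 0]. *)
pose q : {poly C} := \prod_(p <- s) ('X - (e2pi (p.1)%:C%C)%:P) ^+ p.2.
have qE z : q.[e2pi z] = pole_factor s z.
  by rewrite horner_prod; apply: eq_bigr => p _; rewrite horner_exp hornerXsubC.
exists q; split.
  rewrite horner_prod prodf_seq_neq0; apply/allP => p _ /=.
  by rewrite horner_exp hornerXsubC sub0r expf_neq0// oppr_eq0 e2pi_neq0.
exists dl => // e e0.
have dln : - dl <= dl by rewrite ge0_cp// ltW.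
have hc : cont_on (fun x => hat psi (x +i* (- dl))%C) 0 1.
  move=> x x01; apply: ccont_hor; apply: cdiff_cont.
  by have [] := hdl x (- dl) x01 _; rewrite // normrN gtr0_norm.
have [M M0 hM] := cont_on_bounded ler01 hc.
pose r := rad dl.
have r1 : r < 1 by rewrite -expR0 ltr_expR oppr_lt0 mulr_gt0// twopi_gt0.
have r0 : 0 < r := rad_gt0 dl.
have [N hN] : exists N, forall n, (N <= n)%N -> 2 * (M * r ^+ n) <= e.
  have /cvgrPdist_le /(_ (e / (2 * (M + 1)))) : r ^+ n @[n --> \oo] --> (0 : R).
    by apply: cvg_expr; rewrite gtr0_norm.
  have M1 : 0 < 2 * (M + 1) by rewrite mulr_gt0// ltr_wpDl.
  move=> /(_ (divr_gt0 e0 M1))[N _ hN]; exists N => n Nn.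
  have := hN n Nn; rewrite /= sub0r normrN gtr0_norm ?exprn_gt0//.
  rewrite ler_pdivlMr//; apply: le_trans.
  have rn : 0 <= r ^+ n by rewrite exprn_ge0// ltW.
  have -> : r ^+ n * (2 * (M + 1)) = 2 * (M * r ^+ n) + 2 * r ^+ n by ring.
  by rewrite lerDl mulr_ge0.
exists N => n Nn; apply: le_trans (hN _ Nn).
pose Psi z := hat psi z * e2pi (- n%:R * z).
have dPsi z : in_rect 0 1 (- dl) dl z -> cdiff Psi z.
  case: z => x y /andP[/= x01 y01]; apply: cdiffM.
    by have [] := hdl x y x01 _; rewrite // ler_norml.
  apply: (@cdiff_comp _ (fun z => - n%:R * z)); last exact: cdiff_e2pi.
  by apply: cdiffM; [exact: cdiff_cst|exact: cdiff_id].
have Psi_per y : - dl <= y <= dl -> Psi (1 +i* y)%C = Psi (0 +i* y)%C.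
  move=> ydl; have -> : (1 +i* y)%C = (0 +i* y)%C + 1 :> C.
    by apply/eqP; rewrite eq_complex /= !addr0 add0r !eqxx.
  rewrite /Psi hr2; last first.
    have -> : normc (0 +i* y)%C = `|y| by rewrite /normc expr0n add0r sqrtr_sqr.
    rewrite -ler_norml in ydl; apply: (le_lt_trans ydl).
    by rewrite /dl gt_min [r2 / 2 < r2]ltr_pdivrMr// ltr_pMr// ltr1n orbT.
  rewrite mulrDr e2piD mulr1; congr (_ * _).
  by rewrite e2piN e2pi_nat invr1 mulr1.
have := cint_periodic dln dPsi Psi_per.
have -> : cint (fun x => Psi (x +i* dl)%C) 0 1 =
  cint (fun x => q.[e2pi (x +i* dl)%C] * phi (x +i* dl)%C *
                     e2pi (- n%:R * (x +i* dl)%C)) 0 1.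
  apply: eq_cint => x x01; rewrite /Psi; congr (_ * _); rewrite qE.
  have dldl : `|dl| <= dl by rewrite gtr0_norm.
  by have [_ ->] := hdl x dl x01 dldl; rewrite ?gt_eqF.
move=> <-.
have cPsi : cont_on (fun x => Psi (x +i* (- dl))%C) 0 1.
  move=> x x01; apply/ccont_hor/cdiff_cont/dPsi.
  by rewrite /in_rect /= x01 lexx dln.
have := normc_cint (M := M * r ^+ n) ler01 cPsi.
rewrite subr0 mulr1; apply=> x x01; rewrite /Psi normcM ler_pM ?normc_ge0 ?hM//.
rewrite normc_e2pi /r /rad -expRM_natl ler_expR.
have -> : complex.Im (- n%:R * (x +i* (- dl))%C : C) = n%:R * dl.
  have -> : (- n%:R : R[i]) = (- n%:R)%:C%C by rewrite rmorphN rmorph_nat.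
  by rewrite /=; ring.
by rewrite -mulr_natl; lra.
Qed.

End ContourShift.

(** * Solid angles *)

Section IteratedIntegral.
Context {R : realType}.
Local Notation mu := (@lebesgue_measure R).
Local Open Scope ereal_scope.

(** A reflection reduces to positive [alpha]; then the scaled pushforward of Lebesgue measure agrees
    with it on half-open intervals. *)
Lemma integral_affine (alpha b : R) (f : R -> \bar R) : (alpha != 0)%R ->
  measurable_fun setT f -> (forall x, 0 <= f x) ->
  \int[mu]_x f x = `|alpha|%:E * \int[mu]_x f (alpha * x + b)%R.
Proof.
move=> a0 mf f0.
wlog agt0 : alpha a0 / (0 < alpha)%R.
  move=> H; have [/H ->//|] := ltP 0%R alpha; rewrite le_eqVlt (negPf a0) /= => al0.
  have Na0 : (0 < - alpha)%R by rewrite oppr_gt0.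
  rewrite (H (- alpha)%R) ?oppr_eq0// normrN; congr (_ * _).
  have mg : measurable_fun setT (fun x : R => f (- alpha * x + b)%R).
    apply: (measurableT_comp mf).
    by apply: measurable_funD => //; apply: measurable_funM.
  have mN : measurable_fun setT (-%R : measurableTypeR R -> measurableTypeR R).
    exact: oppr_measurable.
  transitivity (\int[pushforward mu (-%R : measurableTypeR R -> measurableTypeR R)]_x
      f (- alpha * x + b)%R).
    by apply: eq_measure_integral => //= A mA _; rewrite lebesgue_measureN.
  rewrite ge0_integral_pushforward//= preimage_setT.
  by apply: eq_integral => x _ /=; rewrite mulrNN.
pose phi : measurableTypeR R -> measurableTypeR R := fun x => (alpha * x + b)%R.
have mphi : measurable_fun setT phi.
  by apply: measurable_funD => //; apply: measurable_funM.
pose k : {nonneg R} := NngNum (ltW agt0).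
pose nu := measure_function_pushforward__canonical__measure_function_Measure mu mphi.
transitivity (\int[mscale k nu]_x f x); last first.
  rewrite ge0_integral_mscale//= ge0_integral_pushforward//= preimage_setT.
  by rewrite gtr0_norm.
apply: eq_measure_integral => //= A mA _.
apply: (@lebesgue_measure_unique R (mscale k nu)) => //.
move=> _ [[p q]] _ <- /=.
rewrite -[RHS]/(alpha%:E * mu (phi @^-1` [set` `]p, q]])).
have -> : phi @^-1` `]p, q] = [set` `](p - b) / alpha, (q - b) / alpha]%R].
  apply/seteqP; split=> x; rewrite /= !in_itv /= /phi.
    by move=> /andP[px xq]; rewrite ltr_pdivrMr// ler_pdivlMr// ltrBlDr lerBrDr mulrC px.
  by rewrite ltr_pdivrMr// ler_pdivlMr// ltrBlDr lerBrDr mulrC.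
rewrite !lebesgue_measure_itv /= !lte_fin ltr_pM2r ?invr_gt0// ltrD2r.
case: ifPn => [pq|_]; last by rewrite mule0.
rewrite -!EFinD -EFinM; congr (_%:E); field.
by rewrite gt_eqF.
Qed.

(** Measurability is tested along all measurable families of parameters and coordinates. In this
    form it passes to slices, and the parameter [Z] absorbs the variables already split off by the
    iterated integral. *)
Definition pmeasurable d (Z : measurableType d) n (f : Z -> 'rV[R]_n -> \bar R) :=
  forall d' (Z' : measurableType d') (psi : Z' -> Z) (phi : 'I_n -> Z' -> R),
    measurable_fun setT psi -> (forall k, measurable_fun setT (phi k)) ->
    measurable_fun setT (fun z => f (psi z) (\row_k phi k z)).

Lemma integral_rV_ge0 n (f : 'rV[R]_n -> \bar R) : (forall t, 0 <= f t) ->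
  0 <= integral_rV f.
Proof.
elim: n f => [|n IH] f f0 /=; first exact: f0.
by apply: integral_ge0 => x _; apply: IH => t; exact: f0.
Qed.

Lemma row_mx_row n (T : Type) (x : T -> R) (phi : 'I_n -> T -> R) (z : T) :
  row_mx (x z)%:M (\row_k phi k z) =
  \row_(k < 1 + n) match fintype.split k with inl _ => x z | inr j => phi j z end.
Proof.
apply/rowP => k; rewrite !mxE; case: fintype.split => j; rewrite !mxE//.
by rewrite ord1 eqxx mulr1n.
Qed.

Lemma pmeasurable_slice d (Z : measurableType d) n (f : Z -> 'rV[R]_n.+1 -> \bar R) :
  pmeasurable f ->
  pmeasurable (fun (p : Z * measurableTypeR R) (t : 'rV[R]_n) =>
    f p.1 (row_mx (p.2%:M : 'rV_1) t)).
Proof.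
move=> mf d' Z' psi phi mpsi mphi.
have m1 : measurable_fun setT (fst \o psi).
  exact: measurableT_comp measurable_fst mpsi.
have m2 : measurable_fun setT (snd \o psi).
  exact: measurableT_comp measurable_snd mpsi.
pose phi' (k : 'I_(1 + n)) z : R :=
  match fintype.split k with inl _ => (psi z).2 | inr j => phi j z end.
have := mf _ _ (fst \o psi) phi' m1 _.
rewrite (_ : (fun z => _) = fun z => f (psi z).1 (row_mx (psi z).2%:M (\row_k phi k z))).
  by apply=> k; rewrite /phi'; case: fintype.split.
by apply/funext => z; rewrite (row_mx_row (fun z => (psi z).2)).
Qed.

Lemma measurable_integral_rV d (Z : measurableType d) n
    (f : Z -> 'rV[R]_n -> \bar R) :
  pmeasurable f -> (forall z t, 0 <= f z t) ->
  measurable_fun setT (fun z => integral_rV (f z)).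
Proof.
elim: n d Z f => [|n IH] d Z f mf f0 /=.
  have := mf _ _ id (fun _ _ => 0%R) (@measurable_id _ _ _) (fun k => measurable_cst _).
  apply: eq_measurable_fun => z _ /=; congr (f z _).
  by apply/rowP => -[].
have := IH _ _ _ (pmeasurable_slice mf) (fun p t => f0 _ _).
move=> /(measurable_fun_fubini_tonelli_F (m2 := mu)); apply => p.
by apply: integral_rV_ge0 => t; exact: f0.
Qed.

Definition nmeasurable n (f : 'rV[R]_n -> \bar R) :=
  pmeasurable (fun _ : unit => f).

Lemma nmeasurable_param n (f : 'rV[R]_n.+1 -> \bar R) : nmeasurable f ->
  pmeasurable (fun (x : measurableTypeR R) (t : 'rV[R]_n) => f (row_mx (x%:M : 'rV_1) t)).
Proof.
move=> mf d' Z' psi phi mpsi mphi.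
apply: (pmeasurable_slice mf (psi := fun z => (tt, psi z)) (phi := phi)) => //.
exact: measurable_fun_pair.
Qed.

Lemma nmeasurable_slice n (f : 'rV[R]_n.+1 -> \bar R) (x : R) : nmeasurable f ->
  nmeasurable (fun t : 'rV[R]_n => f (row_mx (x%:M : 'rV_1) t)).
Proof.
move=> /nmeasurable_param mf d' Z' psi phi mpsi mphi.
exact: (mf _ _ (fun=> x) phi).
Qed.

Lemma measurable_slice_integral n (f : 'rV[R]_n.+1 -> \bar R) : nmeasurable f ->
  (forall t, 0 <= f t) ->
  measurable_fun setT (fun x : R =>
    integral_rV (fun t : 'rV[R]_n => f (row_mx (x%:M : 'rV_1) t))).
Proof.
move=> /nmeasurable_param mf f0.
by apply: (measurable_integral_rV mf).
Qed.

Lemma integral_rVD n (f g : 'rV[R]_n -> \bar R) :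
  nmeasurable f -> (forall t, 0 <= f t) ->
  nmeasurable g -> (forall t, 0 <= g t) ->
  integral_rV (fun t => f t + g t) = integral_rV f + integral_rV g.
Proof.
elim: n f g => [//|n IH] f g mf f0 mg g0 /=.
rewrite -ge0_integralD//; first last.
- exact: measurable_slice_integral.
- by move=> x _; apply: integral_rV_ge0.
- exact: measurable_slice_integral.
- by move=> x _; apply: integral_rV_ge0.
by apply: eq_integral => x _; rewrite IH//; exact: nmeasurable_slice.
Qed.

Lemma integral_rVZ n (k : R) (f : 'rV[R]_n -> \bar R) : (0 <= k)%R ->
  nmeasurable f -> (forall t, 0 <= f t) ->
  integral_rV (fun t => k%:E * f t) = k%:E * integral_rV f.
Proof.
move=> k0; elim: n f => [//|n IH] f mf f0 /=.
rewrite -ge0_integralZl//; first last.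
- by move=> x _; apply: integral_rV_ge0.
- exact: measurable_slice_integral.
by apply: eq_integral => x _; rewrite IH//; exact: nmeasurable_slice.
Qed.

Lemma le_integral_rV n (f g : 'rV[R]_n -> \bar R) :
  nmeasurable f -> (forall t, 0 <= f t) -> nmeasurable g ->
  (forall t, f t <= g t) -> integral_rV f <= integral_rV g.
Proof.
elim: n f g => [|n IH] f g mf f0 mg fg /=; first exact: fg.
have g0 t : 0 <= g t by exact: le_trans (f0 t) (fg t).
apply: ge0_le_integral => //.
- by move=> x _; apply: integral_rV_ge0.
- exact: measurable_slice_integral.
- exact: measurable_slice_integral.
by move=> x _; apply: IH => //; exact: nmeasurable_slice.
Qed.

Lemma nmeasurable_affine n (al be : 'rV[R]_n) (f : 'rV[R]_n -> \bar R) :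
  nmeasurable f ->
  nmeasurable (fun t => f (\row_k (al ord0 k * t ord0 k + be ord0 k)%R)).
Proof.
move=> mf d' Z' psi phi mpsi mphi.
have m k : measurable_fun setT (fun z => al ord0 k * phi k z + be ord0 k)%R.
  by apply: measurable_funD => //; apply: measurable_funM.
have := mf _ _ psi _ mpsi m; apply: eq_measurable_fun => z _ /=.
by congr f; apply/rowP => k; rewrite !mxE.
Qed.

Lemma integral_rV_affine n (alpha : R) (b : 'rV[R]_n) (f : 'rV[R]_n -> \bar R) :
  (alpha != 0)%R -> nmeasurable f -> (forall t, 0 <= f t) ->
  integral_rV f = (`|alpha| ^+ n)%:E * integral_rV (fun t => f (alpha *: t + b)%R).
Proof.
move=> a0; elim: n b f => [|n IH] b f mf f0 /=.
  by rewrite expr0 mul1e; congr f; apply/rowP => -[].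
pose b0 := b ord0 (ord0 : 'I_(1 + n)).
pose b' : 'rV[R]_n := rsubmx (b : 'rV_(1 + n)).
have bE : b = row_mx (b0%:M : 'rV_1) b' :> 'rV_(1 + n).
  rewrite -[LHS](@hsubmxK _ 1 1 n); congr row_mx; apply/rowP => i.
  by rewrite !ord1 !mxE eqxx mulr1n; congr (b _ _); exact: val_inj.
have E x t : (alpha *: (row_mx (x%:M : 'rV[R]_1) t) + b =
    row_mx ((alpha * x + b0)%:M : 'rV_1) (alpha *: t + b'))%R.
  rewrite {1}bE scale_row_mx add_row_mx; congr row_mx.
  by apply/rowP => i; rewrite !ord1 !mxE eqxx !mulr1n.
pose H x := integral_rV (fun t => f (row_mx (x%:M : 'rV_1) (alpha *: t + b')%R)).
have H0 x : 0 <= H x by apply: integral_rV_ge0.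
have mH : measurable_fun setT H.
  pose al : 'rV[R]_(1 + n) := row_mx (1%:M : 'rV_1) (\row_k alpha).
  pose be : 'rV[R]_(1 + n) := row_mx (0 : 'rV_1) b'.
  have mf' := @nmeasurable_affine n.+1 al be f mf.
  have := measurable_slice_integral mf' (fun t => f0 _).
  apply: eq_measurable_fun => x _; rewrite /H; congr integral_rV.
  apply/funext => t; congr f; apply/rowP => k; rewrite !mxE.
  by case: fintype.split => j; rewrite !mxE ?ord1 ?eqxx ?mul1r ?addr0.
transitivity (\int[mu]_x ((`|alpha| ^+ n)%:E * H x)).
  by apply: eq_integral => x _; apply: IH => //; exact: nmeasurable_slice.
rewrite ge0_integralZl// ?lee_fin ?exprn_ge0//.
rewrite (integral_affine b0 a0 mH H0) muleA -EFinM -exprSr; congr (_ * _).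
by apply: eq_integral => x _; congr integral_rV; apply/funext => t; rewrite E.
Qed.

Lemma integral_rV0 n : integral_rV (fun _ : 'rV[R]_n => 0) = 0.
Proof. by elim: n => [//|n IH] /=; rewrite IH integral0. Qed.

Lemma nmeasurable_indic_lin n (a : 'rV[R]_n) (b : R) :
  nmeasurable (fun t => (dotp a t == b)%R%:R%:E).
Proof.
move=> d' Z' psi phi mpsi mphi.
have m : measurable_fun setT (fun z => \sum_k a ord0 k * phi k z)%R.
  by apply: measurable_sum => k; apply: measurable_funM.
have -> : (fun z => ((dotp a (\row_k phi k z) == b)%R%:R : R)%:E) =
    EFin \o (fun z => (\1_[set z | (\sum_k a ord0 k * phi k z)%R = b] z)%R).
  apply/funext => z /=; rewrite indicE; congr ((nat_of_bool _)%:R%:E).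
  rewrite /dotp; under eq_bigr => k _ do rewrite mxE.
  by apply/eqP/idP; rewrite inE.
apply/measurable_EFinP; apply: measurable_indic.
rewrite -[X in measurable X]setTI.
exact: (m _ [set b] (measurable_set1 _)).
Qed.

(** If the normal has a nonzero tail, every slice is a hyperplane of the next lower dimension;
    otherwise a single slice contributes, over a null set. *)
Lemma integral_hyperplane n (a : 'rV[R]_n) (b : R) : (a != 0)%R ->
  integral_rV (fun t => (dotp a t == b)%R%:R%:E) = 0.
Proof.
elim: n a b => [|n IH] a b a0 /=.
  by move/eqP: a0 => []; apply/rowP => -[].
pose a1 := a ord0 (ord0 : 'I_(1 + n)).
pose a' : 'rV[R]_n := rsubmx (a : 'rV_(1 + n)).
have aE : a = row_mx (a1%:M : 'rV_1) a' :> 'rV_(1 + n).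
  rewrite -[LHS](@hsubmxK _ 1 1 n); congr row_mx; apply/rowP => i.
  by rewrite !ord1 !mxE eqxx mulr1n; congr (a _ _); exact: val_inj.
have E x t : (dotp a (row_mx (x%:M : 'rV_1) t) == b)%R =
    (dotp a' t == b - a1 * x)%R.
  rewrite [RHS]eq_sym subr_eq [RHS]eq_sym; congr (_ == _).
  rewrite /dotp -[RHS]addrC (@big_split_ord _ _ _ 1 n) /= big_ord1.
  congr (_ + _)%R; last first.
    apply: eq_bigr => k _; congr (_ * _)%R; first by rewrite mxE.
    exact: (row_mxEr (x%:M : 'rV_1) t 0%R k).
  congr (_ * _)%R; first by congr (a _ _); exact: val_inj.
  rewrite (row_mxEl (x%:M : 'rV_1) t 0%R (ord0 : 'I_1)) mxE eqxx mulr1n.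
  by [].
have [a'0|a'0] := eqVneq a' 0%R.
  have a10 : (a1 != 0)%R.
    apply: contra a0 => /eqP a10; rewrite aE a'0 a10.
    apply/eqP/rowP => k; rewrite !mxE; case: fintype.split => j; rewrite !mxE//.
    by rewrite ord1 eqxx mulr1n.
  rewrite -[RHS](@integral_set1 R (fun x => integral_rV
    (fun t : 'rV[R]_n => (dotp a (row_mx (x%:M : 'rV_1) t) == b)%R%:R%:E)) (b / a1)%R).
  rewrite [RHS]integral_mkcond; apply: eq_integral => x _.
  rewrite patchE; case: ifPn => // /negP xb.
  under eq_fun => t do rewrite E.
  rewrite (_ : (fun _ => _) = fun=> 0) ?integral_rV0//.
  apply/funext => t; rewrite /dotp big1 => [|k _]; last by rewrite a'0 mxE mul0r.
  case: eqP => // /esym/eqP; rewrite subr_eq0 => /eqP bE; case: xb.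
  by rewrite inE /= bE mulrC mulKf.
rewrite integral0_eq// => x _.
by under eq_fun => t do rewrite E; exact: IH.
Qed.

End IteratedIntegral.

(** * The weights exp(- c |t|_p^p) and the constant in the solid angle *)

Section LpGauss.
Context {R : realType}.
Local Notation mu := (@lebesgue_measure R).

Lemma measurable_expRN d (Z : measurableType d) (f : Z -> R) :
  measurable_fun setT f -> measurable_fun setT (fun z => expR (- f z)).
Proof. by move=> mf; do 2 apply: measurableT_comp => //. Qed.

Lemma measurable_normpow d (Z : measurableType d) (f : Z -> R) (p : R) :
  measurable_fun setT f -> measurable_fun setT (fun z => `|f z| `^ p).
Proof.
by move=> mf; apply: (measurableT_comp (measurable_powR p)); apply: measurableT_comp.
Qed.

Definition rmeasurable n (f : 'rV[R]_n -> R) :=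
  forall d' (Z' : measurableType d') (phi : 'I_n -> Z' -> R),
    (forall k, measurable_fun setT (phi k)) ->
    measurable_fun setT (fun z => f (\row_k phi k z)).

Lemma rmeasurable_EFin n (f : 'rV[R]_n -> R) : rmeasurable f ->
  nmeasurable (fun t => (f t)%:E).
Proof. by move=> mf d' Z' psi phi _ mphi; apply/measurable_EFinP; exact: mf. Qed.

Lemma rmeasurableM n (f g : 'rV[R]_n -> R) : rmeasurable f -> rmeasurable g ->
  rmeasurable (fun t => f t * g t).
Proof.
by move=> mf mg d' Z' phi mphi; apply: measurable_funM; [exact: mf|exact: mg].
Qed.

Definition lpp (p : R) n (t : 'rV[R]_n) : R := \sum_k `|t 0 k| `^ p.

Definition gaussw (p c : R) n (t : 'rV[R]_n) : R := expR (- (c * lpp p t)).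

Lemma measurable_gauss1 (p c : R) :
  measurable_fun setT (fun x : R => expR (- (c * `|x| `^ p))).
Proof.
apply: measurable_expRN.
apply: measurable_funM => //.
exact: measurable_normpow.
Qed.

Lemma rmeasurable_gaussw p c n : rmeasurable (@gaussw p c n).
Proof.
move=> d' Z' phi mphi.
apply: measurable_expRN.
apply: measurable_funM => //.
apply: measurable_sum => k.
apply: measurable_normpow.
by apply: eq_measurable_fun (mphi k) => z _; rewrite mxE.
Qed.

(** The integrand is dominated by [c^-1] times the sum of the exponential density and its mirror
    image, each of integral 1. *)
Lemma integral_expR_abs (c : R) : 0 < c ->
  (\int[mu]_x (expR (- (c * `|x|)))%:E <= (2 / c)%:E)%E.
Proof.
move=> c0.
have mpdf := @measurable_exponential_pdf R c.
have mpdfN : measurable_fun setT (fun x : R => exponential_pdf c (-1 * x + 0)).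
  apply: (measurableT_comp mpdf).
  by apply: measurable_funD => //; apply: measurable_funM.
have pdf0 (x : R) : 0 <= exponential_pdf c x by apply: exponential_pdf_ge0; exact: ltW.
have i1 : (\int[mu]_x (exponential_pdf c x)%:E = 1)%E by exact: integral_exponential_pdf.
have i2 : (\int[mu]_x (exponential_pdf c (-1 * x + 0))%:E = 1)%E.
  rewrite -i1 (@integral_affine R (-1) 0 (fun x => (exponential_pdf c x)%:E))//.
  - by rewrite normrN1 mul1e.
  - exact/measurable_EFinP.
have -> : ((2 / c)%:E = (c^-1)%:E * \int[mu]_x ((exponential_pdf c x)%:E +
    (exponential_pdf c (-1 * x + 0))%:E))%E.
  rewrite ge0_integralD//=; first last.
  - exact/measurable_EFinP.
  - by move=> x _; rewrite lee_fin.
  - exact/measurable_EFinP.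
  - by move=> x _; rewrite lee_fin.
  by rewrite i1 i2 -EFinD -EFinM mulrC.
rewrite -ge0_integralZl//=; first last.
- by rewrite lee_fin invr_ge0 ltW.
- by move=> x _; rewrite -EFinD lee_fin addr_ge0.
- by apply: emeasurable_funD; apply/measurable_EFinP.
apply: ge0_le_integral => [//||||].
- by move=> x _; rewrite lee_fin expR_ge0.
- apply/measurable_EFinP.
  apply: measurable_expRN.
  by apply: measurable_funM.
- apply: emeasurable_funM => //.
  by apply: emeasurable_funD; apply/measurable_EFinP.
move=> x _; rewrite -EFinD -EFinM lee_fin mulN1r addr0.
have [x0|x0] := leP 0 x.
  rewrite (exponential_pdfE c x0) mulrDr mulrA mulVf ?gt_eqF// mul1r mulNr.
  by rewrite ger0_norm// lerDl mulr_ge0// invr_ge0 ltW.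
have Nx0 : 0 <= - x by rewrite oppr_ge0 ltW.
rewrite (exponential_pdfE c Nx0) mulrDr addrC mulrA mulVf ?gt_eqF// mul1r mulNr.
by rewrite ltr0_norm// lerDl mulr_ge0// invr_ge0 ltW.
Qed.

(** For [1 <= p] the power is at least [|x| - 1], which compares the weight with a two-sided
    exponential. *)
Lemma integral_gauss1_lty (p c : R) : 1 <= p -> 0 < c ->
  (\int[mu]_x (expR (- (c * `|x| `^ p)))%:E < +oo)%E.
Proof.
move=> p1 c0.
apply: (@le_lt_trans _ _ ((expR c * (2 / c))%:E)); last by rewrite ltry.
rewrite EFinM; apply: (@le_trans _ _ ((expR c)%:E *
  \int[mu]_x (expR (- (c * `|x|)))%:E)%E); last first.
  by rewrite lee_pmul2l ?lte_fin ?expR_gt0// integral_expR_abs.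
have m1 : measurable_fun setT (fun x : R => (expR (- (c * `|x|)))%:E).
  apply/measurable_EFinP; apply: measurable_expRN.
  by apply: measurable_funM.
rewrite -ge0_integralZl//=.
apply: ge0_le_integral => [//||||].
- by move=> x _; rewrite lee_fin expR_ge0.
- by apply/measurable_EFinP; exact: measurable_gauss1.
- exact: emeasurable_funM.
move=> x _; rewrite -EFinM lee_fin -expRD ler_expR.
suff : `|x| - 1 <= `|x| `^ p by rewrite -(ler_pM2l c0); lra.
have [x1|x1] := leP 1 `|x|.
  by apply: le_trans (ler_powR x1 p1); rewrite powRr1// gerBl.
by apply: le_trans (powR_ge0 _ _); rewrite subr_le0 ltW.
Qed.

Lemma integral_gaussw_lty (p c : R) n : 1 <= p -> 0 < c ->
  (integral_rV (fun t : 'rV[R]_n => (gaussw p c t)%:E) < +oo)%E.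
Proof.
move=> p1 c0; elim: n => [|n IH] /=; first by rewrite ltry.
have E x (t : 'rV[R]_n) : gaussw p c (row_mx (x%:M : 'rV_1) t) =
    expR (- (c * `|x| `^ p)) * gaussw p c t.
  rewrite /gaussw -expRD -opprD -mulrDr; congr (expR (- (c * _))).
  rewrite /lpp (@big_split_ord _ _ _ 1 n) /= big_ord1; congr (_ + _).
    by rewrite (row_mxEl (x%:M : 'rV_1) t 0%R (ord0 : 'I_1)) mxE eqxx mulr1n.
  by apply: eq_bigr => k _; rewrite (row_mxEr (x%:M : 'rV_1) t 0%R k).
have g0 (t : 'rV[R]_n) : (0 <= (gaussw p c t)%:E)%E by rewrite lee_fin expR_ge0.
have mg := rmeasurable_EFin (@rmeasurable_gaussw p c n).
under eq_integral => x _.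
  under eq_fun => t do rewrite E EFinM.
  rewrite integral_rVZ ?expR_ge0//.
  over.
have [q qE] : exists q, integral_rV (fun t : 'rV[R]_n => (gaussw p c t)%:E) = q%:E.
  exists (fine (integral_rV (fun t : 'rV[R]_n => (gaussw p c t)%:E))).
  by rewrite fineK// ge0_fin_numE// integral_rV_ge0.
have q0 : 0 <= q by rewrite -lee_fin -qE integral_rV_ge0.
rewrite qE; under eq_integral => x _ do rewrite muleC.
rewrite ge0_integralZl//=; last first.
  by apply/measurable_EFinP; exact: measurable_gauss1.
by rewrite lte_mul_pinfty ?integral_gauss1_lty// ?lee_fin.
Qed.

Lemma lpnorm_powR (p : R) n (t : 'rV[R]_n) : 0 < p -> lpnorm p t `^ p = lpp p t.
Proof.
move=> p0; rewrite /lpnorm -powRrM mulVf ?gt_eqF// powRr1//.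
by apply: sumr_ge0 => k _; exact: powR_ge0.
Qed.

Lemma lppZ (p lam : R) n (t : 'rV[R]_n) : 0 <= lam ->
  lpp p (lam *: t) = lam `^ p * lpp p t.
Proof.
move=> l0; rewrite /lpp mulr_sumr; apply: eq_bigr => k _.
by rewrite mxE normrM ger0_norm// powRM.
Qed.

Lemma lpp_ge0 p n (t : 'rV[R]_n) : 0 <= lpp p t.
Proof. by apply: sumr_ge0 => k _; exact: powR_ge0. Qed.

Lemma le_lpp p n (t : 'rV[R]_n) k (M : R) : 0 <= p -> 0 <= M -> M <= `|t 0 k| ->
  M `^ p <= lpp p t.
Proof.
move=> p0 M0 Mt; apply: (@le_trans _ _ (`|t 0 k| `^ p)).
  by apply: ge0_ler_powR => //; rewrite nnegrE.
by rewrite /lpp (bigD1 k)//= lerDl sumr_ge0// => j _; exact: powR_ge0.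
Qed.

(** Since [fine] sends infinity to 0, finiteness is proved as well. The lower bound comes from the
    interval from 1 to 2, the upper one from t^(1/p) <= 1 + t <= 2 e^(t/2). *)
Lemma Gamma_pV1_gt0 (p : R) : 1 <= p -> 0 < @Gamma R (p^-1 + 1).
Proof.
move=> p1; have p0 : 0 < p := lt_le_trans ltr01 p1.
rewrite /Gamma addrK /Rintegral.
pose f := fun t : R => (t `^ p^-1 * expR (- t))%:E.
rewrite -/f.
have f0 t : (0 <= f t)%E by rewrite lee_fin mulr_ge0 ?powR_ge0 ?expR_ge0.
have mf : measurable_fun setT f.
  apply/measurable_EFinP; apply: measurable_funM; first exact: measurable_powR.
  exact: measurable_expRN.
have q1 : p^-1 <= 1 by rewrite invf_le1.
have q0 : 0 <= p^-1 by rewrite invr_ge0 ltW.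
apply: fine_gt0; apply/andP; split.
  have h : (0 < \int[mu]_(t in `[1%R, 2%R]) (expR (- 2))%:E)%E.
    rewrite integral_cst//= lebesgue_measure_itv /= lte_fin.
    have -> : (1 < 2 :> R) by rewrite ltr1n.
    by rewrite -EFinB -EFinM lte_fin mulr_gt0 ?expR_gt0//; lra.
  apply: (lt_le_trans h).
  apply: (@le_trans _ _ (\int[mu]_(t in `[1%R, 2%R]) f t)%E).
    apply: ge0_le_integral => [//||||].
    - by move=> x _; rewrite lee_fin expR_ge0.
    - exact: measurable_cst.
    - exact: measurable_funTS.
    move=> x /=; rewrite in_itv /= => /andP[x1 x2]; rewrite lee_fin.
    rewrite -[leLHS]mul1r ler_pM ?expR_ge0//; last by rewrite ler_expR lerN2.
    by rewrite -(powRr0 x) ler_powR.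
  apply: ge0_subset_integral => //; first exact: measurable_funTS.
  by move=> x /=; rewrite !in_itv /= andbT => /andP[x1 _]; exact: lt_le_trans x1.
apply: (@le_lt_trans _ _ (2%:E * \int[mu]_x (expR (- (2^-1 * `|x|)))%:E)%E); last first.
  rewrite lte_mul_pinfty ?lee_fin//.
  by apply: (le_lt_trans (integral_expR_abs _)); rewrite ?ltry ?invr_gt0.
have m1 : measurable_fun setT (fun x : R => (expR (- (2^-1 * `|x|)))%:E).
  apply/measurable_EFinP; apply: measurable_expRN.
  by apply: measurable_funM.
rewrite -ge0_integralZl//=.
rewrite integral_mkcond; apply: ge0_le_integral => [//||||].
- by move=> x _; rewrite patchE; case: ifP => // _; exact: (f0 x).
- by apply/(measurable_restrictT _ _).1 => //; exact: measurable_funTS.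
- exact: emeasurable_funM.
move=> x _; rewrite patchE -EFinM; case: ifPn => [|_]; last first.
  by rewrite lee_fin mulr_ge0 ?expR_ge0.
rewrite inE /= in_itv /= andbT => x0; rewrite lee_fin gtr0_norm//.
have xq : x `^ p^-1 <= 1 + x.
  have [x1|x1] := leP 1 x.
    by rewrite (le_trans (ler_powR x1 q1))// powRr1 ?ltW// ltrDr.
  apply: (@le_trans _ _ (1 `^ p^-1)); last by rewrite powR1 lerDl ltW.
  by apply: ge0_ler_powR; rewrite ?nnegrE ?(ltW x0) ?(ltW x1).
have e2 : 1 + 2^-1 * x <= expR (2^-1 * x) := expR_ge1Dx _.
have -> : expR (- (2^-1 * x)) = expR (2^-1 * x) * expR (- x).
  by rewrite -expRD; congr expR; field.
by rewrite mulrA ler_wpM2r ?expR_ge0//; lra.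
Qed.

End LpGauss.

(** * The solid angle as the weighted volume of the tangent cone *)

Section SolidAngleFormula.
Context {R : realType} (p : R) (hp : 1 <= p) {d : nat}.
Implicit Types (C : pred 'rV[R]_d) (x t u : 'rV[R]_d).
Local Notation I := (@integral_rV R d).

Let p0 : 0 < p := lt_le_trans ltr01 hp.

Definition ind C t : R := (C t)%:R.

Lemma rmeasurable_affine (f : 'rV[R]_d -> R) (al : R) b : rmeasurable f ->
  rmeasurable (fun t => f (al *: t + b)).
Proof.
move=> mf d' Z' phi mphi.
have m k : measurable_fun setT (fun z => al * phi k z + b ord0 k).
  by apply: measurable_funD => //; apply: measurable_funM.
have := mf _ _ _ m; apply: eq_measurable_fun => z _.
by congr f; apply/rowP => k; rewrite !mxE.
Qed.

Definition angle (c : R) C : R := fine (I (fun u => (ind C u * gaussw p c u)%:E)).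

Lemma weighted_ge0 c C t : (0 <= (ind C t * gaussw p c t)%:E)%E.
Proof. by rewrite lee_fin mulr_ge0 ?ler0n// expR_ge0. Qed.

Lemma weighted_measurable c C : rmeasurable (ind C) ->
  nmeasurable (fun t => (ind C t * gaussw p c t)%:E).
Proof.
by move=> mC; apply/rmeasurable_EFin/rmeasurableM => //; exact: rmeasurable_gaussw.
Qed.

Lemma gauss_measurable c : nmeasurable (fun t : 'rV[R]_d => (gaussw p c t)%:E).
Proof. exact/rmeasurable_EFin/rmeasurable_gaussw. Qed.

Lemma weighted_fin c C : 0 < c -> rmeasurable (ind C) ->
  I (fun u => (ind C u * gaussw p c u)%:E) = (angle c C)%:E.
Proof.
move=> c0 mC; rewrite fineK// ge0_fin_numE; last first.
  by apply: integral_rV_ge0 => t; exact: weighted_ge0.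
apply: le_lt_trans (integral_gaussw_lty d hp c0).
apply: le_integral_rV.
- exact: weighted_measurable.
- exact: weighted_ge0.
- exact: gauss_measurable.
- by move=> t; rewrite lee_fin ler_piMl ?expR_ge0// lern1 leq_b1.
Qed.

Lemma angle_ge0 c C : 0 <= angle c C.
Proof. by apply: fine_ge0; apply: integral_rV_ge0 => t; exact: weighted_ge0. Qed.

Lemma le_angle c C C' : 0 < c -> rmeasurable (ind C) -> rmeasurable (ind C') ->
  (forall t, C t -> C' t) -> angle c C <= angle c C'.
Proof.
move=> c0 mC mC' CC'; rewrite -lee_fin -!weighted_fin//.
apply: le_integral_rV.
- exact: weighted_measurable.
- exact: weighted_ge0.
- exact: weighted_measurable.
move=> t; rewrite lee_fin ler_wpM2r ?expR_ge0// ler_nat.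
by have := CC' t; case: (C t) => // ->.
Qed.

Lemma angle_near c C C' (M : R) : 0 < c -> 0 < M ->
  rmeasurable (ind C) -> rmeasurable (ind C') ->
  (forall u, (forall k, `|u 0 k| < M) -> C u = C' u) ->
  `|angle c C - angle c C'| <=
    expR (- (c / 2 * M `^ p)) * angle (c / 2) predT.
Proof.
move=> c0 M0 mC mC' CC'.
have c20 : 0 < c / 2 by rewrite divr_gt0.
have mT : rmeasurable (ind predT) by move=> ? ? ? _; exact: measurable_cst.
have H D D' : rmeasurable (ind D) -> rmeasurable (ind D') ->
    (forall u, (forall k, `|u 0 k| < M) -> D u = D' u) ->
    angle c D <= angle c D' + expR (- (c / 2 * M `^ p)) * angle (c / 2) predT.
  move=> mD mD' DD'; rewrite -lee_fin EFinD EFinM -!weighted_fin//.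
  rewrite -integral_rVZ ?expR_ge0//; first last.
  - by move=> t; exact: weighted_ge0.
  - exact: weighted_measurable.
  have mk : nmeasurable (fun t : 'rV[R]_d =>
      ((expR (- (c / 2 * M `^ p)))%:E * (ind predT t * gaussw p (c / 2) t)%:E)%E).
    have -> : (fun t : 'rV[R]_d =>
      ((expR (- (c / 2 * M `^ p)))%:E * (ind predT t * gaussw p (c / 2) t)%:E)%E) =
      (fun t => (expR (- (c / 2 * M `^ p)) * (ind predT t * gaussw p (c / 2) t))%:E).
      by [].
    apply/rmeasurable_EFin/rmeasurableM; first by move=> ? ? ? _; exact: measurable_cst.
    by apply: rmeasurableM => //; exact: rmeasurable_gaussw.
  have k0 t : (0 <= (expR (- (c / 2 * M `^ p)))%:E * (ind predT t * gaussw p (c / 2) t)%:E)%E.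
    by rewrite -EFinM lee_fin mulr_ge0 ?expR_ge0// -lee_fin weighted_ge0.
  rewrite -integral_rVD//; first last.
  - by move=> t; exact: weighted_ge0.
  - exact: weighted_measurable.
  apply: le_integral_rV.
  - exact: weighted_measurable.
  - by move=> t; exact: weighted_ge0.
  - have -> : (fun t : 'rV[R]_d => ((ind D' t * gaussw p c t)%:E +
        (expR (- (c / 2 * M `^ p)))%:E * (ind predT t * gaussw p (c / 2) t)%:E)%E) =
      (fun t => (ind D' t * gaussw p c t +
        expR (- (c / 2 * M `^ p)) * (ind predT t * gaussw p (c / 2) t))%:E) by [].
    apply: rmeasurable_EFin => d' Z' phi mphi; apply: measurable_funD.
      by apply: (rmeasurableM mD' (@rmeasurable_gaussw _ p c d)).
    apply: measurable_funM; first exact: measurable_cst.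
    by apply: (rmeasurableM mT (@rmeasurable_gaussw _ p (c / 2) d)).
  move=> t; rewrite -EFinM -EFinD lee_fin.
  have [ts|/existsNP[k /negP]] := pselect (forall k, `|t 0 k| < M).
    by rewrite /ind DD'// lerDl mulr_ge0 ?mulr_ge0 ?expR_ge0// ler0n.
  rewrite -leNgt => Mk.
  have gle : gaussw p c t <= expR (- (c / 2 * M `^ p)) * gaussw p (c / 2) t.
    rewrite /gaussw -expRD ler_expR.
    have : M `^ p <= lpp p t by apply: (le_lpp (ltW p0) (ltW M0) Mk).
    by rewrite -(ler_pM2l c20); lra.
  apply: (@le_trans _ _ (gaussw p c t)).
    by rewrite ler_piMl ?expR_ge0// lern1 leq_b1.
  by rewrite /ind mul1r (le_trans gle)// lerDr mulr_ge0 ?expR_ge0// ler0n.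
rewrite ler_distl; apply/andP; split; last exact: H.
by rewrite lerBlDr; apply: H => // u /CC'.
Qed.

Definition gauss_const : R := (2 * Gamma (p^-1 + 1)) `^ p.

Lemma gauss_const_gt0 : 0 < gauss_const.
Proof. by apply: powR_gt0; rewrite mulr_gt0// Gamma_pV1_gt0. Qed.

Local Notation c := gauss_const.

(** Substitution t = e^(1/p) u + x, whose Jacobian e^(d/p) cancels the normalising factor. *)
Lemma rescale (C : pred 'rV[R]_d) x (e : R) : 0 < e -> rmeasurable (ind C) ->
  (e `^ (d%:R / p))^-1 * fine (integral_rV (fun t =>
     (\1_[set t | C t] t * expR (- (c / e) * lpnorm p (t - x) `^ p))%:E)) =
  angle c (fun u => C (e `^ p^-1 *: u + x)).
Proof.
move=> e0 mC; set lam := e `^ p^-1.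
have lam0 : 0 < lam by exact: powR_gt0.
have lamp : lam `^ p = e by rewrite /lam -powRrM mulVf ?gt_eqF// powRr1// ltW.
have -> : e `^ (d%:R / p) = lam ^+ d.
  by rewrite mulrC powRrM powR_mulrn// ltW.
pose f t := (ind C t * gaussw p (c / e) (t - x))%:E.
have -> : (fun t => (\1_[set t | C t] t *
    expR (- (c / e) * lpnorm p (t - x) `^ p))%:E) = f.
  apply/funext => t; rewrite /f lpnorm_powR// mulNr; congr ((_ * _)%:E).
  rewrite indicE /ind; congr ((nat_of_bool _)%:R).
  by apply/idP/idP; rewrite inE.
have mf : nmeasurable f.
  apply/rmeasurable_EFin/rmeasurableM => //.
  have -> : (fun t => gaussw p (c / e) (t - x)) =
      (fun t => gaussw p (c / e) (1 *: t + (- x))).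
    by apply/funext => t; rewrite scale1r.
  by apply: rmeasurable_affine; exact: rmeasurable_gaussw.
have f0 t : (0 <= f t)%E by rewrite lee_fin mulr_ge0 ?ler0n ?expR_ge0.
have lamn0 : lam != 0 by rewrite gt_eqF.
rewrite (integral_rV_affine x lamn0 mf f0) gtr0_norm//.
have mC' : rmeasurable (ind (fun u => C (lam *: u + x))).
  exact: (@rmeasurable_affine (ind C) lam x mC).
have -> : (fun t => f (lam *: t + x)) =
    (fun u => (ind (fun u => C (lam *: u + x)) u * gaussw p c u)%:E).
  apply/funext => t; rewrite /f /ind addrK /gaussw lppZ ?(ltW lam0)// lamp.
  by congr (_ * expR (- _))%:E; rewrite mulrA divfK// gt_eqF.
rewrite weighted_fin ?gauss_const_gt0// -EFinM /= mulrA mulVf ?mul1r//.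
by rewrite expf_neq0.
Qed.

(** After rescaling, the set agrees with its tangent cone [C0] on a cube whose side grows without
    bound as [e] tends to 0, so [angle_near] applies. *)
Lemma solid_angleE C C0 x (rho : R) : 0 < rho ->
  rmeasurable (ind C) -> rmeasurable (ind C0) ->
  (forall (lam : R) (u : 'rV[R]_d), 0 < lam -> C0 (lam *: u) = C0 u) ->
  (forall y : 'rV[R]_d, (forall k, `|y 0 k| < rho) -> C (x + y) = C0 y) ->
  solid_angle p [set t | C t] x = angle c C0.
Proof.
move=> rho0 mC mC0 coneC0 near; rewrite /solid_angle.
apply: cvg_lim => //; apply/cvgrPdist_le => eps eps0.
have c20 : 0 < c / 2 by rewrite divr_gt0// gauss_const_gt0.
pose K := angle (c / 2) (predT : pred 'rV[R]_d).
have K0 : 0 <= K by exact: angle_ge0.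
pose q := c / 2 * rho `^ p.
have q0 : 0 < q by rewrite mulr_gt0// powR_gt0.
(* The error is at most exp(- q / e) K <= (e / q) (K + 1), which is below [eps] for such [e]. *)
have m0 : 0 < eps * q / (K + 1).
  by apply: divr_gt0; [apply: mulr_gt0|lra].
near=> e.
have e0 : 0 < e by near: e; exact: nbhs_right_gt.
have em : e < eps * q / (K + 1) by near: e; exact: nbhs_right_lt.
rewrite rescale// distrC.
set lam := e `^ p^-1; have lam0 : 0 < lam by exact: powR_gt0.
have lamp : lam `^ p = e by rewrite /lam -powRrM mulVf ?gt_eqF// powRr1// ltW.
have M0 : 0 < rho / lam by rewrite divr_gt0.
have mC' : rmeasurable (ind (fun u => C (lam *: u + x))).
  exact: (@rmeasurable_affine (ind C) lam x mC).
have key u : (forall k, `|u 0 k| < rho / lam) -> C (lam *: u + x) = C0 u.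
  move=> hu; rewrite addrC near ?coneC0// => k.
  by rewrite mxE normrM gtr0_norm// mulrC -ltr_pdivlMr.
apply: (le_trans (angle_near gauss_const_gt0 M0 mC' mC0 key)); rewrite -/K.
rewrite powRM ?invr_ge0 ?(ltW rho0) ?(ltW lam0)//.
have -> : lam^-1 `^ p = e^-1.
  have := lamp; rewrite -powR_inv1 ?(ltW lam0)// -powRrM mulrC powRrM => ->.
  by rewrite powR_inv1// ltW.
rewrite mulrA -/q.
have h1 : expR (- (q / e)) <= e / q.
  rewrite expRN -[e / q]invrK lef_pV2 ?posrE ?expR_gt0 ?invr_gt0 ?divr_gt0//.
  by rewrite invf_div (le_trans _ (expR_ge1Dx _))// lerDr.
apply: (@le_trans _ _ (e / q * (K + 1))).
  by apply: ler_pM => //; rewrite ?expR_ge0 ?lerDl.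
have K1 : 0 < K + 1 by lra.
rewrite mulrAC ler_pdivrMr//; apply: ltW; rewrite -ltr_pdivlMr//.
Unshelve. all: by end_near.
Qed.

End SolidAngleFormula.

(** * Solid angles of polyhedral cones *)

Section Dotp.
Context {S : comPzRingType} {n : nat}.
Implicit Types x y z : 'rV[S]_n.

Lemma dotpC x y : dotp x y = dotp y x.
Proof. by apply: eq_bigr => k _; rewrite mulrC. Qed.

Lemma dotpDr x y z : dotp x (y + z) = dotp x y + dotp x z.
Proof. by rewrite -big_split; apply: eq_bigr => k _; rewrite mxE mulrDr. Qed.

Lemma dotpZr (k : S) x y : dotp x (k *: y) = k * dotp x y.
Proof. by rewrite mulr_sumr; apply: eq_bigr => i _; rewrite mxE mulrCA. Qed.

Lemma dotpNr x y : dotp x (- y) = - dotp x y.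
Proof. by rewrite -scaleN1r dotpZr mulN1r. Qed.

Lemma dotpBr x y z : dotp x (y - z) = dotp x y - dotp x z.
Proof. by rewrite dotpDr dotpNr. Qed.

Lemma dotp0r x : dotp x 0 = 0.
Proof. by apply: big1 => k _; rewrite mxE mulr0. Qed.

Lemma dotpDl x y z : dotp (x + y) z = dotp x z + dotp y z.
Proof. by rewrite dotpC dotpDr !(dotpC z). Qed.

Lemma dotpZl (k : S) x y : dotp (k *: x) y = k * dotp x y.
Proof. by rewrite dotpC dotpZr dotpC. Qed.

Lemma dotpNl x y : dotp (- x) y = - dotp x y.
Proof. by rewrite dotpC dotpNr dotpC. Qed.

Lemma dotp0l x : dotp 0 x = 0.
Proof. by rewrite dotpC dotp0r. Qed.

Lemma dotp_suml (I : Type) (r : seq I) (P : pred I) (F : I -> 'rV[S]_n) x :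
  dotp (\sum_(i <- r | P i) F i) x = \sum_(i <- r | P i) dotp (F i) x.
Proof.
elim/big_rec2: _ => [|i y1 y2 _ <-]; first exact: dotp0l.
by rewrite dotpDl.
Qed.

Lemma dotp_delta x k : dotp x (delta_mx 0 k) = x 0 k.
Proof.
rewrite /dotp (bigD1 k)//= mxE !eqxx mulr1 big1 ?addr0// => i ik.
by rewrite mxE eqxx (negPf ik) mulr0.
Qed.

End Dotp.

Lemma dotp_map (S S' : comPzRingType) (f : {rmorphism S -> S'}) n (x y : 'rV[S]_n) :
  dotp (map_mx f x) (map_mx f y) = f (dotp x y).
Proof. by rewrite rmorph_sum; apply: eq_bigr => k _; rewrite !mxE rmorphM. Qed.

Lemma small_pos (R : realFieldType) (I : finType) (P : pred I) (u : I -> R) :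
  (forall i, P i -> 0 < u i) ->
  exists2 l : R, 0 < l & forall i, P i -> l < u i.
Proof.
move=> u0; pose m := \big[Num.min/1]_(i | P i) u i.
have m0 : 0 < m by apply: lt_bigmin.
exists (m / 2); first by rewrite divr_gt0.
move=> i Pi; apply: (@lt_le_trans _ _ m); last exact: bigmin_le_cond.
by rewrite ltr_pdivrMr// ltr_pMr// ltr1n.
Qed.

Section Measurability.
Context {R : realType} {n : nat}.

Lemma rmeasurable_cst (k : R) : rmeasurable (fun _ : 'rV[R]_n => k).
Proof. by move=> ? ? ? _; exact: measurable_cst. Qed.

Lemma rmeasurableD (f g : 'rV[R]_n -> R) : rmeasurable f -> rmeasurable g ->
  rmeasurable (fun t => f t + g t).
Proof.
by move=> mf mg d' Z' phi mphi; apply: measurable_funD; [exact: mf|exact: mg].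
Qed.

Lemma rmeasurable_sum (I : Type) (r : seq I) (f : I -> 'rV[R]_n -> R) :
  (forall i, rmeasurable (f i)) -> rmeasurable (fun t => \sum_(i <- r) f i t).
Proof.
move=> mf; elim: r => [|i r IH].
  have -> : (fun t : 'rV[R]_n => \sum_(i <- [::]) f i t) = fun=> 0.
    by apply/funext => t; rewrite big_nil.
  exact: rmeasurable_cst.
have -> : (fun t => \sum_(j <- i :: r) f j t) = fun t => f i t + \sum_(j <- r) f j t.
  by apply/funext => t; rewrite big_cons.
exact: rmeasurableD.
Qed.

Lemma rmeasurable_prod (I : Type) (r : seq I) (f : I -> 'rV[R]_n -> R) :
  (forall i, rmeasurable (f i)) -> rmeasurable (fun t => \prod_(i <- r) f i t).
Proof.
move=> mf; elim: r => [|i r IH].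
  have -> : (fun t : 'rV[R]_n => \prod_(i <- [::]) f i t) = fun=> 1.
    by apply/funext => t; rewrite big_nil.
  exact: rmeasurable_cst.
have -> : (fun t => \prod_(j <- i :: r) f j t) = fun t => f i t * \prod_(j <- r) f j t.
  by apply/funext => t; rewrite big_cons.
exact: rmeasurableM.
Qed.

Lemma rmeasurable_half_space (a : 'rV[R]_n) :
  rmeasurable (fun u => (dotp a u <= 0)%R%:R : R).
Proof.
move=> d' Z' phi mphi.
have m : measurable_fun setT (fun z => \sum_k a ord0 k * phi k z).
  by apply: measurable_sum => k; apply: measurable_funM.
have -> : (fun z => (dotp a (\row_k phi k z) <= 0)%R%:R : R) =
    \1_[set z | \sum_k a ord0 k * phi k z <= 0].
  apply/funext => z; rewrite indicE /dotp.
  under eq_bigr => k _ do rewrite mxE.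
  by congr ((nat_of_bool _)%:R); apply/idP/idP; rewrite inE.
apply: measurable_indic.
have := m measurableT [set y | y <= 0]; rewrite setTI; apply.
by rewrite -set_itvNyc; exact: measurable_itv.
Qed.

Lemma integral_rV_sum (I : Type) (r : seq I) (f : I -> 'rV[R]_n -> R) :
  (forall i, rmeasurable (f i)) -> (forall i t, 0 <= f i t) ->
  integral_rV (fun t => (\sum_(i <- r) f i t)%:E) =
  (\sum_(i <- r) integral_rV (fun t => (f i t)%:E))%E.
Proof.
move=> mf f0; elim: r => [|i r IH].
  rewrite big_nil -[RHS](@integral_rV0 R n); congr integral_rV.
  by apply/funext => t; rewrite big_nil.
rewrite big_cons -IH -integral_rVD.
- by congr integral_rV; apply/funext => t; rewrite big_cons EFinD.
- exact: rmeasurable_EFin.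
- by move=> t; rewrite lee_fin.
- by apply/rmeasurable_EFin/rmeasurable_sum.
- by move=> t; rewrite lee_fin sumr_ge0.
Qed.

End Measurability.

(** * From relations between indicators to relations between solid angles *)

Section AngleRelation.
Context {R : realType} (p : R) (hp : 1 <= p) {d : nat} (c : R) (c0 : 0 < c).
Context {T : finType} (a : T -> 'rV[R]_d) (a0 : forall i, a i != 0).

Definition generic (u : 'rV[R]_d) := forall i, dotp (a i) u != 0.

Lemma angle_opp (C : pred 'rV[R]_d) : rmeasurable (ind C) ->
  angle p c (fun u => C (- u)) = angle p c C.
Proof.
move=> mC; rewrite /angle; congr fine.
pose h u := (ind C u * gaussw p c u)%:E.
have mh : nmeasurable h by exact: weighted_measurable.
have h0 t : (0 <= h t)%E by exact: weighted_ge0.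
have hE : (fun u => h (-1 *: u + 0)) = fun u => (ind C (- u) * gaussw p c u)%:E.
  apply/funext => u; rewrite /h addr0 scaleN1r /gaussw; congr (_ * expR (- (_ * _)))%:E.
  by apply: eq_bigr => k _; rewrite mxE normrN.
have n10 : (-1 : R) != 0 by rewrite oppr_eq0 oner_eq0.
have E1 : (`|-1 : R| ^+ d)%:E = 1%E by rewrite normrN1 expr1n.
have := integral_rV_affine 0 n10 mh h0.
rewrite E1.
rewrite mul1e.
rewrite hE.
by move=> ->.
Qed.

(** The relation may fail on finitely many hyperplanes, which are null sets. The coefficients are
    split into positive and negative parts because the iterated integral is additive for nonnegative
    functions. *)
Lemma angle_rel (X : finType) (g : X -> R) (C : X -> pred 'rV[R]_d) :
  (forall x, rmeasurable (ind (C x))) ->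
  (forall u, generic u -> \sum_x g x * ind (C x) u = 0) ->
  \sum_x g x * angle p c (C x) = 0.
Proof.
move=> mC gen.
pose f (h : X -> R) u := \sum_x h x * (ind (C x) u * gaussw p c u).
have mt (h : X -> R) x : rmeasurable (fun u => h x * (ind (C x) u * gaussw p c u)).
  by apply: rmeasurableM; [exact: rmeasurable_cst|apply: rmeasurableM => //;
    exact: rmeasurable_gaussw].
have mf h : rmeasurable (f h) by apply: rmeasurable_sum => x; exact: mt.
have t0 (h : X -> R) : (forall x, 0 <= h x) -> forall x u,
    0 <= h x * (ind (C x) u * gaussw p c u).
  by move=> h0 x u; rewrite mulr_ge0// mulr_ge0 ?ler0n ?expR_ge0.
have If (h : X -> R) : (forall x, 0 <= h x) ->
    integral_rV (fun u => (f h u)%:E) = (\sum_x h x * angle p c (C x))%:E.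
  move=> h0; rewrite /f integral_rV_sum//; last by move=> x u; exact: t0.
  rewrite -sumEFin; apply: eq_bigr => x _.
  rewrite EFinM -weighted_fin// -integral_rVZ//.
    exact: weighted_measurable.
  by move=> u; exact: weighted_ge0.
have le (h h' : X -> R) : (forall x, 0 <= h x) -> (forall x, 0 <= h' x) ->
    (forall u, generic u -> \sum_x h x * ind (C x) u = \sum_x h' x * ind (C x) u) ->
    \sum_x h x * angle p c (C x) <= \sum_x h' x * angle p c (C x).
  move=> h0 h'0 E; rewrite -lee_fin -!If//.
  (* As indicators and weights are at most 1, [N] bounds the integrand; on the exceptional
     hyperplanes the correction terms [z i], of integral 0, therefore dominate it. *)
  pose N := \sum_x h x.
  have N0 : 0 <= N by apply: sumr_ge0.
  pose z i (u : 'rV[R]_d) : R := N * (dotp (a i) u == 0)%:R.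
  have mz i : nmeasurable (fun u => (z i u)%:E).
    move=> d' Z' psi phi mpsi mphi.
    have := @nmeasurable_indic_lin R d (a i) 0 d' Z' psi phi mpsi mphi.
    move=> /measurable_EFinP m; apply/measurable_EFinP.
    by apply: measurable_funM => //; exact: measurable_cst.
  have rz i : rmeasurable (z i).
    move=> d' Z' phi mphi; apply/measurable_EFinP.
    exact: (mz i d' Z' (fun=> tt) phi).
  have z0 i u : 0 <= z i u by rewrite mulr_ge0// ler0n.
  have Iz : integral_rV (fun u => (\sum_i z i u)%:E) = 0%E.
    rewrite integral_rV_sum// big1// => i _.
    rewrite (_ : (fun t => _) = fun t => (N%:E * (dotp (a i) t == 0)%R%:R%:E)%E)//.
    rewrite integral_rVZ//; first by rewrite integral_hyperplane// mule0.
    exact: nmeasurable_indic_lin.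
  rewrite -[leRHS]adde0 -Iz -integral_rVD; first last.
  - by move=> t; rewrite lee_fin sumr_ge0.
  - by apply/rmeasurable_EFin/rmeasurable_sum.
  - by move=> t; rewrite lee_fin sumr_ge0// => x _; exact: t0.
  - exact/rmeasurable_EFin.
  apply: le_integral_rV.
  - exact/rmeasurable_EFin.
  - by move=> t; rewrite lee_fin sumr_ge0// => x _; exact: t0.
  - have -> : (fun t : 'rV[R]_d => ((f h' t)%:E + (\sum_i z i t)%:E)%E) =
      (fun t => (f h' t + \sum_i z i t)%:E) by [].
    by apply/rmeasurable_EFin/rmeasurableD => //; exact: rmeasurable_sum.
  move=> u; rewrite -EFinD lee_fin.
  have fE k : f k u = (\sum_x k x * ind (C x) u) * gaussw p c u.
    by rewrite mulr_suml; apply: eq_bigr => x _; rewrite mulrA.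
  have [gu|/existsNP[i /negP]] := pselect (generic u).
    by rewrite !fE E// lerDl sumr_ge0.
  rewrite negbK => ui; apply: (@le_trans _ _ N).
    apply: ler_sum => x _; rewrite ler_piMr//.
    have g1 : gaussw p c u <= 1.
      by rewrite /gaussw -expR0 ler_expR oppr_le0 mulr_ge0 ?lpp_ge0// ltW.
    by rewrite /ind; case: (C x u); rewrite ?mul1r ?mul0r.
  rewrite ler_wpDl// ?sumr_ge0// => [x _|]; first exact: t0.
  rewrite (bigD1 i)//= /z ui mulr1 lerDl sumr_ge0// => j _; exact: z0.
pose gp x := Num.max (g x) 0; pose gn x := Num.max (- g x) 0.
have gpn x : g x = gp x - gn x.
  rewrite /gp /gn; case: (leP 0 (g x)) => h; first by rewrite max_r ?subr0// oppr_le0.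
  by rewrite max_l ?sub0r ?opprK// oppr_ge0 ltW.
have gp0 x : 0 <= gp x by rewrite le_max lexx orbT.
have gn0 x : 0 <= gn x by rewrite le_max lexx orbT.
have E (w : X -> R) : \sum_x g x * w x = \sum_x gp x * w x - \sum_x gn x * w x.
  by rewrite -sumrB; apply: eq_bigr => x _; rewrite gpn mulrBl.
have geq u : generic u -> \sum_x gp x * ind (C x) u = \sum_x gn x * ind (C x) u.
  by move=> /gen; rewrite E => /eqP; rewrite subr_eq0 => /eqP.
rewrite E; apply/eqP; rewrite subr_eq0 eq_le !le// => u /geq //.
Qed.

Definition gcone (A : {set T}) : pred 'rV[R]_d :=
  fun u => [forall i in A, dotp (a i) u <= 0].

Lemma ind_gcone A u : ind (gcone A) u = \prod_(i in A) (dotp (a i) u <= 0)%R%:R.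
Proof.
rewrite /ind /gcone; case: (boolP [forall _ in _, _]) => [/forall_inP h|].
  by rewrite big1// => i /h ->.
rewrite negb_forall_in => /exists_inP[i iA /negPf h].
by rewrite (bigD1 i)//= h mul0r.
Qed.

Lemma rmeasurable_gcone A : rmeasurable (ind (gcone A)).
Proof.
have -> : ind (gcone A) = fun u =>
    \prod_(i <- enum A) (dotp (a i) u <= 0)%R%:R.
  by apply/funext => u; rewrite ind_gcone big_enum.
by apply: rmeasurable_prod => i; exact: rmeasurable_half_space.
Qed.

Definition act (A : {set T}) (x : 'rV[R]_d) := [set i in A | dotp (a i) x == 0].

(** The solid angle of [gcone A] at [x]: the tangent cone is cut out by the inequalities that are
    equalities at [x]. *)
Definition weight (A : {set T}) (x : 'rV[R]_d) : R :=
  (gcone A x)%:R * angle p c (gcone (act A x)).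

Lemma gcone_near A x u (l : R) : 0 < l ->
  (forall i, dotp (a i) x != 0 -> l * `|dotp (a i) u| < `|dotp (a i) x|) ->
  gcone A (x + l *: u) = gcone A x && gcone (act A x) u.
Proof.
move=> l0 hl; have near i : dotp (a i) x != 0 ->
    (dotp (a i) (x + l *: u) <= 0) = (dotp (a i) x <= 0).
  move=> /hl; rewrite dotpDr dotpZr; move: (dotp (a i) x) (dotp _ _) => y z.
  have h : `|l * z| = l * `|z| by rewrite normrM gtr0_norm.
  rewrite -h ltr_norml; case: (lerP y 0) => y0.
    by rewrite ler0_norm// opprK => /andP[h1 h2]; apply/idP; lra.
  by rewrite gtr0_norm// => /andP[h1 h2]; apply/negbTE; rewrite -ltNge; lra.
have act0 i : dotp (a i) x == 0 ->
    (dotp (a i) (x + l *: u) <= 0) = (dotp (a i) u <= 0).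
  by move=> /eqP xi; rewrite dotpDr xi add0r dotpZr pmulr_rle0.
apply/forall_inP/andP => [h|[/forall_inP h1 /forall_inP h2] i iA].
  split; apply/forall_inP => i.
    move=> iA; case: (boolP (dotp (a i) x == 0)) => [/eqP -> //|xi].
    by rewrite -near// h.
  by rewrite inE => /andP[iA xi]; rewrite -act0// h.
case: (boolP (dotp (a i) x == 0)) => xi; last by rewrite near// h1.
by rewrite act0// h2// inE iA.
Qed.

(** Localisation at [x]: for generic [u] and small [l], the point [x + l *: u] is generic and its
    membership in a cone splits into that of [x] and that of [u] in the tangent cone. The signs [s]
    admit opposite cones in the same relation. *)
Lemma weight_rel (X : finType) (g : X -> R) (s : X -> bool) (A : X -> {set T}) :
  (forall u, generic u ->
    \sum_k g k * ind (gcone (A k)) ((-1) ^+ s k *: u) = 0) ->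
  forall x, \sum_k g k * weight (A k) ((-1) ^+ s k *: x) = 0.
Proof.
move=> gen x.
pose C k := fun u : 'rV[R]_d => gcone (act (A k) x) ((-1) ^+ s k *: u).
pose g' k := g k * (gcone (A k) ((-1) ^+ s k *: x))%:R.
have actS k : act (A k) ((-1) ^+ s k *: x) = act (A k) x.
  apply/setP => i; rewrite !inE dotpZr mulf_eq0 signr_eq0//.
have mC k : rmeasurable (ind (C k)).
  have -> : ind (C k) = fun u => ind (gcone (act (A k) x)) ((-1) ^+ s k *: u + 0).
    by apply/funext => u; rewrite addr0.
  by apply: rmeasurable_affine; exact: rmeasurable_gcone.
have aC k : angle p c (C k) = angle p c (gcone (act (A k) x)).
  rewrite /C; case: (s k); last by congr angle; apply/funext => u; rewrite scale1r.
  rewrite -[RHS]angle_opp; last exact: rmeasurable_gcone.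
  by congr angle; apply/funext => u; rewrite expr1 scaleN1r.
rewrite -[RHS](@angle_rel _ g' C mC).
  apply: eq_bigr => k _; rewrite /weight actS aC /g'.
  by rewrite mulrA.
move=> u gu.
have [l l0 hl] : exists2 l : R, 0 < l & forall i, dotp (a i) x != 0 ->
    l < `|dotp (a i) x| / `|dotp (a i) u|.
  apply: (@small_pos R T (fun i => dotp (a i) x != 0)
    (fun i => `|dotp (a i) x| / `|dotp (a i) u|)) => i xi.
  by rewrite divr_gt0// normr_gt0.
have hl' i : dotp (a i) x != 0 -> l * `|dotp (a i) u| < `|dotp (a i) x|.
  by move=> /hl; rewrite ltr_pdivlMr// normr_gt0.
rewrite -[RHS](gen (x + l *: u)).
  apply: eq_bigr => k _; rewrite /g' -mulrA; congr (_ * _).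
  rewrite /ind scalerDr scalerA [_ * l]mulrC -scalerA gcone_near//.
    by rewrite actS -mulnb natrM mulrC.
  by move=> i; rewrite !dotpZr mulf_eq0 signr_eq0 /= !normrM !normrX !normrN1 !expr1n !mul1r; exact: hl'.
move=> i; rewrite dotpDr dotpZr.
have [->|xi] := eqVneq (dotp (a i) x) 0.
  by rewrite add0r mulf_neq0 ?gu// gt_eqF.
rewrite addr_eq0; apply: contraTneq (hl' i xi) => ->.
by rewrite normrN normrM gtr0_norm// ltxx.
Qed.

End AngleRelation.

(** * Reciprocity modulo cones containing lines *)

Section Reciprocity.
Context {R : realType} {d : nat} {T : finType} (a : T -> 'rV[R]_d).
Implicit Types (A B : {set T}) (x u : 'rV[R]_d) (phi psi : 'rV[R]_d -> R).

Lemma prod1B (h : T -> R) (N : {set T}) :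
  \prod_(i in N) (1 - h i) =
  \sum_(Q : {set T} | Q \subset N) (-1) ^+ #|Q| * \prod_(i in Q) h i.
Proof.
have -> : \prod_(i in N) (1 - h i) =
    \prod_i ((if i \in N then - h i else 0) + 1).
  by rewrite big_mkcond; apply: eq_bigr => i _; case: ifP => _; rewrite ?add0r// addrC.
rewrite bigA_distr [RHS]big_mkcond; apply: eq_bigr => Q _.
rewrite -big_mkcond /=; case: ifP => [QN|/negbT/fintype.subsetPn[i iQ iN]].
  by rewrite -prodrN; apply: eq_bigr => i /(fintype.subsetP QN) ->.
by rewrite (bigD1 i)//= (negPf iN) mul0r.
Qed.

(** The hypothesis says that one sign pattern on [A] is impossible. Expanding the factors [1 - h i]
    isolates the full product as the term of the subset [N]. *)
Lemma circuit (h : T -> R) (A N : {set T}) : N \subset A ->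
  \prod_(i in A :\: N) h i * \prod_(i in N) (1 - h i) = 0 ->
  \prod_(i in A) h i = \sum_(Q : {set T} | Q \proper N)
    - (-1) ^+ (#|N| + #|Q|) * \prod_(i in (A :\: N) :|: Q) h i.
Proof.
move=> NA; rewrite prod1B mulr_sumr (bigD1 N)//=.
have E (Q : {set T}) : Q \subset N -> \prod_(i in A :\: N) h i * ((-1) ^+ #|Q| * \prod_(i in Q) h i) =
    (-1) ^+ #|Q| * \prod_(i in (A :\: N) :|: Q) h i.
  move=> QN; rewrite mulrCA; congr (_ * _); rewrite [RHS](eq_bigl [predU (A :\: N) & Q]).
    rewrite bigU//=; rewrite disjoint_sym finset.disjoints_subset.
    by apply/fintype.subsetP => i /(fintype.subsetP QN); rewrite !inE => ->.
  by move=> i; rewrite !inE.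
rewrite E// [_ :|: _](_ : _ = A); last by rewrite finset.setUC -{1}(finset.setIidPr NA) finset.setID.
move=> /eqP; rewrite addr_eq0 => /eqP H.
have := congr1 (fun z => (-1) ^+ #|N| * z) H.
rewrite /= mulrA -expr2 sqrr_sign mul1r => ->.
rewrite mulrN mulr_sumr -sumrN; apply: eq_big => [Q|Q /andP[QN _]].
  by rewrite finset.properEneq andbC.
by rewrite E// exprD !mulNr mulrA.
Qed.

Lemma dependency A : (d < #|A|)%N -> exists l : T -> R,
  [/\ forall i, i \notin A -> l i = 0, exists i, l i != 0 &
      \sum_i l i *: a i = 0].
Proof.
move=> dA; pose M : 'M[R]_(#|A|, d) := \matrix_i a (enum_val i).
have : kermx M != 0.
  by rewrite -mxrank_eq0 mxrank_ker subn_eq0 -ltnNge (leq_ltn_trans (rank_leq_col M)).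
move=> /rowV0Pn[r /sub_kermxP rM r0].
pose l i := \sum_(j | enum_val j == i) r 0 j.
exists l; split.
- move=> i iA; rewrite /l big_pred0// => j; apply/negbTE; apply: contraNneq iA => <-.
  exact: enum_valP.
- have [j rj] : exists j, r 0 j != 0.
    apply/existsP; apply: contraNT r0; rewrite negb_exists => /forallP h.
    by apply/eqP/rowP => j; rewrite mxE; apply/eqP; rewrite -[_ == _]negbK h.
  exists (enum_val j); rewrite /l (big_pred1 j)// => k /=.
  by rewrite (inj_eq enum_val_inj).
- transitivity (r *m M); last exact: rM.
  rewrite mulmx_sum_row; under eq_bigr => i _ do rewrite scaler_suml.
  rewrite (exchange_big_dep predT)//=; apply: eq_bigr => j _.
  by rewrite (big_pred1 (enum_val j)) ?rowK// => i /=; rewrite eq_sym.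
Qed.

(** More than [d] normals satisfy a linear relation with coefficients [l]. For generic [x] the
    products [<a i, x>] cannot all have the sign opposite to [l i], since the relation would then
    pair with [x] to a negative number; this is the excluded pattern of [circuit]. *)
Lemma circuit_rel A : (d < #|A|)%N ->
  exists (k : {set T} -> R) (g : {set T} -> {set T}),
    (forall Q, k Q != 0 -> g Q \proper A) /\
    forall x, generic a x ->
      ind (gcone a A) x = \sum_Q k Q * ind (gcone a (g Q)) x.
Proof.
move=> /dependency[l [lA [i0 li0] ldep]].
pose N : {set T} := [set i | l i < 0]%SET.
have NA : N \subset A.
  apply/fintype.subsetP => i; rewrite inE; apply: contraTT => /lA ->.
  by rewrite ltxx.
exists (fun Q : {set T} => if Q \proper N then - (-1) ^+ (#|N| + #|Q|) else 0),
  (fun Q : {set T} => (A :\: N) :|: Q); split=> [Q|x gx].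
  case: ifP => [QN _|_]; last by rewrite eqxx.
  have [/fintype.subsetP QN' [i iN iQ]] := fintype.properP QN.
  apply/fintype.properP; split.
    by rewrite finset.subUset finset.subsetDl (fintype.subset_trans _ NA)//; apply/fintype.subsetP.
  by exists i; rewrite ?(fintype.subsetP NA)// !inE negb_or iQ andbT negb_and negbK; move: iN; rewrite inE => ->.
rewrite ind_gcone (circuit NA); last first.
  apply/eqP; apply: contraPT ldep => h.
  have neg i : (i \in A) && (0 <= l i) -> dotp (a i) x < 0.
    move=> /andP[iA li]; rewrite lt_neqAle gx /=.
    apply: contraR h => xi; rewrite (bigD1 i) ?inE ?iA -?leNgt ?li//=.
    by rewrite (negPf xi) !mul0r.
  have pos i : l i < 0 -> 0 < dotp (a i) x.
    move=> li; rewrite ltNge; apply: contraR h; rewrite negbK => xi.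
    by rewrite mulrC (bigD1 i) ?inE//= xi subrr !mul0r.
  move=> /(congr1 (dotp^~ x)); rewrite dotp0l dotp_suml.
  apply/eqP; rewrite lt_eqF//; under eq_bigr => i _ do rewrite dotpZl.
  have le0 i : l i * dotp (a i) x <= 0.
    case: (ltrgtP (l i) 0) => li.
    - by rewrite ltW// nmulr_rlt0// pos.
    - rewrite pmulr_rle0// ltW// neg// ltW// andbT.
      by apply: contraTT li => /lA ->; rewrite ltxx.
    - by rewrite li mul0r.
  rewrite (bigD1 i0)//= ltr_wnDr//; first by apply: sumr_le0 => i _; exact: le0.
  rewrite lt_neqAle le0 andbT mulf_neq0//; exact: gx.
rewrite big_mkcond; apply: eq_bigr => Q _; case: ifP => _; last by rewrite mul0r.
by rewrite ind_gcone.
Qed.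

(** Combinations of cones with fewer than [d] inequalities, each of which contains a line, up to the
    hyperplanes orthogonal to the normals. *)
Definition small_span phi := exists e : {set T} -> R,
  (forall B, (d <= #|B|)%N -> e B = 0) /\
  forall x, generic a x -> phi x = \sum_B e B * ind (gcone a B) x.

Lemma small_spanD phi psi : small_span phi -> small_span psi ->
  small_span (fun x => phi x + psi x).
Proof.
move=> [e [e0 he]] [f [f0 hf]]; exists (fun B => e B + f B); split=> [B dB|x gx].
  by rewrite e0// f0// addr0.
by rewrite he// hf// -big_split; apply: eq_bigr => B _; rewrite mulrDl.
Qed.

Lemma small_spanZ (k : R) phi : small_span phi -> small_span (fun x => k * phi x).
Proof.
move=> [e [e0 he]]; exists (fun B => k * e B); split=> [B dB|x gx].
  by rewrite e0// mulr0.
by rewrite he// mulr_sumr; apply: eq_bigr => B _; rewrite mulrA.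
Qed.

Lemma small_span_eq phi psi : (forall x, generic a x -> phi x = psi x) ->
  small_span phi -> small_span psi.
Proof. by move=> E [e [e0 he]]; exists e; split=> // x gx; rewrite -E// he. Qed.

Lemma small_span0 : small_span (fun=> 0).
Proof. by exists (fun=> 0); split=> // x _; rewrite big1// => B _; rewrite mul0r. Qed.

Lemma small_span_sum (I : Type) (r : seq I) (P : pred I) (f : I -> 'rV[R]_d -> R) :
  (forall i, P i -> small_span (f i)) ->
  small_span (fun x => \sum_(i <- r | P i) f i x).
Proof.
move=> h; elim: r => [|i r IH].
  by apply: small_span_eq small_span0 => x _; rewrite big_nil.
case Pi: (P i).
  apply: (@small_span_eq (fun x => f i x + \sum_(j <- r | P j) f j x)).
    by move=> x _; rewrite big_cons Pi.
  exact: small_spanD (h _ Pi) IH.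
by apply: small_span_eq IH => x _; rewrite big_cons Pi.
Qed.

Lemma small_span_gcone B : (#|B| < d)%N -> small_span (ind (gcone a B)).
Proof.
move=> Bd; exists (fun B' => (B' == B)%:R); split=> [B'|x _].
  by apply: contraTeq; rewrite pnatr_eq0 eqb0 negbK -ltnNge => /eqP ->.
rewrite (bigD1 B)//= eqxx mul1r big1 ?addr0// => B' /negPf ->.
by rewrite mul0r.
Qed.

Lemma genericN x : generic a x -> generic a (- x).
Proof. by move=> gx i; rewrite dotpNr oppr_eq0. Qed.

Lemma ind_gcone_opp A x : generic a x -> ind (gcone a A) (- x) =
  \sum_(Q : {set T} | Q \subset A) (-1) ^+ #|Q| * ind (gcone a Q) x.
Proof.
move=> gx; under eq_bigr => Q _ do rewrite ind_gcone.
rewrite -prod1B ind_gcone; apply: eq_bigr => i _.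
by rewrite dotpNr oppr_le0; case: (ltrgtP (dotp (a i) x) 0) (gx i) => // _ _;
  rewrite ?subrr ?subr0.
Qed.

(* Up to d normals the indicator of the opposite cone expands into those of the
   faces of A; beyond, a linear relation between the normals leads to smaller
   sets A. *)
Lemma reciprocity A : small_span (fun x =>
  ind (gcone a A) (- x) - (-1) ^+ d * ind (gcone a A) x).
Proof.
move: {2}#|A|.+1 (ltnSn #|A|) => n; elim: n A => [//|n IH] A; rewrite ltnS => An.
have [dA|Ad] := ltnP d #|A|.
  have [k [g [hg hk]]] := circuit_rel dA.
  apply: (@small_span_eq (fun x => \sum_(Q | k Q != 0) k Q *
     (ind (gcone a (g Q)) (- x) - (-1) ^+ d * ind (gcone a (g Q)) x))).
    move=> x gx; rewrite (hk x gx) (hk _ (genericN gx)) mulr_sumr -sumrB.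
    rewrite big_mkcond; apply: eq_bigr => Q _.
    have [->|_] /= := eqVneq (k Q) 0; first by rewrite !mul0r mulr0 subr0.
    by rewrite mulrBr mulrCA.
  apply: small_span_sum => Q /hg /proper_card gA; apply: small_spanZ.
  by apply: IH; exact: leq_trans gA An.
pose c : R := (-1) ^+ #|A| - (-1) ^+ d.
apply: (@small_span_eq (fun x => c * ind (gcone a A) x +
  \sum_(Q : {set T} | Q \proper A) (-1) ^+ #|Q| * ind (gcone a Q) x)).
  move=> x gx; rewrite ind_gcone_opp// [in RHS](bigD1 A)//= /c mulrBl addrAC.
  congr (_ + _ - _); apply: eq_bigl => Q.
  by rewrite finset.properEneq andbC.
apply: small_spanD; last first.
  apply: small_span_sum => Q /proper_card QA; apply: small_spanZ.
  by apply: small_span_gcone; exact: leq_trans QA Ad.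
(* With exactly [d] normals the signs in [c] cancel; with fewer, the cone itself is small. *)
move: Ad; rewrite leq_eqVlt => /predU1P[E|Ad].
  apply: (@small_span_eq (fun=> 0)); last exact: small_span0.
  by move=> x _; rewrite /c E subrr mul0r.
by apply: small_spanZ; exact: small_span_gcone.
Qed.

End Reciprocity.

(** * Sums over lattices *)

From mathcomp Require Import zify finmap.
From mathcomp.analysis.showcase Require Import summability.

Section HasSum.
Context {R : realType}.
Local Notation C := (Cplx R).

Definition has_sum (I : eqType) (b : I -> C) (s : C) :=
  forall e : R, 0 < e -> exists J : seq I, forall J' : seq I, uniq J' ->
    {subset J <= J'} -> normc (\sum_(i <- J') b i - s) <= e.

Lemma eq_has_sum (I : eqType) (b b' : I -> C) s : (forall i, b i = b' i) ->
  has_sum b s -> has_sum b' s.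
Proof. by move=> /funext ->. Qed.

Lemma has_sum_unique (I : eqType) (b : I -> C) s s' :
  has_sum b s -> has_sum b s' -> s = s'.
Proof.
move=> h h'; apply: normc_eq => e e0; have e20 : 0 < e / 2 by rewrite divr_gt0.
have [J hJ] := h _ e20; have [J' hJ'] := h' _ e20.
have {}hJ := hJ (undup (J ++ J')) (undup_uniq _).
have {}hJ' := hJ' (undup (J ++ J')) (undup_uniq _).
set t := \sum_(i <- _) _ in hJ hJ'.
have -> : s - s' = (t - s') - (t - s) by rewrite opprB [RHS]addrC subrKA.
apply: (le_trans (le_normcD _ _)); rewrite normcN [e]splitr lerD//.
  by apply: hJ' => i iJ; rewrite mem_undup mem_cat iJ orbT.
by apply: hJ => i iJ; rewrite mem_undup mem_cat iJ.
Qed.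

Lemma has_sumD (I : eqType) (b b' : I -> C) s s' : has_sum b s -> has_sum b' s' ->
  has_sum (fun i => b i + b' i) (s + s').
Proof.
move=> h h' e e0; have e20 : 0 < e / 2 by rewrite divr_gt0.
have [J hJ] := h _ e20; have [J' hJ'] := h' _ e20.
exists (J ++ J') => J1 u sub; rewrite big_split /= opprD addrACA.
apply: (le_trans (le_normcD _ _)); rewrite [e]splitr lerD//.
  by apply: hJ => // i iJ; apply: sub; rewrite mem_cat iJ.
by apply: hJ' => // i iJ; apply: sub; rewrite mem_cat iJ orbT.
Qed.

Lemma has_sumZ (I : eqType) (k : C) (b : I -> C) s : has_sum b s ->
  has_sum (fun i => k * b i) (k * s).
Proof.
move=> h e e0; have k0 : 0 < normc k + 1 by rewrite ltr_wpDl// normc_ge0.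
have [J hJ] := h (e / (normc k + 1)) (divr_gt0 e0 k0); exists J => J1 u sub.
rewrite -mulr_sumr -mulrBr normcM.
apply: (@le_trans _ _ ((normc k + 1) * (e / (normc k + 1)))).
  by apply: ler_pM; rewrite ?normc_ge0// ?lerDl// hJ.
by rewrite mulrC divfK// gt_eqF.
Qed.

Lemma has_sumB (I : eqType) (b b' : I -> C) s s' : has_sum b s -> has_sum b' s' ->
  has_sum (fun i => b i - b' i) (s - s').
Proof.
move=> h /(has_sumZ (-1)) h'; rewrite -[- s']mulN1r.
by apply: eq_has_sum (has_sumD h h') => i; rewrite mulN1r.
Qed.

Lemma has_sum_bij (I I' : eqType) (b : I -> C) s (h : I' -> I) (h' : I -> I') :
  cancel h h' -> cancel h' h -> has_sum b s -> has_sum (b \o h) s.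
Proof.
move=> hK h'K hb e e0; have [J hJ] := hb _ e0.
exists (map h' J) => J' u sub.
have := hJ (map h J'); rewrite big_map; apply.
  by rewrite map_inj_uniq//; exact: can_inj hK.
move=> i iJ; rewrite -(h'K i); apply: map_f; apply: sub; exact: map_f.
Qed.

Lemma sum_seq_split (V : nmodType) (I : eqType) (J J' : seq I) (b : I -> V) :
  uniq J -> uniq J' -> {subset J <= J'} ->
  \sum_(i <- J') b i = \sum_(i <- J) b i + \sum_(i <- J' | i \notin J) b i.
Proof.
move=> uJ uJ' sub; rewrite (bigID (mem J))/=; congr (_ + _).
rewrite -big_filter; apply: perm_big; apply: uniq_perm; rewrite ?filter_uniq//.
by move=> i; rewrite mem_filter /=; case: (boolP (i \in J)) => //= /sub ->.
Qed.

Lemma has_sum_fin (I : eqType) (b : I -> C) (J : seq I) : uniq J ->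
  (forall i, i \notin J -> b i = 0) -> has_sum b (\sum_(i <- J) b i).
Proof.
move=> uJ b0 e e0; exists J => J' uJ' sub.
rewrite (sum_seq_split _ uJ uJ' sub) [X in _ + X - _]big1 => [|i /b0 //].
by rewrite addr0 subrr normc0 ltW.
Qed.

Lemma has_sum_le (I : eqType) (b : I -> C) s (J : seq I) (K : R) : uniq J ->
  (forall J' : seq I, uniq J' -> {in J', forall i, i \notin J} ->
     \sum_(i <- J') normc (b i) <= K) ->
  has_sum b s -> normc (s - \sum_(i <- J) b i) <= K.
Proof.
move=> uJ bK hb; apply/ler_addgt0Pl => e e0.
have [J1 hJ1] := hb _ e0; pose J2 := undup (J ++ J1).
have sub2 : {subset J <= J2} by move=> i iJ; rewrite mem_undup mem_cat iJ.
have := hJ1 J2 (undup_uniq _) _; set t := \sum_(i <- J2) b i => h.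
have -> : s - \sum_(i <- J) b i = (t - \sum_(i <- J) b i) - (t - s).
  by rewrite opprB [RHS]addrC addrA subrK.
apply: (le_trans (le_normcD _ _)); rewrite normcN addrC lerD//.
  by apply: h => i iJ; rewrite mem_undup mem_cat iJ orbT.
rewrite /t (sum_seq_split _ uJ (undup_uniq _) sub2) [X in X - _]addrC addrK.
rewrite -big_filter; apply: (le_trans (ler_normc_sum _ _ _)).
apply: bK; first by rewrite filter_uniq// undup_uniq.
by move=> i; rewrite mem_filter => /andP[].
Qed.

Lemma has_sum_le0 (I : eqType) (b : I -> C) s (K : R) :
  (forall J : seq I, uniq J -> \sum_(i <- J) normc (b i) <= K) ->
  has_sum b s -> normc s <= K.
Proof.
move=> bK hb; have := @has_sum_le I b s [::] K isT _ hb.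
by rewrite big_nil subr0; apply=> J' u _; exact: bK.
Qed.

Definition bounded_sums (I : eqType) (be : I -> R) := (forall i, 0 <= be i) /\
  exists K, forall J : seq I, uniq J -> \sum_(i <- J) be i <= K.

Lemma bounded_sums_tail (I : eqType) (be : I -> R) : bounded_sums be ->
  forall e : R, 0 < e -> exists2 J : seq I, uniq J &
    forall J' : seq I, uniq J' -> {in J', forall i, i \notin J} ->
      \sum_(i <- J') be i <= e.
Proof.
move=> [be0 [K hK]] e e0.
pose S := [set x | exists2 J : seq I, uniq J & x = \sum_(i <- J) be i].
have S0 : S 0 by exists [::] => //; rewrite big_nil.
have hS : has_sup S.
  by split; [exists 0|exists K => x [J uJ ->]; exact: hK].
have [x [J uJ ->] xS] := sup_adherent e0 hS; exists J => // J' uJ' dis.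
have : S (\sum_(i <- J ++ J') be i).
  exists (J ++ J') => //; rewrite cat_uniq uJ uJ' andbT /=.
  by apply/hasPn => i /dis.
move=> /(ub_le_sup hS.2); rewrite big_cat /=; lra.
Qed.

Lemma nonneg_has_sum (I : eqType) (be : I -> R) : bounded_sums be ->
  exists s, has_sum (fun i => (be i)%:C%C) s.
Proof.
move=> bbe; have [be0 [K hK]] := bbe.
pose S := [set x | exists2 J : seq I, uniq J & x = \sum_(i <- J) be i].
have S0 : S 0 by exists [::] => //; rewrite big_nil.
have hS : has_sup S.
  by split; [exists 0|exists K => x [J uJ ->]; exact: hK].
exists (sup S)%:C%C => e e0.
have [x [J uJ ->] xS] := sup_adherent e0 hS; exists J => J' uJ' sub.
rewrite -rmorph_sum -rmorphB /= normc_real ler_distl.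
have le1 : \sum_(i <- J') be i <= sup S by apply: (ub_le_sup hS.2); exists J'.
have le2 : \sum_(i <- J) be i <= \sum_(i <- J') be i.
  by rewrite (sum_seq_split _ uJ uJ' sub) lerDl sumr_ge0.
by apply/andP; split; lra.
Qed.

Lemma bounded_sumsD (I : eqType) (be be' : I -> R) : bounded_sums be ->
  bounded_sums be' -> bounded_sums (fun i => be i + be' i).
Proof.
move=> [b0 [K hK]] [b'0 [K' hK']]; split=> [i|]; first by rewrite addr_ge0.
by exists (K + K') => J u; rewrite big_split lerD ?hK ?hK'.
Qed.

Lemma bounded_sums_le (I : eqType) (be be' : I -> R) :
  (forall i, 0 <= be i <= be' i) -> bounded_sums be' -> bounded_sums be.
Proof.
move=> h [b'0 [K hK]]; split=> [i|]; first by case/andP: (h i).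
exists K => J u; apply: le_trans (hK J u).
by apply: ler_sum => i _; case/andP: (h i).
Qed.

Lemma bounded_sumsZ (I : eqType) (k : R) (be : I -> R) : 0 <= k ->
  bounded_sums be -> bounded_sums (fun i => k * be i).
Proof.
move=> k0 [b0 [K hK]]; split=> [i|]; first by rewrite mulr_ge0.
by exists (k * K) => J u; rewrite -mulr_sumr ler_wpM2l// hK.
Qed.

(** A real part [f] dominated by [be] is the difference of the nonnegative families [f + be] and
    [be], for which suprema give the sums. *)
Lemma dominated_has_sum (I : eqType) (b : I -> C) (be : I -> R) :
  bounded_sums be -> (forall i, normc (b i) <= be i) -> exists s, has_sum b s.
Proof.
move=> bbe hb.
have part (f : I -> R) : (forall i, `|f i| <= be i) ->
    exists s, has_sum (fun i => (f i)%:C%C) s.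
  move=> fbe; have [s hs] := nonneg_has_sum bbe.
  have bf : bounded_sums (fun i => f i + be i).
    apply: bounded_sums_le (bounded_sumsD bbe bbe) => i.
    by have := fbe i; rewrite ler_norml => /andP[h1 h2]; apply/andP; split; lra.
  have [s' hs'] := nonneg_has_sum bf; exists (s' - s).
  by apply: eq_has_sum (has_sumB hs' hs) => i; rewrite rmorphD /= addrK.
have [x hx] := part (fun i => complex.Re (b i)) (fun i => le_trans (normc_Re _) (hb i)).
have [y hy] := part (fun i => complex.Im (b i)) (fun i => le_trans (normc_Im _) (hb i)).
exists (x + 'i%C * y); apply: eq_has_sum (has_sumD hx (has_sumZ 'i%C hy)) => i.
by rewrite [RHS]complexE.
Qed.

(** Dominated convergence, for an arbitrary filter so that it serves for real parameters, for
    sequences and along an ultrafilter. A finite set carries all but [e / 4] of the dominating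
    sum. *)
Lemma has_sum_cvg (I : eqType) (K : Type) (F : set_system K) (FF : Filter F)
    (b : K -> I -> C) (b0 : I -> C) (be : I -> R) (s : K -> C) (s0 : C) :
  bounded_sums be -> (forall k i, normc (b k i) <= be i) ->
  (forall i, normc (b0 i) <= be i) ->
  (forall k, has_sum (b k) (s k)) -> has_sum b0 s0 ->
  (forall i (e : R), 0 < e -> \forall k \near F, normc (b k i - b0 i) <= e) ->
  forall e : R, 0 < e -> \forall k \near F, normc (s k - s0) <= e.
Proof.
move=> bbe hb hb0 hs hs0 cv e e0.
have e40 : 0 < e / 4 by rewrite divr_gt0.
have [J uJ tail] := bounded_sums_tail bbe e40.
have e20 : 0 < e / 2 / (size J).+1%:R by rewrite !divr_gt0.
have : \forall k \near F, {in J, forall i,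
    normc (b k i - b0 i) <= e / 2 / (size J).+1%:R}.
  move: (e / 2 / _) e20 => r r0; elim: (J) => [|i J' IH].
    by apply: filterE => k i.
  apply: filterS (filterI (cv i _ r0) IH) => k [h1 h2] j.
  by rewrite inE => /predU1P[->//|/h2].
apply: filterS => k hk.
apply: (@has_sum_le0 _ _ _ e _ (has_sumB (hs k) hs0)) => J' uJ'.
rewrite (bigID (mem J))/= [e]splitr lerD//.
  rewrite -big_filter; apply: (@le_trans _ _ (\sum_(i <- J) e / 2 / (size J).+1%:R)).
    apply: (@le_trans _ _ (\sum_(i <- [seq i <- J' | i \in J]) e / 2 / (size J).+1%:R)).
      rewrite big_seq [leRHS]big_seq; apply: ler_sum => i.
      by rewrite mem_filter => /andP[iJ _]; exact: hk.
    rewrite !big_const_seq !count_predT !iter_addr_0 (ler_wpMn2l (ltW e20))//.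
    apply: uniq_leq_size; first by rewrite filter_uniq.
    by move=> i; rewrite mem_filter => /andP[].
  rewrite big_const_seq count_predT iter_addr_0 -[X in X <= _]mulr_natr mulrAC ler_pdivrMr//.
  by rewrite ler_wpM2l ?ler_nat// divr_ge0// ltW.
rewrite -big_filter.
apply: (@le_trans _ _ (\sum_(i <- [seq i <- J' | i \notin J]) (be i + be i))).
  apply: ler_sum => i _; apply: (le_trans (le_normcD _ _)).
  by rewrite normcN lerD.
rewrite big_split /=.
have t : \sum_(i <- [seq i <- J' | i \notin J]) be i <= e / 4.
  apply: tail; first by rewrite filter_uniq.
  by move=> i; rewrite mem_filter => /andP[].
lra.
Qed.

Lemma cont_at_sum (I : Type) (r : seq I) (f : I -> R -> C) x :
  (forall i, cont_at (f i) x) -> cont_at (fun y => \sum_(i <- r) f i y) x.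
Proof.
move=> hf; elim: r => [|i r IH].
  have -> : (fun y => \sum_(i <- [::]) f i y) = fun=> 0.
    by apply/funext => y; rewrite big_nil.
  exact: cont_at_cst.
have -> : (fun y => \sum_(j <- i :: r) f j y) = fun y => f i y + \sum_(j <- r) f j y.
  by apply/funext => y; rewrite big_cons.
exact: cont_atD.
Qed.

Lemma cint_sum (I : Type) (r : seq I) (f : I -> R -> C) (x y : R) : x <= y ->
  (forall i, cont_on (f i) x y) ->
  cint (fun t => \sum_(i <- r) f i t) x y = \sum_(i <- r) cint (f i) x y.
Proof.
move=> xy hf; elim: r => [|i r IH].
  rewrite big_nil; transitivity (cint (fun=> 0 : C) x y).
    by apply: eq_cint => t _; rewrite big_nil.
  by rewrite cint_cst// mul0r.
rewrite big_cons -IH -cintD//.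
  by apply: eq_cint => t _; rewrite big_cons.
by move=> t ht; apply: cont_at_sum => j; exact: hf.
Qed.

Lemma cont_on_has_sum (I : eqType) (b : I -> R -> C) (be : I -> R) (E : R -> C) :
  bounded_sums be -> (forall i x, normc (b i x) <= be i) ->
  (forall x, has_sum (b^~ x) (E x)) -> (forall i x, cont_at (b i) x) ->
  forall x, cont_at E x.
Proof.
move=> bbe hb hE cb x e e0; have e20 : 0 < e / 2 by rewrite divr_gt0.
have := @has_sum_cvg I R (nbhs x) _ (fun y i => b i y) (b^~ x) be E (E x)
  bbe (fun y i => hb i y) (fun i => hb i x) hE (hE x) _ (e / 2) e20.
case=> [i r r0|dl /= dl0 h].
  have [dl dl0 hdl] := cb i x r r0; exists dl => //= y /=.
  by rewrite distrC => /hdl /ltW.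
exists dl => // y yx; apply: (@le_lt_trans _ _ (e / 2)); last first.
  by rewrite ltr_pdivrMr// ltr_pMr// ltr1n.
by apply: h; rewrite /= distrC.
Qed.

Lemma cint_has_sum (I : eqType) (b : I -> R -> C) (be : I -> R) (E : R -> C) :
  bounded_sums be -> (forall i x, normc (b i x) <= be i) ->
  (forall x, has_sum (b^~ x) (E x)) -> (forall i x, cont_at (b i) x) ->
  has_sum (fun i => cint (b i) 0 1) (cint E 0 1).
Proof.
move=> bbe hb hE cb e e0; have e20 : 0 < e / 2 by rewrite divr_gt0.
have cE := cont_on_has_sum bbe hb hE cb.
have [J uJ tail] := bounded_sums_tail bbe e20.
exists J => J' uJ' sub; rewrite -cint_sum//; last by move=> i x _; exact: cb.
rewrite -cintB//; last by move=> x _; apply: cont_at_sum => i; exact: cb.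
have -> : e = 2 * (e / 2) * (1 - 0) by rewrite subr0 mulr1 mulrC divfK.
apply: normc_cint => // [x _|x _].
  by apply: cont_atB => //; apply: cont_at_sum => i; exact: cb.
rewrite normcB; apply: has_sum_le (hE x) => // J1 uJ1 dis.
apply: (@le_trans _ _ (\sum_(i <- J1) be i)); first by apply: ler_sum => i _.
by apply: tail => // i /dis; apply: contra => /sub.
Qed.

End HasSum.

(** * Lattice sums, characters and difference operators *)

Section LatticeSums.
Context {R : realType} {d : nat}.
Local Notation C := (Cplx R).
Local Notation M := 'rV[int]_d.
Implicit Types (m u : M) (x y : 'rV[R]_d) (s : 'rV[C]_d).

Definition intv m : 'rV[R]_d := map_mx intr m.

Lemma intvD m u : intv (m + u) = intv m + intv u.
Proof. exact: map_mxD. Qed.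

Lemma intvN m : intv (- m) = - intv m.
Proof. exact: map_mxN. Qed.

Lemma intvB m u : intv (m - u) = intv m - intv u.
Proof. exact: map_mxB. Qed.

Lemma intv0 : intv 0 = 0.
Proof. exact: map_mx0. Qed.

Definition norm1 x : R := \sum_k `|x 0 k|.

Lemma norm1_ge0 x : 0 <= norm1 x.
Proof. by apply: sumr_ge0. Qed.

Lemma norm1D x y : norm1 (x + y) <= norm1 x + norm1 y.
Proof. by rewrite -big_split; apply: ler_sum => k _; rewrite mxE ler_normD. Qed.

Lemma norm1Z (k : R) x : norm1 (k *: x) = `|k| * norm1 x.
Proof. by rewrite mulr_sumr; apply: eq_bigr => i _; rewrite mxE normrM. Qed.

Lemma ler_norm1 x k : `|x 0 k| <= norm1 x.
Proof. by rewrite /norm1 (bigD1 k)//= lerDl sumr_ge0. Qed.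

Lemma norm1_eq0 x : norm1 x <= 0 -> x = 0.
Proof.
move=> h; apply/rowP => k; rewrite mxE; apply/eqP; rewrite -normr_le0.
exact: le_trans (ler_norm1 x k) h.
Qed.

Lemma dotp_le x y (b : R) : (forall k, `|x 0 k| <= b) ->
  `|dotp x y| <= b * norm1 y.
Proof.
move=> xb; apply: (le_trans (ler_norm_sum _ _ _)); rewrite mulr_sumr.
by apply: ler_sum => k _; rewrite normrM ler_wpM2r.
Qed.

Lemma dotp_le1 x y : `|dotp x y| <= norm1 x * norm1 y.
Proof. by apply: dotp_le => k; exact: ler_norm1. Qed.

Lemma geometric_sum_le (r : R) n : 0 <= r < 1 -> \sum_(i < n) r ^+ i <= (1 - r)^-1.
Proof.
move=> /andP[r0 r1]; have r1' : 0 < 1 - r by rewrite subr_gt0.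
rewrite -[leLHS](mulfK (lt0r_neq0 r1')) -[leRHS]mul1r ler_wpM2r ?invr_ge0 ?(ltW r1')//.
have -> : (\sum_(i < n) r ^+ i) * (1 - r) = 1 - r ^+ n.
  by rewrite mulrC -opprB mulNr -subrX1 opprB.
by have := exprn_ge0 n r0; lra.
Qed.

(** A finite set of lattice points lies in a box, where the sum factors into [d] two-sided geometric
    sums, each at most [2 / (1 - r)]. *)
Lemma bounded_sums_exp (c : R) : 0 < c ->
  bounded_sums (fun m => expR (- (c * norm1 (intv m)))).
Proof.
move=> c0; split=> [m|]; first exact: expR_ge0.
pose r := expR (- c).
have r01 : 0 <= r < 1 by rewrite expR_ge0 /= /r -expR0 ltr_expR oppr_lt0.
exists ((2 / (1 - r)) ^+ d) => J uJ.
have [N hN] : exists N : nat, {in J, forall m k, (`|m 0%R k| <= N)%N}.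
  exists (\max_(m <- J) \max_k `|m 0%R k|%N) => m mJ k.
  apply: (@leq_trans (\max_k `|m 0%R k|%N)); first exact: (leq_bigmax k).
  exact: (@leq_bigmax_seq _ J predT (fun m => \max_k `|m 0%R k|%N)).
pose phi (g : {ffun 'I_d -> 'I_(N + N).+1}) : M := \row_k ((g k)%:Z - N%:Z).
pose psi m : {ffun 'I_d -> 'I_(N + N).+1} := [ffun k => inord `|(m 0%R k + N%:Z)%R|%N].
have psiK : {in J, cancel psi phi}.
  move=> m mJ; apply/rowP => k; rewrite mxE ffunE.
  have := hN m mJ k; case: (m 0 k) => n hn; rewrite inordK; move: hn; lia.
have -> : \sum_(m <- J) expR (- (c * norm1 (intv m))) =
    \sum_(g <- map psi J) expR (- (c * norm1 (intv (phi g)))).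
  by rewrite big_map; apply: eq_big_seq => m mJ; rewrite psiK.
have up : uniq (map psi J).
  by rewrite map_inj_in_uniq// => m m' mJ mJ' E; rewrite -(psiK m mJ) E psiK.
rewrite big_uniq//=.
apply: (@le_trans _ _ (\sum_g expR (- (c * norm1 (intv (phi g)))))).
  rewrite [leRHS](bigID (mem (map psi J)))/= lerDl.
  by apply: sumr_ge0 => g _; exact: expR_ge0.
pose w (j : 'I_(N + N).+1) := expR (- (c * `|(j%:Z - N%:Z)%:~R|)).
have -> : \sum_g expR (- (c * norm1 (intv (phi g)))) = (\sum_j w j) ^+ d.
  rewrite -[in RHS](card_ord d) -prodr_const bigA_distr_bigA; apply: eq_bigr => g _.
  rewrite /norm1 mulr_sumr -sumrN expR_sum; apply: eq_bigr => k _.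
  by rewrite /w !mxE.
rewrite lerXn2r ?nnegrE//.
- by apply: sumr_ge0 => j _; exact: expR_ge0.
- by rewrite divr_ge0// subr_ge0 ltW//; case/andP: r01.
have wE (n : nat) : expR (- (c * n%:R)) = r ^+ n.
  by rewrite /r -expRM_natr mulNr.
have -> : \sum_j w j = \sum_(0 <= j < (N + N).+1) expR (- (c * `|(j%:Z - N%:Z)%:~R|)).
  by rewrite big_mkord.
rewrite (big_cat_nat (n := N))//=; last by lia.
have -> : \sum_(0 <= j < N) expR (- (c * `|(j%:Z - N%:Z)%:~R|)) = \sum_(i < N) r ^+ i.+1.
  rewrite big_nat_rev big_mkord /=; apply: eq_bigr => i _.
  have -> : (0 + N - i.+1)%N%:Z - N%:Z = - i.+1%:Z by have := ltn_ord i; lia.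
  by rewrite -wE mulrNz normrN normr_nat.
have -> : \sum_(N <= j < (N + N).+1) expR (- (c * `|(j%:Z - N%:Z)%:~R|)) =
    \sum_(i < N.+1) r ^+ i.
  rewrite -{1}[N]add0n big_addn big_mkord subSn ?leq_addr// addnK; apply: eq_bigr => i _.
  by rewrite -wE PoszD addrK normr_nat.
have [r0 r1] := andP r01.
rewrite [2 / _]mulr_natl mulr2n lerD ?geometric_sum_le//.
apply: le_trans (geometric_sum_le N r01).
by apply: ler_sum => i _; rewrite exprS (ler_piMl (exprn_ge0 _ r0) (ltW r1)).
Qed.

Lemma sum_has_sum (b : M -> C) (S : C) : has_sum b S -> @sum _ R[i]%C C b = S.
Proof.
move=> hb; have PF := @totally_filter M.
apply: cvg_lim => // P /near_normcP[e e0 eP].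
have e20 : 0 < e / 2 by rewrite divr_gt0.
have [J hJ] := hb _ e20; exists [fset m in J]%fset => // A /= /fsubsetP sub.
apply: eP; apply: (@le_lt_trans _ _ (e / 2)); last first.
  by rewrite ltr_pdivrMr// ltr_pMr// ltr1n.
rewrite /partial_sum.
have := hJ A (fset_uniq A) _; rewrite (big_seq_fsetE _ _ predT)/=; apply.
by move=> m mJ; apply: sub; rewrite inE.
Qed.

Definition chr s m : C := e2pi (dotp s (map_mx intr m)).

Lemma chrD s m u : chr s (m + u) = chr s m * chr s u.
Proof. by rewrite /chr -e2piD map_mxD dotpDr. Qed.

Lemma chr0 s : chr s 0 = 1.
Proof. by rewrite /chr map_mx0 dotp0r e2pi0. Qed.

Lemma chrNl s m : chr (- s) m = chr s (- m).
Proof. by rewrite /chr map_mxN dotpNr dotpNl. Qed.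

Lemma normc_chr s m :
  normc (chr s m) = expR (- (2 * pi * dotp (map_mx (@complex.Im R) s) (intv m))).
Proof.
rewrite /chr normc_e2pi; congr (expR (- (_ * _))).
rewrite raddf_sum; apply: eq_bigr => k _; rewrite !mxE.
have -> : ((m 0 k)%:~R : C) = ((m 0 k)%:~R : R)%:C%C by rewrite rmorph_int.
by case: (s 0 k) => p q /=; rewrite mulr0 add0r.
Qed.

Lemma holo_dotp (w s : 'rV[C]_d) : holo (fun s => dotp s w) s.
Proof.
constructor.
have -> : (fun s : 'rV[C]_d => dotp s w) = \sum_k (fun s : 'rV[C]_d => s 0 k * w 0 k).
  by apply/funext => t; rewrite fct_sumE.
apply: differentiable_sum => k; apply: differentiableM; first exact: differentiable_coord.
exact: differentiable_cst.
Qed.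

Lemma holo_cst (k : C) s : holo (fun _ : 'rV[C]_d => k) s.
Proof. by constructor; exact: differentiable_cst. Qed.

Lemma holo_chr m s : holo (chr^~ m) s.
Proof.
constructor; case: (holo_dotp (map_mx intr m) s) => hd.
by apply: (differentiable_comp hd); exact: differentiable_e2pi.
Qed.

Lemma holo_sum (I : Type) (r : seq I) (F : I -> 'rV[C]_d -> C) s :
  (forall i, holo (F i) s) -> holo (fun s => \sum_(i <- r) F i s) s.
Proof.
move=> hF; elim: r => [|i r IH].
  have -> : (fun s => \sum_(i <- [::]) F i s) = fun=> 0.
    by apply/funext => t; rewrite big_nil.
  exact: holo_cst.
have -> : (fun s => \sum_(j <- i :: r) F j s) =
    fun s => F i s - (0 - \sum_(j <- r) F j s).
  by apply/funext => t; rewrite big_cons sub0r opprK.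
exact: (holoB (hF i) (holoB (holo_cst 0 s) IH)).
Qed.

Definition shift_op u (f : M -> R) m := f m - f (m - u).

Definition shift_ops (us : seq M) f := foldr shift_op f us.

Definition shift_poly (us : seq M) s : C := \prod_(u <- us) (1 - chr s u).

Lemma has_sum_shift_op u f s S : has_sum (fun m => (f m)%:C%C * chr s m) S ->
  has_sum (fun m => (shift_op u f m)%:C%C * chr s m) (S * (1 - chr s u)).
Proof.
move=> h.
have h' : has_sum (fun m => (f (m - u))%:C%C * chr s (m - u)) S.
  by apply: (has_sum_bij (h := fun m => m - u) (h' := fun m => m + u) _ _ h) => m;
    rewrite ?subrK ?addrK.
rewrite mulrBr mulr1 mulrC.
apply: eq_has_sum (has_sumB h (has_sumZ (chr s u) h')) => m.
by rewrite /shift_op rmorphB /= mulrBl [chr s u * (_ * _)]mulrCA -chrD [u + _]addrC subrK.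
Qed.

Lemma has_sum_shift_ops us f s S : has_sum (fun m => (f m)%:C%C * chr s m) S ->
  has_sum (fun m => (shift_ops us f m)%:C%C * chr s m) (S * shift_poly us s).
Proof.
elim: us => [|u us IH] h; rewrite /shift_poly ?big_nil ?mulr1// big_cons.
by rewrite mulrCA [X in has_sum _ X]mulrC; apply: has_sum_shift_op; exact: IH.
Qed.

Lemma holo_shift_poly us s : holo (shift_poly us) s.
Proof.
elim: us => [|u us IH].
  have -> : shift_poly [::] = fun=> 1 by apply/funext => t; rewrite /shift_poly big_nil.
  exact: holo_cst.
have -> : shift_poly (u :: us) = fun t => (1 - chr t u) * shift_poly us t.
  by apply/funext => t; rewrite /shift_poly big_cons.
exact: (holoM (holoB (holo_cst 1 s) (holo_chr u s)) IH).
Qed.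

Lemma shift_poly_neq0 us : all (fun u => u != 0) us -> exists s, shift_poly us s != 0.
Proof.
elim: us => [_|u us IH /andP[u0 /IH Pus]].
  by exists 0; rewrite /shift_poly big_nil oner_neq0.
have [s hs] : exists s, 1 - chr s u != 0.
  have [k uk] : exists k, u 0 k != 0.
    apply/existsP; apply: contraNT u0; rewrite negb_exists => /forallP h.
    by apply/eqP/rowP => k; rewrite mxE; apply/eqP; rewrite -[_ == _]negbK h.
  (* Here the character takes the value [e2pi] of the imaginary unit, which is exp(- 2 pi) and not
     1. *)
  exists (('i%C * ((u 0 k)%:~R)^-1) *: delta_mx 0 k).
  rewrite /chr dotpZl dotpC dotp_delta mxE -mulrA mulVf ?intr_eq0// mulr1.
  apply/eqP => /eqP; rewrite subr_eq0 => /eqP h.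
  have := congr1 (@normc R) h; rewrite normc1 normc_e2pi /= mulr1 => E.
  have : expR (- (2 * pi)) < 1 :> R by rewrite expR_lt1 oppr_lt0 mulr_gt0// pi_gt0.
  by rewrite -E ltxx.
have hP t : holo (fun t => 1 - chr t u) t.
  exact: (holoB (holo_cst 1 t) (holo_chr u t)).
have [e e0 he] := holo_neq0 (hP s) hs.
have [t st Pt] := entire_dense s (holo_shift_poly us) Pus e0.
exists t; rewrite /shift_poly big_cons; apply: mulf_neq0; [exact: he|exact: Pt].
Qed.

Lemma shift_opsC u us f : shift_op u (shift_ops us f) = shift_ops us (shift_op u f).
Proof.
elim: us => [//|w us IH] /=; rewrite -IH; apply/funext => m; rewrite /shift_op.
by rewrite [m - w - u]addrAC; ring.
Qed.

Lemma shift_ops0 us : shift_ops us (fun=> 0) = fun=> 0.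
Proof. by elim: us => [//|u us IH] /=; rewrite IH; apply/funext => m; rewrite /shift_op subr0. Qed.

Lemma shift_ops_kill us f u : u \in us -> (forall m, f (m + u) = f m) ->
  forall m, shift_ops us f m = 0.
Proof.
elim: us => [//|w us IH]; rewrite inE => /predU1P[->|uus] fu m /=.
  rewrite shift_opsC (_ : shift_op w f = fun=> 0) ?shift_ops0//.
  by apply/funext => m'; rewrite /shift_op -{1}(subrK w m') fu subrr.
by rewrite /shift_op !IH// subr0.
Qed.

Lemma shift_opsD us f g m :
  shift_ops us (fun m => f m + g m) m = shift_ops us f m + shift_ops us g m.
Proof. by elim: us m => [//|u us IH] m /=; rewrite /shift_op !IH; ring. Qed.

Lemma shift_opsZ us (k : R) f m :
  shift_ops us (fun m => k * f m) m = k * shift_ops us f m.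
Proof. by elim: us m => [//|u us IH] m /=; rewrite /shift_op !IH; ring. Qed.

Lemma shift_ops_sum us (I : Type) (r : seq I) (f : I -> M -> R) m :
  shift_ops us (fun m => \sum_(i <- r) f i m) m = \sum_(i <- r) shift_ops us (f i) m.
Proof.
elim: r => [|i r IH].
  rewrite big_nil -[RHS](congr1 (fun g => g m) (shift_ops0 us)).
  by congr (shift_ops us _ m); apply/funext => m'; rewrite big_nil.
rewrite big_cons -IH -shift_opsD.
by congr (shift_ops us _ m); apply/funext => m'; rewrite big_cons.
Qed.

(** The list consists of the sums of sublists of [us]: every operator either keeps the point or
    shifts it once. *)
Lemma shift_ops_support us f (X : M -> Prop) :
  (forall m, f m != 0 -> X m) -> forall m, shift_ops us f m != 0 ->
  exists2 u, X (m - u) & u \in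
    foldr (fun u (S : seq M) => S ++ [seq w + u | w <- S]) [:: 0] us.
Proof.
move=> fX; elim: us => [|u us IH] m /=.
  by move=> /fX Xm; exists 0; rewrite ?subr0// inE.
rewrite /shift_op => h.
have [h1|/IH[w Xw wS]] := eqVneq (shift_ops us f m) 0; last first.
  by exists w => //; rewrite mem_cat wS.
move: h; rewrite h1 sub0r oppr_eq0 => /IH[w Xw wS]; exists (w + u).
  by rewrite opprD addrA addrAC.
by rewrite mem_cat; apply/orP; right; apply: map_f.
Qed.

Lemma lattice_box (N : R) : exists2 J : seq M, uniq J &
  forall m, norm1 (intv m) <= N -> m \in J.
Proof.
pose n := Num.truncn N.
pose phi (g : {ffun 'I_d -> 'I_(n + n).+1}) : M := \row_k ((g k)%:Z - n%:Z).
exists (undup (map phi (enum {: {ffun 'I_d -> 'I_(n + n).+1}}))) => [|m mN].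
  exact: undup_uniq.
rewrite mem_undup; apply/mapP.
exists [ffun k => inord `|(m 0%R k + n%:Z)%R|%N]; first by rewrite mem_enum.
apply/rowP => k; rewrite mxE ffunE.
have : `|(m 0 k)%:~R| <= N.
  by apply: le_trans mN; have := ler_norm1 (intv m : 'rV[R]_d) k; rewrite mxE.
rewrite -intr_norm -abszE => h.
have : (`|m 0%R k| <= n)%N.
  by rewrite truncn_ge_nat ?(le_trans _ h).
case: (m 0 k) => i hi; rewrite inordK; move: hi; lia.
Qed.

End LatticeSums.

(** * The generating series of a polyhedral cone *)

Section PolyhedralCone.
Context {R : realType} (p : R) (hp : 1 <= p) {d : nat}.
Context {T : finType} (a : T -> 'rV[R]_d).
Local Notation C := (Cplx R).
Local Notation M := 'rV[int]_d.
Implicit Types (x y v : 'rV[R]_d) (m u : M) (s : 'rV[C]_d).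
Local Notation full := [set: T]%SET.

(** The matrix of the functionals has a right inverse [D]; the sum of the absolute values of its
    entries bounds the norm. *)
Lemma inj_bound (X : finType) (b : X -> 'rV[R]_d) :
  (forall x, (forall t, dotp (b t) x = 0) -> x = 0) ->
  exists2 K : R, 0 < K & forall x, norm1 x <= K * \sum_t `|dotp (b t) x|.
Proof.
move=> inj; pose B : 'M[R]_(d, #|X|) := \matrix_(k, j) b (enum_val j) 0 k.
have BE x j : (x *m B) 0 j = dotp (b (enum_val j)) x.
  by rewrite mxE; apply: eq_bigr => k _; rewrite !mxE mulrC.
have /row_freeP[D BD] : row_free B.
  rewrite -kermx_eq0; apply/rowV0P => x /sub_kermxP xB; apply: inj => t.
  by rewrite -(enum_rankK t) -BE xB mxE.
pose K := \sum_j \sum_k `|D j k|.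
have K0 : 0 <= K by do 2 (apply: sumr_ge0 => ? _).
exists (K + 1); first by rewrite ltr_wpDl.
move=> x; have xE k : x 0 k = \sum_j dotp (b (enum_val j)) x * D j k.
  by rewrite -[in LHS](mulmx1 x) -BD mulmxA mxE; apply: eq_bigr => j _; rewrite BE.
have Sge (t : X) : `|dotp (b t) x| <= \sum_t `|dotp (b t) x|.
  by rewrite (bigD1 t)//= lerDl sumr_ge0.
apply: (@le_trans _ _ (K * \sum_t `|dotp (b t) x|)); last first.
  by rewrite ler_wpM2r ?lerDl// sumr_ge0.
rewrite /K exchange_big mulr_suml; apply: ler_sum => k _.
rewrite xE mulr_suml; apply: (le_trans (ler_norm_sum _ _ _)).
by apply: ler_sum => j _; rewrite normrM mulrC ler_wpM2l.
Qed.

Definition pointed := forall x, (forall i, dotp (a i) x = 0) -> x = 0.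

Lemma continuous_sum_rV (I : Type) (r : seq I) (F : I -> 'rV[R]_d -> R) :
  (forall i, continuous (F i)) -> continuous (fun x => \sum_(i <- r) F i x).
Proof.
move=> hF; elim: r => [|i r IH].
  have -> : (fun x => \sum_(i <- [::]) F i x) = fun=> 0.
    by apply/funext => t; rewrite big_nil.
  exact: cst_continuous.
have -> : (fun x => \sum_(j <- i :: r) F j x) = fun x => F i x + \sum_(j <- r) F j x.
  by apply/funext => t; rewrite big_cons.
by move=> x; exact: (cvgD (hF i x) (IH x)).
Qed.

Lemma continuous_dotp y : continuous (fun x => dotp y x).
Proof.
apply: continuous_sum_rV => k x; apply: (@differentiable_continuous R _ _ x (fun x : 'rV[R]_d => y 0 k * x 0 k)).
apply: differentiableM; first exact: differentiable_cst.
exact: differentiable_coord.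
Qed.

Lemma continuous_norm1 : continuous (fun x => norm1 x).
Proof.
apply: continuous_sum_rV => k x.
apply: (@continuous_comp _ _ _ (fun x : 'rV[R]_d => x 0 k) (fun z : R => `|z|)).
  exact: coord_continuous.
exact: norm_continuous.
Qed.

Lemma gconeZ A (k : R) x : 0 <= k -> gcone a A x -> gcone a A (k *: x).
Proof.
move=> k0 /forall_inP h; apply/forall_inP => i iA.
by rewrite dotpZr mulr_ge0_le0// h.
Qed.

(** The linear form attains a positive minimum on the compact set of points of norm 1 in the cone;
    homogeneity does the rest. *)
Lemma cone_compact_bound y :
  (forall x, gcone a full x -> x != 0 -> 0 < dotp y x) ->
  exists2 e : R, 0 < e & forall x, gcone a full x -> e * norm1 x <= dotp y x.
Proof.
move=> hy; pose A := [set x | gcone a full x] `&` [set x | norm1 x = 1].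
have unitA x : gcone a full x -> x != 0 -> A ((norm1 x)^-1 *: x).
  move=> hx x0; have n0 : 0 < norm1 x.
    by rewrite lt_def norm1_ge0 andbT; apply: contraNneq x0 => n; rewrite (@norm1_eq0 _ _ x)// n.
  split; first by apply: gconeZ => //; rewrite invr_ge0 ltW.
  by rewrite /= norm1Z gtr0_norm ?invr_gt0// mulVf// gt_eqF.
have [[z Az]|noA] := pselect (A !=set0); last first.
  exists 1 => // x hx; have [->|x0] := eqVneq x 0.
    by rewrite dotp0r (_ : norm1 0 = 0) ?mulr0// /norm1 big1// => k _; rewrite mxE normr0.
  by exfalso; apply: noA; exists ((norm1 x)^-1 *: x); exact: unitA.
have clA : closed A.
  apply: closedI.
    have -> : [set x | gcone a full x] = \bigcap_i [set x | dotp (a i) x <= 0].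
      apply/seteqP; split=> [x /= /forall_inP h i _|x h]; first by apply: h; rewrite inE.
      by apply/forall_inP => i _; exact: h.
    apply: closed_bigI => i _.
    have /continuous_closedP/(_ [set z | z <= 0]) := @continuous_dotp (a i).
    by apply; exact: closed_le.
  have /continuous_closedP/(_ [set z | z = 1]) := continuous_norm1.
  by apply; exact: closed_eq.
have coA : compact A.
  apply: (@subclosed_compact _ _ [set v : 'rV[R]_d | forall i, `[-1, 1]%classic (v ord0 i)]) => //.
    by apply: (@rV_compact R d (fun=> `[-1, 1]%classic)) => i; exact: segment_compact.
  move=> x [_ /= n1] i; rewrite /= in_itv /= -ler_norml -n1; exact: ler_norm1.
have [w Aw wmin] := @compact_EVT_min _ R (fun x => dotp y x) A (ex_intro _ z Az) coA
  (continuous_subspaceT (@continuous_dotp y)).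
have [hw /= w1] := set_mem Aw.
have w0 : w != 0.
  apply/eqP => w0; move/eqP: w1; rewrite w0 /norm1 big1 => [|k _]; last by rewrite mxE normr0.
  by rewrite eq_sym oner_eq0.
exists (dotp y w); first exact: hy.
move=> x hx; have [->|x0] := eqVneq x 0.
  by rewrite dotp0r (_ : norm1 0 = 0) ?mulr0// /norm1 big1// => k _; rewrite mxE normr0.
have n0 : 0 < norm1 x.
  by rewrite lt_def norm1_ge0 andbT; apply: contraNneq x0 => n; rewrite (@norm1_eq0 _ _ x)// n.
have /wmin : (norm1 x)^-1 *: x \in A by apply/mem_set; exact: unitA.
by rewrite dotpZr mulrC ler_pdivlMr.
Qed.

Local Notation c := (gauss_const p).
Local Notation weight := (weight p c a).

Hypothesis a0 : forall i, a i != 0.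

Lemma weight_ge0 A x : 0 <= weight A x.
Proof. by rewrite mulr_ge0 ?ler0n// angle_ge0. Qed.

Definition full_angle := angle p c (predT : pred 'rV[R]_d).

Lemma weight_le A x : weight A x <= full_angle.
Proof.
rewrite /weight; apply: (@le_trans _ _ (angle p c (gcone a (act a A x)))).
  by rewrite ler_piMl ?angle_ge0// lern1 leq_b1.
apply: (le_angle hp (gauss_const_gt0 hp)) => //.
exact: rmeasurable_gcone.
Qed.

Lemma weight_out A x : ~~ gcone a A x -> weight A x = 0.
Proof. by rewrite /weight => /negPf ->; rewrite mul0r. Qed.

Lemma solid_angle_weight K v x : K = [set x | gcone a full x] ->
  (if x \in translate v K then solid_angle p (translate v K) x else 0) =
  weight full (x - v).
Proof.
move=> hK; pose D t := gcone a full (t - v).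
have -> : translate v K = [set t | D t].
  rewrite hK; apply/seteqP; split=> [_ [t ht <-]|t ht] /=; first by rewrite /D addrC addKr.
  by exists (t - v) => //; rewrite addrC subrK.
rewrite (_ : (x \in [set t | D t]) = D x); last by apply/idP/idP => [/set_mem|h] //; apply/mem_set.
rewrite /weight -/(D x); case: (boolP (D x)) => Dx; last by rewrite mul0r.
rewrite mul1r; set A := act a full (x - v).
(* The cube of half side [l] around [x] meets no facet hyperplane that does not pass through [x];
   the added 1 only keeps the denominator positive. *)
have [l l0 hl] : exists2 l : R, 0 < l & forall i, dotp (a i) (x - v) != 0 ->
    l < `|dotp (a i) (x - v)| / (norm1 (a i) + 1).
  apply: (@small_pos R T (fun i => dotp (a i) (x - v) != 0)
    (fun i => `|dotp (a i) (x - v)| / (norm1 (a i) + 1))) => i xi.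
  by rewrite divr_gt0 ?normr_gt0// ltr_wpDl// norm1_ge0.
apply: (solid_angleE hp l0).
- have -> : ind D = fun t => ind (gcone a full) (1 *: t + - v).
    by apply/funext => t; rewrite scale1r.
  by apply: rmeasurable_affine; exact: rmeasurable_gcone.
- exact: rmeasurable_gcone.
- move=> k u k0; rewrite /gcone; apply: eq_forallb_in => i _.
  by rewrite dotpZr pmulr_rle0.
move=> y hy; rewrite /D addrAC -[y]scale1r gcone_near//.
  by rewrite -/(D x) Dx scale1r.
move=> i /hl; rewrite mul1r => h; have n1 : 0 < norm1 (a i) + 1.
  by rewrite ltr_wpDl// norm1_ge0.
apply: (@le_lt_trans _ _ (l * norm1 (a i))).
  by rewrite dotpC; apply: dotp_le => k; exact: ltW.
apply: (@le_lt_trans _ _ (l * (norm1 (a i) + 1))).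
  by rewrite ler_wpM2l ?(ltW l0)// lerDl.
by rewrite -ltr_pdivlMr.
Qed.

Lemma series_term K v s : K = [set x | gcone a full x] ->
  solid_angle_series p (translate v K) s =
  @sum _ R[i]%C C (fun m => (weight full (intv m - v))%:C%C * chr s m).
Proof.
move=> hK; rewrite /solid_angle_series; congr (@sum _ R[i]%C C _).
apply/funext => m; rewrite -(solid_angle_weight v (intv m) hK).
by case: ifP => _; rewrite ?mul0r.
Qed.

(** Weights are bounded by the full angle, and the linear lower bound on the cone makes the
    characters decay exponentially; moving the apex to [v] costs only the constant [B]. *)
Lemma series_bound v s (e : R) : 0 < e ->
  (forall x, gcone a full x -> e * norm1 x <= dotp (map_mx (@complex.Im R) s) x) ->
  exists2 be, bounded_sums be &
    forall m, normc ((weight full (intv m - v))%:C%C * chr s m) <= be m.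
Proof.
move=> e0 he; set y := map_mx _ s in he *.
pose k := 2 * pi * e; have k0 : 0 < k by rewrite !mulr_gt0// pi_gt0.
pose B := full_angle * expR (k * norm1 v - 2 * pi * dotp y v).
have f0 : 0 <= full_angle by exact: angle_ge0.
have B0 : 0 <= B by rewrite mulr_ge0// expR_ge0.
exists (fun m => B * expR (- (k * norm1 (intv m)))).
  exact: (bounded_sumsZ B0 (bounded_sums_exp (d := d) k0)).
move=> m.
rewrite normcM normc_real normc_chr -/y ger0_norm ?weight_ge0//.
have [h|/weight_out ->] := boolP (gcone a full (intv m - v)); last first.
  by rewrite mul0r mulr_ge0// expR_ge0.
have -> : B * expR (- (k * norm1 (intv m))) =
    full_angle * expR (k * norm1 v - 2 * pi * dotp y v - k * norm1 (intv m)).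
  by rewrite /B -mulrA -expRD.
rewrite ler_pM ?weight_ge0 ?expR_ge0 ?weight_le// ler_expR.
have := he _ h; rewrite dotpBr => h1.
have h2 : norm1 (intv m) <= norm1 (intv m - v) + norm1 v.
  by rewrite -{1}(subrK v (intv m)) norm1D.
have p0 := @pi_gt0 R.
have h3 : 2 * pi * (e * norm1 (intv m - v)) <= 2 * pi * (dotp y (intv m) - dotp y v).
  by rewrite ler_pM2l// mulr_gt0.
have h4 : k * norm1 (intv m) <= k * (norm1 (intv m - v) + norm1 v) by rewrite ler_pM2l.
move: h3 h4; rewrite /k !mulrDr !mulrN !mulrA; lra.
Qed.

Lemma series_dominated v s :
  (forall x, gcone a full x -> x != 0 -> 0 < dotp (map_mx (@complex.Im R) s) x) ->
  exists S, has_sum (fun m => (weight full (intv m - v))%:C%C * chr s m) S.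
Proof.
move=> /cone_compact_bound[e e0 he]; have [be B h] := series_bound v e0 he.
exact: (dominated_has_sum B h).
Qed.

End PolyhedralCone.

(** * Cones with rational facet normals *)

Lemma int_scale n (q : 'I_n -> rat) : exists D : int, D != 0 /\
  exists u : 'I_n -> int, forall k, (u k)%:~R = D%:~R * q k.
Proof.
exists (\prod_k denq (q k)); split; first by apply/prodf_neq0 => k _; exact: denq_neq0.
exists (fun k => numq (q k) * \prod_(j | j != k) denq (q j)) => k.
rewrite [in RHS](bigD1 k)//= !rmorphM /= numqE.
by move: (_%:~R) ((\prod_(_ | _) _)%:~R) => x y; ring.
Qed.

Section RationalCone.
Context {R : realType} (p : R) (hp : 1 <= p) {d : nat}.
Context {T : finType} (a : T -> 'rV[R]_d) (a0 : forall i, a i != 0).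
Local Notation C := (Cplx R).
Local Notation Cd := 'rV[Cplx R]_d.
Local Notation M := 'rV[int]_d.
Local Notation full := [set: T]%SET.
Local Notation weight := (weight p (gauss_const p) a).
Implicit Types (x y v : 'rV[R]_d) (m u : M) (s : Cd).

(** The three groups of terms form one family over [bool + {set T}], where [inl true] is the
    opposite cone, so that [weight_rel] transports reciprocity of indicators to weights. *)
Lemma weight_reciprocity : exists e : {set T} -> R,
  (forall B : {set T}, (d <= #|B|)%N -> e B = 0) /\
  forall x, weight full (- x) - (-1) ^+ d * weight full x =
    \sum_B e B * weight B x.
Proof.
have [e [e0 he]] := reciprocity a full; exists e; split=> // x.
pose g (k : bool + {set T}) : R :=
  match k with inl b => if b then 1 else - (-1) ^+ d | inr B => - e B end.
pose s (k : bool + {set T}) := if k is inl b then b else false.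
pose A (k : bool + {set T}) := if k is inr B then B else full.
have sumE (w : {set T} -> 'rV[R]_d -> R) y :
    \sum_k g k * w (A k) ((-1) ^+ s k *: y) =
    w full (- y) - (-1) ^+ d * w full y - \sum_B e B * w B y.
  rewrite big_sumType big_bool /= expr1 expr0 scaleN1r scale1r mul1r mulNr.
  congr (_ + _); rewrite -sumrN; apply: eq_bigr => B _.
  by rewrite mulNr.
have := @weight_rel R p hp d (gauss_const p) (gauss_const_gt0 hp) T a a0 _ g s A _ x.
rewrite (sumE weight) => H; apply/eqP; rewrite -subr_eq0; apply/eqP; apply: H => y gy.
by rewrite (sumE (fun B => ind (gcone a B))) he// subrr.
Qed.

Definition rational_normals := forall i, exists (k : R) (b : M),
  k != 0 /\ a i = k *: intv b.

(** Fewer than [d] rational equations have a nonzero rational solution; clearing denominators makes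
    it integral. *)
Lemma integer_lineality (B : {set T}) : rational_normals -> (#|B| < d)%N ->
  exists2 u, u != 0 & forall i, i \in B -> dotp (a i) (intv u) = 0.
Proof.
move=> /choice[k /choice[b hab]] Bd.
pose N : 'M[rat]_(#|B|, d) := \matrix_(j, l) (b (enum_val j) 0 l)%:~R.
have : cokermx N != 0.
  by rewrite -mxrank_eq0 mxrank_coker subn_eq0 -ltnNge (leq_ltn_trans (rank_leq_row N)).
move: (cokermx N) (mulmx_coker N) => Z NZ cN.
have [l [j0 clj]] : exists l j, Z l j != 0.
  move: cN => /eqP; apply: contra_notP => /forallNP h; apply/matrixP => l j; rewrite [RHS]mxE.
  by apply/eqP; apply: contrapT => /negP n; apply: (h l); exists j.
have [D [D0 [u hu]]] := int_scale (fun l => Z l j0).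
exists (\row_l u l).
  apply: contraNneq clj => /rowP/(_ l); rewrite !mxE => ul.
  have := hu l; rewrite ul => /esym/eqP; rewrite mulf_eq0 intr_eq0 (negPf D0).
  exact.
move=> i iB; rewrite (hab i).2 dotpZl dotp_map; apply/eqP.
rewrite mulf_eq0 (negPf (hab i).1) /= intr_eq0 -(intr_eq0 rat) rmorph_sum /=.
have /matrixP/(_ (enum_rank_in iB i) j0) := NZ.
rewrite !mxE => E; apply/eqP.
transitivity (D%:~R * (\sum_j N (enum_rank_in iB i) j * Z j j0)); last by rewrite E mulr0.
rewrite mulr_sumr.
apply: eq_bigr => j _; rewrite !mxE rmorphM /= hu enum_rankK_in//.
by rewrite mulrCA.
Qed.

Definition cone_weight v m := weight full (intv m - v).

(** The coefficient of [- m] in the series of the cone with apex [- v]. *)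
Definition opp_cone_weight v m := weight full (v - intv m).

Lemma weightD (A : {set T}) x y : (forall i, i \in A -> dotp (a i) y = 0) ->
  weight A (x + y) = weight A x.
Proof.
move=> h; have E i : i \in A -> dotp (a i) (x + y) = dotp (a i) x.
  by move=> iA; rewrite dotpDr h// addr0.
rewrite /weight; congr (_%:R * angle p _ (gcone a _)).
  by congr nat_of_bool; apply: eq_forallb_in => i iA; rewrite E.
by apply/setP => i; rewrite !inE; case: (boolP (i \in A)) => //= iA; rewrite E.
Qed.

(** One lattice vector for each set of fewer than [d] normals: the weights of that cone are
    invariant under it, so its difference operator kills their contribution. *)
Lemma rational_shift_ops : rational_normals ->
  exists us : seq M, all (fun u => u != 0) us /\
  forall v m, shift_ops us (opp_cone_weight v) m =
    (-1) ^+ d * shift_ops us (cone_weight v) m.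
Proof.
move=> hr; have [e [e0 he]] := weight_reciprocity.
have /choice[w hw] (B : {set T}) : exists u, (#|B| < d)%N ->
    u != 0 /\ forall i, i \in B -> dotp (a i) (intv u) = 0.
  have [Bd|_] := boolP (#|B| < d)%N; last by exists 0.
  by have [u u0 hu] := integer_lineality hr Bd; exists u.
exists [seq w B | B : {set T} <- enum {: {set T}} & (#|B| < d)%N]; set us := map _ _.
split.
  by apply/allP => u /mapP[B]; rewrite mem_filter => /andP[/hw[]] ? _ _ ->.
move=> v m; apply/eqP; rewrite -subr_eq0 -mulNr -shift_opsZ -shift_opsD; apply/eqP.
transitivity (shift_ops us (fun m => \sum_B e B * weight B (intv m - v)) m).
  by congr (shift_ops us _ m); apply/funext => m';
    rewrite -he opprB mulNr.
rewrite shift_ops_sum big1// => B _; rewrite shift_opsZ.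
have [Bd|/e0 ->] := ltnP #|B| d; last by rewrite mul0r.
have [_ wB] := hw B Bd.
rewrite (@shift_ops_kill _ _ us _ (w B)) ?mulr0//.
  by apply: map_f; rewrite mem_filter Bd mem_enum.
by move=> m'; rewrite intvD addrAC (weightD _ wB).
Qed.

Definition tube : set Cd :=
  [set s | forall x, gcone a full x -> x != 0 -> 0 < dotp (map_mx (@complex.Im R) s) x].

Lemma series_domainE K s : K = [set x | gcone a full x] -> series_domain K s <-> tube s.
Proof.
move=> ->; split=> h x hx x0; have := h x hx x0.
  by rewrite dotpNl oppr_lt0.
by rewrite dotpNl oppr_lt0.
Qed.

Hypothesis apex : pointed a.

Lemma cone_norm1 : exists2 k : R, 0 < k & forall x, gcone a full x ->
  k * norm1 x <= dotp (- \sum_i a i) x.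
Proof.
have [K K0 hK] := inj_bound apex; exists K^-1; first by rewrite invr_gt0.
move=> x /forall_inP hx; rewrite mulrC ler_pdivrMr// mulrC.
apply: (le_trans (hK x)); rewrite ler_pM2l// dotpNl dotp_suml -sumrN.
by apply: ler_sum => i _; rewrite ler0_norm// hx.
Qed.

(** The negated sum of the normals is bounded below by [k * norm1] on the cone; moving the imaginary
    part by less than [k / 2] in each coordinate keeps it positive. *)
Lemma polydisc_tube : exists b, exists2 e : R, 0 < e & polydisc b e `<=` tube.
Proof.
have [k k0 hk] := cone_norm1.
exists ('i%C *: Cvec (- \sum_i a i)), (k / 2); first by rewrite divr_gt0.
move=> s hs x hx x0; set y := - \sum_i a i in hk hs *.
have n0 : 0 < norm1 x.
  by rewrite lt_def norm1_ge0 andbT; apply: contraNneq x0 => n; rewrite (@norm1_eq0 _ _ x)// n.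
have : `|dotp (map_mx (@complex.Im R) s - y) x| <= k / 2 * norm1 x.
  apply: dotp_le => i; apply: (@le_trans _ _ (normc (s 0 i - ('i%C *: Cvec y) 0 i))).
    apply: le_trans (normc_Im _); rewrite !mxE; case: (s 0 i) => u w /=.
    by rewrite mul0r mul1r add0r.
  exact: ltW.
rewrite dotpDl dotpNl ler_norml => /andP[h _].
have := hk _ hx; have := mulr_gt0 k0 n0; lra.
Qed.

Lemma dense_openI (U V : set Cd) : open U -> dense U -> dense V -> dense (U `&` V).
Proof.
move=> oU dU dV O O0 oO; rewrite setIA; apply: dV; first exact: dU.
exact: openI.
Qed.

Lemma continuous_oppv : continuous (fun s => - s).
Proof. by move=> s; exact: opp_continuous. Qed.

(* The support lies both in a finite union of translates of the cone and in one
   of the opposite cone. *)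
Lemma finite_support v (us : seq M) :
  (forall m, shift_ops us (opp_cone_weight v) m =
    (-1) ^+ d * shift_ops us (cone_weight v) m) ->
  exists2 J : seq M, uniq J &
    forall m, m \notin J -> shift_ops us (cone_weight v) m = 0.
Proof.
move=> rel; set S := foldr (fun u (S : seq M) => S ++ [seq w + u | w <- S]) [:: 0] us.
pose W : R := \sum_(w <- S) norm1 (intv w).
have hW w : w \in S -> norm1 (intv w) <= W.
  by move=> wS; rewrite /W (big_rem w)//= lerDl sumr_ge0// => ? _; exact: norm1_ge0.
have [K K0 hK] := inj_bound apex.
pose B i := norm1 (a i) * (W + norm1 v).
have [J uJ hJ] := @lattice_box R d (K * \sum_i B i); exists J => // m mJ.
apply/eqP; apply: contraNT mJ => f0; apply: hJ; apply: le_trans (hK _) _.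
rewrite ler_pM2l//; apply: ler_sum => i _.
have g0 : shift_ops us (opp_cone_weight v) m != 0.
  by rewrite rel mulf_neq0// signr_eq0.
have [w /= /forall_inP/(_ i) hw wS] : exists2 w, gcone a full (intv (m - w) - v) & w \in S.
  apply: (@shift_ops_support _ _ us _ (fun m => gcone a full (intv m - v))) f0 => m'.
  by apply: contra_neqT => /weight_out; exact.
have [w' /= /forall_inP/(_ i) hw' wS'] : exists2 w, gcone a full (v - intv (m - w)) & w \in S.
  apply: (@shift_ops_support _ _ us _ (fun m => gcone a full (v - intv m))) g0 => m'.
  by apply: contra_neqT => /weight_out; exact.
have {hw} := hw (finset.in_setT i); have {hw'} := hw' (finset.in_setT i).
rewrite !intvB !dotpBr => h' h.
have b0 := norm1_ge0 (a i).
have bnd u : u \in S -> `|dotp (a i) (intv u)| <= norm1 (a i) * W.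
  by move=> uS; apply: le_trans (dotp_le1 _ _) _; rewrite ler_wpM2l// hW.
have bv := dotp_le1 (a i) v.
move: (bnd _ wS) (bnd _ wS') bv; rewrite /B mulrDr !ler_norml.
move=> /andP[? ?] /andP[? ?] /andP[? ?]; apply/andP; split; lra.
Qed.

(** Stated for arbitrary shifts [us], since it also serves, with no shift at all, when all
    coefficients vanish. *)
Lemma reciprocity_of_shift_ops K v (us : seq M) F :
  K = [set x | gcone a full x] -> all (fun u => u != 0) us ->
  (forall m, shift_ops us (opp_cone_weight v) m =
    (-1) ^+ d * shift_ops us (cone_weight v) m) ->
  is_alpha p v K F ->
  (exists G, is_alpha p (- v) K G) /\
  (forall G, is_alpha p (- v) K G ->
     meromorphic_eq (fun s => F (- s)) (fun s => (-1) ^+ d * G s)).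
Proof.
move=> hK us0 rel [mF hF].
pose P := shift_poly us : Cd -> C.
have [J uJ hJ] : exists2 J : seq M, uniq J &
    forall m, m \notin J -> shift_ops us (cone_weight v) m = 0.
  exact: finite_support.
(* Finite support makes this an entire exponential sum, so that [Q / P] is a continuation of the
   series. *)
pose Q s : C := \sum_(m <- J) (shift_ops us (cone_weight v) m)%:C%C * chr s m.
have finQ s : has_sum (fun m => (shift_ops us (cone_weight v) m)%:C%C * chr s m) (Q s).
  by apply: has_sum_fin => // m /hJ ->; rewrite mul0r.
have FQ s : tube s -> F s * P s = Q s.
  move=> hs; have [S hS] := series_dominated hp v hs.
  rewrite hF; last exact/(series_domainE _ hK).
  rewrite (series_term hp v s hK) (sum_has_sum hS).
  exact: has_sum_unique (has_sum_shift_ops us hS) (finQ s).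
pose P' s : C := P (- s); pose Q' s : C := (-1) ^+ d * Q (- s).
have GQ s : tube s -> solid_angle_series p (translate (- v) K) s * P' s = Q' s.
  move=> hs; have [S hS] := series_dominated hp (- v) hs.
  rewrite (series_term hp (- v) s hK) (sum_has_sum hS).
  have hS' : has_sum (fun m => (opp_cone_weight v m)%:C%C * chr (- s) m) S.
    apply: eq_has_sum (has_sum_bij (h := @GRing.opp M) (h' := @GRing.opp M) (@opprK _) (@opprK _) hS) => m /=.
    by rewrite -chrNl intvN opprK addrC.
  apply: (has_sum_unique (has_sum_shift_ops us hS')).
  apply: eq_has_sum (has_sumZ ((-1) ^+ d) (finQ (- s))) => m.
  by rewrite rel rmorphM rmorphXn rmorphN1 mulrA.
have P'0 : exists s, P' s != 0.
  by have [s hs] := @shift_poly_neq0 R _ us us0; exists (- s); rewrite /P' opprK.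
have hP s : holo P s by exact: holo_shift_poly.
have hQ s : holo Q s.
  exact: (holo_sum _ (fun m => holoM (holo_cst _ s) (holo_chr m s))).
have hP' s : holo P' s.
  have -> : P' = shift_poly (map -%R us).
    by apply/funext => t; rewrite /P' /P /shift_poly big_map; apply: eq_bigr => u _; rewrite chrNl.
  exact: holo_shift_poly.
have hQ' s : holo Q' s.
  have -> : Q' = fun s => (-1) ^+ d * \sum_(m <- J) (shift_ops us (cone_weight v) m)%:C%C * chr s (- m).
    apply/funext => t; rewrite /Q' /Q.
    by rewrite (eq_bigr _ (fun m _ => congr1 ( *%R _) (chrNl t m))).
  exact: (holoM (holo_cst _ s)
    (holo_sum _ (fun m => holoM (holo_cst _ s) (holo_chr (- m) s)))).
have [b [e e0 hb]] := polydisc_tube.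
split.
  (* In the tube the value has to be that of the series even where [P'] vanishes. Both branches
     agree wherever [P'] does not, which is all that meromorphy sees. *)
  exists (fun s => if `[< tube s >] then solid_angle_series p (translate (- v) K) s
                   else Q' s / P' s); split; last first.
    by move=> s /(series_domainE _ hK) hs; rewrite asboolT.
  move=> t; exists 1, Q', P'; split=> //.
  - by move=> s _; case: (hQ' s).
  - by move=> s _; case: (hP' s).
  - rewrite ball_polydisc//=; have [s hs Ps] := entire_dense t hP' P'0 ltr01.
    by exists s.
  - move=> s _ Ps; case: asboolP => // hs.
    by rewrite -GQ// mulfK.
move=> G [mG hG].
have [U1 [oU1 dU1 hU1]] : exists U : set Cd, [/\ open U, dense U &
    forall s, U s -> P s != 0 /\ F s = Q s / P s].
  apply: (meromorphic_identity mF hP hQ); first exact: shift_poly_neq0.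
  by exists b, e => // s /hb; exact: FQ.
have [U2 [oU2 dU2 hU2]] : exists U : set Cd, [/\ open U, dense U &
    forall s, U s -> P' s != 0 /\ G s = Q' s / P' s].
  apply: (meromorphic_identity mG hP' hQ' P'0); exists b, e => // s /hb hs.
  by rewrite hG ?GQ//; apply/(series_domainE _ hK).
pose U1' := [set s | U1 (- s)].
have oU1' : open U1'.
  by have /continuousP := continuous_oppv; apply.
have dU1' : dense U1'.
  move=> O [t Ot] oO; have [s [Os Us]] : [set s | O (- s)] `&` U1 !=set0.
    apply: dU1; first by exists (- t); rewrite /= opprK.
    by have /continuousP := continuous_oppv; apply.
  by exists (- s); split => //; rewrite /U1' /= opprK.
exists (U1' `&` U2); split; [exact: openI|exact: dense_openI|].
move=> s [/hU1[_ ->] /hU2[_ ->]].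
by rewrite /Q' !mulrA -exprD addnn -mul2n exprM sqrrN expr1n expr1n mul1r.
Qed.

End RationalCone.

(** * Facets and rational subspaces *)

Lemma dotp_sumr (S : comPzRingType) n (I : Type) (r : seq I) (P : pred I)
    (F : I -> 'rV[S]_n) x :
  dotp x (\sum_(i <- r | P i) F i) = \sum_(i <- r | P i) dotp x (F i).
Proof. by rewrite dotpC dotp_suml; apply: eq_bigr => i _; rewrite dotpC. Qed.

Section Facets.
Context {R : realType} {d : nat}.
Implicit Types (x y u v z : 'rV[R]_d) (K : set 'rV[R]_d).

(** A minimal subsystem of the defining inequalities is kept. Its members are genuine facets: each
    is tight at a point where all the others are strict. *)
Lemma cone_facets K : pointed_cone K 0 -> has_dim K d ->
  exists (T : finType) (a : T -> 'rV[R]_d),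
    [/\ forall i, a i != 0, pointed a, K = [set x | gcone a [set: T]%SET x] &
        forall i, exists2 q, dotp (a i) q = 0 &
          forall l, l != i -> dotp (a l) q < 0].
Proof.
move=> [n [a [b [a0 KE HE]]]] [[x0 [M [Kx0 KM Mfree]]] _].
have b0 i : b i = 0.
  have : (\bigcap_i bounding_hyperplane (a i) (b i)) 0 by rewrite HE.
  by move=> /(_ i I); rewrite /bounding_hyperplane /= dotp0r.
have KP x : K x <-> forall i, dotp (a i) x <= 0.
  rewrite KE; split=> [h i|h i _]; first by have := h i I; rewrite /half_space /= b0.
  by rewrite /half_space /= b0.
have apex x : (forall i, dotp (a i) x = 0) -> x = 0.
  move=> h; suff : (\bigcap_i bounding_hyperplane (a i) (b i)) x by rewrite HE.
  by move=> i _; rewrite /bounding_hyperplane /= h b0.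
pose repr (S : {set 'I_n}) := `[< forall x, (forall i, i \in S -> dotp (a i) x <= 0) -> K x >].
have repT : repr [set: 'I_n]%SET.
  by apply/asboolP => x h; apply/KP => i; apply: h; rewrite finset.in_setT.
pose S := [arg min_(S < [set: 'I_n]%SET | repr S) #|S|].
have [/asboolP SK Smin] : repr S /\ forall S', repr S' -> (#|S| <= #|S'|)%N.
  by rewrite /S; case: arg_minnP.
(* A point with all inequalities strict: if one were tight, its normal would vanish on [x0] and on
   the rows of the invertible matrix [M]. *)
pose p0 := x0 + \sum_i (x0 + row i M).
have p0lt i : dotp (a i) p0 < 0.
  have le0 j : dotp (a i) (x0 + row j M) <= 0 by have /KP := KM j; exact.
  have lex : dotp (a i) x0 <= 0 by have /KP := Kx0; exact.
  rewrite /p0 dotpDr dotp_sumr; have sle : \sum_j dotp (a i) (x0 + row j M) <= 0.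
    by apply: sumr_le0 => j _.
  rewrite lt_neqAle -[X in _ <= X]addr0 lerD// andbT.
  apply: contra (a0 i) => /eqP E.
  have ex0 : dotp (a i) x0 = 0 by lra.
  have es : \sum_j - dotp (a i) (x0 + row j M) = 0 by rewrite sumrN; lra.
  have er j : dotp (a i) (row j M) = 0.
    move/eqP: es; rewrite psumr_eq0 => [/allP/(_ j)|k _]; last by rewrite oppr_ge0.
    by rewrite mem_index_enum => /(_ isT)/=; rewrite oppr_eq0 dotpDr ex0 add0r => /eqP.
  have : M *m (a i)^T = 0.
    apply/matrixP => j k; rewrite !mxE -[RHS](er j).
    by apply: eq_bigr => l _; rewrite !mxE mulrC ord1.
  have Mu : M \in unitmx by rewrite -row_free_unit.
  move=> /(congr1 (mulmx (invmx M))); rewrite mulKmx// mulmx0 => /(congr1 trmx).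
  by rewrite trmxK trmx0 => ->.
exists {i | i \in S}, (fun i => a (val i)); split.
- by move=> i; exact: a0.
- move=> x h; apply: apex => i; apply/eqP; rewrite eq_le.
  have hS j : j \in S -> dotp (a j) x = 0 by move=> jS; exact: (h (Sub j jS)).
  have /KP/(_ i) -> /= : K x by apply: SK => j /hS ->.
  by rewrite -oppr_le0 -dotpNr; have /KP : K (- x) by apply: SK => j /hS; rewrite dotpNr => ->; rewrite oppr0.
- apply/seteqP; split=> x /=.
    by move=> /KP h; apply/forall_inP => i _; exact: h.
  by move=> /forall_inP h; apply: SK => i iS; apply: (h (Sub i iS)); rewrite finset.in_setT.
move=> [i iS] /=.
(* By minimality, dropping the inequality [i] admits a point that violates it alone. *)
have [z hz zi] : exists2 z, (forall l, l \in S -> l != i -> dotp (a l) z <= 0) & 0 < dotp (a i) z.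
  apply: contrapT => nz; have : repr (S :\ i).
    apply/asboolP => x h; apply: SK => l lS; have [->|li] := eqVneq l i.
      rewrite leNgt; apply/negP => xi; apply: nz; exists x => // k kS ki.
      by apply: h; rewrite !inE ki.
    by apply: h; rewrite !inE li.
  by move=> /Smin; rewrite (cardsD1 i S) iS ltnn.
(* A positive combination of [p0] and [z] on the hyperplane of [a i], between its two sides. *)
exists (dotp (a i) z *: p0 - dotp (a i) p0 *: z).
  by rewrite dotpBr !dotpZr mulrC subrr.
move=> [l lS] /= li; rewrite dotpBr !dotpZr.
have h1 : dotp (a i) z * dotp (a l) p0 < 0 by rewrite pmulr_rlt0.
have h2 : 0 <= dotp (a i) p0 * dotp (a l) z.
  by rewrite nmulr_rge0// hz//; apply: contraNneq li => E; apply/eqP/val_inj.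
lra.
Qed.

Local Notation L := 'rV[int]_d.

(** A largest rational subspace inside the hyperplane contains all its rational points; the columns
    of its cokernel matrix, with denominators cleared, are the integer equations. *)
Lemma lattice_equations (a : 'rV[R]_d) : exists e : 'I_d -> L,
  forall m : L, dotp a (intv m) = 0 <-> forall k, dotp (e k) m = 0.
Proof.
pose good (B : 'M[rat]_d) := forall q : 'rV[rat]_d, (q <= B)%MS -> dotp a (map_mx ratr q) = 0.
pose P n := `[< exists2 B, good B & \rank B = n >].
have P0 : exists n, P n.
  exists 0%N; apply/asboolP; exists 0; last exact: mxrank0.
  by move=> q /submx0null ->; rewrite map_mx0 dotp0r.
have Ple n : P n -> (n <= d)%N by move=> /asboolP[B _ <-]; exact: rank_leq_row.
have [n /asboolP[B gB Bn] nmax] := ex_maxnP P0 Ple.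
have BP q : dotp a (map_mx ratr q) = 0 -> (q <= B)%MS.
  move=> q0; have gBq : good (B + q)%MS.
    move=> q' /sub_addsmxP[[D D'] /= ->]; rewrite map_mxD dotpDr gB ?submxMl// add0r.
    rewrite [D']mx11_scalar mul_scalar_mx map_mxZ dotpZr q0 mulr0//.
  have le : (\rank (B + q)%MS <= \rank B)%N.
    by rewrite Bn; apply: nmax; apply/asboolP; exists (B + q)%MS.
  have : (B + q <= B)%MS.
    have [_ E] := mxrank_leqif_sup (addsmxSl B q).
    by rewrite -E eqn_leq le andbT mxrankS// addsmxSl.
  by apply: submx_trans; exact: addsmxSr.
have /choice[D /all_and2[D0 /choice[u hu]]] (k : 'I_d) := int_scale (fun j => cokermx B j k).
exists (fun k => \row_j u k j) => m.
have -> : dotp a (intv m) = 0 <-> (map_mx intr m : 'rV[rat]_d) *m cokermx B = 0.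
  have E : intv m = map_mx ratr (map_mx intr m : 'rV[rat]_d) :> 'rV[R]_d.
    by apply/rowP => k; rewrite !mxE ratr_int.
  rewrite E; split=> [/BP|h]; first by rewrite submxE => /eqP.
  by apply: gB; rewrite submxE; apply/eqP.
have key k : (dotp (\row_j u k j) m)%:~R = (D k)%:~R * ((map_mx intr m : 'rV[rat]_d) *m cokermx B) 0 k.
  rewrite [X in _ * X]mxE mulr_sumr rmorph_sum; apply: eq_bigr => j _.
  by rewrite [map_mx _ _ _ _]mxE rmorphM /= mxE hu; ring.
split=> [h k|h]; first by apply/eqP; rewrite -(intr_eq0 rat) key h mxE mulr0.
apply/rowP => k; rewrite [RHS]mxE; have := key k; rewrite h => /esym/eqP.
by rewrite mulf_eq0 intr_eq0 (negPf (D0 k)) => /eqP.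
Qed.

(** Dirichlet's pigeonhole: among [Q ^ d + 1] multiples of [u] two have fractional parts in the same
    box of side [1 / Q], and their difference is nearly integral. *)
Lemma dirichlet u (e : R) : 0 < e -> exists (r : L) (t : nat),
  (0 < t)%N /\ norm1 (intv r - t%:R *: u) < e.
Proof.
move=> e0; pose Q := (Num.truncn (d%:R / e)).+1.
have Qe : d%:R / Q%:R < e.
  by rewrite ltr_pdivrMr ?ltr0n// mulrC -ltr_pdivrMr// truncnS_gt.
pose fr (j : nat) k : R := j%:R * u 0 k - (Num.floor (j%:R * u 0 k))%:~R.
have fr01 j k : 0 <= fr j k < 1.
  rewrite /fr subr_ge0 ltrBlDr addrC floor_le.
  by have := floorD1_gt (j%:R * u 0 k); rewrite intrD.
pose box (j : 'I_(Q ^ d).+1) : {ffun 'I_d -> 'I_Q} :=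
  [ffun k => inord (Num.truncn (Q%:R * fr j k))].
have [j1 [j2 [j12 bE]]] : exists j1 j2 : 'I_(Q ^ d).+1, (j1 < j2)%N /\ box j1 = box j2.
  have /injectivePn[j1 [j2 n12 E]] : ~~ injectiveb box.
    apply/injectiveP => /leq_card; by rewrite card_ffun !card_ord ltnn.
  have [lt|lt|E'] := ltngtP j1 j2; [by exists j1, j2|by exists j2, j1|].
  by case/eqP: n12; apply: val_inj.
have close k : `|fr j2 k - fr j1 k| < Q%:R^-1.
  have Q0 : 0 < Q%:R :> R by rewrite ltr0n.
  have tr j : (Num.truncn (Q%:R * fr j k) < Q)%N /\
      (Num.truncn (Q%:R * fr j k))%:R <= Q%:R * fr j k < (Num.truncn (Q%:R * fr j k)).+1%:R.
    have /andP[f0 f1] := fr01 j k; have q0 : 0 <= Q%:R * fr j k by rewrite mulr_ge0// ltW.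
    split; last exact: truncn_itv.
    by rewrite truncn_lt_nat// gtr_pMr.
  have [t1 /andP[h1 h1']] := tr j1; have [t2 /andP[h2 h2']] := tr j2.
  move/ffunP: bE => /(_ k); rewrite !ffunE => /(congr1 val); rewrite /= !inordK// => E.
  rewrite -(ltr_pM2l Q0) mulfV ?gt_eqF// -[X in X * `|_|]gtr0_norm// -normrM mulrBr.
  move: h1 h1' h2 h2'; rewrite E -!natr1 ltr_norml => *; apply/andP; split; lra.
exists (\row_k (Num.floor (j2%:R * u 0 k) - Num.floor (j1%:R * u 0 k))), (j2 - j1)%N.
split; first by rewrite subn_gt0.
apply: le_lt_trans Qe.
have -> : d%:R / Q%:R = \sum_(k < d) Q%:R^-1 :> R by rewrite sumr_const card_ord mulr_natl.
apply: ler_sum => k _; apply: ltW; apply: le_lt_trans (close k).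
rewrite -normrN !mxE /fr intrB natrB ?(ltnW j12)//.
by rewrite le_eqVlt; apply/orP; left; apply/eqP; congr `|_|; ring.
Qed.

Section IrrationalNormal.
Context {T : finType} (a : T -> 'rV[R]_d) (apex : pointed a).
Local Notation full := [set: T]%SET.

(* An irrational facet contains a ray of the cone that is not contained in the
   rational span of the lattice points of the facet hyperplane. *)
Lemma irrational_ray i q (e : 'I_d -> L) : a i != 0 ->
  dotp (a i) q = 0 -> (forall l, l != i -> dotp (a l) q < 0) ->
  (forall m, dotp (a i) (intv m) = 0 <-> forall k, dotp (e k) m = 0) ->
  ~ (exists (k : R) (b : L), k != 0 /\ a i = k *: intv b) ->
  exists u k, [/\ gcone a full u, dotp (a i) u = 0,
    dotp (intv (e k)) u != 0 &
    forall z, (forall l, dotp (a l) u = 0 -> dotp (a l) z = 0) ->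
      dotp (intv (e k)) z = 0 -> z = 0].
Proof.
move=> ai0 aq al he irr.
have [k ek] : exists k, e k != 0.
  apply: contrapT => /forallNP n; move/eqP: ai0; apply; apply/rowP => k.
  have /he : forall k', dotp (e k') (delta_mx 0 k) = 0.
    by move=> k'; have /negP := n k'; rewrite negbK => /eqP ->; rewrite dotp0l.
  by rewrite (_ : intv _ = delta_mx 0 k) ?dotp_delta ?mxE// /intv map_delta_mx.
pose w : 'rV[R]_d := intv (e k).
have w0 : w != 0.
  apply: contraNneq ek => /rowP E; apply/eqP/rowP => j.
  by have := E j; rewrite !mxE => /eqP; rewrite intr_eq0 => /eqP.
have sq (x : 'rV[R]_d) : dotp x x = 0 -> x = 0.
  move=> /eqP; rewrite psumr_eq0 => [/allP h|j _]; last by rewrite -expr2 sqr_ge0.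
  by apply/rowP => j; have := h j; rewrite mem_index_enum mulf_eq0 orbb mxE => /(_ isT)/eqP.
(* The component of [w] orthogonal to [a i] works; were it zero, [a i] would be proportional to an
   integer vector. *)
have [z0 az0 wz0] : exists2 z, dotp (a i) z = 0 & dotp w z != 0.
  have aa : dotp (a i) (a i) != 0 by apply: contraNneq ai0 => /sq ->.
  pose c := dotp (a i) w / dotp (a i) (a i); pose z := w - c *: a i.
  have az : dotp (a i) z = 0 by rewrite dotpBr dotpZr divfK// subrr.
  exists z => //; apply/eqP => wz; apply: irr.
  have zz : z = 0 by apply: sq; rewrite {1}/z dotpDl dotpNl dotpZl az mulr0 subr0.
  have wE : w = c *: a i by apply/eqP; rewrite -subr_eq0 -/z zz.
  have c0 : c != 0 by apply: contraNneq w0 => c0; rewrite wE c0 scale0r.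
  by exists c^-1, (e k); rewrite invr_eq0 c0 -/w wE scalerA mulVf// scale1r.
(* If [w] vanishes at the relative interior point [q] of the facet, a small move along [z0] stays in
   the facet and leaves the kernel of [w]. *)
have [u0 [Ku0 au0 wu0]] : exists u, [/\ gcone a full u, dotp (a i) u = 0 & dotp w u != 0].
  have [wq|wq] := eqVneq (dotp w q) 0; last first.
    exists q; split=> //; apply/forall_inP => l _; have [->|/al/ltW//] := eqVneq l i.
    by rewrite aq.
  have [t t0 ht] : exists2 t : R, 0 < t & forall l, l != i ->
      t < - dotp (a l) q / (`|dotp (a l) z0| + 1).
    apply: (@small_pos R T (fun l => l != i)
      (fun l => - dotp (a l) q / (`|dotp (a l) z0| + 1))) => l /al h.
    by rewrite divr_gt0 ?oppr_gt0// ltr_wpDl.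
  exists (q + t *: z0); split.
  - apply/forall_inP => l _; rewrite dotpDr dotpZr; have [->|li] := eqVneq l i.
      by rewrite aq az0 mulr0 addr0.
    have := ht l li; rewrite ltr_pdivlMr ?ltr_wpDl// mulrDr mulr1 => h.
    have : t * dotp (a l) z0 <= t * `|dotp (a l) z0| by rewrite ler_pM2l// ler_norm.
    lra.
  - by rewrite dotpDr dotpZr aq az0 mulr0 addr0.
  - by rewrite dotpDr dotpZr wq add0r mulf_neq0// gt_eqF.
(* Among the points of the facet outside the kernel of [w], one with the largest number of active
   facets spans a ray. *)
pose P n := `[< exists u, [/\ gcone a full u, dotp (a i) u = 0, dotp w u != 0 &
  #|act a full u| = n] >].
have P0 : exists n, P n by exists #|act a full u0|; apply/asboolP; exists u0.
have Ple n : P n -> (n <= #|T|)%N by move=> /asboolP[u [_ _ _ <-]]; exact: max_card.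
have [n /asboolP[u [Ku au wu un]] nmax] := ex_maxnP P0 Ple.
exists u, k; split=> // z az wz; apply: contrapT => /eqP z0'.
have [z' [az' wz' [l0 l0z]]] : exists z, [/\ forall l, dotp (a l) u = 0 -> dotp (a l) z = 0,
    dotp w z = 0 & exists l, 0 < dotp (a l) z].
  have [l lz] : exists l, dotp (a l) z != 0.
    apply: contrapT => /forallNP h; move/eqP: z0'; apply; apply: apex => l.
    by have /negP := h l; rewrite negbK => /eqP.
  have [lz'|lz'] := ltP 0 (dotp (a l) z); first by exists z; split=> //; exists l.
  exists (- z); split; last by exists l; rewrite dotpNr oppr_gt0 lt_neqAle lz.
    by move=> j /az h; rewrite dotpNr h oppr0.
  by rewrite dotpNr wz oppr0.
(* Ratio test: moving along [z'] stays in the cone until the facet with the smallest ratio becomes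
   active. Since [w] vanishes on [z'], its value is preserved, contradicting maximality. *)
pose rat l := - dotp (a l) u / dotp (a l) z'.
have [l1 l1z l1min] : exists2 l1, 0 < dotp (a l1) z' &
    forall l, 0 < dotp (a l) z' -> rat l1 <= rat l.
  exists [arg min_(l < l0 | 0 < dotp (a l) z') rat l]%O; case: arg_minP => //.
have Kul l : dotp (a l) u <= 0 by move/forall_inP: Ku; apply; rewrite finset.in_setT.
pose t := rat l1.
have t0 : 0 <= t by rewrite divr_ge0 ?oppr_ge0// ltW.
have : P #|act a full (u + t *: z')|.
  apply/asboolP; exists (u + t *: z'); split=> //.
  - apply/forall_inP => l _; rewrite dotpDr dotpZr.
    have [lz|lz] := ltP 0 (dotp (a l) z').
      by have := l1min l lz; rewrite -/t /rat ler_pdivlMr//; lra.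
    by rewrite -[X in _ <= X]addr0 lerD// mulr_ge0_le0.
  - by rewrite dotpDr dotpZr au (az' i au) mulr0 addr0.
  - by rewrite dotpDr dotpZr wz' mulr0 addr0.
move=> /nmax; rewrite -un leqNgt => /negP; apply; apply: proper_card.
apply/fintype.properP; split.
  apply/fintype.subsetP => l; rewrite !inE => /eqP lu.
  by rewrite dotpDr dotpZr lu (az' l lu) mulr0 addr0 eqxx.
exists l1; rewrite !inE.
  by rewrite dotpDr dotpZr /t /rat (divfK (lt0r_neq0 l1z)) subrr eqxx.
by apply/eqP => /az' E; rewrite E ltxx in l1z.
Qed.

End IrrationalNormal.

End Facets.

(** * Restriction of the series to rational lines *)

Section LevelSums.
Context {R : realType} {d : nat}.
Local Notation C := (Cplx R).
Local Notation Cd := 'rV[Cplx R]_d.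
Local Notation M := 'rV[int]_d.
Implicit Types (m u : M) (s : Cd).

(** For [k != 0] the integral does not depend on the height, and it tends to 0 as the height goes to
    infinity with the sign of [k]. *)
Lemma cint_e2pi (k : int) (y : R) :
  cint (fun x => e2pi (k%:~R * (x +i* y)%C)) 0 1 = (k == 0)%:R.
Proof.
have kE : (k%:~R : C) = (k%:~R : R)%:C%C by rewrite rmorph_int.
have [->|k0] := eqVneq k 0.
  transitivity (cint (fun=> 1 : C) 0 1); last by rewrite cint_cst// subr0 mulr1.
  by apply: eq_cint => x _; rewrite mul0r e2pi0.
pose I (y : R) := cint (fun x : R => e2pi (k%:~R * (x +i* y)%C)) 0 1.
have dk (z : C) : cdiff (fun z => e2pi (k%:~R * z)) z.
  apply: (@cdiff_comp _ (fun z => k%:~R * z)); last exact: cdiff_e2pi.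
  by apply: cdiffM; [exact: cdiff_cst|exact: cdiff_id].
have le y1 y2 : y1 <= y2 -> I y1 = I y2.
  move=> y12; apply: (@cint_periodic _ (fun z => e2pi (k%:~R * z))) => // t _.
  have -> : (1 +i* t)%C = (0 +i* t)%C + 1 :> C.
    by apply/eqP; rewrite eq_complex /= !addr0 add0r !eqxx.
  by rewrite mulrDr mulr1 e2piD e2pi_int mulr1.
have Ieq y1 y2 : I y1 = I y2 by have [h|/ltW h] := leP y1 y2; [exact: le|exact/esym/le].
have bd t : normc (I t) <= 2 * expR (- (2 * pi * (k%:~R * t))).
  rewrite -[X in _ <= X]mulr1 -[X in _ * X](subr0 (1 : R)).
  apply: normc_cint => // [x _|x _]; first by apply: (@ccont_hor _ (fun z : C => e2pi (k%:~R * z))); exact: (cdiff_cont (dk _)).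
  by rewrite normc_e2pi kE /= mul0r addr0.
apply: normc_eq => e e0; rewrite subr0 -/(I y).
pose t := 2 / e; have t0 : 0 < t by rewrite divr_gt0.
have kk : 1 <= `|k%:~R : R| by rewrite -intr_norm ler1z -gtz0_ge1 normr_gt0.
rewrite (Ieq y (Num.sg k%:~R * t)); apply: (le_trans (bd _)).
have -> : k%:~R * (Num.sg k%:~R * t) = `|k%:~R| * t by rewrite mulrA [_ * Num.sg _]mulrC -normrEsg.
apply: (@le_trans _ _ (2 * expR (- t))).
  rewrite ler_pM2l// ler_expR lerN2 mulrA -[X in X <= _]mul1r ler_pM2r//.
  by apply: mulr_ege1 => //; have := @pi_ge2 R; lra.
rewrite expRN ler_pdivrMr ?expR_gt0//.
apply: (@le_trans _ _ (e * (1 + t))); last by rewrite ler_pM2l// expR_ge1Dx.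
by rewrite mulrDr mulr1 /t mulrC divfK ?gt_eqF// lerDr ltW.
Qed.

Lemma e2piMn n (z : C) : e2pi (n%:R * z) = e2pi z ^+ n.
Proof.
elim: n => [|n IH]; first by rewrite mul0r e2pi0.
by rewrite -natr1 mulrDl mul1r e2piD IH exprSr.
Qed.

Lemma has_sum_sum (I : eqType) (J : Type) (r : seq J) (b : J -> I -> C) (S : J -> C) :
  (forall j, has_sum (b j) (S j)) ->
  has_sum (fun i => \sum_(j <- r) b j i) (\sum_(j <- r) S j).
Proof.
move=> h; elim: r => [|j r IH].
  have := @has_sum_fin R I (fun=> 0) [::] isT (fun _ _ => erefl).
  rewrite !big_nil; apply: eq_has_sum => i; by rewrite big_nil.
rewrite big_cons; apply: eq_has_sum (has_sumD (h j) IH) => i.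
by rewrite big_cons.
Qed.

Lemma chr_line s eta (z : C) m :
  chr (s + z *: map_mx intr eta) m = chr s m * e2pi ((dotp eta m)%:~R * z).
Proof. by rewrite /chr dotpDl dotpZl dotp_map e2piD [z * _]mulrC. Qed.

Lemma normc_chr_line s eta (x y : R) m :
  normc (chr (s + (x +i* y)%C *: map_mx intr eta) m) =
  normc (chr (s + (0 +i* y)%C *: map_mx intr eta) m).
Proof.
rewrite !chr_line [LHS]normcM [RHS]normcM; congr (_ * _); rewrite !normc_e2pi.
have -> : ((dotp eta m)%:~R : C) = ((dotp eta m)%:~R : R)%:C%C by rewrite rmorph_int.
by rewrite /= !mul0r !addr0.
Qed.

Variables (f : M -> R) (F : Cd -> C) (s0 : Cd) (eta : M) (A : int -> C).
Local Notation pt z := (s0 + z *: map_mx intr eta).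
Hypothesis dom : forall t : R, 0 < t -> exists2 be, bounded_sums be &
  forall m, normc ((f m)%:C%C * chr (pt (0 +i* t)%C) m) <= be m.
Hypothesis hF : forall z : C, 0 < complex.Im z ->
  has_sum (fun m => (f m)%:C%C * chr (pt z) m) (F (pt z)).
Hypothesis lq : forall t : R, 0 <= t <= 1 -> local_quotient (fun z => F (pt z)) t.
Hypothesis hA : forall k, has_sum
  (fun m => if dotp eta m == k then (f m)%:C%C * chr s0 m else 0) (A k).

(** On the line, [F] is the Fourier series whose coefficient of index [k] is the level sum [A k].
    The left-hand side is then the [n]-th Fourier coefficient of [q.[e2pi z] * F], to which
    [fourier_decay] applies. *)
Lemma level_decay : exists2 q : {poly C}, q.[0] != 0 &
  forall e : R, 0 < e -> exists N : nat, forall n, (N <= n)%N ->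
    normc (\sum_(j < size q) q`_j * A (n%:Z - j%:Z)) <= e.
Proof.
have chr_per (z : C) m : chr (pt (z + 1)) m = chr (pt z) m.
  by rewrite !chr_line mulrDr mulr1 e2piD e2pi_int mulr1.
have per (z : C) : 0 < complex.Im z -> F (pt (z + 1)) = F (pt z).
  move=> Imz; apply: has_sum_unique (hF Imz).
  have /hF : 0 < complex.Im (z + 1) by case: (z) Imz => ? ?; rewrite /= addr0.
  by apply: eq_has_sum => m; rewrite chr_per.
have [q [q0 [dl dl0 hq]]] := fourier_decay per lq.
exists q => // e /hq[N hN]; exists N => n /hN.
congr (normc _ <= _).
have [be bbe hbe] := dom dl0.
pose tau x : C := (x +i* dl)%C.
pose k j m : int := dotp eta m + j%:Z - n%:Z.
(* The term of [m] in the integrand at height [dl], written at the base point [s0]: integration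
   leaves only those [j] with [dotp eta m = n - j]. *)
pose b m x : C := (f m)%:C%C * chr s0 m *
  \sum_(j < size q) q`_j * e2pi ((k j m)%:~R * tau x).
pose E x : C := q.[e2pi (tau x)] * F (pt (tau x)) * e2pi (- n%:R * tau x).
have bE m x : b m x = q.[e2pi (tau x)] * e2pi (- n%:R * tau x) *
    ((f m)%:C%C * chr (pt (tau x)) m).
  rewrite chr_line horner_coef /b.
  have -> : \sum_(j < size q) q`_j * e2pi ((k j m)%:~R * tau x) =
      (\sum_(j < size q) q`_j * e2pi (tau x) ^+ j) *
      (e2pi (- n%:R * tau x) * e2pi ((dotp eta m)%:~R * tau x)).
    rewrite mulr_suml; apply: eq_bigr => j _; rewrite -mulrA -e2piMn -!e2piD.
    congr (_ * e2pi _); rewrite /k rmorphB rmorphD /= -!pmulrn.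
    by move: (_%:~R) (tau x) => ? ?; ring.
  set S := \sum_(j < size q) _; set e1 := e2pi _; set e2 := e2pi _.
  by rewrite [S * (e1 * e2)]mulrA [S * e1 * e2]mulrC [RHS]mulrC !mulrA.
have Eb x : has_sum (b^~ x) (E x).
  rewrite /E mulrAC; apply: eq_has_sum (has_sumZ _ (@hF (tau x) dl0)) => m.
  by rewrite bE.
pose K : R := (\sum_(j < size q) normc q`_j * rad dl ^+ j) * expR (2 * pi * (n%:R * dl)).
have K0 : 0 <= K.
  rewrite mulr_ge0 ?expR_ge0// sumr_ge0// => j _.
  by rewrite mulr_ge0 ?normc_ge0// exprn_ge0// ltW// rad_gt0.
have bK m x : normc (b m x) <= K * be m.
  rewrite bE [X in X <= _]normcM; apply: ler_pM; [exact: normc_ge0|exact: normc_ge0| |].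
    rewrite [X in X <= _]normcM; apply: ler_pM; [exact: normc_ge0|exact: normc_ge0| |].
      rewrite horner_coef; apply: (le_trans (ler_normc_sum _ _ _)).
      apply: ler_sum => j _; rewrite [X in X <= _]normcM normcX normc_e2pi_rad.
      exact: lexx.
    rewrite normc_e2pi ler_expR.
    have -> : (- n%:R : C) = (- n%:R : R)%:C%C by rewrite rmorphN rmorph_nat.
    by rewrite /= mul0r addr0; lra.
  apply: le_trans (hbe m); rewrite [X in X <= _]normcM [X in _ <= X]normcM.
  apply: ler_wpM2l; first exact: normc_ge0.
  have E0 : normc (chr (pt (tau x)) m) = normc (chr (pt (0 +i* dl)%C) m).
    exact: normc_chr_line.
  by rewrite le_eqVlt; apply/orP; left; apply/eqP; exact: E0.
have ce (i : int) x : cont_at (fun x => e2pi (i%:~R * tau x)) x.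
  apply: (@ccont_hor _ (fun z : C => e2pi (i%:~R * z))); apply: cdiff_cont.
  apply: (@cdiff_comp _ (fun z => i%:~R * z)); last exact: cdiff_e2pi.
  by apply: cdiffM; [exact: cdiff_cst|exact: cdiff_id].
have cb m x : cont_at (b m) x.
  by apply: cont_atZ; apply: cont_at_sum => j; exact: cont_atZ.
have h1 := cint_has_sum (bounded_sumsZ K0 bbe) bK Eb cb.
apply: has_sum_unique h1 _.
have h2 := has_sum_sum (index_enum 'I_(size q))
  (fun j : 'I_(size q) => has_sumZ q`_j (hA (n%:Z - j%:Z))).
apply: eq_has_sum h2 => m; rewrite /b cintZ; last first.
  by move=> x _; apply: cont_at_sum => j; apply: cont_atZ.
rewrite cint_sum//; last by move=> j x _; exact: cont_atZ.
rewrite mulr_sumr; apply: eq_bigr => j _; rewrite cintZ; last by move=> x _; exact: ce.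
rewrite cint_e2pi /k subr_eq0 -[in RHS](subr_eq0 _ n%:Z).
have -> : (dotp eta m == n%:Z - j%:Z) = (dotp eta m + j%:Z - n%:Z == 0) by lia.
by case: eqP => _; rewrite ?mulr1 ?mulr0// mulrC.
Qed.

Lemma holo_near (G : Cd -> C) s : holo G s -> forall e : R, 0 < e ->
  exists2 dl : R, 0 < dl & forall t, polydisc s dl t -> normc (G t - G s) < e.
Proof.
case=> /differentiable_continuous cG e e0; apply/nbhs_polydiscP.
by apply: (cG [set z | normc (z - G s) < e]); apply/near_normcP; exists e.
Qed.

End LevelSums.

(** * Uniqueness of Fourier coefficients *)

Section FourierUniqueness.
Context {R : realType} {d : nat}.
Local Notation C := (Cplx R).
Local Notation M := 'rV[int]_d.
Implicit Types (m u : M) (x : 'rV[R]_d).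

Lemma normc_chr_real x m : normc (chr (Cvec x) m) = 1.
Proof.
rewrite normc_chr (_ : map_mx _ _ = 0) ?dotp0l ?mulr0 ?oppr0 ?expR0//.
by apply/rowP => k; rewrite !mxE.
Qed.

Lemma normcM_chr_real (z : C) x m : normc (z * chr (Cvec x) m) = normc z.
Proof. by rewrite [LHS]normcM normc_chr_real mulr1. Qed.

Lemma CvecD x y : Cvec (x + y) = Cvec x + Cvec y :> 'rV[C]_d.
Proof. exact: map_mxD. Qed.

Lemma chrDl (s t : 'rV[C]_d) m : chr (s + t) m = chr s m * chr t m.
Proof. by rewrite /chr dotpDl e2piD. Qed.

Lemma e2pi_half : e2pi (2^-1 : C) = -1.
Proof.
rewrite /e2pi (_ : _ * _ = (0 +i* pi)%C).
  by rewrite /cexp /= expR0 cospi sinpi mul1r; apply/eqP; rewrite eq_complex /= oppr0 !eqxx.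
rewrite -[X in X / 2]mulrA mulrAC mulfV ?pnatr_eq0// mul1r; apply/eqP.
by rewrite eq_complex /= !mul0r !mulr0 !mulr1 ?subr0 ?addr0 ?add0r !eqxx.
Qed.

Lemma separating_character m : m != 0 -> exists x, chr (Cvec x) m = -1.
Proof.
move=> m0; have [k mk] : exists k, m 0 k != 0.
  apply/existsP; apply: contraNT m0; rewrite negb_exists => /forallP h.
  by apply/eqP/rowP => k; rewrite mxE; apply/eqP; rewrite -[_ == _]negbK h.
exists ((2 * (m 0 k)%:~R)^-1 *: delta_mx 0 k).
rewrite -e2pi_half /chr; congr e2pi.
rewrite /Cvec map_mxZ map_delta_mx dotpZl dotpC dotp_delta mxE.
have -> : ((m 0 k)%:~R : C) = ((m 0 k)%:~R : R)%:C%C by rewrite rmorph_int.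
have mkR : ((m 0 k)%:~R : R) != 0 by rewrite intr_eq0.
by rewrite -rmorphM invfM divfK//= fmorphV rmorph_nat.
Qed.

(* Averaging the sum with its translate by a half period of a character kills
   one coefficient and fixes another one. *)
Lemma kill_coefficients (b : M -> C) m0 (J : seq M) : m0 \notin J ->
  (forall x, has_sum (fun m => b m * chr (Cvec x) m) 0) ->
  exists b', [/\ forall m, normc (b' m) <= normc (b m),
    forall x, has_sum (fun m => b' m * chr (Cvec x) m) 0, b' m0 = b m0 &
    {in J, forall m, b' m = 0}].
Proof.
move=> + hb; elim: J => [_|m1 J IH]; first by exists b; split.
rewrite inE negb_or => /andP[m01 /IH[b' [b'le b'sum b'0 b'J]]].
have [x1 hx1] : exists x, chr (Cvec x) (m1 - m0) = -1.
  by apply: separating_character; rewrite subr_eq0 eq_sym.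
exists (fun m => 2^-1 * ((1 + chr (Cvec x1) (m - m0)) * b' m)); split.
- move=> m; rewrite !normcM; apply: le_trans (b'le m).
  have -> : normc (2^-1 : C) = 2^-1.
    have -> : (2^-1 : C) = (2^-1 : R)%:C%C by rewrite fmorphV rmorph_nat.
    by rewrite normc_real gtr0_norm// invr_gt0.
  rewrite mulrA ler_piMl ?normc_ge0// mulrC ler_pdivrMr// mul1r.
  by apply: (le_trans (le_normcD _ _)); rewrite normc1 normc_chr_real.
- move=> x; have := has_sumZ (2^-1) (has_sumD (b'sum x)
    (has_sumZ (chr (Cvec x1) (- m0)) (b'sum (x + x1)))).
  rewrite mulr0 addr0 mulr0; apply: eq_has_sum => m.
  rewrite CvecD chrDl (chrD (Cvec x1)).
  move: (b' m) (chr (Cvec x) m) (chr (Cvec x1) m) (chr (Cvec x1) (- m0)) => B X y z.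
  rewrite -[RHS]mulrA !mulrDl mul1r; congr (_ * (_ + _)).
  by rewrite [y * z]mulrC -!mulrA; congr (_ * _); rewrite [RHS]mulrC -mulrA.
- by rewrite subrr chr0 b'0 mulrA mulVf ?mul1r// (_ : 1 + 1 = 2%:R)// pnatr_eq0.
- move=> m; rewrite inE => /predU1P[->|/b'J ->]; last by rewrite !mulr0.
  by rewrite hx1 subrr mul0r mulr0.
Qed.

(** Dominated convergence extends the vanishing from a dense set of [x] to all [x]. Killing the
    finitely many large coefficients other than that of [m0] leaves [b m0] bounded by an arbitrarily
    small tail. *)
Lemma fourier_unique (b : M -> C) (be : M -> R) : bounded_sums be ->
  (forall m, normc (b m) <= be m) ->
  (forall x (e : R), 0 < e -> exists2 y, rball x e y &
    has_sum (fun m => b m * chr (Cvec y) m) 0) ->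
  forall m, b m = 0.
Proof.
move=> bbe hbe hb m0.
have bx x m : normc (b m * chr (Cvec x) m) <= be m.
  by rewrite normcM_chr_real.
have hb' x : has_sum (fun m => b m * chr (Cvec x) m) 0.
  have [S hS] := dominated_has_sum bbe (bx x).
  suff -> : 0 = S by [].
  have e0 (n : nat) : 0 < n.+1%:R^-1 :> R by rewrite invr_gt0 ltr0n.
  have /choice[y hy] (n : nat) : exists y, rball x n.+1%:R^-1 y /\
      has_sum (fun m => b m * chr (Cvec y) m) 0.
    by have [y h1 h2] := hb x _ (e0 n); exists y.
  apply: normc_eq => e e_gt0.
  have := @has_sum_cvg R _ nat \oo _ (fun n m => b m * chr (Cvec (y n)) m)
    (fun m => b m * chr (Cvec x) m) be (fun=> 0) S bbe (fun n m => bx (y n) m)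
    (bx x) (fun n => (hy n).2) hS _ e e_gt0.
  case=> [m r r0|N _ /(_ N)]; last by apply; exact: leqnn.
  have n1 : 0 < normc (b m) + 1 by rewrite ltr_wpDl// normc_ge0.
  have [dl dl0 hdl] := holo_near (holo_chr m (Cvec x)) (divr_gt0 r0 n1).
  have [N hN] : exists N : nat, N.+1%:R^-1 < dl.
    by exists (Num.truncn dl^-1); rewrite invf_plt ?posrE// truncnS_gt.
  exists N => // n /= Nn; rewrite -mulrBr normcM.
  have : normc (chr (Cvec (y n)) m - chr (Cvec x) m) < r / (normc (b m) + 1).
    apply: hdl => k; have /(_ k) := (hy n).1.
    rewrite !mxE -rmorphB normc_real => h; apply: (lt_trans h).
    apply: le_lt_trans hN; rewrite lef_pV2 ?posrE ?ltr0n// ler_nat//.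
  rewrite ltr_pdivlMr// => h; rewrite mulrC; apply: (le_trans _ (ltW h)).
  by rewrite ler_wpM2l ?normc_ge0// lerDl.
apply: normc_eq => e e0; rewrite subr0.
have [J uJ tail] := bounded_sums_tail bbe e0.
have m0J : m0 \notin rem m0 J by rewrite mem_rem_uniqF.
have [b' [b'le b'sum <- b'J]] := @kill_coefficients b m0 (rem m0 J) m0J hb'.
have key (J' : seq M) : uniq J' -> {in J', forall m, m \notin [:: m0]} ->
    \sum_(m <- J') normc (b' m * chr (Cvec 0) m) <= e.
  move=> uJ' dis.
  rewrite (bigID (mem J))/= big1_seq ?add0r => [|m /andP[mJ mJ']]; last first.
    rewrite b'J ?mul0r ?normc0// mem_rem_uniq// inE mJ andbT.
    by have := dis m mJ'; rewrite inE.
  rewrite -big_filter; apply: le_trans (tail [seq m <- J' | m \notin J] _ _).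
  - apply: ler_sum => m _; rewrite normcM_chr_real.
    exact: le_trans (b'le m) (hbe m).
  - by rewrite filter_uniq.
  - by move=> m; rewrite mem_filter => /andP[].
have u0 : uniq [:: m0] by [].
by have := has_sum_le u0 key (b'sum 0); rewrite big_seq1 sub0r normcN normcM_chr_real.
Qed.

End FourierUniqueness.

(** * Lattice points near an irrational ray *)

Section Recession.
Context {R : realType} {d : nat} {T : finType} (a : T -> 'rV[R]_d).
Hypotheses (a0 : forall i, a i != 0) (apex : pointed a).
Local Notation L := 'rV[int]_d.
Local Notation full := [set: T]%SET.
Implicit Types (x y z v : 'rV[R]_d) (m r : L).

Lemma round_vector z : exists m : L, forall k, `|(intv m - z) 0 k| <= 1.
Proof.
exists (\row_k Num.floor (z 0 k)) => k; rewrite !mxE.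
have := floor_le (z 0 k); have := floorD1_gt (z 0 k); rewrite intrD.
by move=> ? ?; rewrite ler_norml; apply/andP; split; lra.
Qed.

(** A slight push of [y] by a form positive on the cone, scaled up and rounded, is integral and
    strictly positive on the cone while staying close in direction to [y]. *)
Lemma integer_dual_vector y (e : R) : 0 < e ->
  (forall x, gcone a full x -> 0 <= dotp y x) ->
  exists (eta : L) (lam kap : R), [/\ 0 < lam, 0 < kap,
    forall x, gcone a full x -> kap * norm1 x <= dotp (intv eta) x &
    forall x, lam * (dotp y x - e * norm1 x) <= dotp (intv eta) x].
Proof.
move=> e0 hy; have [k k0 hk] := cone_norm1 apex; move: (- \sum_i a i) hk => b hk.
pose e1 := e / 2 / (norm1 b + 1).
have nb : 0 < norm1 b + 1 by rewrite ltr_wpDl// norm1_ge0.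
have e10 : 0 < e1 by rewrite !divr_gt0.
have e1E : e / 2 = e1 * (norm1 b + 1) by rewrite /e1 divfK// gt_eqF.
clearbody e1.
(* Rounding costs at most [norm1 x]. The first summand lets the push [e1 *: b] absorb this on the
   cone, the second lets half of [e] absorb it everywhere. *)
pose lam : R := 2 / (e1 * k) + 2 / e.
have ek0 : 0 < e1 * k by rewrite mulr_gt0.
have i1 : 0 < 2 / (e1 * k) by rewrite divr_gt0.
have i2 : 0 < 2 / e by rewrite divr_gt0.
have l0 : 0 < lam by rewrite addr_gt0.
have l1 : 2 <= lam * (e1 * k).
  by rewrite /lam mulrDl divfK ?gt_eqF// lerDl mulr_ge0// ltW.
have l2 : 2 <= lam * e.
  by rewrite /lam mulrDl [2 / e * e]divfK ?gt_eqF// lerDr mulr_ge0// ltW.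
clearbody lam.
have [eta heta] := round_vector (lam *: (y + e1 *: b)).
have near x : `|dotp (intv eta) x - lam * (dotp y x + e1 * dotp b x)| <= norm1 x.
  have -> : dotp (intv eta) x - lam * (dotp y x + e1 * dotp b x) =
    dotp (intv eta - lam *: (y + e1 *: b)) x.
    by rewrite dotpDl dotpNl dotpZl dotpDl dotpZl.
  by rewrite -[leRHS]mul1r; exact: dotp_le.
exists eta, lam, 1; split=> // x.
  move=> hx; have := near x; rewrite ler_norml => /andP[h _].
  have h1 := hy _ hx; have h2 := hk _ hx; have n0 := norm1_ge0 x.
  have h3 : lam * (e1 * k) * norm1 x <= lam * (e1 * dotp b x).
    by rewrite -!mulrA; rewrite ler_pM2l// ler_pM2l.
  have h4 : 2 * norm1 x <= lam * (e1 * k) * norm1 x by rewrite ler_wpM2r.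
  have h5 : 0 <= lam * dotp y x by rewrite mulr_ge0// ltW.
  move: h; rewrite mulrDr; lra.
have := near x; rewrite ler_norml => /andP[h _]; have n0 := norm1_ge0 x.
have hb : `|dotp b x| <= (norm1 b + 1) * norm1 x.
  by apply: (le_trans (dotp_le1 _ _)); rewrite ler_wpM2r// lerDl.
have h1 : - (e / 2 * norm1 x) <= e1 * dotp b x.
  have : e1 * `|dotp b x| <= e / 2 * norm1 x.
    by rewrite e1E -mulrA ler_pM2l.
  have : - `|dotp b x| <= dotp b x by rewrite lerNl -normrN ler_norm.
  by rewrite -(ler_pM2l e10); lra.
have h2 : lam * (dotp y x - e / 2 * norm1 x) <= lam * (dotp y x + e1 * dotp b x).
  by rewrite ler_pM2l// lerD2l.
have h3 : norm1 x <= lam * (e / 2 * norm1 x).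
  have := ler_wpM2r n0 l2; lra.
move: h h2; rewrite !mulrBr !mulrDr; lra.
Qed.

(** Rounding a point far out along the facet and slightly displaced along [a i] gives a lattice
    point on the prescribed side of this facet, deep inside all others. *)
Lemma facet_lattice_point v i q (s : R) : dotp (a i) q = 0 ->
  (forall l, l != i -> dotp (a l) q < 0) -> `|s| = 1 ->
  exists m, s * dotp (a i) (intv m - v) < 0 /\ forall l, l != i ->
    dotp (a l) (intv m - v) < - (2 * `|dotp (a i) (intv m - v)|).
Proof.
move=> aq al s1; pose n := norm1 (a i).
have n0 : 0 < n.
  by rewrite lt_def norm1_ge0 andbT; apply: contraNneq (a0 i) => E; rewrite (@norm1_eq0 _ _ (a i))// -/n E.
have ss : s * s = 1 by rewrite -expr2 -real_normK ?num_real// s1 expr1n.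
have aa0 : 0 < dotp (a i) (a i).
  rewrite lt_def sumr_ge0 => [|k _]; last by rewrite -expr2 sqr_ge0.
  rewrite andbT psumr_neq0 => [|k _]; last by rewrite -expr2 sqr_ge0.
  have [k ak] : exists k, a i 0 k != 0.
    apply/existsP; apply: contraNT (a0 i); rewrite negb_exists => /forallP h.
    by apply/eqP/rowP => k; rewrite mxE; apply/eqP; rewrite -[_ == _]negbK h.
  apply/hasP; exists k; first by rewrite mem_index_enum.
  by rewrite /= lt_def mulf_neq0//= -expr2 sqr_ge0.
pose c := 2 * n / dotp (a i) (a i).
(* The value of [a i] is [2 * n] in absolute value up to a rounding error [n], hence at most
   [3 * n]; the required margin is twice that. The other terms absorb displacement and rounding. *)
pose B l := 6 * n + `|c * dotp (a l) (a i)| + norm1 (a l) + 1.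
pose t := \sum_(l | l != i) B l / - dotp (a l) q.
have B0 l : 0 < B l by have := norm1_ge0 (a l); have := normr_ge0 (c * dotp (a l) (a i)); rewrite /B; lra.
have tl l : l != i -> t * dotp (a l) q <= - B l.
  move=> li; have q0 : 0 < - dotp (a l) q by rewrite oppr_gt0 al.
  suff : B l <= t * - dotp (a l) q by lra.
  rewrite -ler_pdivrMr// /t (bigD1 l)//= lerDl sumr_ge0// => j /andP[ji _].
  by rewrite divr_ge0 ?(ltW (B0 _))// oppr_ge0 ltW// al.
have [m hm] := round_vector (v + (t *: q - (s * c) *: a i)).
have near l : `|dotp (a l) (intv m - v) - (t * dotp (a l) q - s * (c * dotp (a l) (a i)))| <= norm1 (a l).
  have -> : dotp (a l) (intv m - v) - (t * dotp (a l) q - s * (c * dotp (a l) (a i))) =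
      dotp (intv m - (v + (t *: q - (s * c) *: a i))) (a l).
    by rewrite [RHS]dotpC !dotpBr dotpDr dotpBr !dotpZr; ring.
  by rewrite -[leRHS]mul1r; exact: dotp_le.
have := near i; rewrite aq mulr0 sub0r opprK /c divfK ?gt_eqF// -/n => hi.
have hs : `|s * dotp (a i) (intv m - v) + 2 * n| <= n.
  have -> : s * dotp (a i) (intv m - v) + 2 * n = s * (dotp (a i) (intv m - v) + s * (2 * n)).
    by rewrite mulrDr [s * (s * _)]mulrA ss mul1r.
  by rewrite normrM s1 mul1r.
have hb : `|dotp (a i) (intv m - v)| = `|s * dotp (a i) (intv m - v)| by rewrite normrM s1 mul1r.
exists m; split; first by move: hs; rewrite ler_norml => /andP[? ?]; lra.
move=> l li; rewrite hb ltr0_norm; last by move: hs; rewrite ler_norml => /andP[? ?]; lra.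
have := near l; have := tl l li; rewrite ler_norml => h1 /andP[_ h2].
have h3 : - (s * (c * dotp (a l) (a i))) <= `|c * dotp (a l) (a i)|.
  by rewrite -[leRHS]mul1r -s1 -normrM -normrN ler_norm.
by move: hs h1; rewrite ler_norml /B => /andP[? ?]; lra.
Qed.

(** The functionals active at [u] vanish together only on the line of [u], where [g] does not
    vanish; so the whole family is injective. *)
Lemma transversal_bound u w g : dotp w u != 0 ->
  (forall z, (forall l, dotp (a l) u = 0 -> dotp (a l) z = 0) -> dotp w z = 0 -> z = 0) ->
  dotp g u != 0 -> exists2 k : R, 0 < k & forall x,
    norm1 x <= k * (\sum_(l | dotp (a l) u == 0) `|dotp (a l) x| + `|dotp g x|).
Proof.
move=> wu hw gu.
pose b (t : T + 'I_1) := if t is inl l then if dotp (a l) u == 0 then a l else 0 else g.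
have [x hx|k k0 hk] := @inj_bound R d _ b.
  have al l : dotp (a l) u = 0 -> dotp (a l) x = 0.
    by move=> lu; have := hx (inl l); rewrite /b lu eqxx.
  pose c := dotp w x / dotp w u.
  have zu : x - c *: u = 0.
    apply: hw => [l lu|]; first by rewrite dotpBr dotpZr lu al// mulr0 subr0.
    by rewrite dotpBr dotpZr divfK// subrr.
  have xE : x = c *: u by apply/eqP; rewrite -subr_eq0 zu.
  have := hx (inr ord0); rewrite /b xE dotpZr => /eqP; rewrite mulf_eq0 (negPf gu) orbF.
  by move=> /eqP ->; rewrite scale0r.
exists k => // x; apply: (le_trans (hk x)); rewrite ler_pM2l// big_sumType big_ord1.
rewrite lerD2r [leRHS]big_mkcond; apply: ler_sum => l _ /=.
by case: ifP => _ //; rewrite dotp0l normr0.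
Qed.

Section Approximation.
Variables (e : T -> 'I_d -> L) (u : 'rV[R]_d) (i : T) (k0 : 'I_d) (eta : L).
Hypothesis he : forall l m, dotp (a l) (intv m) = 0 <-> forall k, dotp (e l k) m = 0.
Hypotheses (iu : dotp (a i) u = 0) (wu : dotp (intv (e i k0)) u != 0).
Hypotheses (Ku : gcone a full u) (etau : 0 < dotp (intv eta) u).

(** Says that [u] lies in the real span of the lattice points of the hyperplane of [a l]. *)
Definition tangent_lattice l := forall k, dotp (intv (e l k)) u = 0.

(** A lattice point [r] close to a multiple of [u]. Among the hyperplanes through [u], that of [a j]
    is displaced most, by less than [eps] and with sign [s]; this normalises the other
    displacements. *)
Definition good_approximation (c0 eps : R) (j : T) (s : bool) r :=
  [/\ forall l, dotp (a l) u = 0 -> `|dotp (a l) (intv r)| <= (-1) ^+ s * dotp (a j) (intv r),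
      0 < (-1) ^+ s * dotp (a j) (intv r) < eps,
      forall l, dotp (a l) u = 0 -> tangent_lattice l -> dotp (a l) (intv r) = 0,
      1 <= dotp eta r &
      forall l, dotp (a l) u != 0 -> dotp (a l) (intv r) <= - c0].

Lemma add_gt0_trans (x y z w : R) : - x < y -> x <= z -> z <= w -> 0 < w + y.
Proof. lra. Qed.

Lemma add_le_half (c x y z w : R) : y < x -> x <= c -> w <= z -> c < - z / 2 ->
  w + y <= - c.
Proof. lra. Qed.

Lemma ge1_mul_npos (t z : R) : 1 <= t -> z <= 0 -> t * z <= z.
Proof. by move=> t1 z0; rewrite -subr_le0 -{2}[z]mul1r -mulrBl mulr_ge0_le0// subr_ge0. Qed.

(** The pair [(j, s)] must not depend on [eps]. If each of the finitely many pairs failed for some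
    [eps], an approximation finer than all of these would still realise some pair. *)
Lemma exists_approximation : exists2 c0 : R, 0 < c0 & exists j s,
  dotp (a j) u = 0 /\ forall eps : R, 0 < eps -> exists r, good_approximation c0 eps j s r.
Proof.
have Kul l : dotp (a l) u <= 0 by move/forall_inP: Ku; apply; rewrite finset.in_setT.
have [c0 c00 hc0] : exists2 c0 : R, 0 < c0 & forall l, dotp (a l) u != 0 -> c0 < - dotp (a l) u / 2.
  apply: (@small_pos R T (fun l => dotp (a l) u != 0) (fun l => - dotp (a l) u / 2)) => l lu.
  by rewrite divr_gt0// oppr_gt0 lt_neqAle lu Kul.
exists c0 => //; apply: contrapT => /forallNP no.
have /choice[ep hep] (js : T * bool) : exists eps : R, 0 < eps /\
    (dotp (a js.1) u = 0 -> ~ exists r, good_approximation c0 eps js.1 js.2 r).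
  apply: contrapT => /forallNP h; apply: (no js.1); exists js.2; split.
    apply: contrapT => ju; apply: (h 1); split => // /ju [].
  move=> eps eps0; apply: contrapT => n; apply: (h eps); split.
  by []. by move=> _.
have [mu1 mu10 hmu1] : exists2 m : R, 0 < m & forall js, true -> m < ep js.
  by apply: (@small_pos R _ predT ep) => js _; have [] := hep js.
(* One threshold for each use below: integrality, escape from the facet [i], growth of [eta], depth
   in the other facets, and the failing values of [eps]. *)
pose mu := Num.min (Num.min 1 `|dotp (intv (e i k0)) u|) (Num.min (dotp (intv eta) u) (Num.min c0 mu1)).
have mu0 : 0 < mu by rewrite !lt_min ltr01 normr_gt0 wu etau c00 mu10.
have muw : mu <= `|dotp (intv (e i k0)) u| by rewrite /mu !ge_min lexx !orbT.
have mu_1 : mu <= 1 by rewrite /mu !ge_min lexx.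
have mueta : mu <= dotp (intv eta) u by rewrite /mu !ge_min lexx !orbT.
have muc : mu <= c0 by rewrite /mu !ge_min lexx !orbT.
have mu_mu1 : mu <= mu1 by rewrite /mu !ge_min lexx !orbT.
clearbody mu.
pose B : R := 1 + norm1 (intv eta) + \sum_l norm1 (a l) + \sum_l \sum_k norm1 (intv (e l k)).
have s1 : 0 <= \sum_l norm1 (a l) by apply: sumr_ge0 => l _; exact: norm1_ge0.
have s2 : 0 <= \sum_l \sum_k norm1 (intv (e l k)) :> R.
  by apply: sumr_ge0 => l _; apply: sumr_ge0 => k _; exact: norm1_ge0.
have n1 : 0 <= norm1 (intv eta) :> R by exact: norm1_ge0.
have B0 : 0 < B by rewrite /B; lra.
have Ba l : norm1 (a l) <= B.
  have : norm1 (a l) <= \sum_l norm1 (a l).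
    by rewrite (bigD1 l)//= lerDl sumr_ge0// => j _; exact: norm1_ge0.
  by rewrite /B; lra.
have Be l k : norm1 (intv (e l k)) <= B.
  have : norm1 (intv (e l k)) <= \sum_l \sum_k norm1 (intv (e l k)) :> R.
    rewrite (bigD1 l)//= (bigD1 k)//= -addrA lerDl addr_ge0//.
      by apply: sumr_ge0 => j _; exact: norm1_ge0.
    by apply: sumr_ge0 => j _; apply: sumr_ge0 => k' _; exact: norm1_ge0.
  by rewrite /B; lra.
have Beta : norm1 (intv eta) <= B by rewrite /B; lra.
have [r [t [t0 hr]]] := dirichlet u (divr_gt0 mu0 B0).
set del := intv r - t%:R *: u in hr.
have t1 : 1 <= t%:R :> R by rewrite ler1n.
have close g : norm1 g <= B -> `|dotp g del| < mu.
  move=> gB; apply: (le_lt_trans (dotp_le1 _ _)).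
  apply: (@le_lt_trans _ _ (B * norm1 del)); first by rewrite ler_wpM2r// norm1_ge0.
  by rewrite mulrC -ltr_pdivlMr.
have rE g : dotp g (intv r) = t%:R * dotp g u + dotp g del.
  by rewrite /del dotpBr dotpZr addrC subrK.
have flat l : dotp (a l) u = 0 -> `|dotp (a l) (intv r)| < mu.
  by move=> lu; rewrite rE lu mulr0 add0r close.
(* The equations take integer values at [r] of absolute value less than 1. *)
have tang l : tangent_lattice l -> dotp (a l) (intv r) = 0.
  move=> tl; apply/he => k; apply/eqP; rewrite -absz_eq0 -leqn0 -ltnS -(@ltr_nat R).
  rewrite natr_absz intr_norm -(dotp_map (intr : {rmorphism int -> R})).
  have := close _ (Be l k); rewrite /intv -/(intv r) -/(intv (e l k)) rE tl mulr0 add0r.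
  by move=> h; apply: (lt_le_trans h).
(* Otherwise [r] would satisfy the equation [e i k0], whose value is at least [mu] in absolute value
   at [t%:R *: u] and changes by less than [mu]. *)
have ai : dotp (a i) (intv r) != 0.
  apply/eqP => /he/(_ k0) E; have := close _ (Be i k0).
  have : dotp (intv (e i k0)) (intv r) = 0 :> R.
    by rewrite /intv (dotp_map (intr : {rmorphism int -> R})) E.
  rewrite rE => /eqP; rewrite addr_eq0 => /eqP h.
  rewrite -normrN -h normrM; apply/negP; rewrite -leNgt.
  apply: (@le_trans _ _ `|dotp (intv (e i k0)) u|).
    exact: muw.
  by rewrite ler_peMl// ger0_norm.
pose j := [arg max_(l > i | dotp (a l) u == 0) `|dotp (a l) (intv r)|]%O.
have [ju jmax] : dotp (a j) u = 0 /\ forall l, dotp (a l) u = 0 ->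
    `|dotp (a l) (intv r)| <= `|dotp (a j) (intv r)|.
  rewrite /j; case: arg_maxP => [|l /eqP lu lmax]; first exact/eqP.
  by split=> // l' /eqP; exact: lmax.
have aj : 0 < `|dotp (a j) (intv r)|.
  by apply: lt_le_trans (jmax i iu); rewrite normr_gt0.
pose s := dotp (a j) (intv r) < 0.
have sE : (-1) ^+ s * dotp (a j) (intv r) = `|dotp (a j) (intv r)|.
  rewrite /s; case: ltP => h; first by rewrite expr1 mulN1r ltr0_norm.
  by rewrite expr0 mul1r ger0_norm.
have [_ /(_ ju)] := hep (j, s); apply; exists r; split=> /=.
- by move=> l lu; rewrite sE jmax.
- rewrite sE aj /=; apply: (lt_trans (flat _ ju)); exact: le_lt_trans (hmu1 (j, s) isT).
- by move=> l _; exact: tang.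
- rewrite -gtz0_ge1 -(ltr0z R) -(dotp_map (intr : {rmorphism int -> R})) -/(intv _) rE.
  have := close _ Beta; rewrite ltr_norml => /andP[h _].
  have h2 : dotp (intv eta) u <= t%:R * dotp (intv eta) u by rewrite ler_peMl// ltW.
  exact: add_gt0_trans h mueta h2.
- move=> l lu; rewrite rE; have := close _ (Ba l); rewrite ltr_norml => /andP[_ h].
  have h2 : t%:R * dotp (a l) u <= dotp (a l) u by exact: ge1_mul_npos.
  exact: add_le_half h muc h2 (hc0 l lu).
Qed.

(* Lattice points [X b n] running to infinity along the irrational ray, such
   that the two hyperplanes [a j] translated by [X true n] and [X false n]
   separate the lattice point [m0] from opposite sides. *)
Lemma approximating_sequences v (q : T -> 'rV[R]_d) :
  (forall l, dotp (a l) (q l) = 0) ->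
  (forall j l, l != j -> dotp (a l) (q j) < 0) ->
  exists (X : bool -> nat -> L) (gam : R) (m0 : L) (b0 : bool) (N0 : nat),
  [/\ forall b n l, dotp (a l) u = 0 -> `|dotp (a l) (intv (X b n))| <= gam,
      forall b n l, dotp (a l) u != 0 -> dotp (a l) (intv (X b n)) <= - n%:R,
      forall b n, n%:Z <= dotp eta (X b n),
      forall n l, dotp (a l) u = 0 -> `|dotp (a l) (intv (X true n)) -
         dotp (a l) (intv (X false n))| <= n.+1%:R^-1 /\ (tangent_lattice l ->
         dotp (a l) (intv (X true n)) = dotp (a l) (intv (X false n))) &
      forall n, (N0 <= n)%N -> ~~ gcone a full (intv (m0 + X b0 n) - v) /\
         forall l, dotp (a l) (intv (m0 + X (~~ b0) n) - v) < 0].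
Proof.
move=> aq al; have [c0 c00 [j [s [ju happ]]]] := exists_approximation.
have sn : `|(-1) ^+ s : R| = 1 by rewrite normr_sign.
have [m0 [m0j m0l]] := facet_lattice_point v (aq j) (al j) sn.
pose gam := `|dotp (a j) (intv m0 - v)|.
have gamE : (-1) ^+ s * dotp (a j) (intv m0 - v) = - gam.
  have -> : gam = `|(-1) ^+ s * dotp (a j) (intv m0 - v)| by rewrite normrM sn mul1r.
  by rewrite ltr0_norm// opprK.
have gam0 : 0 < gam by rewrite -oppr_lt0 -gamE.
(* A multiple of [r n] by at least [W n - 1] reaches level [n] of [eta] and, since [r n] has depth
   [c0], depth [n] in the facets away from [u]. *)
pose W n : R := n%:R + 1 + n%:R / c0.
have W0 n : 0 < W n by rewrite /W ltr_wpDr ?divr_ge0 ?(ltW c00)// ltr_wpDl.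
(* The first bound makes the multiplier [N n] exceed [W n]; the second makes the two sequences,
   which differ by [2 *: r n], close on the hyperplanes through [u]. *)
pose ep n : R := Num.min (gam / (W n + 1)) (2 * n.+1%:R)^-1.
have ep0 n : 0 < ep n.
  rewrite lt_min; apply/andP; split; last by rewrite invr_gt0 mulr_gt0.
  by apply: divr_gt0 => //; have := W0 n; lra.
have /choice[r hr] n := happ (ep n) (ep0 n).
pose be n : R := (-1) ^+ s * dotp (a j) (intv (r n)).
pose N n := Num.truncn (gam / be n).
have be0 n : 0 < be n by have [_ /andP[]] := hr n.
have be1 n : be n < gam / (W n + 1) by have [_ /andP[_]] := hr n; rewrite lt_min => /andP[].
have be2 n : be n * 2 <= n.+1%:R^-1.
  have [_ /andP[_]] := hr n; rewrite lt_min => /andP[_ /ltW]; rewrite -/(be n) => h _ _ _.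
  by rewrite -ler_pdivlMr// -invfM mulrC.
have Nle n : (N n)%:R * be n <= gam.
  by rewrite -ler_pdivlMr// truncn_le divr_ge0 ?(ltW gam0)// ltW.
have Ngt n : gam < ((N n)%:R + 1) * be n by rewrite -ltr_pdivrMr// natr1 truncnS_gt.
have NW n : W n < (N n)%:R.
  have h : W n + 1 < gam / be n.
    by rewrite ltr_pdivlMr// mulrC -ltr_pdivlMr//; have := W0 n; lra.
  by have := truncnS_gt (gam / be n); rewrite -/(N n) -natr1; lra.
(* The offset [gam] of [m0] from the facet [j] lies between [N n] and [N n + 1] steps of size
   [be n]: one multiplier overshoots it, the other falls strictly short. *)
pose z (b : bool) n : int := if b then (N n)%:Z + 1 else (N n)%:Z - 1.
pose X b n : L := z b n *: r n.
have XE g b n : dotp g (intv (X b n)) = (z b n)%:~R * dotp g (intv (r n)).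
  rewrite -dotpZr; congr dotp; apply/rowP => k; rewrite !mxE.
  by rewrite rmorphM.
have zE b n : (z b n)%:~R = (N n)%:R + (if b then 1 else -1) :> R.
  by rewrite /z; case: b; rewrite ?rmorphB ?rmorphD.
have Wn n : n%:R + 1 <= W n by rewrite /W lerDl divr_ge0// ltW.
have Wc n : n%:R / c0 <= W n - 1 by rewrite /W addrAC addrK lerDr.
have zge b n : W n - 1 <= (z b n)%:~R.
  by rewrite zE; have := NW n; case: b; lra.
have zn b n : n%:R <= (z b n)%:~R :> R by have := zge b n; have := Wn n; lra.
have zge0 b n : 0 <= (z b n)%:~R :> R by apply: le_trans (zn b n).
have bgam n : be n <= gam.
  have := Nle n; have : 1 * be n <= (N n)%:R * be n.
    rewrite ler_pM2r//; have := NW n; have := Wn n; have := ler0n R n; lra.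
  by lra.
have zb b n : (z b n)%:~R * be n <= 2 * gam.
  have : (z b n)%:~R * be n <= ((N n)%:R + 1) * be n.
    by rewrite ler_pM2r// zE; case: b; lra.
  by rewrite mulrDl mul1r; have := Nle n; have := bgam n; lra.
have Xflat b n l : dotp (a l) u = 0 -> `|dotp (a l) (intv (X b n))| <= (z b n)%:~R * be n.
  move=> lu; rewrite XE normrM ger0_norm// ler_wpM2l//.
  by have [h _ _ _ _] := hr n; exact: h.
have Xneg b n l : dotp (a l) u != 0 -> dotp (a l) (intv (X b n)) <= - n%:R.
  move=> lu; rewrite XE; have [_ _ _ _ /(_ l lu) h] := hr n.
  apply: (@le_trans _ _ ((z b n)%:~R * - c0)); first exact: ler_wpM2l.
  rewrite mulrN lerN2 -ler_pdivrMr//; have := zge b n; have := Wc n; lra.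
have [N0 hN0] : exists N0 : nat, forall l, dotp (a l) (intv m0 - v) < N0%:R.
  exists (Num.truncn (\sum_l `|dotp (a l) (intv m0 - v)|)).+1 => l.
  apply: le_lt_trans (truncnS_gt _); apply: (le_trans (ler_norm _)).
  by rewrite (bigD1 l)//= lerDl sumr_ge0.
have jX b n : (-1) ^+ s * dotp (a j) (intv (m0 + X b n) - v) = (z b n)%:~R * be n - gam.
  by rewrite intvD addrAC dotpDr mulrDr gamE XE mulrCA addrC.
have jXt n : 0 < (-1) ^+ s * dotp (a j) (intv (m0 + X true n) - v).
  by rewrite jX zE subr_gt0 Ngt.
have jXf n : (-1) ^+ s * dotp (a j) (intv (m0 + X false n) - v) < 0.
  by rewrite jX zE subr_lt0 mulrDl mulN1r; have := Nle n; have := be0 n; lra.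
have lX b n l : (N0 <= n)%N -> l != j -> dotp (a l) (intv (m0 + X b n) - v) < 0.
  move=> nN lj; rewrite intvD addrAC dotpDr; have [lu|lu] := eqVneq (dotp (a l) u) 0.
    have := m0l l lj; rewrite -/gam; have := le_trans (Xflat b n l lu) (zb b n).
    by rewrite ler_norml => /andP[_]; lra.
  have := Xneg b n l lu; have := hN0 l; have : N0%:R <= n%:R :> R by rewrite ler_nat.
  by lra.
exists X, (2 * gam), m0, (~~ s), N0; split=> //.
- by move=> b n l lu; exact: le_trans (Xflat b n l lu) (zb b n).
- move=> b n; rewrite -(ler_int R); apply: (le_trans (zn b n)).
  have -> : dotp eta (X b n) = z b n * dotp eta (r n) by rewrite dotpZr.
  rewrite rmorphM /= ler_peMr//; have [_ _ _ h _] := hr n.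
  by rewrite ler1z.
- move=> n l lu; split; last first.
    by move=> tl; rewrite !XE; have [_ _ /(_ l lu tl) -> _ _] := hr n; rewrite !mulr0.
  rewrite !XE !zE -mulrBl normrM; have [/(_ l lu) h _ _ _ _] := hr n.
  have -> : (N n)%:R + 1 - ((N n)%:R + -1) = 2 :> R by ring.
  rewrite ger0_norm//; apply: le_trans (be2 n); rewrite mulrC ler_pM2r//.
move=> n nN; split.
  apply/negP => /forall_inP/(_ j); rewrite finset.in_setT => /(_ isT).
  move: (jXt n) (jXf n); case: (s) => /=; rewrite ?expr1 ?expr0 ?mul1r ?mulN1r => h1 h2; lra.
move=> l; have [->|lj] := eqVneq l j; last exact: lX.
move: (jXt n) (jXf n); case: (s) => /=; rewrite ?expr1 ?expr0 ?mul1r ?mulN1r => h1 h2; lra.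
Qed.

End Approximation.
End Recession.

(** * Cones with an irrational facet normal *)

Section UltrafilterLimits.
Context {R : realType}.

Lemma ultra_const (U : set_system nat) (UU : UltraFilter U) (I : finType) (c : nat -> I) :
  exists x, \forall n \near U, c n = x.
Proof.
apply: contrapT => /forallNP no.
have : \forall n \near U, forall x, c n <> x.
  apply: filter_forall => x.
  by have [/no[]|] := in_ultra_setVsetC [set n | c n = x] UU.
by move=> /filter_ex[n /(_ (c n))].
Qed.

Lemma sg_diff (x y : R) : Num.sg x <> Num.sg y -> `|x| <= `|x - y|.
Proof.
case: (ltrgtP x 0) => [x0|x0|->]; last by rewrite normr0.
  case: (ltrgtP y 0) => [y0|y0|->]; [by rewrite !ltr0_sg| |by rewrite subr0].
  move=> _; have xy : x - y < 0 by lra.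
  by rewrite !ltr0_norm//; lra.
case: (ltrgtP y 0) => [y0|y0|->]; [|by rewrite !gtr0_sg|by rewrite subr0].
move=> _; have xy : 0 < x - y by lra.
by rewrite !gtr0_norm//; lra.
Qed.

Lemma abs_add_le (y w g : R) : 0 <= g -> y - w <= g -> `|y| + y <= 2 * (g + `|w|).
Proof.
move=> g0 h; have h1 := ler_norm w; have h2 := normr_ge0 w.
by case: (leP 0 y) => [|/ltW] s; [rewrite (ger0_norm s)|rewrite (ler0_norm s)]; lra.
Qed.

Definition nullseq (U : set_system nat) (c : nat -> Cplx R) :=
  forall e : R, 0 < e -> \forall n \near U, normc (c n) <= e.

Lemma nullseqD (U : set_system nat) (UF : Filter U) c c' :
  nullseq U c -> nullseq U c' -> nullseq U (fun n => c n + c' n).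
Proof.
move=> h h' e e0; have e20 : 0 < e / 2 by rewrite divr_gt0.
apply: filterS2 (h _ e20) (h' _ e20) => n h1 h2.
by apply: (le_trans (le_normcD _ _)); rewrite [leRHS]splitr lerD.
Qed.

Lemma nullseqM (U : set_system nat) (UF : Filter U) (B : R) k c :
  (forall n, normc (k n) <= B) -> nullseq U c -> nullseq U (fun n => k n * c n).
Proof.
move=> hk h e e0; have B0 : 0 <= B by exact: le_trans (normc_ge0 _) (hk 0%N).
have B1 : 0 < B + 1 by rewrite ltr_wpDl.
apply: filterS (h _ (divr_gt0 e0 B1)) => n hn; rewrite normcM.
apply: (@le_trans _ _ (B * (e / (B + 1)))); first by rewrite ler_pM// normc_ge0.
by rewrite mulrA ler_pdivrMr// [B * e]mulrC ler_pM2l// lerDl.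
Qed.

Lemma nullseq_sum (U : set_system nat) (UF : Filter U) r (q : nat -> Cplx R)
    (c : nat -> nat -> Cplx R) :
  (forall i, nullseq U (c i)) -> nullseq U (fun n => \sum_(i < r) q i * c i n).
Proof.
move=> hc; elim: r => [|r IH].
  by move=> e e0; apply: nearW => n; rewrite big_ord0 normc0 ltW.
move=> e e0; apply: filterS (nullseqD UF IH (nullseqM UF (fun=> lexx (normc (q r))) (hc r)) e0).
by move=> n; rewrite big_ord_recr.
Qed.

Lemma nullseq_cst (U : set_system nat) (UF : ProperFilter U) (x : Cplx R) :
  nullseq U (fun=> x) -> x = 0.
Proof.
move=> h; apply: eq0_normc; apply/eqP; rewrite eq_le normc_ge0 andbT.
by apply/ler_addgt0Pl => e /h/filter_ex[_]; rewrite addr0.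
Qed.

End UltrafilterLimits.

(** * Comparison of the two limits of the coefficients *)

Section IrrationalContradiction.
Context {R : realType} (p : R) (hp : 1 <= p) {d : nat}.
Context {T : finType} (a : T -> 'rV[R]_d).
Local Notation C := (Cplx R).
Local Notation Cd := 'rV[Cplx R]_d.
Local Notation M := 'rV[int]_d.
Local Notation full := [set: T]%SET.
Implicit Types (x y z : 'rV[R]_d) (m : M) (n : nat) (b : bool) (j : int) (l : T).

Variables (v u : 'rV[R]_d) (eta : M) (X : bool -> nat -> M) (gam Ke : R).
Variable tangent : T -> Prop.
Local Notation I l := (dotp (a l) u == 0).
Local Notation f := (cone_weight p a v).

Definition ray_dual : 'rV[R]_d := - \sum_(l | I l) a l.
Local Notation y0 := ray_dual.

(** Twice the sum of the positive parts: it measures how far [x] violates the inequalities active at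
    [u], and stays bounded on the supports of all translated series. *)
Definition excess x : R := \sum_(l | I l) (`|dotp (a l) x| + dotp (a l) x).

(** By [hKe], on a fixed level of [eta] the form [ray_dual] controls the norm up to a bounded
    excess, so each level sum converges although the base point is on the boundary of the domain.
    The hypothesis [low] bounds [eta] below on each coset of lattice points along a facet that is
    not tangent. *)
Hypotheses (Ke0 : 0 < Ke)
  (hKe : forall x, norm1 x <= Ke * (dotp y0 x + excess x + `|dotp (intv eta) x|)).
Hypotheses (gam0 : 0 <= gam)
  (Xgam : forall b n l, dotp (a l) u = 0 -> `|dotp (a l) (intv (X b n))| <= gam)
  (Xneg : forall b n l, dotp (a l) u != 0 -> dotp (a l) (intv (X b n)) <= - n%:R)
  (Xeta : forall b n, n%:Z <= dotp eta (X b n))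
  (Xclose : forall n l, dotp (a l) u = 0 ->
    `|dotp (a l) (intv (X true n)) - dotp (a l) (intv (X false n))| <= n.+1%:R^-1)
  (Xtan : forall n l, dotp (a l) u = 0 -> tangent l ->
    dotp (a l) (intv (X true n)) = dotp (a l) (intv (X false n)))
  (low : forall l, dotp (a l) u = 0 -> ~ tangent l -> exists (g : M) (k : R),
    [/\ 0 <= k, forall m, dotp (a l) (intv m) = 0 -> dotp g m = 0 &
     forall x, - (k * (excess x + `|dotp (intv g) x|)) <= dotp (intv eta) x]).

Lemma ray_dualE x : dotp y0 x = - \sum_(l | I l) dotp (a l) x.
Proof. by rewrite dotpNl dotp_suml. Qed.

Definition excess_bound : R := \sum_(l | I l) 2 * (gam + `|dotp (a l) v|).

Lemma excess_le m : (forall l, dotp (a l) u = 0 -> dotp (a l) (intv m - v) <= gam) ->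
  excess (intv m) <= excess_bound.
Proof.
move=> h; apply: ler_sum => l /eqP lu; apply: abs_add_le => //.
by rewrite -dotpBr h.
Qed.

Definition spt x : Cd := Cvec x + 'i%C *: Cvec y0.

Lemma Im_spt x : map_mx (@complex.Im R) (spt x) = y0.
Proof. by apply/rowP => k; rewrite !mxE /= mul0r mul1r !add0r. Qed.

Lemma normc_chr_spt x m : normc (chr (spt x) m) = expR (- (2 * pi * dotp y0 (intv m))).
Proof. by rewrite normc_chr Im_spt. Qed.

Definition level_bound j m : R :=
  full_angle p (d := d) * expR (2 * pi * (excess_bound + `|j%:~R|)) *
  expR (- (2 * pi / Ke * norm1 (intv m))).

Lemma full_angle_ge0 : 0 <= full_angle p (d := d) :> R.
Proof. exact: angle_ge0. Qed.

Lemma bounded_level j : bounded_sums (level_bound j).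
Proof.
apply: bounded_sumsZ; first by rewrite mulr_ge0 ?full_angle_ge0// expR_ge0.
by apply: bounded_sums_exp; rewrite divr_gt0// twopi_gt0.
Qed.

Lemma level_bound_ge j m : excess (intv m) <= excess_bound -> dotp eta m = j ->
  full_angle p (d := d) * expR (- (2 * pi * dotp y0 (intv m))) <= level_bound j m.
Proof.
move=> em ej.
have -> : level_bound j m = full_angle p (d := d) *
    expR (2 * pi * (excess_bound + `|j%:~R|) + - (2 * pi / Ke * norm1 (intv m))).
  by rewrite expRD mulrA.
rewrite ler_wpM2l ?full_angle_ge0// ler_expR.
have := hKe (intv m); rewrite /intv (dotp_map (intr : {rmorphism int -> R})) ej => h.
have {h} : norm1 (intv m) / Ke <= dotp y0 (intv m) + excess (intv m) + `|j%:~R|.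
  by rewrite ler_pdivrMr// mulrC.
have t := @twopi_gt0 R => h.
have : 2 * pi * (norm1 (intv m) / Ke) <= 2 * pi * (dotp y0 (intv m) + excess_bound + `|j%:~R|).
  by rewrite ler_pM2l//; move: h em; lra.
rewrite [2 * pi / Ke * _]mulrAC -[2 * pi * norm1 _ / Ke]mulrA.
move: (2 * pi) => k; lra.
Qed.

Lemma level_dominated j (Y : M) x : (forall l, dotp (a l) u = 0 -> `|dotp (a l) (intv Y)| <= gam) ->
  forall m, normc (if dotp eta m == j then (f (m + Y))%:C%C * chr (spt x) m else 0)
    <= level_bound j m.
Proof.
move=> hY m; have [B0 _] := bounded_level j.
case: eqP => [ej|_]; last by rewrite normc0.
rewrite [X in X <= _]normcM normc_chr_spt normc_real ger0_norm ?weight_ge0//.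
have [h|/weight_out E] := boolP (gcone a full (intv (m + Y) - v)); last first.
  by rewrite /cone_weight E mul0r.
apply: (le_trans _ (level_bound_ge _ ej)).
  by rewrite ler_wpM2r ?expR_ge0//; exact: weight_le.
apply: excess_le => l lu; move/forall_inP/(_ l): h; rewrite finset.in_setT => /(_ isT).
rewrite intvD addrAC dotpDr; have := hY l lu; rewrite ler_norml => /andP[h _].
by move: h; lra.
Qed.

Lemma weight_sg y z : (forall l, Num.sg (dotp (a l) y) = Num.sg (dotp (a l) z)) ->
  weight p (gauss_const p) a full y = weight p (gauss_const p) a full z.
Proof.
move=> h; rewrite /weight; congr (_%:R * angle p _ (gcone a _)).
  congr nat_of_bool; apply: eq_forallb_in => l _.
  by rewrite -[in LHS]sgr_le0 -[in RHS]sgr_le0 h.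
by apply/setP => l; rewrite !inE -[in LHS]sgr_eq0 -[in RHS]sgr_eq0 h.
Qed.

Variable U : set_system nat.
Hypotheses (UU : UltraFilter U) (Uoo : \oo `<=` U).

(** A weight depends only on membership in the cone and on the set of active facets, a finite datum
    that is constant along the ultrafilter. *)
Lemma limit_weight b m : exists c : R, \forall n \near U, f (m + X b n) = c.
Proof.
have [[g A] h] := @ultra_const U UU (bool * {set T})%type (fun n =>
  (gcone a full (intv (m + X b n) - v), act a full (intv (m + X b n) - v))).
exists (g%:R * angle p (gauss_const p) (gcone a A)).
by apply: filterS h => n [E1 E2]; rewrite /cone_weight /weight E1 E2.
Qed.

Variable fl : bool -> M -> R.
Hypothesis hfl : forall b m, \forall n \near U, f (m + X b n) = fl b m.
Local Notation h m := (fl true m - fl false m).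

Lemma near_inv (e : R) : 0 < e -> \forall n \near U, n.+1%:R^-1 < e.
Proof.
move=> e0; apply: Uoo; exists (Num.truncn e^-1) => // n /= Nn.
by rewrite invf_plt ?posrE// (lt_le_trans (truncnS_gt _))// ler_nat.
Qed.

Lemma near_large (N : nat) : \forall n \near U, (N <= n)%N.
Proof. by apply: Uoo; exists N. Qed.

(** If the limits differ, one facet [l] separates the two translates along the ultrafilter. Facets
    away from [u] are eventually strict for both and tangent ones see equal values; otherwise the
    two values are close and of different signs, hence both small. *)
Lemma limit_support m : h m != 0 -> exists l, [/\ dotp (a l) u = 0, ~ tangent l &
  \forall n \near U, `|dotp (a l) (intv m - v) + dotp (a l) (intv (X true n))| <= n.+1%:R^-1].
Proof.
move=> hm.
pose c n := [pick l | Num.sg (dotp (a l) (intv (m + X true n) - v)) !=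
  Num.sg (dotp (a l) (intv (m + X false n) - v))].
have XE b n l : dotp (a l) (intv (m + X b n) - v) =
    dotp (a l) (intv m - v) + dotp (a l) (intv (X b n)).
  by rewrite intvD addrAC dotpDr.
have [[l|] hc] := ultra_const UU c; last first.
  exfalso; have [n [[E ht] hf]] := filter_ex (filterI (filterI hc (hfl true m)) (hfl false m)).
  move/eqP: hm; apply; rewrite -ht -hf; apply/eqP; rewrite subr_eq0; apply/eqP.
  apply: weight_sg => l; move: E; rewrite /c; case: pickP => // no _.
  by have /negbFE/eqP := no l.
have hl : \forall n \near U, Num.sg (dotp (a l) (intv m - v) + dotp (a l) (intv (X true n))) <>
    Num.sg (dotp (a l) (intv m - v) + dotp (a l) (intv (X false n))).
  by apply: filterS hc => n; rewrite /c; case: pickP => // l' /eqP + [<-]; rewrite !XE.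
have lu : dotp (a l) u = 0.
  apply/eqP; apply: contrapT => /negP lu.
  have [n [Nn]] := filter_ex (filterI (near_large (Num.truncn `|dotp (a l) (intv m - v)|).+1) hl).
  have neg b : dotp (a l) (intv m - v) + dotp (a l) (intv (X b n)) < 0.
    have h1 := Xneg b n lu; have h2 := truncnS_gt `|dotp (a l) (intv m - v)|.
    have h3 := ler_norm (dotp (a l) (intv m - v)).
    have h4 : (Num.truncn `|dotp (a l) (intv m - v)|).+1%:R <= n%:R :> R by rewrite ler_nat.
    by move: h1 h2 h3 h4; lra.
  by apply; rewrite !ltr0_sg.
exists l; split=> //.
  by move=> tl; have [n] := filter_ex hl; apply; rewrite (Xtan n lu tl).
apply: filterS hl => n /sg_diff; rewrite opprD addrACA subrr add0r => hh.
by apply: (le_trans hh); exact: Xclose.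
Qed.

(** Two points attached to the same facet [l] have the same limiting value of [a l], so their
    difference lies on its hyperplane. The integer form of [low] is thus constant on them, and the
    excess is bounded. *)
Lemma limit_low : exists N : int, forall m, h m != 0 -> N <= dotp eta m.
Proof.
pose S l m := \forall n \near U,
  `|dotp (a l) (intv m - v) + dotp (a l) (intv (X true n))| <= n.+1%:R^-1.
have Sdiff l m m' : S l m -> S l m' -> dotp (a l) (intv (m - m')) = 0.
  move=> hm hm'; apply/eqP; rewrite -normr_le0; apply/ler_addgt0Pl => e e0.
  have e20 : 0 < e / 2 by rewrite divr_gt0.
  have [n [[h1 h2] h3]] := filter_ex (filterI (filterI hm hm') (near_inv e20)).
  have -> : dotp (a l) (intv (m - m')) =
    (dotp (a l) (intv m - v) + dotp (a l) (intv (X true n))) -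
    (dotp (a l) (intv m' - v) + dotp (a l) (intv (X true n))).
    by rewrite intvB !dotpBr; ring.
  apply: (le_trans (ler_normB _ _)); apply: (le_trans (lerD h1 h2)).
  by rewrite addr0 [leRHS]splitr lerD// ltW.
have /choice[E hE] l : exists E : R, 0 <= E /\ forall m, dotp (a l) u = 0 -> ~ tangent l ->
    S l m -> excess (intv m) <= excess_bound -> - E <= dotp (intv eta) (intv m).
  have [[m1 hm1]|no] := pselect (exists m, S l m); last first.
    by exists 0; split=> // m _ _ Sm; exfalso; apply: no; exists m.
  have [[lu nt]|no] := pselect (dotp (a l) u = 0 /\ ~ tangent l); last first.
    by exists 0; split=> // m lu nt; exfalso; apply: no.
  have [g [k [k0 hg hx]]] := low lu nt.
  have B0 : 0 <= excess_bound.
    by apply: sumr_ge0 => l' _; rewrite mulr_ge0// addr_ge0.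
  exists (k * (excess_bound + `|dotp (intv g) (intv m1)|)); split.
    by rewrite mulr_ge0// addr_ge0.
  move=> m _ _ Sm em; apply: le_trans (hx (intv m)); rewrite lerN2 ler_wpM2l//.
  rewrite lerD//; suff -> : dotp (intv g) (intv m) = dotp (intv g) (intv m1) :> R by [].
  have := hg _ (Sdiff l m m1 Sm hm1); rewrite dotpBr => /eqP; rewrite subr_eq0 => /eqP gE.
  by rewrite /intv !(dotp_map (intr : {rmorphism int -> R})) gE.
exists (Num.floor (- \sum_l E l)) => m hm.
have [l [lu nt Sm]] := limit_support hm.
rewrite -(ler_int R); apply: (le_trans (floor_le _)).
have : - E l <= dotp (intv eta) (intv m).
  apply: (hE l).2 => //; apply: excess_le => l' lu'.
  have [b hb] : exists b, fl b m != 0.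
    have [E1|] := eqVneq (fl true m) 0; last by exists true.
    by exists false; apply: contraNneq hm => E2; rewrite E1 E2 subrr.
  have [n fn] := filter_ex (hfl b m).
  have [g|/weight_out E0] := boolP (gcone a full (intv (m + X b n) - v)); last first.
    by move: hb; rewrite -fn /cone_weight E0 eqxx.
  move/forall_inP/(_ l'): g; rewrite finset.in_setT => /(_ isT).
  rewrite intvD addrAC dotpDr; have := Xgam b n lu'; rewrite ler_norml => /andP[g _].
  by move: g; lra.
rewrite {1}/intv (dotp_map (intr : {rmorphism int -> R})); apply: le_trans.
rewrite lerN2 (bigD1 l)//= lerDl sumr_ge0// => k _; exact: (hE k).1.
Qed.

Variables (F : Cd -> C) (kap : R).
Hypotheses (kap0 : 0 < kap)
  (hkap : forall x, gcone a full x -> kap * norm1 x <= dotp (intv eta) x)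
  (Fmer : meromorphic F)
  (Fsum : forall s, tube a s -> has_sum (fun m => (f m)%:C%C * chr s m) (F s)).
Local Notation pt x z := (spt x + z *: map_mx intr eta).

Lemma Im_pt x (z : C) : map_mx (@complex.Im R) (pt x z) = y0 + complex.Im z *: intv eta.
Proof.
rewrite -(Im_spt x); apply/rowP => k; rewrite /intv !mxE.
have -> : ((eta 0 k)%:~R : C) = ((eta 0 k)%:~R : R)%:C%C by rewrite rmorph_int.
by move: (_ + 'i%C * _); case: z => s t [s' t'] /=; rewrite mulr0 add0r.
Qed.

Lemma pt_dual x (z : C) w : 0 < complex.Im z -> gcone a full w ->
  complex.Im z * kap * norm1 w <= dotp (map_mx (@complex.Im R) (pt x z)) w.
Proof.
move=> z0 hw; rewrite Im_pt dotpDl dotpZl -mulrA.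
have : complex.Im z * (kap * norm1 w) <= complex.Im z * dotp (intv eta) w.
  by rewrite ler_pM2l// hkap.
have : 0 <= dotp y0 w.
  rewrite ray_dualE oppr_ge0 sumr_le0// => l _.
  by move/forall_inP: hw; apply; rewrite finset.in_setT.
by lra.
Qed.

Lemma pt_tube x (z : C) : 0 < complex.Im z -> tube a (pt x z).
Proof.
move=> z0 w hw w0; apply: lt_le_trans (pt_dual x z0 hw); rewrite !mulr_gt0//.
by rewrite lt_def norm1_ge0 andbT; apply: contraNneq w0 => n; rewrite (@norm1_eq0 _ _ w)// n.
Qed.

Definition good_point x := forall t : R, 0 <= t <= 1 -> local_quotient (fun z : C => F (pt x z)) t.

Lemma good_dense x (e : R) : 0 < e -> exists2 y, rball x e y & good_point y.
Proof.
move=> e0; have [w we hw] := meromorphic_line (spt x) (map_mx intr eta) Fmer e0.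
exists (x + w); first by move=> k; have := we k; rewrite !mxE subr0 addrAC subrr add0r.
by move=> t /hw; rewrite /spt CvecD [Cvec x + Cvec w + _]addrAC.
Qed.

Lemma normc_chr_shift b n x : normc (chr (spt x) (- X b n)) <=
  expR (2 * pi * \sum_(l | I l) gam).
Proof.
rewrite normc_chr_spt ler_expR ray_dualE intvN -mulrN opprK ler_pM2l ?twopi_gt0//.
apply: ler_sum => l /eqP lu; rewrite dotpNr.
by apply: le_trans (Xgam b n lu); rewrite -normrN ler_norm.
Qed.

Lemma limit_dominated j b x m :
  normc (if dotp eta m == j then (fl b m)%:C%C * chr (spt x) m else 0) <= level_bound j m.
Proof.
have [n <-] := filter_ex (hfl b m).
by apply: level_dominated => l lu; exact: Xgam.
Qed.

(** Translating by [X b n] moves level [k] to level [k + dotp eta (X b n)], which tends to infinity.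
    There the combination with coefficients [q] is small, while the translated level sums converge
    to [L b] by domination. *)
Lemma limit_recurrence x (A : int -> C) (L : bool -> int -> C) (q : {poly C}) :
  (forall k, has_sum (fun m => if dotp eta m == k then (f m)%:C%C * chr (spt x) m else 0) (A k)) ->
  (forall b k, has_sum (fun m => if dotp eta m == k then (fl b m)%:C%C * chr (spt x) m else 0)
    (L b k)) ->
  (forall e : R, 0 < e -> exists N : nat, forall n, (N <= n)%N ->
    normc (\sum_(j < size q) q`_j * A (n%:Z - j%:Z)) <= e) ->
  forall b k, \sum_(j < size q) q`_j * L b (k - j%:Z) = 0.
Proof.
move=> hA hL hq b k.
(* The prefactor turns a sum over level [j + dotp eta (X b n)] into one over level [j] with
   translated weights; it is bounded because [X b n] stays near the hyperplanes through [u]. *)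
pose c n j : C := chr (spt x) (- X b n) * A (j + dotp eta (X b n)).
have hc n j : has_sum (fun m => if dotp eta m == j then (f (m + X b n))%:C%C * chr (spt x) m
    else 0) (c n j).
  have := has_sumZ (chr (spt x) (- X b n)) (has_sum_bij (addrK (X b n)) (subrK (X b n))
    (hA (j + dotp eta (X b n)))).
  apply: eq_has_sum => m /=; rewrite dotpDr (inj_eq (addIr _)).
  case: (dotp eta m == j); last exact: mulr0.
  by rewrite [LHS]mulrCA -chrD addrCA addNr addr0.
have conv j : nullseq U (fun n => c n j - L b j).
  apply: (has_sum_cvg _ (bounded_level j) _ _ (hc^~ j) (hL b j)).
  - by move=> n; apply: level_dominated => l; exact: Xgam.
  - exact: limit_dominated.
  move=> m e e0; apply: filterS (hfl b m) => n ->.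
  by rewrite subrr normc0 ltW.
have null : nullseq U (fun n => \sum_(j < size q) q`_j * c n (k - j%:Z)).
  move=> e e0; pose S n := \sum_(j < size q) q`_j * A (k + dotp eta (X b n) - j%:Z).
  have S0 : nullseq U S.
    move=> e' /hq[N hN]; apply: filterS (near_large (N + absz k)%N) => n Nn.
    have Xn := Xeta b n; have -> : S n = \sum_(j < size q) q`_j *
        A ((absz (k + dotp eta (X b n)))%:Z - j%:Z).
      by apply: eq_bigr => j _; congr (_ * A (_ - _)); lia.
    by apply: hN; lia.
  apply: filterS (nullseqM _ (fun n => normc_chr_shift b n x) S0 e0) => n.
  rewrite /S mulr_sumr; congr (normc _ <= _); apply: eq_bigr => j _.
  by rewrite /c mulrCA; congr (_ * (_ * A _)); rewrite addrAC.
apply/eqP; rewrite -oppr_eq0; apply/eqP; apply: (@nullseq_cst R U _ _) => e e0.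
have FU : Filter U by exact: filter_filter.
have null1 : nullseq U (fun n => \sum_(j < size q) q`_j * (c n (k - j%:Z) - L b (k - j%:Z))).
  exact: (nullseq_sum FU _ (fun j : nat => q`_j) (fun j : nat => conv (k - j%:Z))).
have null2 : nullseq U (fun n => -1 * \sum_(j < size q) q`_j * c n (k - j%:Z)).
  apply: (@nullseqM R U FU 1 (fun=> -1) _ _ null) => _.
  by rewrite normcN normc1.
apply: filterS (nullseqD FU null1 null2 e0) => n.
congr (normc _ <= _); rewrite mulN1r -sumrN -big_split /= -sumrN; apply: eq_bigr => j _.
by rewrite mulrBr addrAC subrr add0r.
Qed.

Lemma limit_levels x : good_point x -> forall j,
  has_sum (fun m => if dotp eta m == j then (h m)%:C%C * chr (spt x) m else 0) 0.
Proof.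
move=> gx.
have X0 l : dotp (a l) u = 0 -> `|dotp (a l) (intv 0)| <= gam.
  by rewrite intv0 dotp0r normr0.
have /choice[A hA] k : exists A, has_sum (fun m =>
    if dotp eta m == k then (f m)%:C%C * chr (spt x) m else 0) A.
  have [A hA] := dominated_has_sum (bounded_level k) (level_dominated k x X0).
  by exists A; apply: eq_has_sum hA => m; rewrite addr0.
have /choice[L hL] b : exists L, forall k, has_sum (fun m =>
    if dotp eta m == k then (fl b m)%:C%C * chr (spt x) m else 0) (L k).
  have /choice[L hL] := fun k : int =>
    dominated_has_sum (bounded_level k) (limit_dominated k b x).
  by exists L.
have dom (t : R) : 0 < t -> exists2 be, bounded_sums be &
    forall m, normc ((f m)%:C%C * chr (pt x (0 +i* t)%C) m) <= be m.
  move=> t0; apply: (series_bound hp v (e := t * kap)); first exact: mulr_gt0.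
  by move=> w; exact: (@pt_dual x (0 +i* t)%C).
have hF (z : C) : 0 < complex.Im z -> has_sum (fun m => (f m)%:C%C * chr (pt x z) m) (F (pt x z)).
  by move=> z0; apply: Fsum; exact: pt_tube.
have [q q0 hq] := level_decay dom hF gx hA.
have rec := limit_recurrence hA hL hq.
pose D j := L true j - L false j.
have hD j : has_sum (fun m => if dotp eta m == j then (h m)%:C%C * chr (spt x) m else 0) (D j).
  apply: eq_has_sum (has_sumB (hL true j) (hL false j)) => m.
  case: (dotp eta m == j); last exact: subr0.
  by rewrite rmorphB mulrBl.
have [N hN] := limit_low.
(* Zeros propagate upwards: once all lower levels vanish, the recurrence reduces to [q]_0 * D j =
   0[, and]q[_0] is nonzero. *)
have D0 (k : nat) j : j < N + k%:Z -> D j = 0.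
  elim: k j => [|k IH] j jk.
    apply: eq0_normc; apply/eqP; rewrite eq_le normc_ge0 andbT.
    apply: has_sum_le0 (hD j) => J _; rewrite big1// => m _.
    case: eqP => [mj|_]; last by rewrite normc0.
    have [->|/hN] := eqVneq (h m) 0; first by rewrite mul0r normc0.
    by rewrite mj; lia.
  have : \sum_(i < size q) q`_i * D (j - i%:Z) = 0.
    under eq_bigr do rewrite mulrBr.
    by rewrite sumrB !rec subrr.
  have : (0 < size q)%N.
    by rewrite lt0n; apply: contraNneq q0 => /eqP; rewrite size_poly_eq0 => /eqP->; rewrite horner0.
  case: (size q) => // r _; rewrite big_ord_recl big1 => [|i _].
    rewrite addr0 subr0 => /(congr1 (@normc R)); rewrite normcM normc0 => /eqP.
    rewrite mulf_eq0 => /orP[/eqP/eq0_normc|/eqP/eq0_normc//].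
    by rewrite -horner_coef0 => E; rewrite E eqxx in q0.
  by rewrite IH ?mulr0// lift0; lia.
by move=> j; have := hD j; rewrite (D0 (absz (j - N)).+1)//; lia.
Qed.

(** On the level of [m] the difference has vanishing Fourier sums at a dense set of real points, so
    [fourier_unique] applies; the characters at the imaginary base point never vanish. *)
Lemma limit_weights_eq m : fl true m = fl false m.
Proof.
apply/eqP; rewrite -subr_eq0; apply/eqP; pose j := dotp eta m.
pose b m' : C := if dotp eta m' == j then (h m')%:C%C * chr ('i%C *: Cvec y0) m' else 0.
have spt0 : 'i%C *: Cvec y0 = spt 0 by rewrite /spt /Cvec map_mx0 add0r.
have bb : bounded_sums (fun m => level_bound j m + level_bound j m).
  exact: (bounded_sumsD (bounded_level j) (bounded_level j)).
have hb m' : normc (b m') <= level_bound j m' + level_bound j m'.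
  have := lerD (limit_dominated j true 0 m') (limit_dominated j false 0 m').
  apply: le_trans; rewrite /b spt0; case: ifP => _; last by rewrite normc0 addr0.
  rewrite rmorphB mulrBl; apply: le_trans (le_normcD _ _) _.
  by rewrite normcN.
have : b m = 0.
  apply: (fourier_unique bb hb) => x e e0; have [y ye gy] := good_dense x e0.
  exists y => //; apply: eq_has_sum (limit_levels gy j) => m'.
  rewrite /b -/j; case: (dotp eta m' == j); last by rewrite mul0r.
  by rewrite /spt chrDl [chr _ _ * chr _ _]mulrC mulrA.
rewrite /b eqxx => /(congr1 (@normc R)); rewrite normcM normc_chr normc0 => /eqP.
rewrite mulf_eq0 [X in _ || X]gt_eqF ?expR_gt0// orbF => /eqP.
by rewrite normc_real => /normr0_eq0.
Qed.

End IrrationalContradiction.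

Section IrrationalNormals.
Context {R : realType} (p : R) (hp : 1 <= p) {d : nat}.
Context {T : finType} (a : T -> 'rV[R]_d).
Hypotheses (a0 : forall i, a i != 0) (apex : pointed a).
Local Notation C := (Cplx R).
Local Notation M := 'rV[int]_d.
Local Notation full := [set: T]%SET.
Implicit Types (x u v : 'rV[R]_d) (m : M) (l : T).

Lemma excessE u x : \sum_(l | dotp (a l) u == 0) `|dotp (a l) x| =
  dotp (ray_dual a u) x + excess a u x.
Proof. by rewrite ray_dualE /excess big_split /= addrCA addNr addr0. Qed.

Lemma ray_dual_ge0 u x : gcone a full x -> 0 <= dotp (ray_dual a u) x.
Proof.
move=> hx; rewrite ray_dualE oppr_ge0 sumr_le0// => l _.
by move/forall_inP: hx; apply; rewrite finset.in_setT.
Qed.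

Lemma weight_interior x : (forall l, dotp (a l) x < 0) ->
  weight p (gauss_const p) a full x = full_angle p (d := d).
Proof.
move=> h; rewrite /weight; have -> : act a full x = finset.set0.
  by apply/setP => l; rewrite !inE lt_eqF.
have -> : gcone a full x by apply/forall_inP => l _; exact: ltW.
rewrite mul1r /full_angle; congr (angle p _ _); apply/funext => y.
by apply/forall_inP => l; rewrite finset.in_set0.
Qed.

(** The two limits coincide everywhere, yet at [m0] one of them is eventually taken outside the cone
    and the other in its interior. *)
Lemma irrational_normal_contradiction i v K (F : 'rV[C]_d -> C) :
  K = [set x | gcone a full x] ->
  (forall l, exists2 q, dotp (a l) q = 0 & forall k, k != l -> dotp (a k) q < 0) ->
  ~ (exists (k : R) (b : M), k != 0 /\ a i = k *: intv b) ->
  full_angle p (d := d) != 0 :> R -> ~ is_alpha p v K F.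
Proof.
move=> hK hf irr f0 [Fmer Fser].
have /choice[q hq] l : exists q, dotp (a l) q = 0 /\ forall k, k != l -> dotp (a k) q < 0.
  by have [q] := hf l; exists q.
have /choice[e he] := fun l => lattice_equations (a l).
have [u [k0 [Ku iu wu tr]]] := irrational_ray apex (a0 i) (hq i).1 (hq i).2 (he i) irr.
have /choice[gk hgk] l : exists gk : M * R, 0 < gk.2 /\ (~ tangent_lattice e u l ->
    (forall m, dotp (a l) (intv m) = 0 -> dotp gk.1 m = 0) /\
    forall x, norm1 x <= gk.2 * (\sum_(l | dotp (a l) u == 0) `|dotp (a l) x| +
      `|dotp (intv gk.1) x|)).
  have [t|/existsNP[j /eqP hj]] := pselect (tangent_lattice e u l).
    by exists (0, 1); split=> // /(_ t).
  have [k k_gt0 hk] := transversal_bound wu tr hj; exists (e l j, k); split=> // _.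
  by split=> [m /(he l)/(_ j)|x]; [|exact: hk].
(* With [Kt^-1] as tolerance of [eta], the loss proportional to [norm1 x] is covered by the
   transversal bound of every facet at once, which yields [low]. *)
pose Kt := 1 + \sum_l (gk l).2.
have gk0 l : 0 <= (gk l).2 by exact: ltW (hgk l).1.
have Kt0 : 0 < Kt by rewrite ltr_pwDl// sumr_ge0.
have eps0 : 0 < Kt^-1 by rewrite invr_gt0.
have [eta [lam [kap [lam0 kap0 hkap hlam]]]] :=
  integer_dual_vector apex eps0 (@ray_dual_ge0 u).
have u0 : 0 < norm1 u.
  rewrite lt_def norm1_ge0 andbT; apply: contraNneq wu => n.
  by have := @norm1_eq0 _ _ u; rewrite n lexx => /(_ isT) ->; rewrite dotp0r.
have etau : 0 < dotp (intv eta) u.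
  by apply: lt_le_trans (hkap u Ku); rewrite mulr_gt0.
have [Ke Ke0 hKe] := transversal_bound wu tr (lt0r_neq0 etau).
have {}hKe x : norm1 x <= Ke * (dotp (ray_dual a u) x + excess a u x + `|dotp (intv eta) x|).
  by rewrite -excessE.
have low l : dotp (a l) u = 0 -> ~ tangent_lattice e u l -> exists (g : M) (k : R),
    [/\ 0 <= k, forall m, dotp (a l) (intv m) = 0 -> dotp g m = 0 &
     forall x, - (k * (excess a u x + `|dotp (intv g) x|)) <= dotp (intv eta) x].
  move=> _ nt; have [gm gx] := (hgk l).2 nt; exists (gk l).1, lam; split=> //.
    exact: ltW.
  move=> x; apply: le_trans (hlam x); rewrite -mulrN ler_pM2l//.
  have S0 : 0 <= \sum_(l | dotp (a l) u == 0) `|dotp (a l) x| by exact: sumr_ge0.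
  have : Kt^-1 * norm1 x <=
      dotp (ray_dual a u) x + excess a u x + `|dotp (intv (gk l).1) x|.
    rewrite ler_pdivrMl// -excessE; apply: (le_trans (gx x)).
    rewrite ler_wpM2r ?addr_ge0// /Kt (bigD1 l)//= addrCA lerDl addr_ge0//.
    exact: sumr_ge0.
  by rewrite lerNl opprB lerBlDl addrA.
have [X [gam [m0 [b0 [N0 [Xg Xn Xe Xc hm]]]]]] := approximating_sequences a0 he iu wu Ku etau v
  (fun l => (hq l).1) (fun j l lj => (hq j).2 l lj).
have gam0 : 0 <= gam by exact: le_trans (normr_ge0 _) (Xg true 0%N i iu).
have [U [UU Uoo]] := @ultraFilterLemma nat \oo _.
have /choice[fl hfl] b : exists fl : M -> R, forall m,
    \forall n \near U, cone_weight p a v (m + X b n) = fl m.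
  have /choice[fl hfl] := fun m => limit_weight p a v X UU b m.
  by exists fl.
have Fsum s : tube a s -> has_sum (fun m => (cone_weight p a v m)%:C%C * chr s m) (F s).
  move=> ts; have [S hS] := series_dominated hp v ts.
  by rewrite Fser ?(series_term hp v s hK) ?(sum_has_sum hS)//; exact/(series_domainE s hK).
have E := limit_weights_eq hp Ke0 hKe gam0 Xg Xn Xe (fun n l lu => (Xc n l lu).1)
  (fun n l lu => (Xc n l lu).2) low UU Uoo hfl kap0 hkap Fmer Fsum m0.
have [n [[ht hff] /hm[out inn]]] := filter_ex (filterI (filterI (hfl true m0) (hfl false m0))
  (near_large Uoo N0)).
move: E f0; rewrite -ht -hff /cone_weight.
case: (b0) out inn => /= /weight_out -> /weight_interior ->; first by move=> <-; rewrite eqxx.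
by move=> ->; rewrite eqxx.
Qed.

End IrrationalNormals.

Theorem theorem3p2 (R : realType) (p : R) (hp : 1 <= p) (d : nat)
    (K : set 'rV[R]_d) (hK : pointed_cone K 0) (hdim : has_dim K d)
    (v : 'rV[R]_d) (F : 'rV[Cplx R]_d -> Cplx R) (hF : is_alpha p v K F) :
  (exists G : 'rV[Cplx R]_d -> Cplx R, is_alpha p (- v) K G) /\
  (forall G : 'rV[Cplx R]_d -> Cplx R, is_alpha p (- v) K G ->
     meromorphic_eq (fun s => F (- s)) (fun s => (-1) ^+ d * G s)).
Proof.
have [T [a [a0 apex hKa hf]]] := cone_facets hK hdim.
(* The contradiction needs a nonzero full angle. If it vanishes, every coefficient is 0, and
   reciprocity holds with the empty list of shifts. *)
have [f0|f0] := eqVneq (full_angle p (d := d)) 0.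
  have w0 x : weight p (gauss_const p) a [set: T]%SET x = 0.
    by apply/eqP; rewrite eq_le weight_ge0// andbT -f0 weight_le.
  apply: (reciprocity_of_shift_ops hp apex (us := [::]) hKa _ _ hF) => // m.
  by rewrite /= /opp_cone_weight /cone_weight !w0 mulr0.
have [r|/existsNP[i irr]] := pselect (rational_normals a).
  have [us [us0 hus]] := rational_shift_ops hp a0 r.
  exact: (reciprocity_of_shift_ops hp apex hKa us0 (hus v) hF).
by exfalso; apply: (irrational_normal_contradiction hp a0 apex hKa hf irr f0 hF).
Qed.
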